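(* Let $k$ be a field of characteristic zero. If $G$ is a commutative affine algebraic group over $k$ of dimension $l$, then, for any simply connected space $X$ of finite rational type, there is an algebra isomorphism $$\mathrm{HR}_\ast(X,G)\,\cong\,\mathrm{Sym}_k\big[\overline{\mathrm{H}}_{\ast+1}(X;k)^{\oplus l}\big].$$
   Context: $\mathrm{Sym}_k$ is the graded symmetric algebra over $k$; $\overline{\mathrm{H}}_{\ast+1}(X;k)$ is the graded vector space whose degree $n$ component is the reduced homology $\overline{\mathrm{H}}_{n+1}(X;k)$. Finite rational type means $\mathrm{H}_i(X;\mathbb{Q})$ is finite-dimensional for every $i$. Representation homology: the functor of points $G:\mathrm{CommAlg}_k\to\mathrm{Groups}$ has a left adjoint $\Gamma\mapsto\Gamma_G=\mathcal{O}[\mathrm{Rep}_G(\Gamma)]$. For a pointed connected space $X$, let $\mathbb{G}X$ be the Kan loop group of a reduced simplicial set model of $X$ (a semi-free simplicial group); applying $(-)_G$ degreewise, $\mathrm{HR}_\ast(X,G):=\pi_\ast[(\mathbb{G}X)_G]$, a graded commutative $k$-algebra. *)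

(* Defs.v *)
From HB Require Import structures.
From mathcomp Require Import all_boot all_order all_algebra.
From mathcomp Require Import boolp.
From mathcomp Require Import finmap monalg.

Set Implicit Arguments.
Unset Strict Implicit.
Unset Printing Implicit Defensive.

Import GRing.Theory.

Local Open Scope ring_scope.
Local Open Scope quotient_scope.

Section MultiplicativeTheory.
Variables (G H : groupType) (f : {multiplicative G -> H}).

Lemma mult1 : f 1%g = 1%g.
Proof. by apply: (mulgI (f 1%g)); rewrite -gmulfM !mulg1. Qed.

Lemma multV x : f (x^-1)%g = ((f x)^-1)%g.
Proof. by apply: (mulgI (f x)); rewrite -gmulfM !mulgV mult1. Qed.

Lemma multF x y : f (x / y)%g = (f x / f y)%g.
Proof. by rewrite gmulfM multV. Qed.
End MultiplicativeTheory.

Section PresentedGroup.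
Variables (T : choiceType).

(* The letter (x, true) stands for the generator x, (x, false) for its
   inverse. *)
Definition word := seq (T * bool).

Definition word_inv (w : word) : word := [seq (a.1, ~~ a.2) | a <- rev w].

Variable rel_ : word -> Prop.

Inductive word_eq : word -> word -> Prop :=
| WordRefl u : word_eq u u
| WordSym u v : word_eq u v -> word_eq v u
| WordTrans u v w : word_eq u v -> word_eq v w -> word_eq u w
| WordCat u u' v v' : word_eq u u' -> word_eq v v' -> word_eq (u ++ v) (u' ++ v')
| WordCancel x b : word_eq [:: (x, b); (x, ~~ b)] [::]
| WordRel w : rel_ w -> word_eq w [::].

Definition word_eqb u v := `[< word_eq u v >].

Lemma word_eqb_equiv : equiv_class_of word_eqb.
Proof.
split=> [u|u v|v u w]; first by apply/asboolP/WordRefl.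
- by apply/asbool_equiv_eq; split; apply: WordSym.
- by move=> /asboolP uv /asboolP vw; apply/asboolP/(WordTrans uv vw).
Qed.

Canonical word_equiv := EquivRelPack word_eqb_equiv.

Definition pres_group := {eq_quot word_eqb}.

HB.instance Definition _ := Choice.on pres_group.
HB.instance Definition _ := EqQuotient.on pres_group.

Definition pres_class (w : word) : pres_group := \pi_pres_group w.
Definition pres_gen (x : T) : pres_group := pres_class [:: (x, true)].

Lemma pres_classP u v : pres_class u = pres_class v <-> word_eq u v.
Proof. by split=> [/eqmodP/asboolP|uv]; last by apply/eqmodP/asboolP. Qed.

Lemma word_inv_cat u v : word_inv (u ++ v) = word_inv v ++ word_inv u.
Proof. by rewrite /word_inv rev_cat map_cat. Qed.

Lemma word_invK : involutive word_inv.
Proof.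
move=> w; rewrite /word_inv -map_rev revK -map_comp map_id_in // => -[x b] _.
by rewrite /= negbK.
Qed.

Lemma word_mulV w : word_eq (w ++ word_inv w) [::].
Proof.
elim: w => [|[x b] w IHw]; first exact: WordRefl.
rewrite -cat1s word_inv_cat -catA [w ++ _]catA.
apply: (WordTrans (v := [:: (x, b)] ++ [:: (x, ~~ b)])); last exact: WordCancel.
apply: WordCat; first exact: WordRefl.
by rewrite -[X in word_eq _ X]cat0s; apply: WordCat => //; apply: WordRefl.
Qed.

Lemma word_eq_inv u v : word_eq u v -> word_eq (word_inv u) (word_inv v).
Proof.
move=> uv; apply: (WordTrans (v := word_inv u ++ (v ++ word_inv v))).
  rewrite -[X in word_eq X _]cats0; apply: WordCat; first exact: WordRefl.
  exact/WordSym/word_mulV.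
rewrite catA -[X in word_eq _ X]cat0s; apply: WordCat; last exact: WordRefl.
apply: (WordTrans (v := word_inv u ++ u)).
  by apply: WordCat; [apply: WordRefl | apply: WordSym].
by rewrite -{2}[u]word_invK; apply: word_mulV.
Qed.

Definition pres_one : pres_group := pres_class [::].
Definition pres_mul (x y : pres_group) : pres_group :=
  pres_class (repr x ++ repr y).
Definition pres_inv (x : pres_group) : pres_group :=
  pres_class (word_inv (repr x)).

Lemma word_eq_repr w : word_eq (repr (pres_class w)) w.
Proof. by apply/pres_classP; rewrite /pres_class reprK. Qed.

Lemma pres_mulE u v :
  pres_mul (pres_class u) (pres_class v) = pres_class (u ++ v).
Proof. by apply/pres_classP/WordCat; apply: word_eq_repr. Qed.

Lemma pres_invE u : pres_inv (pres_class u) = pres_class (word_inv u).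
Proof. exact/pres_classP/word_eq_inv/word_eq_repr. Qed.

Lemma pres_ind (P : pres_group -> Prop) :
  (forall w, P (pres_class w)) -> forall x, P x.
Proof. by move=> Pw x; rewrite -[x]reprK; apply: Pw. Qed.

Lemma pres_mulA : associative pres_mul.
Proof.
elim/pres_ind=> u; elim/pres_ind=> v; elim/pres_ind=> w.
by rewrite !pres_mulE catA.
Qed.

Lemma pres_mul1 : left_id pres_one pres_mul.
Proof. by elim/pres_ind=> u; rewrite pres_mulE. Qed.

Lemma pres_mul_1 : right_id pres_one pres_mul.
Proof. by elim/pres_ind=> u; rewrite pres_mulE cats0. Qed.

Lemma pres_mulV : right_inverse pres_one pres_inv pres_mul.
Proof.
elim/pres_ind=> u; rewrite pres_invE pres_mulE.
exact/pres_classP/word_mulV.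
Qed.

Lemma pres_mulV_ : left_inverse pres_one pres_inv pres_mul.
Proof.
elim/pres_ind=> u; rewrite pres_invE pres_mulE.
by apply/pres_classP; rewrite -{2}[u]word_invK; apply: word_mulV.
Qed.

HB.instance Definition _ := isGroup.Build pres_group
  pres_mulA pres_mul1 pres_mul_1 pres_mulV_ pres_mulV.

Lemma pres_classM u v :
  pres_class (u ++ v) = (pres_class u * pres_class v)%g.
Proof. by rewrite -pres_mulE. Qed.

Lemma pres_classV u : pres_class (word_inv u) = ((pres_class u)^-1)%g.
Proof. by rewrite -pres_invE. Qed.

Section Lift.
Variables (H : groupType) (f : T -> H).

Definition word_eval (w : word) : H :=
  foldr (fun a h => ((if a.2 then f a.1 else (f a.1)^-1) * h)%g) 1%g w.

Lemma word_eval_cat u v : word_eval (u ++ v) = (word_eval u * word_eval v)%g.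
Proof. by elim: u => [|a u /= ->]; rewrite ?mul1g // mulgA. Qed.

Hypothesis f_rel : forall w, rel_ w -> word_eval w = 1%g.

Lemma word_eval_eq u v : word_eq u v -> word_eval u = word_eval v.
Proof.
elim=> {u v} [|||u u' v v' _ eu _ ev|x b|] //.
- by move=> u v w _ -> _ ->.
- by rewrite !word_eval_cat eu ev.
- by case: b; rewrite /= mulg1 ?mulgV ?mulVg.
Qed.

Definition pres_lift (x : pres_group) : H := word_eval (repr x).

Lemma pres_liftE w : pres_lift (pres_class w) = word_eval w.
Proof. exact/word_eval_eq/word_eq_repr. Qed.

Lemma pres_lift_gen x : pres_lift (pres_gen x) = f x.
Proof. by rewrite pres_liftE /= mulg1. Qed.

Lemma pres_liftM : {morph pres_lift : x y / (x * y)%g}.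
Proof.
elim/pres_ind=> u; elim/pres_ind=> v.
by rewrite -pres_classM !pres_liftE word_eval_cat.
Qed.
End Lift.

Lemma pres_hom_eq (H : groupType) (f g : {multiplicative pres_group -> H}) :
  (forall x, f (pres_gen x) = g (pres_gen x)) -> f =1 g.
Proof.
move=> fg; elim/pres_ind; elim=> [|[x b] w IHw]; first by rewrite (_ : pres_class [::] = 1%g) // !mult1.
rewrite -cat1s pres_classM !gmulfM IHw; congr (_ * _)%g.
case: b; first exact: fg.
have -> : [:: (x, false)] = word_inv [:: (x, true)] by [].
by rewrite pres_classV !multV; congr (_^-1)%g; apply: fg.
Qed.

End PresentedGroup.

(* [simplex_map m n] is the set of morphisms [m] -> [n] of the simplex
   category, where [n] = {0 < 1 < ... < n}. *)
Record simplex_map (m n : nat) := SimplexMap {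
  simplex_fun :> 'I_m.+1 -> 'I_n.+1;
  simplex_mono : {homo simplex_fun : i j / (i <= j)%N}
}.

Lemma simplex_map_eq m n (f g : simplex_map m n) : f =1 g -> f = g.
Proof.
case: f g => [f f_mono] [g g_mono] /= /funext fg.
by case: _ / fg in g_mono *; congr SimplexMap; apply: Prop_irrelevance.
Qed.

Definition simplex_id n : simplex_map n n :=
  @SimplexMap n n id (fun _ _ => id).

Definition simplex_comp m n p (g : simplex_map n p) (f : simplex_map m n) :
    simplex_map m p :=
  @SimplexMap m p (g \o f) (fun i j ij => simplex_mono g (simplex_mono f ij)).

Lemma coface_mono n (i : 'I_n.+2) :
  {homo (lift i : 'I_n.+1 -> 'I_n.+2) : j k / (j <= k)%N}.
Proof. by move=> j k jk; rewrite /= leq_bump2. Qed.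

(* the injection [n] -> [n+1] that misses i *)
Definition coface n (i : 'I_n.+2) : simplex_map n n.+1 :=
  SimplexMap (@coface_mono n i).

Lemma unbump_lt n (i : 'I_n.+1) (j : 'I_n.+2) : (unbump i j < n.+1)%N.
Proof.
rewrite ltnS /unbump; case: ltnP => /= [|ji].
  by case: j => -[|j] //=; rewrite subn1.
by rewrite subn0 (leq_trans ji) // -ltnS.
Qed.

Lemma codegen_mono n (i : 'I_n.+1) :
  {homo (fun j : 'I_n.+2 => inord (unbump i j) : 'I_n.+1) : j k / (j <= k)%N}.
Proof.
move=> j k jk; rewrite !inordK ?unbump_lt // -leq_bump /bump; move: jk.
rewrite /unbump; case: (ltnP i k) => ik /=; rewrite ?subn1 ?subn0.
  case: k ik => -[|k] //= ? ik; rewrite ltnS in ik.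
  by rewrite ik add1n.
by move=> jk; rewrite (leq_trans jk) // leq_addl.
Qed.

(* the surjection [n+1] -> [n] that takes the value i twice *)
Definition codegen n (i : 'I_n.+1) : simplex_map n.+1 n :=
  SimplexMap (@codegen_mono n i).

(* A simplicial object is a contravariant functor on the simplex category. *)
Definition simplicial_laws (X : nat -> Type)
    (act : forall m n, simplex_map m n -> X n -> X m) : Prop :=
  (forall n, act n n (simplex_id n) =1 id) /\
  (forall m n p (g : simplex_map n p) (f : simplex_map m n),
     act m p (simplex_comp g f) =1 act m n f \o act n p g).

Record sset := SSet {
  sset_obj :> nat -> choiceType;
  sset_act : forall m n, simplex_map m n -> sset_obj n -> sset_obj m;
  sset_laws : simplicial_laws sset_act
}.

Record sgroup := SGroup {
  sgroup_obj :> nat -> groupType;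
  sgroup_act : forall m n,
    simplex_map m n -> {multiplicative sgroup_obj n -> sgroup_obj m};
  sgroup_laws : simplicial_laws sgroup_act
}.

Record scalg (k : fieldType) := SCAlg {
  scalg_obj :> nat -> comAlgType k;
  scalg_act : forall m n,
    simplex_map m n -> {lrmorphism scalg_obj n -> scalg_obj m};
  scalg_laws : simplicial_laws scalg_act
}.

(* Reduced simplicial sets are the models of pointed connected spaces. *)
Definition reduced (X : sset) : Prop := exists x : X 0%N, forall y, y = x.

Section Reduced.
Variable X : sset.

Definition face n (i : 'I_n.+2) : X n.+1 -> X n := sset_act (coface i).
Definition degen n (i : 'I_n.+1) : X n -> X n.+1 := sset_act (codegen i).

(* Edge-path group: generators the 1-simplices, and the relation
   (d_2 s)(d_0 s) = d_1 s for every 2-simplex s (which for s = s_0 s_0 v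
   kills the degenerate 1-simplex s_0 v). *)
Definition edge_rel (w : word (X 1%N)) : Prop :=
  exists s : X 2%N, w =
    [:: (face (inord 2) s, true); (face (inord 0) s, true);
        (face (inord 1) s, false)].

Definition fund_group : groupType := pres_group edge_rel.

Definition simply_connected : Prop := forall g : fund_group, g = 1%g.

(* Degree n of the Kan loop group: generators the (n+1)-simplices, and the
   relations s_0 y = 1; it is free on X_{n+1} minus s_0 X_n. *)
Definition kan_rel n (w : word (X n.+1)) : Prop :=
  exists y : X n, w = [:: (degen ord0 y, true)].

Definition kan_obj n : groupType := pres_group (@kan_rel n).

Definition kan_gen n (x : X n.+1) : kan_obj n := pres_gen (@kan_rel n) x.

(* For f : [m] -> [n], [shift b f] : [m+1] -> [n+1] sends i+1 to f(i)+1, and 0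
   to 0 if b = false, to 1 if b = true. *)
Definition shift_fun m n (b : bool) (f : simplex_map m n) (i : 'I_m.+2) :
    'I_n.+2 :=
  if unlift ord0 i is Some j then lift ord0 (f j) else inord b.

Lemma shift_mono m n b (f : simplex_map m n) :
  {homo shift_fun b f : i j / (i <= j)%N}.
Proof.
move=> i j; rewrite /shift_fun.
case: unliftP => [i' ->|->]; case: unliftP => [j' ->|->] //=.
  by rewrite /bump !leq0n !add1n !ltnS; apply: simplex_mono.
move=> _; rewrite inordK; last by case: b.
by rewrite /bump; case: b.
Qed.

Definition shift m n b (f : simplex_map m n) : simplex_map m.+1 n.+1 :=
  SimplexMap (@shift_mono m n b f).

Lemma shift0 m n b (f : simplex_map m n) : shift b f ord0 = inord b.
Proof. by rewrite /= /shift_fun unlift_none. Qed.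

Lemma shiftS m n b (f : simplex_map m n) i :
  shift b f (lift ord0 i) = lift ord0 (f i).
Proof. by rewrite /= /shift_fun liftK. Qed.

Lemma simplexS_eq m n (f g : simplex_map m.+1 n) :
  f ord0 = g ord0 -> (forall i, f (lift ord0 i) = g (lift ord0 i)) -> f = g.
Proof.
move=> fg0 fgS; apply: simplex_map_eq => i.
by case: (unliftP ord0 i) => [j ->|->].
Qed.

Lemma sset_act_comp m n p (g : simplex_map n p) (f : simplex_map m n) (x : X p) :
  sset_act f (sset_act g x) = sset_act (simplex_comp g f) x.
Proof. by case: (sset_laws X) => _ /(_ m n p g f x) ->. Qed.

Lemma sset_act_id n (x : X n) : sset_act (simplex_id n) x = x.
Proof. by case: (sset_laws X) => /(_ n x). Qed.

Lemma kan_gen_degen n (y : X n) : kan_gen (degen ord0 y) = 1%g.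
Proof. by apply/pres_classP/WordRel; exists y. Qed.

Lemma codegen0E n (i : 'I_n.+2) : codegen ord0 i = i.-1 :> nat.
Proof.
rewrite /= inordK /unbump; first by case: i => -[|i] //= ?; rewrite subn1.
by case: i => -[|i] //=; rewrite subn1.
Qed.

(* The simplicial operator f^* on the Kan loop group: the generator given by x
   goes to t(x') t(x'')^-1, where t denotes the generators, and x', x'' are the
   pullbacks of x along shift false f, shift true f.  For a map f with f(0) = 0
   the second factor is trivial; see kan_d0, kan_dS and kan_s for the usual
   formulas for faces and degeneracies. *)
Definition kan_val m n (f : simplex_map m n) (x : X n.+1) : kan_obj m :=
  (kan_gen (sset_act (shift false f) x) /
   kan_gen (sset_act (shift true f) x))%g.

Lemma kan_val_rel m n (f : simplex_map m n) w :
  kan_rel w -> word_eval (kan_val f) w = 1%g.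
Proof.
case=> y ->; rewrite /= mulg1 /kan_val /degen !sset_act_comp.
suff -> : simplex_comp (codegen ord0) (shift false f) =
          simplex_comp (codegen ord0) (shift true f) by rewrite mulgV.
apply: simplexS_eq => [|i]; apply: val_inj; last first.
  by rewrite [LHS]codegen0E [RHS]codegen0E !shiftS.
by rewrite [LHS]codegen0E [RHS]codegen0E !shift0 !inordK.
Qed.

Definition kan_act m n (f : simplex_map m n) : kan_obj n -> kan_obj m :=
  pres_lift (kan_val f).

HB.instance Definition _ m n (f : simplex_map m n) :=
  monoid.isMultiplicative.Build (kan_obj n) (kan_obj m) (kan_act f)
    (pres_liftM (@kan_val_rel m n f)).

Lemma kan_act_gen m n (f : simplex_map m n) x :
  kan_act f (kan_gen x) = kan_val f x.
Proof. exact/pres_lift_gen/kan_val_rel. Qed.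

Lemma simplex_compE m n p (g : simplex_map n p) (f : simplex_map m n) i :
  simplex_comp g f i = g (f i).
Proof. by []. Qed.

Lemma codegen00 n : codegen ord0 ord0 = ord0 :> 'I_n.+1.
Proof. by apply: val_inj; rewrite [LHS]codegen0E. Qed.

Lemma codegen0S n i : codegen ord0 (lift ord0 i) = i :> 'I_n.+1.
Proof. by apply: val_inj; rewrite [LHS]codegen0E. Qed.

Lemma inord_true n : inord true = lift ord0 ord0 :> 'I_n.+2.
Proof. by apply: val_inj; rewrite [LHS]inordK. Qed.

Lemma inord_false n : inord false = ord0 :> 'I_n.+1.
Proof. by apply: val_inj; rewrite [LHS]inordK. Qed.

Lemma kan_val0 m n (f : simplex_map m n) x : f ord0 = ord0 ->
  kan_val f x = kan_gen (sset_act (shift false f) x).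
Proof.
move=> f0; rewrite /kan_val.
suff -> : shift true f =
          simplex_comp (simplex_comp (shift true f) (coface ord0)) (codegen ord0).
  by rewrite -sset_act_comp kan_gen_degen invg1 mulg1.
apply: simplexS_eq => [|i]; rewrite !simplex_compE.
  by rewrite codegen00 [coface _ _]/= shiftS f0 shift0 inord_true.
by rewrite codegen0S.
Qed.

Lemma shift_false_comp m n p b (g : simplex_map n p) (f : simplex_map m n) :
  simplex_comp (shift b g) (shift false f) = shift b (simplex_comp g f).
Proof.
apply: simplexS_eq => [|i]; rewrite simplex_compE.
  by rewrite shift0 inord_false !shift0.
by rewrite !shiftS.
Qed.

Lemma shift_true_comp m n p b (g : simplex_map n p) (f : simplex_map m n) :
  simplex_comp (shift b g) (shift true f) =
  simplex_comp (shift false g) (shift true f).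
Proof.
apply: simplexS_eq => [|i]; rewrite !simplex_compE.
  by rewrite shift0 inord_true !shiftS.
by rewrite !shiftS.
Qed.

Lemma kan_laws : simplicial_laws kan_act.
Proof.
split=> [n|m n p g f].
  apply: (pres_hom_eq (f := kan_act (simplex_id n)) (g := idfun)) => x.
  rewrite [LHS]kan_act_gen kan_val0 //.
  suff -> : shift false (simplex_id n) = simplex_id n.+1 by rewrite sset_act_id.
  by apply: simplexS_eq => [|i]; rewrite ?shift0 ?shiftS ?inord_false.
apply: (pres_hom_eq (f := kan_act (simplex_comp g f))
                    (g := kan_act f \o kan_act g)) => x.
transitivity (kan_val (simplex_comp g f) x); first exact: kan_act_gen.
transitivity (kan_act f (kan_val g x)); last by rewrite /= -kan_act_gen.
rewrite [in RHS]/kan_val multF /= !kan_act_gen.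
rewrite /kan_val !sset_act_comp !shift_false_comp !(shift_true_comp true).
by rewrite invgF mulgA mulgVK.
Qed.

Definition kan_loop : sgroup := SGroup kan_laws.

(* The standard formulas: d_0 t(x) = t(d_1 x) t(d_0 x)^-1,
   d_i t(x) = t(d_{i+1} x) for i > 0, and s_i t(x) = t(s_{i+1} x). *)
Lemma kan_d0 n (x : X n.+2) :
  sgroup_act kan_loop (coface ord0) (kan_gen x) =
  (kan_gen (face (lift ord0 ord0) x) / kan_gen (face ord0 x))%g.
Proof.
transitivity (kan_val (coface ord0) x); first exact: kan_act_gen.
rewrite /kan_val /face.
congr (kan_gen (sset_act _ x) / kan_gen (sset_act _ x))%g.
  apply: simplexS_eq => [|i]; rewrite ?shift0 ?shiftS; apply: val_inj => //=.
  by rewrite inordK.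
apply: simplexS_eq => [|i]; rewrite ?shift0 ?shiftS; apply: val_inj => //=.
by rewrite inordK.
Qed.

Lemma kan_dS n (i : 'I_n.+1) (x : X n.+2) :
  sgroup_act kan_loop (coface (lift ord0 i)) (kan_gen x) =
  kan_gen (face (lift ord0 (lift ord0 i)) x).
Proof.
transitivity (kan_val (coface (lift ord0 i)) x); first exact: kan_act_gen.
rewrite kan_val0; last exact: val_inj.
congr (kan_gen (sset_act _ x)).
apply: simplexS_eq => [|j]; rewrite ?shift0 ?shiftS; apply: val_inj => /=.
  by rewrite inordK.
by rewrite {1}/bump /= !add1n bumpS.
Qed.

Lemma kan_s n (i : 'I_n.+1) (x : X n.+1) :
  sgroup_act kan_loop (codegen i) (kan_gen x) = kan_gen (degen (lift ord0 i) x).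
Proof.
transitivity (kan_val (codegen i) x); first exact: kan_act_gen.
rewrite kan_val0; last by apply: val_inj; rewrite [LHS]inordK.
congr (kan_gen (sset_act _ x)).
apply: simplexS_eq => [|j]; rewrite ?shift0 ?shiftS; apply: val_inj => /=.
  by rewrite !inordK.
rewrite inordK ?unbump_lt // /bump /= !add1n unbumpS inordK // ltnS.
exact: unbump_lt.
Qed.

End Reduced.

Section Subquotient.
Variables (k : fieldType) (V : lmodType k) (Z B : submodClosed V).

Record subm := Subm { subm_val :> V; subm_valP : subm_val \in Z }.

HB.instance Definition _ := [isSub for subm_val].
HB.instance Definition _ := [Choice of subm by <:].
HB.instance Definition _ := [SubChoice_isSubLmodule of subm by <:].

Definition sub_rel : {pred subm} := [pred x | val x \in B].

Lemma sub_rel_closed : submod_closed sub_rel.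
Proof.
split=> [|a x y]; rewrite !inE ?raddf0 ?rpred0 // => xB yB.
by rewrite linearP rpredD // rpredZ.
Qed.

HB.instance Definition _ := GRing.isSubmodClosed.Build k subm sub_rel
  sub_rel_closed.

(* Z / (Z :&: B) *)
Definition subquot := Quotient.quot sub_rel.

HB.instance Definition _ := GRing.Zmodule.on subquot.

(* the class of x, to be used for x in Z only *)
Definition subclass (x : V) : subquot := \pi_subquot (insubd (0 : subm) x).

Definition subrepr (q : subquot) : V := val (repr q).

Lemma subreprP q : subrepr q \in Z.
Proof. exact: valP. Qed.

Lemma subreprK q : subclass (subrepr q) = q.
Proof. by rewrite /subclass /subrepr valKd reprK. Qed.

Lemma subclassP x y : x \in Z -> y \in Z ->
  reflect (subclass x = subclass y) (x - y \in B).
Proof.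
move=> xZ yZ; have -> : (x - y \in B) =
    (insubd (0 : subm) x - insubd (0 : subm) y \in sub_rel).
  by rewrite inE raddfB /= !insubdK.
by rewrite Quotient.idealrBE; apply: eqP.
Qed.

Lemma subclass_ind (P : subquot -> Prop) :
  (forall x, x \in Z -> P (subclass x)) -> forall q, P q.
Proof. by move=> PZ q; rewrite -[q]subreprK; apply/PZ/subreprP. Qed.

Lemma subclassD x y : x \in Z -> y \in Z ->
  subclass (x + y) = subclass x + subclass y.
Proof.
move=> xZ yZ; rewrite /subclass -raddfD; congr (\pi_subquot _).
by apply: val_inj; rewrite raddfD /= !insubdK // rpredD.
Qed.

Definition subquot_scale (a : k) (q : subquot) : subquot :=
  subclass (a *: subrepr q).

Lemma subquot_scaleE a x : x \in Z ->
  subquot_scale a (subclass x) = subclass (a *: x).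
Proof.
move=> xZ; apply/subclassP; rewrite ?rpredZ ?subreprP // -scalerBr rpredZ //.
by apply/subclassP; rewrite ?subreprP // subreprK.
Qed.

Lemma subquot_scaleA a b q :
  subquot_scale a (subquot_scale b q) = subquot_scale (a * b) q.
Proof.
by elim/subclass_ind: q => x xZ; rewrite !subquot_scaleE ?rpredZ ?scalerA.
Qed.

Lemma subquot_scale1 : left_id 1 subquot_scale.
Proof. by elim/subclass_ind=> x xZ; rewrite subquot_scaleE ?scale1r. Qed.

Lemma subquot_scaleDr : right_distributive subquot_scale +%R.
Proof.
move=> a; elim/subclass_ind=> x xZ; elim/subclass_ind=> y yZ.
rewrite -subclassD // !subquot_scaleE ?rpredD // scalerDr.
by rewrite subclassD ?rpredZ.
Qed.

Lemma subquot_scaleDl q : {morph subquot_scale^~ q : a b / a + b}.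
Proof.
elim/subclass_ind: q => x xZ a b /=.
by rewrite !subquot_scaleE // scalerDl subclassD ?rpredZ.
Qed.

HB.instance Definition _ := GRing.Zmodule_isLmodule.Build k subquot
  subquot_scaleA subquot_scale1 subquot_scaleDr subquot_scaleDl.

Lemma subclassZ a x : x \in Z -> subclass (a *: x) = a *: subclass x.
Proof. by move=> xZ; rewrite -subquot_scaleE. Qed.

End Subquotient.

Section Homology.
Variables (k : fieldType) (X : sset).

Section LinearExtension.
Variables (K : choiceType) (V : lmodType k) (f : K -> V).

Definition lin_ext (c : {malg k[K]}) : V := \sum_(x <- msupp c) c@_x *: f x.

Lemma lin_extEw (E : {fset K}) (c : {malg k[K]}) : (msupp c `<=` E)%fset ->
  lin_ext c = \sum_(x <- E) c@_x *: f x.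
Proof.
move=> cE; apply: big_fset_incl => // x _ /mcoeff_outdom ->.
by rewrite scale0r.
Qed.

Lemma lin_ext_linear : linear lin_ext.
Proof.
move=> a c c'; pose E := (msupp c `|` msupp c' `|` msupp (a *: c + c'))%fset.
have [cE c'E dE] : [/\ msupp c `<=` E, msupp c' `<=` E
    & msupp (a *: c + c') `<=` E]%fset.
  by split; apply/fsubsetP => x xc; rewrite !in_fsetU xc ?orbT.
rewrite (lin_extEw cE) (lin_extEw c'E) (lin_extEw dE).
rewrite scaler_sumr -big_split /=; apply: eq_bigr => x _.
by rewrite mcoeffD mcoeffZ scalerDl scalerA.
Qed.

HB.instance Definition _ :=
  GRing.isLinear.Build k {malg k[K]} V *:%R lin_ext lin_ext_linear.
End LinearExtension.

Definition chain n := {malg k[X n]}.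

Definition boundary n : chain n.+1 -> chain n :=
  lin_ext (fun x => \sum_(i < n.+2) (-1) ^+ i *: << face i x >>).

HB.instance Definition _ n := GRing.Linear.on (@boundary n).

Definition augmentation : chain 0 -> k^o := lin_ext (fun=> 1).

HB.instance Definition _ := GRing.Linear.on augmentation.

Definition cycles n : {pred chain n} :=
  match n with
  | 0 => predT
  | m.+1 => [pred c | boundary c == 0]
  end.
Arguments cycles : clear implicits.

Definition reduced_cycles n : {pred chain n} :=
  match n with
  | 0 => [pred c | augmentation c == 0]
  | m.+1 => cycles m.+1
  end.
Arguments reduced_cycles : clear implicits.

Definition boundaries n : {pred chain n} :=
  [pred c | `[< exists b : chain n.+1, boundary b = c >]].
Arguments boundaries : clear implicits.

Lemma cycles_closed n : submod_closed (cycles n).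
Proof.
case: n => [|n]; split=> //= [|a x y]; rewrite !inE ?raddf0 //.
by move=> /eqP x0 /eqP y0; rewrite linearP /= x0 y0 scaler0 addr0.
Qed.

Lemma reduced_cycles_closed n : submod_closed (reduced_cycles n).
Proof.
case: n => [|n]; last exact: (cycles_closed n.+1).
split=> [|a x y]; rewrite !inE ?raddf0 // => /eqP x0 /eqP y0.
by rewrite linearP /= x0 y0 scaler0 addr0.
Qed.

Lemma boundaries_closed n : submod_closed (boundaries n).
Proof.
split=> [|a x y]; first by apply/asboolP; exists 0; rewrite raddf0.
move=> /asboolP[b <-] /asboolP[c <-]; apply/asboolP.
by exists (a *: b + c); rewrite linearP.
Qed.

HB.instance Definition _ n := GRing.isSubmodClosed.Build k (chain n) (cycles n)
  (cycles_closed n).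
HB.instance Definition _ n := GRing.isSubmodClosed.Build k (chain n)
  (reduced_cycles n) (reduced_cycles_closed n).
HB.instance Definition _ n := GRing.isSubmodClosed.Build k (chain n)
  (boundaries n) (boundaries_closed n).

Definition homology n : lmodType k := subquot (cycles n) (boundaries n).

Definition reduced_homology n : lmodType k :=
  subquot (reduced_cycles n) (boundaries n).

End Homology.

Definition finite_dim (k : fieldType) (V : lmodType k) : Prop :=
  exists d : nat, inhabited (Vector.axiom d V).

Definition finite_rational_type (X : sset) : Prop :=
  forall i, finite_dim (homology rat X i).

Lemma lrmorphism_eq (k : fieldType) (A B : comAlgType k)
  (f g : {lrmorphism A -> B}) : f =1 g -> f = g.
Proof.
case: f g => [f [[a] [b] [c]]] [g [[a'] [b'] [c']]] /= /funext fg.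
case: _ / fg in a' b' c' *.
by rewrite (Prop_irrelevance a a') (Prop_irrelevance b b') (Prop_irrelevance c c').
Qed.

Definition lrcomp (k : fieldType) (A B C : comAlgType k)
    (g : {lrmorphism B -> C}) (f : {lrmorphism A -> B}) : {lrmorphism A -> C} :=
  g \o f.

(* An affine group scheme over k: a representable functor of points
   B |-> Hom(O, B) with a group structure natural in B.  A comAlgType is a
   nonzero ring; nothing is lost, since Hom(O, 0) is a point. *)
Record affine_group (k : fieldType) := AffineGroup {
  coord_ring : comAlgType k;
  point_mul : forall B : comAlgType k,
    {lrmorphism coord_ring -> B} -> {lrmorphism coord_ring -> B} ->
    {lrmorphism coord_ring -> B};
  point_one : forall B : comAlgType k, {lrmorphism coord_ring -> B};
  point_inv : forall B : comAlgType k,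
    {lrmorphism coord_ring -> B} -> {lrmorphism coord_ring -> B};
  point_mulA : forall B, associative (point_mul (B := B));
  point_mul1 : forall B, left_id (point_one B) (point_mul (B := B));
  point_mulV :
    forall B, left_inverse (point_one B) (point_inv (B := B)) (point_mul (B := B));
  point_mul_natural : forall (B C : comAlgType k) (h : {lrmorphism B -> C}) x y,
    lrcomp h (point_mul x y) = point_mul (lrcomp h x) (lrcomp h y)
}.

Section Points.
Variables (k : fieldType) (G : affine_group k).

Definition points (B : comAlgType k) : Type := {lrmorphism coord_ring G -> B}.

HB.instance Definition _ B := gen_eqMixin (points B).
HB.instance Definition _ B := gen_choiceMixin (points B).

Variable B : comAlgType k.

Lemma point_mulVr :
  right_inverse (point_one G B) (@point_inv k G B) (@point_mul k G B).
Proof.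
move=> x; set y := point_inv x; set e := point_mul x y.
have ee : point_mul e e = e.
  by rewrite /e -point_mulA (point_mulA y) point_mulV point_mul1.
by rewrite -[LHS]point_mul1 -(point_mulV e) -point_mulA ee point_mulV.
Qed.

Lemma point_mul_1 : right_id (point_one G B) (@point_mul k G B).
Proof. by move=> x; rewrite -(point_mulV x) point_mulA point_mulVr point_mul1. Qed.

HB.instance Definition _ := isGroup.Build (points B)
  (@point_mulA k G B) (@point_mul1 k G B) point_mul_1
  (@point_mulV k G B) point_mulVr.

End Points.

Definition commutative_group_scheme (k : fieldType) (G : affine_group k) : Prop :=
  forall (B : comAlgType k) (x y : points G B), (x * y = y * x)%g.

Definition finitely_generated (k : fieldType) (A : comAlgType k) : Prop :=
  exists s : seq A, forall S : {pred A}, GRing.subalg_closed S ->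
    {subset s <= S} -> forall a, a \in S.

Definition prime_ideal (R : comNzRingType) (P : {pred R}) : Prop :=
  idealr_closed P /\ prime_idealr_closed P.

Definition prime_chain (R : comNzRingType) (n : nat) : Prop :=
  exists P : nat -> {pred R},
    (forall i, (i <= n)%N -> prime_ideal (P i)) /\
    (forall i, (i < n)%N ->
       {subset P i <= P i.+1} /\ exists2 a, a \in P i.+1 & a \notin P i).

Definition krull_dim (R : comNzRingType) (n : nat) : Prop :=
  prime_chain R n /\ ~ prime_chain R n.+1.

Section FreeAlgebra.
Variables (k : fieldType) (I : choiceType) (B : comAlgType k) (f : I -> B).

Definition monom_eval (m : {cmonom I}) : B := \prod_(i <- finsupp m) f i ^+ m i.

Lemma monom_evalEw (E : {fset I}) (m : {cmonom I}) : (finsupp m `<=` E)%fset ->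
  monom_eval m = \prod_(i <- E) f i ^+ m i.
Proof.
move=> mE; apply: big_fset_incl => // i _ mi.
by rewrite (_ : m i = 0%N) //; apply/eqP; rewrite cmE_eq0.
Qed.

Lemma monom_eval_mmorphism : mmorphism monom_eval.
Proof.
split=> [x y|]; last by rewrite /monom_eval mdom1 big_seq_fset0.
rewrite (@monom_evalEw (finsupp x `|` finsupp y)%fset) ?mdomD //.
rewrite (monom_evalEw (fsubsetUl _ (finsupp y))).
rewrite (monom_evalEw (fsubsetUr (finsupp x) _)) -big_split /=.
by apply: eq_bigr => i _; rewrite cmM exprD.
Qed.

HB.instance Definition _ := monalg.isMultiplicative.Build {cmonom I} B monom_eval
  monom_eval_mmorphism.

(* the algebra map from the free commutative algebra on I that extends f *)
Definition free_eval : {malg k[{cmonom I}]} -> B :=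
  mmap (GRing.in_alg B) monom_eval.

HB.instance Definition _ := GRing.RMorphism.on free_eval.

Lemma free_eval_scalable : scalable free_eval.
Proof. by move=> a P; rewrite /free_eval mmapZ mulr_algl. Qed.

HB.instance Definition _ := GRing.isScalable.Build k {malg k[{cmonom I}]} B *:%R
  free_eval free_eval_scalable.

Definition free_gen (i : I) : {malg k[{cmonom I}]} := << ucm i >>.

Lemma free_eval_gen i : free_eval (free_gen i) = f i.
Proof.
rewrite /free_eval mmapU /= scale1r mul1r /monom_eval mdomU big_seq_fset1.
by rewrite cmUU expr1.
Qed.

End FreeAlgebra.

Section FreeAlgebraTheory.
Variables (k : fieldType) (I : choiceType).

Lemma mmorphism_eq (S : comRingType) (phi psi : {cmonom I} -> S) :
  mmorphism phi -> mmorphism psi ->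
  (forall i, phi (ucm i) = psi (ucm i)) -> phi =1 psi.
Proof.
move=> [phiM phi1] [psiM psi1] phipsi m.
have [n] := ubnP (mdeg m); elim: n m => // n IHn m; rewrite ltnS => mn.
have [/fsetP m0|[i im]] := fset_0Vmem (finsupp m).
  suff -> : m = mone by rewrite phi1 psi1.
  apply/eqP/cmP => i; rewrite cm1; apply/eqP.
  by rewrite cmE_eq0 m0 in_fset0.
have mE : m = mmul (ucm i) (divcm m (ucm i)).
  apply/eqP/cmP => j; rewrite cmM divcmE subnKC // cmU.
  by case: eqP => // <-; rewrite lt0n cmE_neq0.
rewrite mE phiM psiM phipsi IHn //.
by move: mn; rewrite {1}mE mdegM mdegU.
Qed.

Lemma free_monomE (m : {cmonom I}) :
  << m >> = monom_eval (@free_gen k I) m.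
Proof.
apply: (@mmorphism_eq {malg k[{cmonom I}]} (fun m => << m >>)).
- by split=> // x y; apply/malgP => z; rewrite malgM_def fgmulUU mulr1.
- exact: monom_eval_mmorphism.
- by move=> i; rewrite /monom_eval mdomU big_seq_fset1 cmUU expr1.
Qed.

Lemma free_hom_eq (B : comAlgType k) (h h' : {lrmorphism {malg k[{cmonom I}]} -> B}) :
  (forall i, h (free_gen k i) = h' (free_gen k i)) -> h =1 h'.
Proof.
move=> hh P; rewrite [P]monalgE !raddf_sum; apply: eq_bigr => m _.
suff hU c : h << c *g m >> = h' << c *g m >> by exact: hU.
have -> : << c *g m >> = c *: << m >>.
  by rewrite -mul_malgC malgM_def fgmulUU mulr1 mul1m.
rewrite (linearZ_LR h) (linearZ_LR h'); congr (_ *: _).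
rewrite free_monomE (rmorph_prod h) (rmorph_prod h'); apply: eq_bigr => i _.
by rewrite (rmorphXn h) (rmorphXn h') /= hh.
Qed.

End FreeAlgebraTheory.

Section RepAlgebra.
Variables (k : fieldType) (G : affine_group k) (gamma : groupType).

(* Free commutative algebra on symbols (g, u), for g in gamma and u in O(G),
   standing for the function rho |-> u(rho(g)) on representations rho of gamma
   in G. *)
Definition rep_free := {malg k[{cmonom (gamma * coord_ring G)%type}]}.

Definition rep_fun (B : comAlgType k)
    (rho : {multiplicative gamma -> points G B}) (i : gamma * coord_ring G) : B :=
  rho i.1 i.2.

(* The relations that hold for all representations of gamma in all algebras.
   The quotient represents B |-> Hom(gamma, G(B)): see rep_adjunction. *)
Definition rep_ideal : {pred rep_free} :=
  [pred P | `[< forall (B : comAlgType k)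
                  (rho : {multiplicative gamma -> points G B}),
                free_eval (rep_fun rho) P = 0 >]].

Definition trivial_rep (B : comAlgType k) (g : gamma) : points G B := 1%g.

Lemma trivial_repM B : {morph trivial_rep B : x y / (x * y)%g}.
Proof. by move=> x y; rewrite /trivial_rep mulg1. Qed.

HB.instance Definition _ B := monoid.isMultiplicative.Build gamma (points G B)
  (trivial_rep B) (trivial_repM B).

Lemma rep_ideal_closed : idealr_closed rep_ideal.
Proof.
split=> [||a x y].
- by apply/asboolP => B rho; rewrite raddf0.
- apply/asboolP => /(_ k^o (trivial_rep k^o)).
  by rewrite rmorph1 => /eqP; rewrite oner_eq0.
- move=> /asboolP x0 /asboolP y0; apply/asboolP => B rho.
  by rewrite rmorphD rmorphM /= x0 y0 mulr0 addr0.
Qed.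

HB.instance Definition _ := isIdealr.Build rep_free rep_ideal rep_ideal_closed.

(* gamma_G = O[Rep_G(gamma)] *)
Definition rep_alg := Quotient.quot rep_ideal.

HB.instance Definition _ := GRing.ComNzRing.on rep_alg.

Definition rep_pi : rep_free -> rep_alg := \pi_rep_alg.

HB.instance Definition _ := GRing.RMorphism.on rep_pi.

Definition rep_const (a : k) : rep_alg := rep_pi a%:A.

Lemma rep_constM a b : rep_const a * rep_const b = rep_const (a * b).
Proof.
rewrite -[LHS](rmorphM rep_pi); congr (rep_pi _).
by rewrite -scalerAl mul1r scalerA.
Qed.

Lemma rep_const1 : rep_const 1 = 1.
Proof. by rewrite -[RHS](rmorph1 rep_pi); congr (rep_pi _); rewrite scale1r. Qed.

Lemma rep_constD a b : rep_const (a + b) = rep_const a + rep_const b.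
Proof. by rewrite -[RHS](raddfD rep_pi); congr (rep_pi _); rewrite scalerDl. Qed.

Definition rep_scale (a : k) (q : rep_alg) : rep_alg := rep_const a * q.

Lemma rep_scaleA a b q : rep_scale a (rep_scale b q) = rep_scale (a * b) q.
Proof. rewrite /rep_scale -rep_constM; exact: mulrA. Qed.

Lemma rep_scale1 : left_id 1 rep_scale.
Proof. by move=> q; rewrite /rep_scale rep_const1 mul1r. Qed.

Lemma rep_scaleDr : right_distributive rep_scale +%R.
Proof. move=> a x y; exact: mulrDr. Qed.

Lemma rep_scaleDl q : {morph rep_scale^~ q : a b / a + b}.
Proof. move=> a b; rewrite /rep_scale rep_constD; exact: mulrDl. Qed.

HB.instance Definition _ := GRing.Zmodule_isLmodule.Build k rep_alg
  rep_scaleA rep_scale1 rep_scaleDr rep_scaleDl.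

Lemma rep_scaleAl (a : k) (u v : rep_alg) : a *: (u * v) = (a *: u) * v.
Proof. exact: mulrA. Qed.

HB.instance Definition _ := GRing.Lmodule_isLalgebra.Build k rep_alg rep_scaleAl.
HB.instance Definition _ := GRing.Lalgebra_isComAlgebra.Build k rep_alg.

Lemma rep_pi_scalable : scalable rep_pi.
Proof.
move=> a P; rewrite -[LHS]/(rep_pi (a *: P)) -[P in LHS]mul1r scalerAl.
exact: (rmorphM rep_pi).
Qed.

HB.instance Definition _ := GRing.isScalable.Build k rep_free rep_alg *:%R rep_pi
  rep_pi_scalable.

Definition rep_gen (g : gamma) (u : coord_ring G) : rep_alg :=
  rep_pi (free_gen _ (g, u)).

Section Eval.
Variables (B : comAlgType k) (rho : {multiplicative gamma -> points G B}).

Definition rep_eval (q : rep_alg) : B := free_eval (rep_fun rho) (repr q).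

Lemma rep_eval_pi P : rep_eval (rep_pi P) = free_eval (rep_fun rho) P.
Proof.
apply/eqP; rewrite -subr_eq0 -raddfB; apply/eqP.
suff /asboolP : repr (rep_pi P) - P \in rep_ideal by apply.
by rewrite Quotient.idealrBE reprK.
Qed.

Lemma rep_eval_zmod : zmod_morphism rep_eval.
Proof.
move=> x y; rewrite -[x]reprK -[y]reprK -raddfB !rep_eval_pi.
exact: raddfB.
Qed.

Lemma rep_eval_monoid : GRing.monoid_morphism rep_eval.
Proof.
split=> [|x y].
  by rewrite -[1](rmorph1 rep_pi) rep_eval_pi rmorph1.
rewrite -[x]reprK -[y]reprK -(rmorphM rep_pi) !rep_eval_pi.
exact: rmorphM.
Qed.

Lemma rep_eval_scalable : scalable rep_eval.
Proof.
move=> a q; rewrite -[q]reprK -[_ *: _](rmorphM rep_pi) !rep_eval_pi.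
by rewrite -scalerAl mul1r linearZ.
Qed.

HB.instance Definition _ := GRing.isZmodMorphism.Build rep_alg B rep_eval
  rep_eval_zmod.
HB.instance Definition _ := GRing.isMonoidMorphism.Build rep_alg B rep_eval
  rep_eval_monoid.
HB.instance Definition _ := GRing.isScalable.Build k rep_alg B *:%R rep_eval
  rep_eval_scalable.

Lemma rep_eval_gen g u : rep_eval (rep_gen g u) = rho g u.
Proof. by rewrite rep_eval_pi free_eval_gen. Qed.

End Eval.

Lemma rep_eval_inj (x y : rep_alg) :
  (forall (B : comAlgType k) (rho : {multiplicative gamma -> points G B}),
     rep_eval rho x = rep_eval rho y) -> x = y.
Proof.
move=> xy; rewrite -[x]reprK -[y]reprK; apply/eqP; rewrite -Quotient.idealrBE.
by apply/asboolP => B rho; rewrite raddfB /=; apply/eqP; rewrite subr_eq0; apply/eqP/xy.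
Qed.

Lemma rep_gen_zmod g : zmod_morphism (rep_gen g).
Proof.
move=> u v; apply: rep_eval_inj => B rho.
rewrite (raddfB (rep_eval rho)) [LHS]rep_eval_gen.
rewrite (raddfB (rho g : {lrmorphism _ -> B})).
congr (_ - _); exact/esym/rep_eval_gen.
Qed.

Lemma rep_gen_monoid g : GRing.monoid_morphism (rep_gen g).
Proof.
split=> [|u v]; apply: rep_eval_inj => B rho.
  rewrite (rmorph1 (rep_eval rho)) [LHS]rep_eval_gen.
  exact: (rmorph1 (rho g : {lrmorphism _ -> B})).
rewrite (rmorphM (rep_eval rho)) [LHS]rep_eval_gen.
rewrite (rmorphM (rho g : {lrmorphism _ -> B})).
congr (_ * _); exact/esym/rep_eval_gen.
Qed.

Lemma rep_gen_scalable g : scalable (rep_gen g).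
Proof.
move=> a u; apply: rep_eval_inj => B rho.
rewrite (linearZ_LR (rep_eval rho)) [LHS]rep_eval_gen.
rewrite (linearZ_LR (rho g : {lrmorphism _ -> B})).
congr (_ *: _); exact/esym/rep_eval_gen.
Qed.

HB.instance Definition _ g := GRing.isZmodMorphism.Build (coord_ring G) rep_alg
  (rep_gen g) (rep_gen_zmod g).
HB.instance Definition _ g := GRing.isMonoidMorphism.Build (coord_ring G) rep_alg
  (rep_gen g) (rep_gen_monoid g).
HB.instance Definition _ g := GRing.isScalable.Build k (coord_ring G) rep_alg *:%R
  (rep_gen g) (rep_gen_scalable g).

Definition rep_univ (g : gamma) : points G rep_alg := rep_gen g.

Lemma rep_eval_univ (B : comAlgType k)
  (rho : {multiplicative gamma -> points G B}) g :
  lrcomp (rep_eval rho) (rep_univ g) = rho g.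
Proof. by apply: lrmorphism_eq => u; apply: rep_eval_gen. Qed.

Lemma rep_univM : {morph rep_univ : x y / (x * y)%g}.
Proof.
move=> x y; apply: lrmorphism_eq => u; apply: rep_eval_inj => B rho.
rewrite [LHS]rep_eval_gen gmulfM -!rep_eval_univ.
exact: (congr1 (fun h : {lrmorphism coord_ring G -> B} => h u)
  (esym (point_mul_natural (rep_eval rho) (rep_univ x) (rep_univ y)))).
Qed.

HB.instance Definition _ := monoid.isMultiplicative.Build gamma (points G rep_alg)
  rep_univ rep_univM.

Lemma rep_hom_eq (B : comAlgType k) (h h' : {lrmorphism rep_alg -> B}) :
  (forall g u, h (rep_gen g u) = h' (rep_gen g u)) -> h = h'.
Proof.
move=> hh; apply: lrmorphism_eq => q; rewrite -[q]reprK.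
rewrite -[\pi_ _ _]/(rep_pi (repr q)); move: (repr q) => P.
apply: (free_hom_eq (h := lrcomp h rep_pi) (h' := lrcomp h' rep_pi)) => -[g u].
exact: hh.
Qed.

(* gamma |-> gamma_G is left adjoint to the functor of points of G. *)
Lemma rep_adjunction (B : comAlgType k)
    (rho : {multiplicative gamma -> points G B}) :
  exists! h : {lrmorphism rep_alg -> B}, forall g, lrcomp h (rep_univ g) = rho g.
Proof.
exists (rep_eval rho); split; first exact: rep_eval_univ.
move=> h hrho; apply: rep_hom_eq => g u; rewrite /= rep_eval_gen -hrho //.
Qed.

End RepAlgebra.

Section RepFunctor.
Variables (k : fieldType) (G : affine_group k).

Definition rep_map (gamma gamma' : groupType)
    (phi : {multiplicative gamma -> gamma'}) :
    {lrmorphism rep_alg G gamma -> rep_alg G gamma'} :=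
  rep_eval (@rep_univ k G gamma' \o phi).

Lemma rep_map_gen (gamma gamma' : groupType)
    (phi : {multiplicative gamma -> gamma'}) g u :
  rep_map phi (rep_gen g u) = rep_gen (phi g) u.
Proof. exact: rep_eval_gen. Qed.

Variable S : sgroup.

Definition rep_act m n (f : simplex_map m n) :
    {lrmorphism rep_alg G (S n) -> rep_alg G (S m)} :=
  rep_map (sgroup_act S f).

Lemma rep_laws : simplicial_laws rep_act.
Proof.
have [S1 SM] := sgroup_laws S.
split=> [n|m n p g f] q.
  suff /(congr1 (fun h : {lrmorphism _ -> _} => h q)) :
    rep_act (simplex_id n) = idfun by [].
  by apply: rep_hom_eq => x u; rewrite [LHS]rep_map_gen S1.
suff /(congr1 (fun h : {lrmorphism _ -> _} => h q)) :
  rep_act (simplex_comp g f) = lrcomp (rep_act f) (rep_act g) by [].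
apply: rep_hom_eq => x u; rewrite [LHS]rep_map_gen SM.
by rewrite -[RHS]/(rep_act f (rep_act g (rep_gen x u))) !rep_map_gen.
Qed.

Definition rep_scalg : scalg k :=
  @SCAlg k (fun n => rep_alg G (S n)) rep_act rep_laws.

End RepFunctor.

(* Only the data of a graded algebra: its laws play no role in the notion of
   isomorphism. *)
Record graded_alg (k : fieldType) := GradedAlg {
  gr_comp :> nat -> lmodType k;
  gr_one : gr_comp 0;
  gr_mul : forall p q, gr_comp p -> gr_comp q -> gr_comp (p + q)
}.

Definition graded_alg_iso (k : fieldType) (A B : graded_alg k) : Prop :=
  exists phi : forall n, {linear A n -> B n},
    [/\ forall n, bijective (phi n),
        phi 0%N (gr_one A) = gr_one B
      & forall p q (x : A p) (y : A q),
          phi (p + q)%N (gr_mul x y) = gr_mul (phi p x) (phi q y)].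

Section Homotopy.
Variables (k : fieldType) (A : scalg k).

Definition aface n (i : 'I_n.+2) : {lrmorphism A n.+1 -> A n} :=
  scalg_act A (coface i).

(* pi_n is the homology of the Moore complex: the elements all of whose faces
   vanish, modulo the d_0 b with d_i b = 0 for all i > 0. *)
Definition moore_cycles n : {pred A n} :=
  match n with
  | 0 => predT
  | m.+1 => [pred a : A m.+1 | [forall i, aface i a == 0]]
  end.
Arguments moore_cycles : clear implicits.

Definition moore_boundaries n : {pred A n} :=
  [pred a | `[< exists2 b : A n.+1,
                  forall i, i != ord0 -> aface i b = 0 & aface ord0 b = a >]].
Arguments moore_boundaries : clear implicits.

Lemma moore_cycles_closed n : submod_closed (moore_cycles n).
Proof.
case: n => [|n]; split=> //= [|a x y].
  by apply/forallP => i; rewrite raddf0.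
move=> /forallP x0 /forallP y0; apply/forallP => i.
by rewrite linearP /= (eqP (x0 i)) (eqP (y0 i)) scaler0 addr0.
Qed.

Lemma moore_boundaries_closed n : submod_closed (moore_boundaries n).
Proof.
split=> [|a x y].
  by apply/asboolP; exists 0 => [i _|]; rewrite raddf0.
move=> /asboolP[b b0 <-] /asboolP[c c0 <-]; apply/asboolP.
exists (a *: b + c) => [i i0|]; rewrite linearP //=.
by rewrite b0 // c0 // scaler0 addr0.
Qed.

HB.instance Definition _ n := GRing.isSubmodClosed.Build k (A n)
  (moore_cycles n) (moore_cycles_closed n).
HB.instance Definition _ n := GRing.isSubmodClosed.Build k (A n)
  (moore_boundaries n) (moore_boundaries_closed n).

Definition homotopy n : lmodType k :=
  subquot (moore_cycles n) (moore_boundaries n).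

(* A (p,q)-shuffle is encoded by the p-element set S of its steps in the first
   direction, S in {0, ..., p+q-1}.  [stair p S] : [N] -> [p] counts the steps
   in S before a given vertex; it is the composite of the degeneracies indexed
   by the complement of S.  (minn is only there to make it total: it has no
   effect when #|S| = p.) *)
Definition stair_fun N p (S : {set 'I_N}) (i : 'I_N.+1) : 'I_p.+1 :=
  inord (minn p #|[set j in S | (j < i)%N]|).

Lemma stair_mono N p (S : {set 'I_N}) :
  {homo stair_fun p S : i j / (i <= j)%N}.
Proof.
move=> i j ij; rewrite /stair_fun !inordK ?ltnS ?geq_minl //.
rewrite leq_min geq_minl /=; apply: leq_trans (geq_minr _ _) _.
apply/subset_leq_card/subsetP => x; rewrite !inE => /andP[-> xi].
exact: leq_trans xi ij.
Qed.

Definition stair N p (S : {set 'I_N}) : simplex_map N p :=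
  SimplexMap (@stair_mono N p S).

Definition inversions N (S : {set 'I_N}) : nat :=
  #|[set ij : 'I_N * 'I_N | [&& ij.1 \in S, ij.2 \notin S & (ij.2 < ij.1)%N]]|.

(* the Eilenberg-Zilber shuffle product *)
Definition shuffle p q (a : A p) (b : A q) : A (p + q)%N :=
  \sum_(S : {set 'I_(p + q)} | #|S| == p)
    (-1) ^+ inversions S *
    (scalg_act A (stair p S) a * scalg_act A (stair q (~: S)) b).

(* The shuffle product of Moore cycles is a Moore cycle whose class depends
   only on the classes of the factors, so the choice of representatives is
   immaterial. *)
Definition homotopy_mul p q (x : homotopy p) (y : homotopy q) :
    homotopy (p + q)%N :=
  subclass _ _ (shuffle (subrepr x) (subrepr y)).

Definition homotopy_alg : graded_alg k :=
  @GradedAlg k homotopy (subclass _ _ (1 : A 0%N)) homotopy_mul.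

End Homotopy.

Section GradedSym.
Variables (k : fieldType) (V : nat -> lmodType k).

(* Sym(V) is the quotient of the tensor algebra of V by graded commutativity;
   the tensor algebra is itself presented as the free algebra on the
   homogeneous elements of V modulo linearity.  (Squares of elements of odd
   degree are killed only when 2 is invertible in k.) *)
Definition sym_free := {malg k[{fmonom {n : nat & V n}}]}.

Definition sym_letter n (v : V n) : sym_free := << fmu (Tagged V v) >>.

Inductive sym_rel : sym_free -> Prop :=
| SymLinear n (a : k) (u v : V n) :
    sym_rel (sym_letter (a *: u + v) - (a *: sym_letter u + sym_letter v))
| SymComm p q (u : V p) (v : V q) :
    sym_rel (sym_letter u * sym_letter v -
             (-1) ^+ (p * q) *: (sym_letter v * sym_letter u)).

Definition two_sided_ideal (I : {pred sym_free}) : Prop :=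
  submod_closed I /\ (forall a b x, x \in I -> a * x * b \in I).

Definition sym_ideal : {pred sym_free} :=
  [pred x | `[< forall I : {pred sym_free}, two_sided_ideal I ->
                  (forall r, sym_rel r -> r \in I) -> x \in I >]].

Definition word_degree (m : {fmonom {n : nat & V n}}) : nat :=
  sumn [seq tag x | x <- (m : seq _)].

Definition sym_homog n : {pred sym_free} :=
  [pred x | all (fun m => word_degree m == n) (msupp x)].

Lemma sym_ideal_closed : submod_closed sym_ideal.
Proof.
split=> [|a x y]; first by apply/asboolP => I [[]].
move=> /asboolP xI /asboolP yI; apply/asboolP => I idI rI.
by have [[_ +] _] := idI; apply; [apply: xI | apply: yI].
Qed.

Lemma sym_homogP n (x : sym_free) :
  reflect (forall m, x@_m != 0 -> word_degree m = n) (x \in sym_homog n).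
Proof.
apply: (iffP allP) => xn m; first by rewrite mcoeff_neq0 => /xn/eqP.
by rewrite -mcoeff_neq0 => /xn/eqP.
Qed.

Lemma sym_homog_closed n : submod_closed (sym_homog n).
Proof.
split=> [|a x y]; first by apply/sym_homogP => m; rewrite mcoeff0 eqxx.
move=> /sym_homogP xn /sym_homogP yn; apply/sym_homogP => m.
rewrite mcoeffD mcoeffZ; have [x0|/xn //] := eqVneq (x@_m) 0.
by rewrite x0 mulr0 add0r => /yn.
Qed.

HB.instance Definition _ := GRing.isSubmodClosed.Build k sym_free
  sym_ideal sym_ideal_closed.
HB.instance Definition _ n := GRing.isSubmodClosed.Build k sym_free
  (sym_homog n) (sym_homog_closed n).

Definition sym_comp n : lmodType k := subquot (sym_homog n) sym_ideal.

Definition sym_mul p q (x : sym_comp p) (y : sym_comp q) : sym_comp (p + q)%N :=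
  subclass _ _ (subrepr x * subrepr y).

Definition graded_sym : graded_alg k :=
  @GradedAlg k sym_comp (subclass _ _ (1 : sym_free)) sym_mul.

End GradedSym.

Definition HR (k : fieldType) (X : sset) (G : affine_group k) : graded_alg k :=
  homotopy_alg (rep_scalg G (kan_loop X)).

(* Main.v *)
(* Let x_1, ..., x_l be coordinates of G at the unit; there are l of them because
   the dimension of the cotangent space is the Krull dimension in characteristic 0.
   As X is simply connected, every class in H_(n+1)(X; k) is a combination of classes
   of elements g of the loop group whose abelianizations have no nonzero face, and
   sending g to x_i(g) is well defined from homology to HR_n(X, G).  Shuffle products
   extend these maps to a morphism from Sym to HR.

   Injectivity.  As G is commutative, an additive character of a group Gam and an
   invariant derivation of O(G) define a derivation of the representation algebra of
   Gam.  Hence a cocycle of X defines a contraction of HR, which is a derivation for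
   the shuffle product; on Sym it is a partial derivative, and Euler's formula lowers
   the degree of an element of the kernel.

   Surjectivity.  It suffices to treat finite subcomplexes.  Moore cycles in degree
   n > 0 form an ideal, and the product of a cycle with an element of the augmentation
   ideal is a boundary, so that by Artin-Rees a cycle in a high enough power of the
   augmentation ideal is a boundary.  Modulo higher powers, Euler's formula writes a
   multiple of a cycle as a sum of shuffle products of the x_i(g) with contractions. *)

From HB Require Import structures.
Require Import Defs.
From mathcomp Require Import all_boot all_order all_algebra.
From mathcomp Require Import boolp.
From mathcomp Require Import finmap monalg.
From mathcomp Require Import zify ring.
Set Implicit Arguments.
Unset Strict Implicit.
Unset Printing Implicit Defensive.
Import GRing.Theory.
Local Open Scope ring_scope.
From mathcomp Require classical_sets.

(** The loop group supplies only integral chains, and x_i(gh) differs from x_i(g) + x_i(h) by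
    products of functions that vanish at the unit. On elements whose chains have no nonzero face
    such products are boundaries, and a relation with coefficients in k is split into integral ones
    over a family of scalars independent over the integers. Euler's formula yields degreewise
    products of generators with derivatives, whereas the goal is shuffle products of cycles. The
    Eilenberg-Zilber homotopy trades the degreewise product for shuffle products of front and back
    faces, and a contraction of the abelianized loop group replaces the generators by cycles.
    Artin-Rees needs noetherian algebras, hence finitely many simplices in each degree, but a finite
    subcomplex need not be simply connected. So the induction runs in the algebra of the subcomplex,
    while its conclusion is stated modulo boundaries over the whole space. Operators and homotopies
    are defined by recursion along the decalage, where an identity for the shifted object gives the
    next one. *)

Inductive zexp := ZZero | ZAtom of nat | ZAdd of zexp & zexp | ZOpp of zexp.

Fixpoint zeval (V : zmodType) (l : seq V) (e : zexp) : V :=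
  match e with
  | ZZero => 0
  | ZAtom i => l`_i
  | ZAdd e1 e2 => zeval l e1 + zeval l e2
  | ZOpp e1 => - zeval l e1
  end.

Fixpoint zcoef (e : zexp) (i : nat) : int :=
  match e with
  | ZZero => 0
  | ZAtom j => (i == j)%:Z
  | ZAdd e1 e2 => zcoef e1 i + zcoef e2 i
  | ZOpp e1 => - zcoef e1 i
  end.

Lemma zevalE (V : zmodType) (l : seq V) e :
  zeval l e = \sum_(i < size l) l`_i *~ zcoef e i.
Proof.
elim: e => [|j|e1 IH1 e2 IH2|e IH] /=.
- by rewrite big1 // => i _; rewrite mulr0z.
- have [jl|lj] := ltnP j (size l).
    rewrite (bigD1 (Ordinal jl)) //= eqxx big1 ?addr0 // => i ij.
    by case: eqP => [ij'|_]; rewrite ?mulr0z //; case/eqP: ij; apply: val_inj.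
  rewrite nth_default // big1 // => i _; case: eqP => [ij|_]; rewrite ?mulr0z //.
  by have := ltn_ord i; rewrite ij ltnNge lj.
- by rewrite IH1 IH2 -big_split; apply: eq_bigr => i _; rewrite mulrzDr.
- by rewrite IH -sumrN; apply: eq_bigr => i _; rewrite mulrNz.
Qed.

(** Decision by computation: an expression is determined by the integer coefficients of its atoms.
    An index beyond the list evaluates to 0, so coefficients are compared in range. *)
Lemma zmod_eq (V : zmodType) (l : seq V) e1 e2 :
  all (fun i => zcoef e1 i == zcoef e2 i) (iota 0 (size l)) ->
  zeval l e1 = zeval l e2.
Proof.
move=> /allP e12; rewrite !zevalE; apply: eq_bigr => i _.
by rewrite (eqP (e12 _ _)) // mem_iota add0n ltn_ord.
Qed.

Ltac zindex same x l :=
  lazymatch l with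
  | cons ?y ?l' => match constr:(tt) with
      | _ => let _ := match constr:(tt) with _ => same x y end in constr:(0%N)
      | _ => let i := zindex same x l' in constr:(S i)
      end
  end.
Ltac zatoms same t l :=
  lazymatch t with
  | (?a + ?b)%R => let l := zatoms same a l in zatoms same b l
  | (- ?a)%R => zatoms same a l
  | 0%R => l
  | _ => match constr:(tt) with
      | _ => let _ := zindex same t l in l
      | _ => constr:(cons t l)
      end
  end.
Ltac zreify same t l :=
  lazymatch t with
  | (?a + ?b)%R => let a := zreify same a l in let b := zreify same b l in constr:(ZAdd a b)
  | (- ?a)%R => let a := zreify same a l in constr:(ZOpp a)
  | 0%R => constr:(ZZero)
  | _ => let i := zindex same t l in constr:(ZAtom i)
  end.
Ltac zmod_with same :=
  lazymatch goal with
  | |- @eq ?T ?a ?b =>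
      let l := zatoms same a (@nil T) in let l := zatoms same b l in
      let a := zreify same a l in let b := zreify same b l in
      exact (@zmod_eq _ l a b (erefl true))
  end.
(* Equalities that hold in every abelian group; [zmodu] compares atoms up to
   conversion, as needed when they differ in canonical structures. *)
Ltac zmod := zmod_with ltac:(fun x y => constr_eq x y).
Ltac zmodu := zmod_with ltac:(fun x y => unify x y).

(** * Signs and operators of the simplex category *)

Section Sign.
Variable V : zmodType.

(** Multiplication by (-1)^n, by parity rather than through scalars, so that it makes sense in every
    abelian group and reduces on numerals. *)
Definition sgn (n : nat) (x : V) : V := if odd n then - x else x.

Lemma sgn0 n : sgn n 0 = 0.
Proof. by rewrite /sgn oppr0 if_same. Qed.

Lemma sgnS n x : sgn n.+1 x = - sgn n x.
Proof. by rewrite /sgn /=; case: odd => //=; rewrite opprK. Qed.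

Lemma sgnN n x : sgn n (- x) = - sgn n x.
Proof. by rewrite /sgn; case: odd. Qed.

Lemma sgnD n x y : sgn n (x + y) = sgn n x + sgn n y.
Proof. by rewrite /sgn; case: odd => //; rewrite opprD. Qed.

Lemma sgnB n x y : sgn n (x - y) = sgn n x - sgn n y.
Proof. by rewrite sgnD sgnN. Qed.

Lemma sgn_sgn m n x : sgn m (sgn n x) = sgn (m + n) x.
Proof. by rewrite /sgn oddD; do 2!case: odd => //=; rewrite opprK. Qed.

Lemma sgn_sum I (r : seq I) P n (F : I -> V) :
  sgn n (\sum_(i <- r | P i) F i) = \sum_(i <- r | P i) sgn n (F i).
Proof. by apply: (big_morph _ (sgnD n)); rewrite sgn0. Qed.

End Sign.

Lemma raddf_sgn (U V : zmodType) (f : {additive U -> V}) n x :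
  f (sgn n x) = sgn n (f x).
Proof. by rewrite /sgn; case: odd => //; rewrite raddfN. Qed.

Lemma sgnZ (k : pzRingType) (V : lmodType k) n (x : V) :
  sgn n x = (-1) ^+ n *: x.
Proof. by rewrite -signr_odd /sgn; case: odd; rewrite ?scaleN1r ?scale1r. Qed.

Lemma sgnM (k : pzRingType) n (x : k) : sgn n x = (-1) ^+ n * x.
Proof. by rewrite -signr_odd /sgn; case: odd; rewrite ?mulN1r ?mul1r. Qed.

Lemma scale_sgn (k : pzRingType) (V : lmodType k) n a (x : V) :
  sgn n (a *: x) = a *: sgn n x.
Proof. by rewrite /sgn; case: odd; rewrite ?scalerN. Qed.

Lemma shift_id n : shift false (simplex_id n) = simplex_id n.+1.
Proof. by apply: simplexS_eq => [|i]; rewrite ?shift0 ?shiftS ?inord_false. Qed.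

Lemma shift_coface n (i : 'I_n.+2) :
  shift false (coface i) = coface (lift ord0 i).
Proof.
apply: simplexS_eq => [|j]; rewrite ?shift0 ?shiftS ?inord_false; apply: val_inj.
  by [].
by rewrite /= /bump /=; lia.
Qed.

Lemma shift_codegen n (i : 'I_n.+1) :
  shift false (codegen i) = codegen (lift ord0 i).
Proof.
apply: simplexS_eq => [|j]; rewrite ?shift0 ?shiftS ?inord_false; apply: val_inj.
  by rewrite /= inordK.
rewrite /= inordK ?unbump_lt // /bump /= !add1n unbumpS inordK // ltnS.
exact: unbump_lt.
Qed.

(** The vertex 0 is added by the shift and skipped by this coface, so d_0 is a simplicial map from
    the decalage to the object itself. This lets d_0 be pushed through every operator defined by
    recursion. *)
Lemma shift_coface0 m n (f : simplex_map m n) :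
  simplex_comp (shift false f) (coface ord0) = simplex_comp (coface ord0) f.
Proof. by apply: simplex_map_eq => i; rewrite !simplex_compE shiftS. Qed.

Lemma codegen0_coface0 n :
  simplex_comp (codegen ord0) (coface ord0) = simplex_id n.
Proof. by apply: simplex_map_eq => i; rewrite !simplex_compE codegen0S. Qed.

Lemma codegen0_coface1 n :
  simplex_comp (codegen ord0) (coface (lift ord0 ord0)) = simplex_id n.
Proof.
apply: simplex_map_eq => i; rewrite simplex_compE.
by apply: val_inj; rewrite [LHS]codegen0E /= /bump; case: (val i).
Qed.

(** The degeneracy s_0 doubles vertex 0, so it is natural towards the decalage for the operators
    that fix that vertex. The faces d_i with i > 0 and all degeneracies do ([coface_lift0],
    [codegen_at0]). *)
Lemma codegen0_shift m n (f : simplex_map m n) : f ord0 = ord0 ->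
  simplex_comp (codegen ord0) (shift false f) = simplex_comp f (codegen ord0).
Proof.
move=> f0; apply: simplexS_eq => [|i]; rewrite !simplex_compE.
  by rewrite shift0 inord_false !codegen00 f0.
by rewrite shiftS !codegen0S.
Qed.

Lemma coface_lift0 n (i : 'I_n.+1) : coface (lift ord0 i) ord0 = ord0.
Proof. exact: val_inj. Qed.

Lemma codegen_at0 n (i : 'I_n.+1) : codegen i ord0 = ord0.
Proof. by apply: val_inj; rewrite /= inordK // /unbump. Qed.

Lemma shift_at0 m n (f : simplex_map m n) : shift false f ord0 = ord0.
Proof. by rewrite shift0 inord_false. Qed.

Record stype := SType {
  stype_obj :> nat -> Type;
  stype_act : forall m n, simplex_map m n -> stype_obj n -> stype_obj m;
  stype_laws : simplicial_laws stype_act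
}.

Record szmod := SZmod {
  szmod_obj :> nat -> zmodType;
  szmod_act : forall m n,
    simplex_map m n -> {additive szmod_obj n -> szmod_obj m};
  szmod_laws : simplicial_laws szmod_act
}.

Arguments stype_act s {m n} f x : rename.
Arguments szmod_act s {m n} f : rename.

Lemma dec_laws (X : nat -> Type)
    (act : forall m n, simplex_map m n -> X n -> X m) :
  simplicial_laws act ->
  @simplicial_laws (fun n => X n.+1) (fun m n f => act _ _ (shift false f)).
Proof.
case=> act1 actM; split=> [n x|m n p g f x] /=.
  by rewrite shift_id act1.
by rewrite -shift_false_comp actM.
Qed.

(** Decalage: degree n holds the objects of degree n + 1, and vertex 0 is hidden from the operators,
    so that d_i there is d_(i+1) here. *)
Definition sdec (M : stype) : stype := SType (dec_laws (stype_laws M)).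

Definition zdec (T : szmod) : szmod :=
  @SZmod (fun n => T n.+1) (fun m n f => szmod_act T (shift false f))
    (dec_laws (szmod_laws T)).

(** * Simplicial modules *)

Section SimplicialType.
Variable M : stype.

Definition tface n (i : 'I_n.+2) : M n.+1 -> M n := stype_act M (coface i).
Definition tdegen n : M n -> M n.+1 := stype_act M (codegen ord0).

Lemma stype_actM m n p (g : simplex_map n p) (f : simplex_map m n) x :
  stype_act M f (stype_act M g x) = stype_act M (simplex_comp g f) x.
Proof. by case: (stype_laws M) => _ ->. Qed.

Lemma stype_act1 n x : stype_act M (simplex_id n) x = x.
Proof. by case: (stype_laws M) => ->. Qed.

Lemma tface0_degen n (x : M n) : tface ord0 (tdegen x) = x.
Proof. by rewrite /tface stype_actM codegen0_coface0 stype_act1. Qed.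

Lemma tface1_degen n (x : M n) : tface (lift ord0 ord0) (tdegen x) = x.
Proof. by rewrite /tface stype_actM codegen0_coface1 stype_act1. Qed.

Lemma tface_degen n (i : 'I_n.+1) (x : M n.+1) :
  tface (lift ord0 (lift ord0 i)) (tdegen x) = tdegen (tface (lift ord0 i) x).
Proof.
rewrite /tface /tdegen !stype_actM -shift_coface codegen0_shift //.
exact: coface_lift0.
Qed.

End SimplicialType.

Lemma sdec_face (M : stype) n (i : 'I_n.+2) (x : M n.+2) :
  tface (M := sdec M) i x = tface (lift ord0 i) x.
Proof. by rewrite /tface /= shift_coface. Qed.

Definition stype_of_szmod (T : szmod) : stype := SType (szmod_laws T).
Coercion stype_of_szmod : szmod >-> stype.

Section SimplicialModule.
Variable T : szmod.

Definition zface n (i : 'I_n.+2) : {additive T n.+1 -> T n} :=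
  szmod_act T (coface i).
Definition zdegen n : {additive T n -> T n.+1} := szmod_act T (codegen ord0).

Definition alt_bd n (x : T n.+1) : T n := \sum_(i < n.+2) sgn i (zface i x).

Lemma alt_bd_is_additive n : zmod_morphism (@alt_bd n).
Proof.
by move=> x y; rewrite /alt_bd -sumrB; apply: eq_bigr => i _; rewrite raddfB sgnB.
Qed.
HB.instance Definition _ n := GRing.isZmodMorphism.Build _ _ (@alt_bd n)
  (@alt_bd_is_additive n).

Definition moore n (x : T n.+1) := forall i : 'I_n.+1, zface (lift ord0 i) x = 0.

Definition moore_chain n : T n -> Prop :=
  match n with 0 => fun=> True | n'.+1 => @moore n' end.

Definition moore_cycle n : T n -> Prop :=
  match n with 0 => fun=> True | n'.+1 => fun x => forall i, zface i x = 0 end.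

Lemma alt_bd_moore n (x : T n.+1) : moore x -> alt_bd x = zface ord0 x.
Proof.
move=> x0; rewrite /alt_bd big_ord_recl big1 ?addr0 // => i _.
by rewrite x0 sgn0.
Qed.

End SimplicialModule.
Arguments zface {T n} i.
Arguments zdegen {T n}.

Section AltBd.

Lemma zface_dec (T : szmod) n (i : 'I_n.+2) (x : T n.+2) :
  zface (T := zdec T) i x = zface (lift ord0 i) x.
Proof. by rewrite /zface /= shift_coface. Qed.

(** The recursion behind the boundary computations below: what remains after d_0 is, up to sign, the
    boundary of the decalage. Identities are then proved by induction on the degree for all
    simplicial objects at once. *)
Lemma alt_bdS (T : szmod) n (x : T n.+2) :
  alt_bd x = zface ord0 x - alt_bd (T := zdec T) x.
Proof.
rewrite [LHS]/alt_bd big_ord_recl; congr (_ + _); rewrite -sumrN.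
by apply: eq_bigr => i _; rewrite zface_dec lift0 sgnS.
Qed.

Lemma szmod_actM (T : szmod) m n p (g : simplex_map n p) (f : simplex_map m n) x :
  szmod_act T f (szmod_act T g x) = szmod_act T (simplex_comp g f) x.
Proof. exact: (@stype_actM T). Qed.

Lemma szmod_act1 (T : szmod) n x : szmod_act T (simplex_id n) x = x.
Proof. exact: (@stype_act1 T). Qed.

Lemma zface0_nat (T : szmod) m n (f : simplex_map m n) (x : T n.+1) :
  zface ord0 (szmod_act T (shift false f) x) = szmod_act T f (zface ord0 x).
Proof. by rewrite !szmod_actM shift_coface0. Qed.

Lemma zface0_alt_bd (T : szmod) n (x : T n.+2) :
  zface ord0 (alt_bd (T := zdec T) x) = alt_bd (zface ord0 x).
Proof.
rewrite raddf_sum; apply: eq_bigr => i _; rewrite raddf_sgn; congr (sgn _ _).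
exact: zface0_nat.
Qed.

Lemma zface0S (T : szmod) n (i : 'I_n.+2) (x : T n.+2) :
  zface ord0 (zface (lift ord0 i) x) = zface i (zface ord0 x).
Proof. by rewrite -zface0_nat /zface shift_coface. Qed.

Lemma alt_bd1 (T : szmod) (x : T 1%N) :
  alt_bd x = zface ord0 x - zface (lift ord0 ord0) x.
Proof. by rewrite /alt_bd big_ord_recl big_ord1 /sgn. Qed.

(** As d_0 commutes with the boundaries of the decalage and of the object, the mixed terms cancel
    and the square of the boundary of the decalage is left. *)
Lemma alt_bdK n : forall (T : szmod) (x : T n.+2), alt_bd (alt_bd x) = 0.
Proof.
elim: n => [|n IHn] T x.
  rewrite (alt_bdS x) raddfB /= -zface0_alt_bd [X in _ - X]alt_bd1 opprB.
  rewrite addrCA subrr addr0 alt_bd1 raddfB /= !zface_dec.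
  apply/eqP; rewrite subr_eq0; apply/eqP; rewrite /zface !szmod_actM.
  congr (szmod_act T _ _); apply: simplex_map_eq => i; rewrite !ord1; exact: val_inj.
rewrite (alt_bdS x) raddfB /= -zface0_alt_bd [X in _ - X]alt_bdS opprB.
by rewrite IHn sub0r addrN.
Qed.

Lemma zface0_degen (T : szmod) n (x : T n) : zface ord0 (zdegen x) = x.
Proof. exact: (@tface0_degen T). Qed.

Lemma zface1_degen (T : szmod) n (x : T n) : zface (lift ord0 ord0) (zdegen x) = x.
Proof. exact: (@tface1_degen T). Qed.

Lemma zface_degen (T : szmod) n (i : 'I_n.+1) (x : T n.+1) :
  zface (lift ord0 (lift ord0 i)) (zdegen x) = zdegen (zface (lift ord0 i) x).
Proof. exact: (@tface_degen T). Qed.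

End AltBd.

(* For simplicial objects one of whose factors carries no group structure, the
   Eilenberg-MacLane operators are written as functions of pairs (x, y). *)
Record pairing := Pairing {
  pM : stype;
  pU : stype;
  pR : szmod;
  pval : forall n, pM n -> pU n -> pR n;
  pval_nat : forall m n (f : simplex_map m n) x y,
    pval (stype_act pM f x) (stype_act pU f y) = szmod_act pR f (pval x y)
}.

Definition pdec (Q : pairing) : pairing :=
  @Pairing (sdec (pM Q)) (sdec (pU Q)) (zdec (pR Q)) (fun n => @pval Q n.+1)
    (fun m n f => @pval_nat Q m.+1 n.+1 (shift false f)).

(* The shuffle map, by recursion on the first step of a shuffle; it is 0 unless
   n = p + q. *)
Fixpoint shuf (n : nat) : forall (Q : pairing) p q, pM Q p -> pU Q q -> pR Q n :=
  match n with
  | 0 => fun Q p q =>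
      match p, q return pM Q p -> pU Q q -> pR Q 0%N with
      | 0, 0 => @pval Q 0%N
      | _, _ => fun _ _ => 0
      end
  | n'.+1 => fun Q p q x y =>
      match p return pM Q p -> pR Q n'.+1 with
      | 0 => fun=> 0
      | p'.+1 => fun x => shuf n' (Q := pdec Q) (p := p') (q := q) x (tdegen y)
      end x +
      sgn p (match q return pU Q q -> pR Q n'.+1 with
      | 0 => fun=> 0
      | q'.+1 => fun y => shuf n' (Q := pdec Q) (p := p) (q := q') (tdegen x) y
      end y)
  end.
Arguments shuf n Q {p q} x y : rename.
Arguments pval Q {n} x y : rename.

(** * Shuffle products and Eilenberg-Zilber homotopies *)

Section Shuffle.

Lemma shufSS n Q p q (x : pM Q p.+1) (y : pU Q q.+1) :
  shuf n.+1 Q x y = shuf n (pdec Q) (p := p) (q := q.+1) x (tdegen y) +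
    sgn p.+1 (shuf n (pdec Q) (p := p.+1) (q := q) (tdegen x) y).
Proof. by []. Qed.

Lemma shuf0S n Q q (x : pM Q 0%N) (y : pU Q q.+1) :
  shuf n.+1 Q x y = shuf n (pdec Q) (p := 0%N) (q := q) (tdegen x) y.
Proof. exact: add0r. Qed.

Lemma shufS0 n Q p (x : pM Q p.+1) (y : pU Q 0%N) :
  shuf n.+1 Q x y = shuf n (pdec Q) (p := p) (q := 0%N) x (tdegen y).
Proof. by rewrite /= sgn0 addr0. Qed.

Lemma shuf00 n Q (x : pM Q 0%N) (y : pU Q 0%N) : shuf n.+1 Q x y = 0.
Proof. exact: addr0. Qed.

Lemma shuf_dim n : forall Q p q (x : pM Q p) (y : pU Q q),
  n != (p + q)%N -> shuf n Q x y = 0.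
Proof.
elim: n => [|n IHn] Q [|p] [|q] x y // npq.
- exact: shuf00.
- rewrite shuf0S IHn //.
- rewrite shufS0 IHn //; apply: contraNneq npq => ->; lia.
- rewrite shufSS !IHn ?addr0 ?sgn0 ?add0r //; apply: contraNneq npq => ->; lia.
Qed.

(* Shuffles only involve operators that fix the vertex 0. *)
Definition commutes0 (M M' : stype) (a : forall n, M n -> M' n) :=
  forall m n (f : simplex_map m n) x, f ord0 = ord0 ->
    a m (stype_act M f x) = stype_act M' f (a n x).

Lemma commutes0_degen M M' a n x : @commutes0 M M' a ->
  a n.+1 (tdegen x) = tdegen (a n x).
Proof. by move=> aN; apply: aN; apply: codegen_at0. Qed.

Lemma commutes0_dec M M' a : @commutes0 M M' a ->
  @commutes0 (sdec M) (sdec M') (fun n => a n.+1).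
Proof. by move=> aN m n f x _; apply: aN; apply: shift_at0. Qed.

Lemma shuf_nat n : forall Q Q' (a : forall n, pM Q n -> pM Q' n)
    (b : forall n, pU Q n -> pU Q' n)
    (c : forall n, {additive pR Q n -> pR Q' n}),
  commutes0 a -> commutes0 b ->
  (forall n x y, c n (pval Q x y) = pval Q' (a n x) (b n y)) ->
  forall p q (x : pM Q p) (y : pU Q q),
    c n (shuf n Q x y) = shuf n Q' (a p x) (b q y).
Proof.
elim: n => [|n IHn] Q Q' a b c aN bN cN p q x y.
  case: p q x y => [|p] [|q] x y //=; by rewrite ?cN ?raddf0.
have IH := IHn (pdec Q) (pdec Q') (fun n => a n.+1) (fun n => b n.+1)
  (fun n => c n.+1) (commutes0_dec aN) (commutes0_dec bN) (fun n => cN n.+1).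
case: p q x y => [|p] [|q] x y.
- by rewrite !shuf00 raddf0.
- by rewrite !shuf0S -(commutes0_degen _ aN) -IH.
- by rewrite !shufS0 -(commutes0_degen _ bN) -IH.
- by rewrite !shufSS -(commutes0_degen _ aN) -(commutes0_degen _ bN) -!IH raddfD
    raddf_sgn.
Qed.

Lemma tface0_commutes0 M :
  @commutes0 (sdec M) M (fun n => @tface M n ord0).
Proof.
by move=> m n f x _; rewrite /tface [X in stype_act M _ X]/= !stype_actM
  shift_coface0.
Qed.

Lemma zface0_shuf_dec n Q p q (x : pM Q p.+1) (y : pU Q q.+1) :
  zface ord0 (shuf n (pdec Q) (p := p) (q := q) x y) =
  shuf n Q (tface ord0 x) (tface ord0 y).
Proof.
apply: (@shuf_nat n (pdec Q) Q (fun n => @tface _ n ord0)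
  (fun n => @tface _ n ord0) (fun n => @zface _ n ord0)).
- exact: tface0_commutes0.
- exact: tface0_commutes0.
- by move=> m x' y'; rewrite /= pval_nat.
Qed.

(** In each half of the recursion one factor has been degenerated by s_0, which d_0 undoes. Hence
    d_0 alone obeys a graded Leibniz rule, the only contribution to the boundary on Moore chains. *)
Lemma zface0_shufSS n Q p q (x : pM Q p.+1) (y : pU Q q.+1) :
  zface ord0 (shuf n.+1 Q x y) =
  shuf n Q (tface ord0 x) y + sgn p.+1 (shuf n Q x (tface ord0 y)).
Proof.
by rewrite shufSS raddfD raddf_sgn /= !zface0_shuf_dec !tface0_degen.
Qed.

Lemma zface0_shuf0S n Q q (x : pM Q 0%N) (y : pU Q q.+1) :
  zface ord0 (shuf n.+1 Q x y) = shuf n Q x (tface ord0 y).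
Proof. by rewrite shuf0S zface0_shuf_dec tface0_degen. Qed.

Lemma zface0_shufS0 n Q p (x : pM Q p.+1) (y : pU Q 0%N) :
  zface ord0 (shuf n.+1 Q x y) = shuf n Q (tface ord0 x) y.
Proof. by rewrite shufS0 zface0_shuf_dec tface0_degen. Qed.

(** A substitute for x = 0 in a factor without group structure: all pullbacks of x pair to 0. *)
Definition nullM (Q : pairing) m (x : pM Q m) :=
  forall n (f : simplex_map n m) y, pval Q (stype_act _ f x) y = 0.
Definition nullU (Q : pairing) m (y : pU Q m) :=
  forall n (f : simplex_map n m) x, pval Q x (stype_act _ f y) = 0.

Lemma nullM_act Q m n (f : simplex_map n m) (x : pM Q m) :
  nullM x -> nullM (stype_act _ f x).
Proof. by move=> x0 p g y; rewrite stype_actM. Qed.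

Lemma nullU_act Q m n (f : simplex_map n m) (x : pU Q m) :
  nullU x -> nullU (stype_act _ f x).
Proof. by move=> x0 p g y; rewrite stype_actM. Qed.

Lemma nullM_dec Q m (x : pM Q m.+1) : nullM x -> @nullM (pdec Q) m x.
Proof. by move=> x0 n f y; apply: x0. Qed.

Lemma nullU_dec Q m (x : pU Q m.+1) : nullU x -> @nullU (pdec Q) m x.
Proof. by move=> x0 n f y; apply: x0. Qed.

Lemma shuf_nullM n : forall Q p q (x : pM Q p) (y : pU Q q),
  nullM x -> shuf n Q x y = 0.
Proof.
elim: n => [|n IHn] Q [|p] [|q] x y x0 //.
- by rewrite -[x]stype_act1; apply: x0.
- exact: shuf00.
- by rewrite shuf0S IHn //; apply/nullM_dec/nullM_act.
- by rewrite shufS0 IHn //; apply/nullM_dec.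
- rewrite shufSS !IHn ?addr0 ?sgn0 ?addr0 //; last exact: nullM_dec.
  exact/nullM_dec/nullM_act.
Qed.

Lemma shuf_nullU n : forall Q p q (x : pM Q p) (y : pU Q q),
  nullU y -> shuf n Q x y = 0.
Proof.
elim: n => [|n IHn] Q [|p] [|q] x y y0 //.
- by rewrite -[y]stype_act1; apply: y0.
- exact: shuf00.
- by rewrite shuf0S IHn //; apply/nullU_dec.
- by rewrite shufS0 IHn //; apply/nullU_dec/nullU_act.
- rewrite shufSS !IHn ?addr0 ?sgn0 ?addr0 //; last exact/nullU_dec/nullU_act.
  exact: nullU_dec.
Qed.

Definition mooreM (Q : pairing) p : pM Q p -> Prop :=
  match p with 0 => fun=> True
  | p'.+1 => fun x => forall i : 'I_p'.+1, nullM (tface (lift ord0 i) x) end.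
Definition mooreU (Q : pairing) p : pU Q p -> Prop :=
  match p with 0 => fun=> True
  | p'.+1 => fun x => forall i : 'I_p'.+1, nullU (tface (lift ord0 i) x) end.

Lemma mooreM_degen Q p (x : pM Q p) : mooreM x -> @mooreM (pdec Q) p (tdegen x).
Proof.
case: p x => // p x x0 i; apply: nullM_dec; rewrite sdec_face tface_degen.
exact/nullM_act/x0.
Qed.

Lemma mooreU_degen Q p (x : pU Q p) : mooreU x -> @mooreU (pdec Q) p (tdegen x).
Proof.
case: p x => // p x x0 i; apply: nullU_dec; rewrite sdec_face tface_degen.
exact/nullU_act/x0.
Qed.

Lemma mooreM_dec Q p (x : pM Q p.+1) : mooreM x -> @mooreM (pdec Q) p x.
Proof. by case: p x => // p x x0 i; apply: nullM_dec; rewrite sdec_face; apply: x0. Qed.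

Lemma mooreU_dec Q p (x : pU Q p.+1) : mooreU x -> @mooreU (pdec Q) p x.
Proof. by case: p x => // p x x0 i; apply: nullU_dec; rewrite sdec_face; apply: x0. Qed.

(* The two terms of shufSS contribute opposite values of the face d_1, and the
   other faces are faces of a shuffle in the decalage. *)
Lemma zface_shuf n : forall Q p q (x : pM Q p) (y : pU Q q) i,
  mooreM x -> mooreU y -> zface (lift ord0 i) (shuf n.+1 Q x y) = 0.
Proof.
elim: n => [|n IHn] Q p q x y i x0 y0.
  have [pq|npq] := eqVneq 1%N (p + q)%N; last by rewrite shuf_dim ?raddf0.
  rewrite ord1; case: p q x y x0 y0 pq => [|[|p]] [|[|q]] // x y x0 y0 _.
  - by rewrite shuf0S /= -pval_nat -[X in pval Q _ X]stype_act1; apply: y0.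
  - by rewrite shufS0 /= -pval_nat -[X in pval Q X _]stype_act1; apply: x0.
have IH p' q' x' y' j : @mooreM (pdec Q) p' x' -> @mooreU (pdec Q) q' y' ->
    zface (T := pR Q) (lift ord0 (lift ord0 j)) (shuf n.+1 (pdec Q) x' y') = 0.
  by move=> x'0 y'0; rewrite -zface_dec; apply: (IHn (pdec Q)).
have [j ->|->] := unliftP ord0 i.
  case: p q x y x0 y0 => [|p] [|q] x y x0 y0; rewrite ?shuf00 ?raddf0 //.
  - by rewrite shuf0S IH //; apply: mooreU_dec.
  - by rewrite shufS0 IH //; apply: mooreM_dec.
  - rewrite shufSS raddfD raddf_sgn /=.
    rewrite (IH p q.+1 x (tdegen y) j (mooreM_dec x0) (mooreU_degen y0)).
    rewrite (IH p.+1 q (tdegen x) y j (mooreM_degen x0) (mooreU_dec y0)).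
    by rewrite sgn0 addr0.
case: p q x y x0 y0 => [|p] [|q] x y x0 y0; rewrite ?shuf00 ?raddf0 //.
- rewrite shuf0S -zface_dec; case: q y y0 => [|q] y y0; first by rewrite shuf00 raddf0.
  rewrite (@zface0_shuf0S _ (pdec Q)) shuf_nullU //; apply: nullU_dec; rewrite sdec_face; exact: y0.
- rewrite shufS0 -zface_dec; case: p x x0 => [|p] x x0; first by rewrite shuf00 raddf0.
  rewrite (@zface0_shufS0 _ (pdec Q)) shuf_nullM //; apply: nullM_dec; rewrite sdec_face; exact: x0.
rewrite shufSS raddfD raddf_sgn /= -!zface_dec.
have x1 : @tface (sdec (pM Q)) p ord0 (tdegen x) = x by rewrite sdec_face tface1_degen.
have y1 : @tface (sdec (pU Q)) q ord0 (tdegen y) = y by rewrite sdec_face tface1_degen.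
have -> : zface ord0 (shuf n.+1 (pdec Q) (p := p) (q := q.+1) x (tdegen y)) =
    sgn p (shuf n (pdec Q) (p := p) (q := q) x y).
  case: p x x0 {x1} => [|p] x x0; first by rewrite (@zface0_shuf0S _ (pdec Q)) y1 /sgn.
  rewrite (@zface0_shufSS _ (pdec Q)) y1 shuf_nullM ?add0r //.
  by apply: nullM_dec; rewrite sdec_face; apply: x0.
have -> : zface ord0 (shuf n.+1 (pdec Q) (p := p.+1) (q := q) (tdegen x) y) =
    (shuf n (pdec Q) (p := p) (q := q) x y).
  case: q y y0 {y1} => [|q] y y0; first by rewrite (@zface0_shufS0 _ (pdec Q)) x1.
  rewrite (@zface0_shufSS _ (pdec Q)) x1 [X in sgn _ X]shuf_nullU ?sgn0 ?addr0 //.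
  by apply: nullU_dec; rewrite sdec_face; apply: y0.
by rewrite sgnS addrN.
Qed.

End Shuffle.

Arguments shuf : simpl never.
Section AlternatingShuffle.

(** The halves [shufA] and [shufB] of the shuffle map collect the shuffles whose first step is in
    the first and in the second direction. *)
Definition shufA n Q p q : pM Q p -> pU Q q -> pR Q n.+1 :=
  match p return pM Q p -> pU Q q -> pR Q n.+1 with
  | 0 => fun _ _ => 0
  | p'.+1 => fun x y => shuf n (pdec Q) (p := p') (q := q) x (tdegen y)
  end.

Definition shufB n Q p q : pM Q p -> pU Q q -> pR Q n.+1 :=
  match q return pM Q p -> pU Q q -> pR Q n.+1 with
  | 0 => fun _ _ => 0
  | q'.+1 => fun x y => shuf n (pdec Q) (p := p) (q := q') (tdegen x) y
  end.

Lemma shufE n Q p q (x : pM Q p) (y : pU Q q) :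
  shuf n.+1 Q x y = shufA n x y + sgn p (shufB n x y).
Proof. by case: p q x y => [|p] [|q]. Qed.

(** Boundaries in one variable, spelled out as alternating sums of values because the factors cannot
    be added; the tails below omit d_0. *)
Definition altL n Q p q : pM Q p -> pU Q q -> pR Q n :=
  match p return pM Q p -> pU Q q -> pR Q n with
  | 0 => fun _ _ => 0
  | p'.+1 => fun x y => \sum_(i < p'.+2) sgn i (shuf n Q (tface i x) y)
  end.

Definition altR n Q p q : pM Q p -> pU Q q -> pR Q n :=
  match q return pM Q p -> pU Q q -> pR Q n with
  | 0 => fun _ _ => 0
  | q'.+1 => fun x y => \sum_(i < q'.+2) sgn i (shuf n Q x (tface i y))
  end.

Definition tailL n Q p q : pM Q p -> pU Q q -> pR Q n :=
  match p return pM Q p -> pU Q q -> pR Q n with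
  | 0 => fun _ _ => 0
  | p'.+1 => fun x y => \sum_(i < p'.+1) sgn i (shuf n Q (tface (lift ord0 i) x) y)
  end.

Definition tailR n Q p q : pM Q p -> pU Q q -> pR Q n :=
  match q return pM Q p -> pU Q q -> pR Q n with
  | 0 => fun _ _ => 0
  | q'.+1 => fun x y => \sum_(i < q'.+1) sgn i (shuf n Q x (tface (lift ord0 i) y))
  end.

Lemma alt_tail n Q p q (x : pM Q p) (y : pU Q q) :
  altL n x y + sgn p (altR n x y) =
  zface ord0 (shuf n.+1 Q x y) - (tailL n x y + sgn p (tailR n x y)).
Proof.
have bigS m (F : 'I_m.+2 -> pR Q n) : \sum_(i < m.+2) sgn i (F i) =
    F ord0 - \sum_(i < m.+1) sgn i (F (lift ord0 i)).
  rewrite big_ord_recl; congr (_ + _); rewrite -sumrN.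
  by apply: eq_bigr => i _; rewrite lift0 sgnS.
case: p q x y => [|p] [|q] x y.
- by rewrite shuf00 raddf0 sgn0 !addr0 subrr.
- by rewrite zface0_shuf0S /= bigS /sgn /= !add0r.
- by rewrite zface0_shufS0 /= bigS sgn0 !addr0.
- by rewrite zface0_shufSS [LHS]/= !bigS sgnB opprD addrACA.
Qed.

Lemma altL_dec n Q p q (x : pM Q p.+1) (y : pU Q q) :
  altL n (Q := pdec Q) (p := p) (q := q) x (tdegen y) =
  \sum_(i < p.+1) sgn i (shufA n (tface (lift ord0 i) x) y).
Proof.
case: p x => [|p] x; first by rewrite big_ord1 sgn0.
by apply: eq_bigr => i _; rewrite sdec_face.
Qed.

Lemma altR_dec n Q p q (x : pM Q p) (y : pU Q q.+1) :
  altR n (Q := pdec Q) (p := p) (q := q) (tdegen x) y =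
  \sum_(i < q.+1) sgn i (shufB n x (tface (lift ord0 i) y)).
Proof.
case: q y => [|q] y; first by rewrite big_ord1 sgn0.
by apply: eq_bigr => i _; rewrite sdec_face.
Qed.

Lemma altR_degen n Q p q (x : pM Q p.+1) (y : pU Q q.+1) :
  altR n (Q := pdec Q) (p := p) (q := q.+1) x (tdegen y) =
  shuf n (pdec Q) (p := p) (q := q) x y -
  \sum_(i < q.+1) sgn i (shufA n x (tface (lift ord0 i) y)).
Proof.
rewrite /altR big_ord_recl sdec_face tface1_degen; congr (_ + _); rewrite -sumrN.
by apply: eq_bigr => i _; rewrite sdec_face tface_degen lift0 sgnS.
Qed.

Lemma altL_degen n Q p q (x : pM Q p.+1) (y : pU Q q.+1) :
  altL n (Q := pdec Q) (p := p.+1) (q := q) (tdegen x) y =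
  shuf n (pdec Q) (p := p) (q := q) x y -
  \sum_(i < p.+1) sgn i (shufB n (tface (lift ord0 i) x) y).
Proof.
rewrite /altL big_ord_recl sdec_face tface1_degen; congr (_ + _); rewrite -sumrN.
by apply: eq_bigr => i _; rewrite sdec_face tface_degen lift0 sgnS.
Qed.

Lemma tail_shuf1 Q p q (x : pM Q p) (y : pU Q q) :
  zface (lift ord0 ord0) (shuf 1 Q x y) = tailL 0 x y + sgn p (tailR 0 x y).
Proof.
have [pq|npq] := eqVneq 1%N (p + q)%N.
  case: p q x y pq => [|[|p]] [|[|q]] // x y _.
    rewrite shuf0S /= big_ord1 add0r /sgn /= -pval_nat; congr (pval Q _ _).
    by rewrite -[LHS]/(tface _ _) tface1_degen.
  rewrite shufS0 /= big_ord1 sgn0 addr0 /sgn /= -pval_nat; congr (pval Q _ _).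
  by rewrite -[LHS]/(tface _ _) tface1_degen.
rewrite shuf_dim // raddf0; case: p q x y npq => [|p] [|q] x y npq.
- by rewrite /= sgn0 addr0.
- by rewrite /= big1 ?sgn0 ?addr0 // => i _; rewrite shuf_dim ?sgn0.
- by rewrite /= big1 ?sgn0 ?addr0 // => i _; rewrite shuf_dim ?sgn0 //; lia.
- rewrite /= !big1 ?sgn0 ?addr0 // => i _; rewrite shuf_dim ?sgn0 //; lia.
Qed.

(** The full Leibniz rule, without Moore conditions on the factors. By [alt_tail] the d_0 parts
    agree, and the remaining terms are compared in the decalage by induction. *)
Lemma alt_bd_shuf n : forall Q p q (x : pM Q p) (y : pU Q q),
  alt_bd (shuf n.+1 Q x y) = altL n x y + sgn p (altR n x y).
Proof.
elim: n => [|n IHn] Q p q x y.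
  by rewrite alt_tail alt_bd1 tail_shuf1.
rewrite alt_tail alt_bdS; congr (_ - _); move: (IHn (pdec Q)) => {}IHn.
case: p q x y => [|p] [|q] x y.
- by rewrite shuf00 raddf0 /= sgn0 addr0.
- rewrite shuf0S IHn altR_dec /= !add0r /sgn /=.
  by apply: eq_bigr => i _; rewrite [in RHS]shufE /= add0r.
- rewrite shufS0 IHn altL_dec /= !sgn0 !addr0.
  by apply: eq_bigr => i _; rewrite [in RHS]shufE /= sgn0 addr0.
rewrite shufSS raddfD /= raddf_sgn /= !IHn altL_dec altR_dec altR_degen altL_degen.
rewrite /tailL /tailR; under [in RHS]eq_bigr do rewrite shufE sgnD.
under [X in _ = _ + sgn _ X]eq_bigr do rewrite shufE sgnD.
rewrite !big_split /= !(sgnD, sgnB) !sgn_sgn !sgn_sum.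
under [X in _ = (_ + X) + _]eq_bigr do rewrite sgn_sgn addnC -sgn_sgn.
set a := \sum_(i < p.+1) sgn i _; set b := shuf n _ x y.
set c := \sum_(i < q.+1) _; set d := \sum_(i < p.+1) _; set e := \sum_(i < q.+1) _.
have -> : \sum_(i < q.+1) sgn p.+1 (sgn i
    (shufA n x (tface (lift ord0 i) y))) = sgn p.+1 c by rewrite sgn_sum.
have -> : \sum_(i < p.+1) sgn p (sgn i
    (shufB n (tface (lift ord0 i) x) y)) = sgn p d by rewrite sgn_sum.
have -> : \sum_(i < q.+1) sgn p.+1 (sgn i (sgn p.+1
    (shufB n x (tface (lift ord0 i) y)))) = e.
  by apply: eq_bigr => i _; rewrite !sgn_sgn; congr (sgn _ _); lia.
(* The two copies of [b] come from d_1 of the degenerated factor, one in each half of the shuffle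
   map, and have opposite signs. *)
rewrite !sgnS !sgnN opprK; move: (sgn p b) (sgn p c) (sgn p d) => {}b {}c {}d.
by rewrite -!addrA; congr (_ + _); rewrite addrCA addNKr addrCA.
Qed.
End AlternatingShuffle.

Section EilenbergZilber.

Lemma front_mono p n : {homo (fun i : 'I_p.+1 => inord (minn i n) : 'I_n.+1) :
  i j / (i <= j)%N}.
Proof. by move=> i j ij; rewrite !inordK ?ltnS ?geq_minr //; lia. Qed.

(** For p <= n, the inclusion of the first p + 1 vertices. The truncation makes it total and also
    yields the collapse [front n 0] onto a point. *)
Definition front p n : simplex_map p n := SimplexMap (@front_mono p n).

Lemma back_mono r q n : {homo (fun i : 'I_q.+1 => inord (minn (i + r) n) : 'I_n.+1) :
  i j / (i <= j)%N}.
Proof. by move=> i j ij; rewrite !inordK ?ltnS ?geq_minr //; lia. Qed.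

Definition back r q n : simplex_map q n := SimplexMap (@back_mono r q n).

(* EZ o AW, the composite of the shuffle and Alexander-Whitney maps. *)
Definition ezaw n Q (x : pM Q n) (y : pU Q n) : pR Q n :=
  \sum_(p < n.+1) shuf n Q (stype_act _ (front p n) x)
    (stype_act _ (back p (n - p) n) y).

Definition commutes (M M' : stype) (a : forall n, M n -> M' n) :=
  forall m n (f : simplex_map m n) x, a m (stype_act M f x) = stype_act M' f (a n x).

Lemma commutesW M M' a : @commutes M M' a -> commutes0 a.
Proof. by move=> aN m n f x _; apply: aN. Qed.

Lemma commutes_dec M M' a : @commutes M M' a ->
  @commutes (sdec M) (sdec M') (fun n => a n.+1).
Proof. by move=> aN m n f x; apply: aN. Qed.

Lemma tface0_commutes M : @commutes (sdec M) M (fun n => @tface M n ord0).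
Proof.
by move=> m n f x; rewrite /tface [X in stype_act M _ X]/= !stype_actM
  shift_coface0.
Qed.

Lemma ezaw_nat n Q Q' (a : forall n, pM Q n -> pM Q' n)
    (b : forall n, pU Q n -> pU Q' n) (c : forall n, {additive pR Q n -> pR Q' n}) :
  commutes a -> commutes b ->
  (forall n x y, c n (pval Q x y) = pval Q' (a n x) (b n y)) ->
  forall (x : pM Q n) (y : pU Q n), c n (ezaw x y) = ezaw (a n x) (b n y).
Proof.
move=> aN bN cN x y; rewrite /ezaw raddf_sum; apply: eq_bigr => p _.
rewrite -aN -bN; apply: shuf_nat => //; exact: commutesW.
Qed.

Lemma ezaw0 Q (x : pM Q 0%N) (y : pU Q 0%N) : ezaw x y = pval Q x y.
Proof.
rewrite /ezaw big_ord1; congr (pval Q _ _); rewrite -[RHS]stype_act1;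
  by congr (stype_act _ _ _); apply: simplex_map_eq => i; rewrite !ord1.
Qed.

Lemma simplex_val_eq m n (f g : simplex_map m n) :
  (forall i, f i = g i :> nat) -> f = g.
Proof. by move=> fg; apply: simplex_map_eq => i; apply/val_inj/fg. Qed.

Lemma frontE p n i : front p n i = minn i n :> nat.
Proof. by rewrite /= inordK // ltnS geq_minr. Qed.

Lemma backE r q n i : back r q n i = minn (i + r) n :> nat.
Proof. by rewrite /= inordK // ltnS geq_minr. Qed.

Lemma cofaceE n (j : 'I_n.+2) i : coface j i = ((j <= i) + i)%N :> nat.
Proof. by []. Qed.

Lemma front_coface_le p n (i : nat) : (i <= p <= n)%N ->
  simplex_comp (coface (inord i : 'I_n.+2)) (front p n) =
  simplex_comp (front p.+1 n.+1) (coface (inord i)).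
Proof.
move=> ipn; apply: simplex_val_eq => j; rewrite !simplex_compE cofaceE !frontE cofaceE.
by rewrite !inordK; have := ltn_ord j; lia.
Qed.

Lemma front_coface_gt p n (i : nat) : (p < i <= n.+1)%N ->
  simplex_comp (coface (inord i : 'I_n.+2)) (front p n) = front p n.+1.
Proof.
move=> ipn; apply: simplex_val_eq => j; rewrite !simplex_compE cofaceE !frontE.
by rewrite !inordK; have := ltn_ord j; lia.
Qed.

Lemma back_coface_le p q n (i : nat) : (i <= p)%N -> (p + q = n)%N ->
  simplex_comp (coface (inord i : 'I_n.+2)) (back p q n) = back p.+1 q n.+1.
Proof.
move=> ipn pqn; apply: simplex_val_eq => j; rewrite !simplex_compE cofaceE !backE.
by rewrite !inordK; have := ltn_ord j; lia.
Qed.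

Lemma back_coface_gt p q n (i : nat) : (p <= i <= n.+1)%N -> (p + q = n)%N ->
  (p < i)%N ->
  simplex_comp (coface (inord i : 'I_n.+2)) (back p q n) =
  simplex_comp (back p q.+1 n.+1) (coface (inord (i - p))).
Proof.
move=> ipn pqn pi; apply: simplex_val_eq => j.
rewrite !simplex_compE cofaceE !backE cofaceE.
by rewrite !inordK; have := ltn_ord j; lia.
Qed.

Lemma front_coface_last p n : (p <= n)%N ->
  simplex_comp (front p.+1 n) (coface (inord p.+1)) = front p n.
Proof.
move=> pn; apply: simplex_val_eq => j; rewrite !simplex_compE !frontE cofaceE.
by rewrite !inordK; have := ltn_ord j; lia.
Qed.

Lemma back_coface_first p q n :
  simplex_comp (back p q.+1 n) (coface (inord 0)) = back p.+1 q n.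
Proof.
apply: simplex_val_eq => j; rewrite !simplex_compE !backE cofaceE.
by rewrite !inordK //=; lia.
Qed.

Lemma big_ord_inord (V : nmodType) n (F : 'I_n.+1 -> V) :
  \sum_(i < n.+1) F i = \sum_(0 <= i < n.+1) F (inord i).
Proof. by rewrite big_mkord; apply: eq_bigr => i _; rewrite inord_val. Qed.

(** The composite is a chain map: deleting the last vertex of a front part and deleting the first
    vertex of the next back part give the same splitting with opposite signs ([F12]), and the other
    faces of the parts are the parts of faces. *)
Lemma alt_bd_ezaw n Q (x : pM Q n.+1) (y : pU Q n.+1) :
  alt_bd (ezaw x y) =
  \sum_(i < n.+2) sgn i (ezaw (tface i x) (tface i y)).
Proof.
pose F1 p i := shuf n Q (tface (inord i) (stype_act _ (front p.+1 n.+1) x))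
  (stype_act _ (back p.+1 (n - p) n.+1) y).
pose F2 p i := shuf n Q (stype_act _ (front p n.+1) x)
  (tface (inord i) (stype_act _ (back p (n - p).+1 n.+1) y)).
pose G p i := shuf n Q (stype_act _ (front p n) (tface (inord i) x))
  (stype_act _ (back p (n - p) n) (tface (inord i) y)).
have F12 p : (p < n.+1)%N -> F1 p p.+1 = F2 p 0%N.
  rewrite ltnS => pn; rewrite /F1 /F2 /tface !stype_actM front_coface_last ?back_coface_first //.
  exact: leqW.
have GF1 p i : (p < n.+1)%N -> (i <= p)%N -> G p i = F1 p i.
  move=> pn ip; rewrite /G /F1 /tface !stype_actM front_coface_le ?back_coface_le //; lia.
have GF2 p i : (p < n.+1)%N -> (p < i <= n.+1)%N -> G p i = F2 p (i - p)%N.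
  move=> pn ip; rewrite /G /F2 /tface !stype_actM front_coface_gt ?back_coface_gt //; lia.
transitivity (\sum_(p < n.+1) (\sum_(0 <= i < p.+2) sgn i (F1 p i) +
    sgn p (\sum_(0 <= i < (n - p).+2) sgn i (F2 p i)))).
  rewrite raddf_sum /=; under eq_bigr do rewrite alt_bd_shuf.
  rewrite big_split /= big_split /=; congr (_ + _).
    rewrite big_ord_recl add0r; apply: eq_bigr => p _.
    transitivity (\sum_(i < p.+2) sgn i (shuf n Q (tface i (stype_act _
      (front p.+1 n.+1) x)) (stype_act _ (back p.+1 (n - p) n.+1) y))) => //.
    rewrite big_ord_inord; apply: eq_big_nat => i ip.
    by rewrite inordK // /F1.
  rewrite big_ord_recr /= subnn sgn0 addr0; apply: eq_bigr => p _.
  rewrite subSn; last by rewrite -ltnS.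
  congr (sgn _ _); rewrite /altR big_ord_inord; apply: eq_big_nat => i ip.
  by rewrite inordK.
transitivity (\sum_(p < n.+1) \sum_(0 <= i < n.+2) sgn i (G p i)); last first.
  rewrite exchange_big /= big_mkord; apply: eq_bigr => i _; rewrite /ezaw sgn_sum.
  by apply: eq_bigr => p _; rewrite /G inord_val.
apply: eq_bigr => p _; have pn := ltn_ord p.
rewrite [RHS](@big_cat_nat _ _ _ p.+1) //=; last exact: leqW.
rewrite big_nat_recr //= F12 // -addrA; congr (_ + _).
  by apply: eq_big_nat => i ip; rewrite GF1 //; lia.
rewrite big_nat_recl //= sgnD addrA sgnS addNr add0r.
rewrite -[X in _ = \sum_(X <= _ < _) _]add0n big_addn sgn_sum.
have -> : (n.+2 - p.+1)%N = (n - p).+1 by lia.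
apply: eq_big_nat => i ip; rewrite sgn_sgn GF2 //; last by lia.
by congr (sgn _ (F2 _ _)); lia.
Qed.

(* Eilenberg and Mac Lane's recursive homotopy between the identity and EZ o AW. *)
Fixpoint emh n : forall Q, pM Q n -> pU Q n -> pR Q n.+1 :=
  match n with
  | 0 => fun Q x y => pval Q (tdegen x) (tdegen y)
  | n'.+1 => fun Q x y => ezaw (Q := pdec Q) (n := n'.+1) (tdegen x) (tdegen y) -
      @emh n' (pdec Q) x y
  end.
Arguments emh n Q x y : rename, clear implicits, simpl never.

Lemma emh_nat n : forall Q Q' (a : forall n, pM Q n -> pM Q' n)
    (b : forall n, pU Q n -> pU Q' n) (c : forall n, {additive pR Q n -> pR Q' n}),
  commutes a -> commutes b ->
  (forall n x y, c n (pval Q x y) = pval Q' (a n x) (b n y)) ->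
  forall (x : pM Q n) (y : pU Q n), c n.+1 (emh n Q x y) = emh n Q' (a n x) (b n y).
Proof.
elim: n => [|n IHn] Q Q' a b c aN bN cN x y.
  by rewrite /emh cN !(commutes0_degen _ (commutesW aN)) !(commutes0_degen _ (commutesW bN)).
rewrite /emh -/emh raddfB.
rewrite (@ezaw_nat _ (pdec Q) (pdec Q') (fun n => a n.+1) (fun n => b n.+1)
  (fun n => c n.+1) (commutes_dec aN) (commutes_dec bN) (fun n => cN n.+1)).
rewrite (IHn (pdec Q) (pdec Q') (fun n => a n.+1) (fun n => b n.+1)
  (fun n => c n.+1) (commutes_dec aN) (commutes_dec bN) (fun n => cN n.+1)).
by rewrite -(commutes0_degen x (commutesW aN)) -(commutes0_degen y (commutesW bN)).
Qed.

Lemma zface0_emh n Q (x : pM Q n.+1) (y : pU Q n.+1) :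
  zface (T := pR Q) ord0 (emh n (pdec Q) x y) = emh n Q (tface ord0 x) (tface ord0 y).
Proof.
apply: (@emh_nat n (pdec Q) Q (fun n => @tface _ n ord0)
  (fun n => @tface _ n ord0) (fun n => @zface _ n ord0)).
- exact: tface0_commutes.
- exact: tface0_commutes.
- by move=> m x' y'; rewrite /= pval_nat.
Qed.

Lemma zface0_ezaw n Q (x : pM Q n.+1) (y : pU Q n.+1) :
  zface (T := pR Q) ord0 (ezaw (Q := pdec Q) (n := n) x y) = ezaw (tface ord0 x) (tface ord0 y).
Proof.
apply: (@ezaw_nat n (pdec Q) Q (fun n => @tface _ n ord0)
  (fun n => @tface _ n ord0) (fun n => @zface _ n ord0)).
- exact: tface0_commutes.
- exact: tface0_commutes.
- by move=> m x' y'; rewrite /= pval_nat.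
Qed.

Lemma alt_bd_emh0 Q (x : pM Q 0%N) (y : pU Q 0%N) : alt_bd (emh 0 Q x y) = 0.
Proof.
rewrite alt_bd1 /emh /= -!pval_nat.
by rewrite -![stype_act _ (coface _) _]/(tface _ _) !tface0_degen !tface1_degen subrr.
Qed.

(** Isolated because it serves twice: in the lowest case its hypothesis comes from [alt_bd_emh0] for
    the decalage, in the others from the induction hypothesis. *)
Lemma alt_bd_emh_step n Q (x : pM Q n.+1) (y : pU Q n.+1) :
  alt_bd (T := zdec (pR Q)) (emh n (pdec Q) x y) =
    ezaw (Q := pdec Q) (n := n) x y - pval Q x y -
    \sum_(i < n.+1) sgn i
      (ezaw (Q := pdec Q) (n := n) (tdegen (tface (lift ord0 i) x))
         (tdegen (tface (lift ord0 i) y)) - emh n Q (tface (lift ord0 i) x)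
           (tface (lift ord0 i) y)) ->
  alt_bd (emh n.+1 Q x y) + \sum_(i < n.+2) sgn i (emh n Q (tface i x) (tface i y))
    = ezaw x y - pval Q x y.
Proof.
move=> IH; rewrite alt_bdS /emh -/emh !raddfB /= zface0_emh zface0_ezaw !tface0_degen.
rewrite (@alt_bd_ezaw n (pdec Q)) big_ord_recl !sdec_face !tface1_degen.
rewrite IH [X in _ + X = _]big_ord_recl.
under eq_bigr do rewrite !sdec_face !tface_degen lift0 sgnS.
under [X in _ + (_ + X) = _]eq_bigr do rewrite lift0 sgnS.
under [X in _ - - (_ - X)]eq_bigr do rewrite sgnB.
rewrite sumrB !sumrN ![sgn ord0 _]/(sgn 0 _) /sgn /=.
zmod.
Qed.

Lemma alt_bd_emh n : forall Q (x : pM Q n.+1) (y : pU Q n.+1),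
  alt_bd (emh n.+1 Q x y) + \sum_(i < n.+2) sgn i (emh n Q (tface i x) (tface i y))
  = ezaw x y - pval Q x y.
Proof.
elim: n => [|n IHn] Q x y; apply: alt_bd_emh_step.
  rewrite (@alt_bd_emh0 (pdec Q)) (@ezaw0 (pdec Q)) -[pval (pdec Q) _ _]/(pval Q x y) subrr big_ord1 sub0r.
  by rewrite /emh ezaw0 subrr sgn0 oppr0.
have /(canRL (addrK _)) -> := IHn (pdec Q) x y; congr (_ - _).
by apply: eq_bigr => i _; rewrite !sdec_face /emh -/emh opprB addrC subrK.
Qed.
End EilenbergZilber.
Arguments emh n Q x y : rename, clear implicits, simpl never.

(** * Projection onto the Moore complex *)

Section MooreProjection.

Lemma zface1S (T : szmod) n (i : 'I_n.+1) (x : T n.+2) :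
  zface (lift ord0 i) (zface (lift ord0 ord0) x) =
  zface (lift ord0 ord0) (zface (lift ord0 (lift ord0 i)) x).
Proof.
rewrite /zface !szmod_actM; congr (szmod_act _ _ _); apply: simplex_val_eq => j.
by rewrite !simplex_compE !cofaceE /= /bump /=; lia.
Qed.

(** Unfolded, the composite (1 - s_0 d_1)(1 - s_1 d_2)(1 - s_2 d_3)..., the usual retraction onto
    the Moore complex, which kills degeneracies. *)
Fixpoint mproj n : forall T : szmod, T n -> T n :=
  match n with
  | 0 => fun T x => x
  | n'.+1 => fun T x => let y := @mproj n' (zdec T) x in
      y - zdegen (zface (lift ord0 ord0) y)
  end.
Arguments mproj n T x : rename, clear implicits, simpl never.

Lemma mprojS n (T : szmod) (x : T n.+1) : mproj n.+1 T x =
  (mproj n (zdec T) x : T n.+1) -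
  zdegen (zface (lift ord0 ord0) (mproj n (zdec T) x : T n.+1)).
Proof. by []. Qed.

Lemma mproj_is_additive n : forall T, zmod_morphism (mproj n T).
Proof.
elim: n => [//|n IHn] T x y; rewrite !mprojS (IHn (zdec T)) !raddfB /=; zmod.
Qed.
HB.instance Definition _ n T := GRing.isZmodMorphism.Build _ _ (mproj n T)
  (@mproj_is_additive n T).

Lemma mproj_nat n : forall (T T' : szmod) (a : forall n, {additive T n -> T' n}),
  @commutes0 T T' a -> forall x, a n (mproj n T x) = mproj n T' (a n x).
Proof.
elim: n => [//|n IHn] T T' a aN x; rewrite !mprojS raddfB.
rewrite (aN _ _ (codegen ord0)) ?codegen_at0 // (aN _ _ (coface (lift ord0 ord0))) ?coface_lift0 //.
have e : @commutes0 (zdec T) (zdec T') (fun n => a n.+1) by apply: (commutes0_dec aN).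
by rewrite (IHn (zdec T) (zdec T') (fun n => a n.+1) e).
Qed.

Lemma zface0_mproj n (T : szmod) (x : T n.+1) :
  zface ord0 (mproj n (zdec T) x) = mproj n T (zface ord0 x).
Proof.
apply: (@mproj_nat n (zdec T) T (fun n => @zface T n ord0)).
exact: (@tface0_commutes0 T).
Qed.

Lemma mproj_moore n : forall (T : szmod) (x : T n.+1), moore (mproj n.+1 T x).
Proof.
elim: n => [|n IHn] T x i; rewrite mprojS.
  by rewrite ord1 raddfB /= zface1_degen subrr.
set y := mproj n.+1 (zdec T) x.
have y0 (j : 'I_n.+1) : zface (T := T) (lift ord0 (lift ord0 j)) y = 0.
  by rewrite -zface_dec; apply: (IHn (zdec T)).
have [j ->|->] := unliftP ord0 i; last by rewrite raddfB /= zface1_degen subrr.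
by rewrite raddfB /= y0 zface_degen sub0r zface1S y0 !raddf0.
Qed.

Lemma mproj_id n : forall (T : szmod) (x : T n.+1), moore x -> mproj n.+1 T x = x.
Proof.
elim: n => [|n IHn] T x x0; rewrite mprojS.
  by rewrite x0 raddf0 subr0.
have -> : mproj n.+1 (zdec T) x = x by apply: (IHn (zdec T)) => i; rewrite zface_dec x0.
by rewrite x0 raddf0 subr0.
Qed.

(** The correction s_0 d_1 vanishes on projected boundaries: d_1 is d_0 of the decalage, where it is
    the boundary of a boundary. This uses the formula two degrees below, hence the strong
    induction. *)
Lemma alt_bd_mproj n : forall (T : szmod) (x : T n.+1),
  alt_bd (mproj n.+1 T x) = mproj n T (alt_bd x).
Proof.
elim/ltn_ind: n => -[|n] IHn T x; rewrite alt_bd_moore; try exact: mproj_moore.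
  rewrite mprojS raddfB /= zface0_degen -[mproj 0 (zdec T) x]/x.
  by rewrite -[mproj 0 T _]/(alt_bd x) alt_bd1.
rewrite mprojS [LHS]raddfB zface0_degen zface0_mproj alt_bdS [RHS]raddfB /=.
congr (_ - _); rewrite -[LHS]zface_dec -alt_bd_moore; last exact: mproj_moore.
rewrite (IHn n) // mprojS.
suff -> : zface (T := T) (lift ord0 ord0) (mproj n (zdec T) (alt_bd (T := zdec T) x)) = 0.
  by rewrite raddf0 subr0.
case: n IHn x => [|n] IHn x.
  rewrite -[mproj _ _ _]/(alt_bd (T := zdec T) x) alt_bd1 !zface_dec raddfB /=.
  by rewrite zface1S subrr.
rewrite -zface_dec -alt_bd_moore; last exact: mproj_moore.
by rewrite (IHn n) 1?leqW // alt_bdK raddf0.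
Qed.

Lemma mproj_degen n : forall (T : szmod) (i : 'I_n.+1) (x : T n),
  mproj n.+1 T (szmod_act T (codegen i) x) = 0.
Proof.
elim: n => [|n IHn] T i x.
  rewrite ord1 mprojS; change (zdegen x - zdegen (zface (lift ord0 ord0) (zdegen x)) = 0).
  by rewrite zface1_degen subrr.
have [j ->|->] := unliftP ord0 i; rewrite mprojS.
  by rewrite -shift_codegen (IHn (zdec T)) !raddf0 addr0.
have -> : mproj n.+1 (zdec T) (szmod_act T (codegen ord0) x) =
    zdegen (mproj n.+1 T x).
  apply/esym/(@mproj_nat n.+1 T (zdec T) (fun n => @zdegen T n)) => m p f y f0.
  by rewrite /zdegen [LHS]szmod_actM [RHS]szmod_actM codegen0_shift.
by rewrite zface1_degen subrr.
Qed.

(* The recursion of emh, for the Moore projection instead of EZ o AW. *)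
Fixpoint mproj_h n : forall T : szmod, T n -> T n.+1 :=
  match n with
  | 0 => fun T x => zdegen x
  | n'.+1 => fun T x => mproj n'.+1 (zdec T) (zdegen x) - @mproj_h n' (zdec T) x
  end.
Arguments mproj_h n T x : rename, clear implicits, simpl never.

Lemma mproj_hS n (T : szmod) (x : T n.+1) : mproj_h n.+1 T x =
  (mproj n.+1 (zdec T) (zdegen x) : T n.+2) - mproj_h n (zdec T) x.
Proof. by []. Qed.

Lemma mproj_h_is_additive n : forall T, zmod_morphism (mproj_h n T).
Proof.
elim: n => [|n IHn] T x y; first by rewrite /mproj_h raddfB.
by rewrite !mproj_hS (IHn (zdec T)) !raddfB /=; zmod.
Qed.
HB.instance Definition _ n T := GRing.isZmodMorphism.Build _ _ (mproj_h n T)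
  (@mproj_h_is_additive n T).

Lemma mproj_h_nat n : forall (T T' : szmod) (a : forall n, {additive T n -> T' n}),
  @commutes0 T T' a -> forall x, a n.+1 (mproj_h n T x) = mproj_h n T' (a n x).
Proof.
elim: n => [|n IHn] T T' a aN x; first by apply: aN; rewrite codegen_at0.
have sN y : a n.+2 (zdegen y) = zdegen (a n.+1 y) := aN _ _ (codegen ord0) y (codegen_at0 _).
rewrite !mproj_hS raddfB -sN.
have e : @commutes0 (zdec T) (zdec T') (fun n => a n.+1) by apply: (commutes0_dec aN).
rewrite (IHn (zdec T) (zdec T') (fun n => a n.+1) e); congr (_ - _).
exact: (mproj_nat (T := zdec T) (T' := zdec T') (a := fun n => a n.+1) e).
Qed.

Lemma alt_bd_mproj_h n : forall (T : szmod) (x : T n.+1),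
  alt_bd (mproj_h n.+1 T x) + mproj_h n T (alt_bd x) = mproj n.+1 T x - x.
Proof.
have z0 m (T : szmod) (x : T m.+1) :
    zface (T := T) ord0 (mproj_h m (zdec T) x) = mproj_h m T (zface ord0 x).
  apply: (@mproj_h_nat m (zdec T) T (fun n => @zface T n ord0)).
  exact: (@tface0_commutes0 T).
have bd m (T : szmod) (x : T m.+1) : alt_bd (mproj_h m.+1 T x) =
    mproj m.+1 T x - mproj_h m T (zface ord0 x) -
    (mproj m (zdec T) (alt_bd (T := zdec T) (zdegen x)) -
      alt_bd (T := zdec T) (mproj_h m (zdec T) x)).
  rewrite mproj_hS alt_bdS [X in X - _]raddfB [X in _ - X](raddfB (@alt_bd (zdec T) m)).
  by rewrite zface0_mproj zface0_degen z0 -(@alt_bd_mproj _ (zdec T)).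
have bd0 (T : szmod) (x : T 0%N) : alt_bd (zdegen x) = 0.
  by rewrite alt_bd1 zface0_degen zface1_degen subrr.
elim: n => [|n IHn] T x; rewrite bd.
  rewrite (bd0 (zdec T)) alt_bd1 !zface_dec zface1_degen zface_degen raddfB /=.
  rewrite -[mproj 0 (zdec T) _]/(x - zdegen (zface (lift ord0 ord0) x)).
  rewrite -![mproj_h 0 T _]/(zdegen _) [alt_bd x]alt_bd1 [zdegen (_ - _)]raddfB /=; zmod.
rewrite (_ : alt_bd (T := zdec T) (zdegen x) = x - zdegen (T := T) (alt_bd (T := zdec T) x)).
  have /(canRL (addrK _)) -> := IHn (zdec T) x.
  rewrite [in X in _ + mproj_h _ _ X]alt_bdS.
  rewrite [mproj_h n.+1 T (_ - _)]raddfB /= [mproj_h n.+1 T (alt_bd (T := zdec T) _)]mproj_hS.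
  rewrite [mproj n.+1 (zdec T) (_ - _)]raddfB /=; zmod.
rewrite {1}/alt_bd big_ord_recl zface_dec zface1_degen; congr (_ + _).
rewrite /alt_bd raddf_sum -sumrN; apply: eq_bigr => i _.
by rewrite !zface_dec zface_degen lift0 sgnS [zdegen (sgn _ _)]raddf_sgn.
Qed.

End MooreProjection.
Arguments mproj n T x : rename, clear implicits, simpl never.
Arguments mproj_h n T x : rename, clear implicits, simpl never.

(** * Shuffles as subsets *)

Section ShuffleSets.

Definition shset N Q p q (x : pM Q p) (y : pU Q q) : pR Q N :=
  \sum_(S : {set 'I_N} | #|S| == p)
    sgn (inversions S) (pval Q (stype_act _ (stair p S) x)
      (stype_act _ (stair q (~: S)) y)).

Definition up_set N (S : {set 'I_N}) : {set 'I_N.+1} := [set lift ord0 i | i in S].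
Definition down_set N (S : {set 'I_N.+1}) : {set 'I_N} := [set i | lift ord0 i \in S].

Lemma up_setK N (S : {set 'I_N}) : down_set (up_set S) = S.
Proof. by apply/setP => i; rewrite inE mem_imset //; apply: lift_inj. Qed.

Lemma ord0_up_set N (S : {set 'I_N}) : (ord0 \in up_set S) = false.
Proof. by apply/negbTE/imsetP => -[i _]. Qed.

Lemma lift_up_set N (S : {set 'I_N}) i : (lift ord0 i \in up_set S) = (i \in S).
Proof. by rewrite mem_imset //; apply: lift_inj. Qed.

Lemma down_setC N (S : {set 'I_N.+1}) : down_set (~: S) = ~: down_set S.
Proof. by apply/setP => i; rewrite !inE. Qed.

Lemma set_cases N (S : {set 'I_N.+1}) :
  S = if ord0 \in S then ord0 |: up_set (down_set S) else up_set (down_set S).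
Proof.
apply/setP => i; case: (unliftP ord0 i) => [j|] ->.
  by case: ifP => _; rewrite ?inE ?lift_up_set ?inE.
by case S0: (ord0 \in S); rewrite ?inE ?eqxx ?ord0_up_set.
Qed.

Lemma card_split N (P : pred 'I_N.+1) :
  #|[set i | P i]| = (P ord0 + #|[set i : 'I_N | P (lift ord0 i)]|)%N.
Proof. by rewrite -!sum1dep_card [LHS]big_mkcond big_ord_recl -big_mkcond /=; case: (P ord0). Qed.

Lemma stair_up N p (S : {set 'I_N.+1}) i : ord0 \in S ->
  stair p.+1 S (lift ord0 i) = (stair p (down_set S) i).+1 :> nat.
Proof.
move=> S0; rewrite /= !inordK ?ltnS ?geq_minl // -minnSS; congr minn.
rewrite card_split S0 /=; congr (_ + _)%N; apply: eq_card => j.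
by rewrite !inE.
Qed.

Lemma stair_stay N p (S : {set 'I_N.+1}) i : ord0 \notin S ->
  stair p S (lift ord0 i) = stair p (down_set S) i :> nat.
Proof.
move=> S0; rewrite /= !inordK ?ltnS ?geq_minl //; congr minn.
rewrite card_split (negbTE S0) /= add0n; apply: eq_card => j.
by rewrite !inE.
Qed.

Lemma stair0 N p (S : {set 'I_N}) : stair p S ord0 = 0%N :> nat.
Proof.
rewrite /= inordK ?ltnS ?geq_minl // (_ : [set j in S | _] = set0) ?cards0 ?minn0 //.
by apply/setP => j; rewrite !inE andbF.
Qed.

Lemma stair_shift N p (S : {set 'I_N.+1}) : ord0 \in S ->
  stair p.+1 S = shift false (stair p (down_set S)).
Proof.
move=> S0; apply: simplexS_eq => [|i]; apply: val_inj.
  by rewrite [LHS]stair0 shift_at0.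
by rewrite [LHS]stair_up // shiftS.
Qed.

Lemma stair_codegen N p (S : {set 'I_N.+1}) : ord0 \notin S ->
  stair p S = simplex_comp (codegen ord0) (shift false (stair p (down_set S))).
Proof.
move=> S0; apply: simplexS_eq => [|i]; rewrite simplex_compE; apply: val_inj.
  by rewrite [LHS]stair0 shift_at0 codegen00.
by rewrite [LHS]stair_stay // shiftS codegen0S.
Qed.

(** If 0 is not in S, it is smaller than every element of S and adds one inversion for each of them;
    if 0 is in S, it adds none. *)
Lemma inversions_down N (S : {set 'I_N.+1}) :
  inversions S = (inversions (down_set S) +
    (if ord0 \in S then 0 else #|down_set S|))%N.
Proof.
have inv M (A : {set 'I_M}) :
    inversions A = (\sum_(i in A) \sum_(j | (j \notin A) && (j < i)%N) 1)%N.
  rewrite /inversions -sum1dep_card pair_big_dep /=.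
  by apply: eq_bigl => -[i j].
rewrite !inv -[X in if _ then _ else X]sum1_card.
have e (i : 'I_N.+1) : (\sum_(j | (j \notin S) && (j < i)) 1 =
    ((ord0 \notin S) && (0 < i)) +
    \sum_(j : 'I_N | (lift ord0 j \notin S) && (lift ord0 j < i)%N) 1)%N.
  by rewrite big_mkcond big_ord_recl -big_mkcond /=; case: ifP => //= ->.
rewrite big_mkcond big_ord_recl -big_mkcond.
rewrite [X in (X + _)%N = _](_ : (if ord0 \in S then _ else _) = 0%N); last first.
  by case: ifP => // _; rewrite big_pred0 // => j; rewrite andbF.
rewrite add0n; under eq_bigr do rewrite e andbT.
rewrite big_split /= addnC; congr (_ + _)%N.
  apply: eq_big => [i|i _]; first by rewrite inE.
  by apply: eq_bigl => j; rewrite inE.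
case: ifP => S0 /=; first by rewrite big1.
by apply: eq_bigl => i; rewrite inE.
Qed.

Lemma sum_set_split (V : nmodType) N (F : {set 'I_N.+1} -> V) (P : pred {set 'I_N.+1}) :
  \sum_(S | P S) F S =
  \sum_(S : {set 'I_N} | P (ord0 |: up_set S)) F (ord0 |: up_set S) +
  \sum_(S : {set 'I_N} | P (up_set S)) F (up_set S).
Proof.
rewrite (bigID (fun S : {set 'I_N.+1} => ord0 \in S)) /=; congr (_ + _).
  rewrite (reindex_onto (fun S => ord0 |: up_set S) (@down_set N)) /=.
    apply: eq_bigl => S.
    have -> : down_set (ord0 |: up_set S) = S.
      by apply/setP => i; rewrite !inE lift_up_set.
    by rewrite setU11 eqxx !andbT.
  by move=> S /andP[_ S0]; rewrite {2}(set_cases S) S0.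
rewrite (reindex_onto (@up_set N) (@down_set N)) /=.
  by apply: eq_bigl => S; rewrite ord0_up_set up_setK eqxx !andbT.
by move=> S /andP[_ /negbTE S0]; rewrite {2}(set_cases S) S0.
Qed.

(** Whether 0 belongs to S is the direction of the first step. When it does not, the extra
    inversions give the sign (-1)^p of the recursion. *)
Lemma shset_shuf N : forall Q p q (x : pM Q p) (y : pU Q q),
  N = (p + q)%N -> shset N x y = shuf N Q x y.
Proof.
elim: N => [|N IHN] Q p q x y.
  case: p q x y => [|p] [|q] x y // _; rewrite /shset.
  rewrite (big_pred1 set0) => [|S]; last first.
    by rewrite cards_eq0; apply/eqP/eqP.
  rewrite /inversions (_ : [set ij | _] = set0) ?cards0; last first.
    by apply/setP => -[[]].
  rewrite /sgn /=; congr (pval Q _ _); rewrite -[RHS]stype_act1;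
    by congr (stype_act _ _ _); apply: simplex_map_eq => i; rewrite !ord1.
move=> Npq; rewrite shufE /shset sum_set_split.
have cU (S : {set 'I_N}) : #|ord0 |: up_set S| = #|S|.+1.
  by rewrite cardsU1 ord0_up_set card_imset //; apply: lift_inj.
have cS (S : {set 'I_N}) : #|up_set S| = #|S|.
  by rewrite card_imset //; apply: lift_inj.
have dU (S : {set 'I_N}) : down_set (ord0 |: up_set S) = S.
  by apply/setP => i; rewrite !inE lift_up_set.
congr (_ + _).
  case: p x Npq => [|p] x Npq; first by rewrite big_pred0 // => S; rewrite cU.
  rewrite /shufA -IHN; last by lia.
  apply: eq_big => [S|S _]; first by rewrite cU eqSS.
  rewrite inversions_down !inE eqxx addn0 dU; congr (sgn _ _).
  rewrite stair_shift ?inE ?eqxx // stair_codegen ?inE ?eqxx // down_setC dU.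
  by rewrite -stype_actM.
case: q y Npq => [|q] y Npq.
  rewrite big_pred0 ?sgn0 // => S; rewrite cS; apply/negbTE.
  have SN : (#|S| <= N)%N by rewrite -[N in (_ <= N)%N]card_ord max_card.
  by move: SN Npq; case: eqP => // ->; lia.
rewrite /shufB -IHN; last by lia.
rewrite /shset sgn_sum; apply: eq_big => [S|S]; rewrite cS //.
rewrite inversions_down ord0_up_set up_setK => /eqP Sp.
  rewrite sgn_sgn Sp addnC; congr (sgn _ _).
rewrite (stair_codegen p (S := up_set S)) ?ord0_up_set // stair_shift ?inE ?ord0_up_set //.
by rewrite down_setC up_setK -stype_actM.
Qed.
End ShuffleSets.

(** * The shuffle product of a simplicial algebra *)

Section ShuffleProduct.
Variable k : fieldType.

Definition adec (A : scalg k) : scalg k :=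
  @SCAlg k (fun n => A n.+1) (fun m n f => scalg_act A (shift false f))
    (dec_laws (scalg_laws A)).

Definition szmod_of_scalg (A : scalg k) : szmod :=
  @SZmod (fun n => A n) (fun m n f => scalg_act A f) (scalg_laws A).
Coercion szmod_of_scalg : scalg >-> szmod.

Lemma pmul_nat (A : scalg k) m n (f : simplex_map m n) (x y : A n) :
  scalg_act A f x * scalg_act A f y = scalg_act A f (x * y).
Proof. by rewrite rmorphM. Qed.

Definition pmul (A : scalg k) : pairing :=
  @Pairing A A A (fun n (x y : A n) => x * y) (@pmul_nat A).

End ShuffleProduct.

(** Locked, so that conversion does not unfold the recursion and products are only rewritten by the
    equations below. *)
HB.lock Definition msh (k : fieldType) n (A : scalg k) p q (x : A p) (y : A q) : A n :=
  shuf n (pmul A) x y.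
Arguments msh {k} n A {p q} x y : simpl never.

Section ShuffleProductTheory.
Variable k : fieldType.

Definition adegen (A : scalg k) n : A n -> A n.+1 := scalg_act A (codegen ord0).
Arguments adegen {A n} x.

Lemma shuf_pdec n (A : scalg k) p q (x : A p.+1) (y : A q.+1) :
  shuf n (pdec (pmul A)) (p := p) (q := q) x y = msh n (adec A) (p := p) (q := q) x y.
Proof.
rewrite msh.unlock.
exact: (@shuf_nat n (pdec (pmul A)) (pmul (adec A)) (fun _ x => x) (fun _ x => x)
  (fun n => (idfun : {additive A n.+1 -> A n.+1}))).
Qed.

Lemma mshE n (A : scalg k) p q (x : A p) (y : A q) : msh n A x y = shuf n (pmul A) x y.
Proof. by rewrite msh.unlock. Qed.

Lemma mshSS n (A : scalg k) p q (x : A p.+1) (y : A q.+1) :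
  msh n.+1 A x y = msh n (adec A) (p := p) (q := q.+1) x (adegen y) +
    sgn p.+1 (msh n (adec A) (p := p.+1) (q := q) (adegen x) y).
Proof. by rewrite mshE shufSS !shuf_pdec. Qed.

Lemma msh0S n (A : scalg k) q (x : A 0%N) (y : A q.+1) :
  msh n.+1 A x y = msh n (adec A) (p := 0%N) (q := q) (adegen x) y.
Proof. by rewrite mshE shuf0S !shuf_pdec. Qed.

Lemma mshS0 n (A : scalg k) p (x : A p.+1) (y : A 0%N) :
  msh n.+1 A x y = msh n (adec A) (p := p) (q := 0%N) x (adegen y).
Proof. by rewrite mshE shufS0 !shuf_pdec. Qed.

Lemma msh00 n (A : scalg k) (x y : A 0%N) : msh n.+1 A x y = 0.
Proof. by rewrite mshE; apply: (@shuf00 n (pmul A)). Qed.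

Lemma msh_dim n (A : scalg k) p q (x : A p) (y : A q) :
  n != (p + q)%N -> msh n A x y = 0.
Proof. by rewrite mshE; apply: (@shuf_dim n (pmul A)). Qed.

Lemma msh_adegen n (A : scalg k) p q (x : A p) (y : A q) :
  adegen (msh n A x y) = msh n (adec A) (p := p) (q := q) (adegen x) (adegen y).
Proof.
rewrite !mshE; apply: (@shuf_nat n (pmul A) (pmul (adec A)) (fun n => @adegen A n)
  (fun n => @adegen A n) (fun n => (scalg_act A (codegen ord0) : {additive A n -> A n.+1}))).
- move=> m p' f z f0; rewrite /adegen; have [_ aM] := scalg_laws A.
  rewrite -[LHS]/((scalg_act A _ \o scalg_act A f) z) -aM -codegen0_shift //.
  exact: aM.
- move=> m p' f z f0; rewrite /adegen; have [_ aM] := scalg_laws A.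
  rewrite -[LHS]/((scalg_act A _ \o scalg_act A f) z) -aM -codegen0_shift //.
  exact: aM.
- by move=> m u v; rewrite /= rmorphM.
Qed.

Lemma msh_linear n : forall (A : scalg k) p q (x : A p), linear (fun y : A q => msh n A x y).
Proof.
elim: n => [|n IHn] A [|p] [|q] x a y z.
- by rewrite !mshE /shuf /= mulrDr scalerAr.
- by rewrite !mshE /shuf /= scaler0 addr0.
- by rewrite !mshE /shuf /= scaler0 addr0.
- by rewrite !mshE /shuf /= scaler0 addr0.
- by rewrite !msh00 scaler0 addr0.
- by rewrite !msh0S IHn.
- by rewrite !mshS0 /adegen linearP (IHn (adec A)).
- rewrite !mshSS /adegen linearP !(IHn (adec A)) sgnD scale_sgn scalerDr.
  by rewrite addrACA.
Qed.

HB.instance Definition _ n (A : scalg k) p q (x : A p) :=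
  GRing.isLinear.Build k (A q) (A n) *:%R (@msh k n A p q x) (@msh_linear n A p q x).

Lemma msh_comm n : forall (A : scalg k) p q (x : A p) (y : A q),
  msh n A x y = sgn (p * q) (msh n A y x).
Proof.
elim: n => [|n IHn] A [|p] [|q] x y.
- by rewrite !mshE /shuf /= mulrC.
- by rewrite !mshE /shuf /= sgn0.
- by rewrite !mshE /shuf /= sgn0.
- by rewrite !mshE /shuf /= sgn0.
- by rewrite !msh00 sgn0.
- by rewrite msh0S mshS0 IHn.
- by rewrite msh0S mshS0 IHn !muln0.
- rewrite !mshSS (IHn (adec A) p) (IHn (adec A) p.+1) sgnD !sgn_sgn addrC.
  by congr (_ + _); rewrite /sgn !oddD !oddM /=; case: (odd p); case: (odd q).
Qed.

Lemma mshDr n (A : scalg k) p q (x : A p) (y y' : A q) :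
  msh n A x (y + y') = msh n A x y + msh n A x y'.
Proof. exact: raddfD. Qed.

Lemma mshNr n (A : scalg k) p q r (x : A p) (y : A q) :
  msh n A x (sgn r y) = sgn r (msh n A x y).
Proof. exact: raddf_sgn. Qed.

Lemma mshDl n (A : scalg k) p q (x x' : A p) (y : A q) :
  msh n A (x + x') y = msh n A x y + msh n A x' y.
Proof. by rewrite msh_comm raddfD sgnD -!msh_comm. Qed.

Lemma mshZl n (A : scalg k) p q a (x : A p) (y : A q) :
  msh n A (a *: x) y = a *: msh n A x y.
Proof. by rewrite msh_comm linearZ /= scale_sgn -msh_comm. Qed.

Lemma msh0l n (A : scalg k) p q (y : A q) : msh n A (0 : A p) y = 0.
Proof. by rewrite -[0](scale0r 0) mshZl scale0r. Qed.

Lemma mshNl n (A : scalg k) p q r (x : A p) (y : A q) :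
  msh n A (sgn r x) y = sgn r (msh n A x y).
Proof. by rewrite !sgnZ mshZl. Qed.

Lemma msh_suml n (A : scalg k) p q I (r : seq I) (P : pred I) (F : I -> A p) (y : A q) :
  msh n A (\sum_(i <- r | P i) F i) y = \sum_(i <- r | P i) msh n A (F i) y.
Proof.
by apply: (big_morph (fun x => msh n A x y)) => [u v|]; rewrite ?mshDl ?msh0l.
Qed.

Lemma msh_assoc0 (A : scalg k) p q r l m (x : A p) (y : A q) (z : A r) :
  m = (q + r)%N -> l = (p + q)%N ->
  msh 0 A x (msh m A y z) = msh 0 A (msh l A x y) z.
Proof.
move=> em el.
  case: m em l el => [|m] em [|l] el; case: p x el => [|p] x el; case: r z em => [|r] z em;
    rewrite !mshE /shuf //=; try (by exfalso; lia).
  have q0 : q = 0%N by lia. subst q; exact: mulrA.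
Qed.

(** The total degree is a separate index and the intermediate degrees are variables with equations,
    which avoids any transport between p + (q + r) and (p + q) + r. *)
Lemma msh_assoc n : forall (A : scalg k) p q r l m (x : A p) (y : A q) (z : A r),
  m = (q + r)%N -> l = (p + q)%N ->
  msh n A x (msh m A y z) = msh n A (msh l A x y) z.
Proof.
elim: n => [|n IHn] A p q r l m x y z em el; first exact: msh_assoc0.
case: p x el => [|p] x el; case: q y em el => [|q] y em el;
  case: r z em => [|r] z em; rewrite ?add0n ?addn0 ?addSn in em el; subst m l.
- by rewrite !msh00.
- by rewrite !msh0S msh_adegen (IHn (adec A) 0%N 0%N r 0%N r).
- rewrite msh0S (@mshS0 _ _ q) (@mshS0 _ _ q) (@msh0S _ _ q).
  by rewrite (IHn (adec A) 0%N q 0%N q q) // addn0.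
  rewrite msh0S mshSS mshSS msh_adegen (@msh0S _ _ q) mshDr mshNr.
  by rewrite (IHn (adec A) 0%N q r.+1 q) // (IHn (adec A) 0%N q.+1 r q.+1) //; lia.
- rewrite mshS0 mshS0 mshS0 msh_adegen.
  by rewrite (IHn (adec A) p 0%N 0%N p) ?addn0.
- rewrite mshSS msh_adegen (@msh0S _ A r) (@mshSS _ A _ r) !msh_adegen (@mshS0 _ A p).
  rewrite (IHn (adec A) p 0%N r.+1 p) ?addn0 //.
  by rewrite (IHn (adec A) p.+1 0%N r p.+1) ?addn0.
- rewrite mshSS msh_adegen (@mshS0 _ A q) (@mshS0 _ A) (@mshSS _ A) mshDl mshNl.
  rewrite (IHn (adec A) p q.+1 0%N (p + q.+1)%N) ?addn0 //.
  by rewrite (IHn (adec A) p.+1 q 0%N (p + q.+1)%N) ?addn0 //; lia.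
- rewrite (@mshSS _ A) msh_adegen (@mshSS _ A) (@mshSS _ A) msh_adegen (@mshSS _ A) mshDl mshNl !mshDr !mshNr.
  rewrite sgnD sgn_sgn addrA (IHn (adec A) p q.+1 r.+1 (p + q.+1)%N) //.
  rewrite (IHn (adec A) p.+1 q r.+1 (p + q.+1)%N) //; try lia.
  rewrite (IHn (adec A) p.+1 q.+1 r (p + q.+1).+1) //; try lia.
Qed.
End ShuffleProductTheory.

(** * Moore cycles and boundaries *)

Section MooreBoundaries.

Definition mbd (T : szmod) n (x : T n) : Prop :=
  exists2 b : T n.+1, moore b & zface ord0 b = x.

Lemma mbd0 (T : szmod) n : mbd (0 : T n).
Proof. by exists 0 => [i|]; rewrite raddf0. Qed.

Lemma mbdB (T : szmod) n (x y : T n) : mbd x -> mbd y -> mbd (x - y).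
Proof.
move=> [b b0 <-] [c c0 <-]; exists (b - c); last by rewrite raddfB.
by move=> i; rewrite raddfB /= b0 c0 subr0.
Qed.

Lemma mbdN (T : szmod) n (x : T n) : mbd x -> mbd (- x).
Proof. by rewrite -sub0r; apply/mbdB/mbd0. Qed.

Lemma mbdD (T : szmod) n (x y : T n) : mbd x -> mbd y -> mbd (x + y).
Proof. by move=> xb /mbdN; rewrite -{2}[y]opprK; apply: mbdB. Qed.

Lemma mbd_sgn (T : szmod) n p (x : T n) : mbd x -> mbd (sgn p x).
Proof. by rewrite /sgn; case: odd => // /mbdN. Qed.

Lemma mbd_sum (T : szmod) n I (r : seq I) (P : pred I) (F : I -> T n) :
  (forall i, P i -> mbd (F i)) -> mbd (\sum_(i <- r | P i) F i).
Proof. by move=> FP; apply: big_ind => //; [apply: mbd0 | apply: mbdD]. Qed.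

Lemma moore_cycle0 (T : szmod) n : moore_cycle (0 : T n).
Proof. by case: n => // n i; rewrite raddf0. Qed.

Lemma moore_cycleB (T : szmod) n (x y : T n) :
  moore_cycle x -> moore_cycle y -> moore_cycle (x - y).
Proof. by case: n x y => // n x y x0 y0 i; rewrite raddfB /= x0 y0 subr0. Qed.

Lemma moore_cycleN (T : szmod) n (x : T n) : moore_cycle x -> moore_cycle (- x).
Proof. by rewrite -sub0r; apply/moore_cycleB/moore_cycle0. Qed.

Lemma moore_cycleD (T : szmod) n (x y : T n) :
  moore_cycle x -> moore_cycle y -> moore_cycle (x + y).
Proof. by move=> xb /moore_cycleN; rewrite -{2}[y]opprK; apply: moore_cycleB. Qed.

Lemma moore_cycle_sum (T : szmod) n I (r : seq I) (P : pred I) (F : I -> T n) :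
  (forall i, P i -> moore_cycle (F i)) -> moore_cycle (\sum_(i <- r | P i) F i).
Proof. by move=> FP; apply: big_ind => //; [apply: moore_cycle0 | apply: moore_cycleD]. Qed.

Lemma mbd_cycle (T : szmod) n (x : T n) : mbd x -> moore_cycle x.
Proof. by case: n x => // n x [b b0 <-] i; rewrite -zface0S b0 raddf0. Qed.

Lemma moore_cycle_moore (T : szmod) n (x : T n.+1) : moore_cycle x -> moore x.
Proof. by move=> x0 i; rewrite x0. Qed.

Lemma moore_cycle_alt (T : szmod) n (x : T n.+1) : moore_cycle x -> alt_bd x = 0.
Proof. by move=> x0; rewrite alt_bd_moore ?x0 //; apply: moore_cycle_moore. Qed.

Lemma mproj_cycle (T : szmod) n (x : T n) : moore_cycle x -> mproj n T x = x.
Proof. by case: n x => // n x x0; apply/mproj_id/moore_cycle_moore. Qed.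

Lemma mproj_alt_bd (T : szmod) n (b : T n.+1) : mbd (mproj n T (alt_bd b)).
Proof.
exists (mproj n.+1 T b); first exact: mproj_moore.
by rewrite -alt_bd_mproj alt_bd_moore //; apply: mproj_moore.
Qed.

(** The Moore projection is a chain map that fixes cycles, so a cycle that bounds in the
    unnormalized complex bounds in the Moore complex. *)
Lemma alt_bd_mbd (T : szmod) n (b : T n.+1) : moore_cycle (alt_bd b) -> mbd (alt_bd b).
Proof. by move=> /mproj_cycle <-; apply: mproj_alt_bd. Qed.

Lemma alt_cycle_mproj (T : szmod) n (x : T n.+1) : alt_bd x = 0 ->
  moore_cycle (mproj n.+1 T x).
Proof.
move=> x0 i; have [j ->|->] := unliftP ord0 i; first exact: mproj_moore.
by rewrite -alt_bd_moore ?alt_bd_mproj ?x0 ?raddf0 //; apply: mproj_moore.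
Qed.

Lemma alt_cycle_mproj_homologous (T : szmod) n (x : T n.+1) : alt_bd x = 0 ->
  exists b, mproj n.+1 T x - x = alt_bd b.
Proof.
by move=> x0; exists (mproj_h n.+1 T x); rewrite -alt_bd_mproj_h x0 raddf0 addr0.
Qed.

Lemma codegenE n (i : 'I_n.+1) j : codegen i j = (j - (i < j))%N :> nat.
Proof. by rewrite /= inordK // unbump_lt. Qed.

Lemma zface_codegen0 (T : szmod) n (i : 'I_n.+2) (j : 'I_n.+3) (x : T n.+1) :
  moore_cycle x -> j != i :> nat -> j != i.+1 :> nat ->
  zface j (szmod_act T (codegen i) x) = 0.
Proof.
move=> x0 ji ji1; rewrite /zface szmod_actM.
(* The identities d_j s_i = s_(i-1) d_j for j < i and d_j s_i = s_i d_(j-1) for j > i + 1, packed in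
   one pair of indices. *)
pose j' : 'I_n.+2 := inord (if (j < i)%N then (j : nat) else j.-1).
pose i' : 'I_n.+1 := inord (if (j < i)%N then i.-1 else (i : nat)).
have ltj := ltn_ord j; have lti := ltn_ord i.
have j'E : j' = (if (j < i)%N then j : nat else j.-1) :> nat.
  by rewrite inordK //; case: ifP; lia.
have i'E : i' = (if (j < i)%N then i.-1 else (i : nat)) :> nat.
  by rewrite inordK //; case: ifP; lia.
have -> : simplex_comp (codegen i) (coface j) = simplex_comp (coface j') (codegen i').
  apply: simplex_val_eq => l; rewrite !simplex_compE !codegenE !cofaceE !codegenE i'E j'E.
  by have := ltn_ord l; case: ifP; lia.
by rewrite -szmod_actM -/(zface j') x0 raddf0.
Qed.

End MooreBoundaries.

Section SimplicialAlgebra.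
Variables (k : fieldType) (A : scalg k).

Lemma zfaceZ n i a (x : A n.+1) : zface (T := A) i (a *: x) = a *: zface (T := A) i x.
Proof. exact: (linearZ_LR (scalg_act A (coface i))). Qed.

Lemma mbdZ n a (x : A n) : mbd (T := A) x -> mbd (T := A) (a *: x).
Proof.
move=> [b b0 <-]; exists (a *: b : A n.+1); last by rewrite zfaceZ.
by move=> i; rewrite zfaceZ b0 scaler0.
Qed.

Lemma moore_cycleZ n a (x : A n) :
  moore_cycle (T := A) x -> moore_cycle (T := A) (a *: x).
Proof. by case: n x => // n x x0 i; rewrite zfaceZ x0 scaler0. Qed.

Lemma moore_cyclesP n (x : A n) : reflect (moore_cycle (T := A) x) (x \in @moore_cycles k A n).
Proof.
case: n x => [|n] x; first exact: ReflectT.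
by apply: (iffP forallP) => x0 i; apply/eqP/x0.
Qed.

Lemma moore_boundariesP n (x : A n) : reflect (mbd (T := A) x) (x \in @moore_boundaries k A n).
Proof.
apply: (iffP (asboolP _)) => -[b b0 b1]; exists b => // i.
  by apply: b0.
by have [j ->|->] := unliftP ord0 i; rewrite ?eqxx // => _; apply: b0.
Qed.

(* The only nonzero faces of s_i x times a simplex b are d_i and d_(i+1), equal to
   x d_i b and x d_(i+1) b; for suitable b, varying i moves y to its first vertex. *)
Lemma mbd_mul_vertex n (x y : A n.+1) : moore_cycle (T := A) x ->
  mbd (T := A) (x * y - x * scalg_act A (simplex_comp (front 0 n.+1) (front n.+1 0)) y).
Proof.
move=> x0.
(* [r i] sends the vertices below i to 0, from the identity at i = 0 to the constant map at i = n +
   2; [g i] is chosen so that it composes with the cofaces i and i + 1 to [r i] and [r i.+1]. *)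
have r_mono i : {homo (fun j : 'I_n.+2 => inord (if (j < i)%N then 0 else (j : nat)) : 'I_n.+2) :
    j l / (j <= l)%N}.
  by move=> j l jl; have ltj := ltn_ord j; have ltl := ltn_ord l; rewrite !inordK; do ?case: ifP; lia.
pose r i := SimplexMap (r_mono i).
have g_mono i : {homo (fun j : 'I_n.+3 => inord (if (j <= i)%N then 0 else j.-1) : 'I_n.+2) :
    j l / (j <= l)%N}.
  by move=> j l jl; have ltj := ltn_ord j; have ltl := ltn_ord l; rewrite !inordK; do ?case: ifP; lia.
pose g i := SimplexMap (g_mono i).
have rE i j : r i j = (if (j < i)%N then 0 else (j : nat))%N :> nat.
  by rewrite /= inordK //; case: ifP.
have gE i j : g i j = (if (j <= i)%N then 0 else j.-1)%N :> nat.
  by rewrite /= inordK //; have := ltn_ord j; case: ifP; lia.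
have rx i (m : A n.+1) : moore_cycle (T := A) (x * scalg_act A (r i) m).
  by move=> j; rewrite [LHS](rmorphM (scalg_act A (coface j))) /=
    -[X in X * _]/(zface (T := A) j x) x0 mul0r.
have step i : (i < n.+2)%N ->
    mbd (T := A) (x * scalg_act A (r i) y - x * scalg_act A (r i.+1) y).
  move=> ltin; pose b : A n.+2 := scalg_act A (codegen (inord i)) x * scalg_act A (g i) y.
  have aM := (scalg_laws A).2.
  have bd j : zface (T := A) j b = zface (T := A) j (scalg_act A (codegen (inord i)) x) *
      scalg_act A (simplex_comp (g i) (coface j)) y.
    by rewrite aM -[LHS]/(scalg_act A (coface j) b) /b rmorphM.
  have gr : simplex_comp (g i) (coface (inord i)) = r i.
    apply: simplex_val_eq => j; rewrite simplex_compE gE cofaceE rE inordK //; last by lia.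
    by do ?case: ifP; lia.
  have gr1 : simplex_comp (g i) (coface (inord i.+1)) = r i.+1.
    apply: simplex_val_eq => j; rewrite simplex_compE gE cofaceE rE inordK //.
    by do ?case: ifP; lia.
  have si j : (j == i \/ j == i.+1) ->
      scalg_act A (coface (inord j : 'I_n.+3)) (scalg_act A (codegen (inord i)) x) = x.
    move=> ji; rewrite -[LHS]/((scalg_act A (coface _) \o scalg_act A (codegen _)) x) -aM.
    rewrite (_ : simplex_comp _ _ = simplex_id _) ?(scalg_laws A).1 //.
    apply: simplex_val_eq => l; rewrite simplex_compE codegenE cofaceE !inordK //; last first.
      by case: ji => /eqP->; lia.
    by have := ltn_ord l; case: ji => /eqP->; rewrite /=; lia.
  have altb : alt_bd (T := A) b =
      sgn i (x * scalg_act A (r i) y - x * scalg_act A (r i.+1) y).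
    have lti : (i < n.+3)%N by lia.
    rewrite /alt_bd (bigD1 (Ordinal lti)) //= (bigD1 (Ordinal (ltin : (i.+1 < n.+3)%N))) /=;
      last by rewrite -val_eqE /=; lia.
    rewrite big1 ?addr0 => [|j /andP[ji ji1]].
      rewrite !bd sgnB; congr (_ + _).
        have -> : Ordinal lti = inord i by apply: val_inj; rewrite /= inordK.
        by rewrite gr -[X in X * _]/(scalg_act A _ _) si //; left.
      have -> : Ordinal (ltin : (i.+1 < n.+3)%N) = inord i.+1.
        by apply: val_inj; rewrite /= inordK.
      rewrite gr1 -[X in X * _]/(scalg_act A _ _) si ?sgnS //; by right.
    rewrite bd (zface_codegen0 (T := A)) ?mul0r ?sgn0 //.
      by move: ji; rewrite -val_eqE /= inordK.
    by move: ji1; rewrite -val_eqE /= inordK.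
  have -> : x * scalg_act A (r i) y - x * scalg_act A (r i.+1) y =
      sgn i (alt_bd (T := A) b).
    by rewrite altb sgn_sgn addnn /sgn odd_double.
  apply/mbd_sgn/alt_bd_mbd; rewrite altb /sgn.
  by case: odd; [apply: moore_cycleN|]; apply: moore_cycleB; apply: rx.
have all i : (i <= n.+2)%N -> mbd (T := A) (x * y - x * scalg_act A (r i) y).
  elim: i => [_|i IHi ltin].
    have -> : r 0%N = simplex_id n.+1 by apply: simplex_val_eq => j; rewrite rE.
    by rewrite (scalg_laws A).1 subrr; apply: mbd0.
  rewrite (_ : _ - _ = (x * y - x * scalg_act A (r i) y) +
    (x * scalg_act A (r i) y - x * scalg_act A (r i.+1) y)); last by zmod.
  by apply: mbdD; [apply/IHi/ltnW | apply: step].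
have -> : simplex_comp (front 0 n.+1) (front n.+1 0) = r n.+2; last exact: all.
apply: simplex_val_eq => j; rewrite simplex_compE rE ltn_ord frontE.
by rewrite [front n.+1 0 j]ord1 min0n.
Qed.

Lemma msh_p0 n (x : A 0%N) (y : A n) : msh n A x y = scalg_act A (front n 0) x * y.
Proof.
elim: n A x y => [|n IHn] B x y.
  rewrite mshE /shuf /= (_ : front 0 0 = simplex_id 0) ?(scalg_laws B).1 //.
  by apply: simplex_map_eq => i; rewrite !ord1.
rewrite msh0S (IHn (adec B)); congr (_ * y).
rewrite /adegen -[LHS]/((scalg_act B (shift false (front n 0)) \o scalg_act B (codegen ord0)) x).
rewrite -(scalg_laws B).2; congr (scalg_act B _ x).
by apply: simplex_map_eq => i; rewrite [LHS]ord1 [RHS]ord1.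
Qed.

Lemma msh1l n (y : A n) : msh n A (1 : A 0%N) y = y.
Proof. by rewrite msh_p0 rmorph1 mul1r. Qed.

Lemma nullM0 n : nullM (Q := pmul A) (0 : A n).
Proof. by move=> m f y; rewrite /= raddf0 mul0r. Qed.

Lemma nullU0 n : nullU (Q := pmul A) (0 : A n).
Proof. by move=> m f y; rewrite /= raddf0 mulr0. Qed.

Lemma msh_moore n p q (x : A p) (y : A q) :
  moore_chain (T := A) x -> moore_chain (T := A) y ->
  moore (T := A) (msh n.+1 A x y).
Proof.
move=> x0 y0 i; rewrite mshE; apply: (@zface_shuf n (pmul A)).
- case: p x x0 => // p x x0 j; rewrite -[tface _ _]/(zface (T := A) (lift ord0 j) x) x0.
  exact: nullM0.
- case: q y y0 => // q y y0 j; rewrite -[tface _ _]/(zface (T := A) (lift ord0 j) y) y0.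
  exact: nullU0.
Qed.

Lemma zface0_mshSS n p q (x : A p.+1) (y : A q.+1) :
  zface (T := A) ord0 (msh n.+1 A x y) =
  msh n A (zface (T := A) ord0 x) y + sgn p.+1 (msh n A x (zface (T := A) ord0 y)).
Proof. by rewrite !mshE; apply: (@zface0_shufSS n (pmul A)). Qed.

Lemma zface0_msh0S n q (x : A 0%N) (y : A q.+1) :
  zface (T := A) ord0 (msh n.+1 A x y) = msh n A x (zface (T := A) ord0 y).
Proof. by rewrite !mshE; apply: (@zface0_shuf0S n (pmul A)). Qed.

Lemma zface0_mshS0 n p (x : A p.+1) (y : A 0%N) :
  zface (T := A) ord0 (msh n.+1 A x y) = msh n A (zface (T := A) ord0 x) y.
Proof. by rewrite !mshE; apply: (@zface0_shufS0 n (pmul A)). Qed.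

Lemma moore_cycle_chain n (x : A n) : moore_cycle (T := A) x -> moore_chain (T := A) x.
Proof. by case: n x => // n x; apply: moore_cycle_moore. Qed.

Lemma msh_cycle n p q (x : A p) (y : A q) :
  moore_cycle (T := A) x -> moore_cycle (T := A) y -> moore_cycle (T := A) (msh n A x y).
Proof.
case: n => // n x0 y0 i; have [j ->|->] := unliftP ord0 i.
  by apply: msh_moore; apply: moore_cycle_chain.
case: p q x y x0 y0 => [|p] [|q] x y x0 y0.
- by rewrite msh00 raddf0.
- by rewrite zface0_msh0S y0 raddf0.
- by rewrite zface0_mshS0 x0 msh0l.
- by rewrite zface0_mshSS x0 y0 msh0l raddf0 sgn0 addr0.
Qed.

Lemma msh_mbdr n p q (x : A p) (y : A q) :
  moore_cycle (T := A) x -> mbd (T := A) y -> mbd (T := A) (msh n A x y).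
Proof.
move=> x0 [b b0 <-]; exists (sgn p (msh n.+1 A x b) : A n.+1).
  by move=> i; rewrite raddf_sgn /= msh_moore ?sgn0 //; apply: moore_cycle_chain.
rewrite raddf_sgn /=; case: p x x0 => [|p] x x0; first by rewrite zface0_msh0S.
by rewrite zface0_mshSS x0 msh0l add0r sgn_sgn addnn /sgn odd_double.
Qed.

Lemma msh_mbdl n p q (x : A p) (y : A q) :
  mbd (T := A) x -> moore_cycle (T := A) y -> mbd (T := A) (msh n A x y).
Proof. by move=> xb y0; rewrite msh_comm; apply/mbd_sgn/msh_mbdr. Qed.

Lemma shuffle_msh p q (x : A p) (y : A q) : shuffle x y = msh (p + q) A x y.
Proof.
rewrite mshE -(@shset_shuf _ (pmul A)) // /shuffle /shset.
by apply: eq_bigr => S _; rewrite sgnM.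
Qed.

End SimplicialAlgebra.

Section Bundle.
Variables (k : pzRingType) (V W : lmodType k) (f : V -> W) (f_lin : linear f).
(** The idle [let] keeps the proof of linearity among the parameters, where the canonical instance
    finds it. *)
Definition bundled_linear := let _ := f_lin in f.
HB.instance Definition _ :=
  GRing.isLinear.Build k V W *:%R bundled_linear f_lin.
Definition mk_linear : {linear V -> W} := bundled_linear.
End Bundle.

(** * Commutative algebra *)

Section LinearAlgebra.
Variable k : fieldType.

(** Used to define maps out of quotients by representatives: linearity of the relation reduces
    uniqueness to the case of 0, and the choice of values is then automatically linear. *)
Lemma linear_of_rel (V W : lmodType k) (R : V -> W -> Prop) :
  (forall v, exists w, R v w) -> (forall w, R 0 w -> w = 0) ->
  (forall a v w v' w', R v w -> R v' w' -> R (a *: v + v') (a *: w + w')) ->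
  exists f : {linear V -> W}, forall v, R v (f v).
Proof.
move=> tot uniq lin; have [f fR] := choice tot.
have sub v w w' : R v w -> R v w' -> w = w'.
  move=> vw vw'; have := lin (-1) _ _ _ _ vw vw'.
  by rewrite !scaleN1r addNr => /uniq /eqP; rewrite addrC subr_eq0 => /eqP.
have f_lin : linear f.
  by move=> a u v; apply: (sub (a *: u + v)) => //; apply: lin.
by exists (mk_linear f_lin).
Qed.

Lemma complement (V : lmodType k) (N : V -> Prop) :
  N 0 -> (forall a x y, N x -> N y -> N (a *: x + y)) ->
  exists p : {linear V -> V}, (forall v, N (v - p v)) /\ (forall v, N v -> p v = 0).
Proof.
move=> N0 NL.
have NN x : N x -> N (- x).
  by move=> Nx; rewrite -scaleN1r -[_ *: _]addr0; apply: NL.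
have ND x y : N x -> N y -> N (x + y).
  by move=> Nx Ny; rewrite -[x]scale1r; apply: NL.
have NZ a x : N x -> N (a *: x).
  by move=> Nx; rewrite -[_ *: _]addr0; apply: NL.
(* Zorn's lemma gives a complement E of N as a maximal subspace meeting N in 0. The property does
   not ask for 0 in E, so that the empty union satisfies it; 0 is recovered from maximality. *)
pose P (E : V -> Prop) := (forall a x y, E x -> E y -> E (a *: x + y)) /\
  (forall x, E x -> N x -> x = 0).
have [F FP Ftot|E [[EL EN] Emax]] := @classical_sets.Zorn_bigcup V P.
  split=> [a x y [A FA Ax] [B FB By]|x [A FA Ax] Nx]; last exact: (FP A FA).2.
  have [AB|BA] := Ftot A B FA FB.
    by exists B => //; apply: (FP B FB).1 => //; apply: AB.
  by exists A => //; apply: (FP A FA).1 => //; apply: BA.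
have E0 : E 0.
  apply: contrapT => nE0; apply: (Emax (fun x => E x \/ x = 0)).
    split=> [x Ex|]; first by left.
    by move=> /(_ 0 (or_intror erefl)).
  split=> [a x y [Ex|->] [Ey|->]|x [Ex|->] //]; last exact: EN.
  - by left; apply: EL.
  - by case: nE0; rewrite -(subrr x) addrC -scaleN1r; apply: EL.
  - by rewrite scaler0 add0r; left.
  - by rewrite scaler0 addr0; right.
have EN_all v : exists e, E e /\ N (v - e).
  apply: contrapT => nv.
  apply: (Emax (fun x => exists a e, E e /\ x = a *: v + e)).
    split=> [x Ex|]; first by exists 0, x; rewrite scale0r add0r.
    move=> /(_ v) ev; apply: nv; exists v; split; last by rewrite subrr.
    by apply: ev; exists 1, 0; rewrite scale1r addr0.
  split=> [a x y [b [e [Ee ->]]] [c [f [Ef ->]]]|x [a [e [Ee ->]]] Nx].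
    exists (a * b + c), (a *: e + f); split; first exact: EL.
    by rewrite scalerDr scalerDl scalerA addrACA.
  have [a0|a0] := eqVneq a 0.
    by move: Nx; rewrite a0 scale0r !add0r; apply: EN.
  case: nv; exists (- (a^-1 *: e)); split.
    by rewrite -scaleNr -[_ *: _]addr0; apply: EL.
  by rewrite opprK -[v]scale1r -(mulVf a0) -scalerA -scalerDr; apply: NZ.
have [|w [Ew]|a v w v' w' [Ew Nw] [Ew' Nw']|p pR] :=
    @linear_of_rel V V (fun v e => E e /\ N (v - e)).
- exact: EN_all.
- by rewrite sub0r => /NN; rewrite opprK; apply: EN.
- split; first exact: EL.
  by rewrite opprD addrACA -scalerBr; apply: NL.
exists p; split=> [v|v Nv]; first exact: (pR v).2.
apply: EN (pR v).1 _; have -> : p v = v + - (v - p v) by rewrite opprB addrC subrK.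
by apply: ND => //; apply/NN/(pR v).2.
Qed.

(** The inverse of f between a complement of its kernel and its image, extended by 0 on a complement
    of the image. *)
Lemma generalized_inverse (V W : lmodType k) (f : {linear V -> W}) :
  exists g : {linear W -> V}, forall v, f (g (f v)) = f v.
Proof.
have [||p [pN p0]] := @complement V (fun v => f v = 0).
- exact: raddf0.
- by move=> a x y x0 y0; rewrite linearP x0 y0 scaler0 addr0.
have [||q [qN q0]] := @complement W (fun w => exists v, f v = w).
- by exists 0; rewrite raddf0.
- by move=> a _ _ [x <-] [y <-]; exists (a *: x + y); rewrite linearP.
have fp v : f (p v) = f v.
  by apply/esym/eqP; rewrite -subr_eq0 -raddfB; apply/eqP/pN.
have [w|v [u [->]]|a w _ w' _ [u [-> uw]] [u' [-> uw']]|g gR] :=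
    @linear_of_rel W V (fun w v => exists u, v = p u /\ f u = w - q w).
- by have [v vw] := qN w; exists (p v), v.
- by rewrite raddf0 subr0; apply: p0.
- exists (a *: u + u'); rewrite linearP; split=> //.
  by rewrite (linearP f) uw uw' (linearP q) scalerBr opprD addrACA.
exists g => v; have [u [-> fu]] := gR (f v).
by rewrite fp fu q0 ?subr0 //; exists v.
Qed.

End LinearAlgebra.

(** * Scalars independent over the integers *)

Section IntegralCoefficients.
Variables (k : fieldType) (char0 : [pchar k] =i pred0).

Lemma natr_char0 n : ((n%:R : k) == 0) = (n == 0%N).
Proof. by have /pcharf0P := char0; apply. Qed.

Lemma intr_char0 (z : int) : ((z%:~R : k) == 0) = (z == 0).
Proof.
case: z => n; first exact: natr_char0.
by rewrite NegzE rmorphN /= oppr_eq0 natr_char0.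
Qed.

Definition int_free (e : seq k) := forall z : nat -> int,
  \sum_(i < size e) (z i)%:~R * e`_i = 0 -> forall i, (i < size e)%N -> z i = 0.

(** Greedy choice: a scalar that depends on the earlier ones only enlarges the common denominator N.
    With it, a relation over k between integral chains becomes, after multiplication by N, one
    integral relation for each element of e. *)
Lemma int_free_basis (s : seq k) : exists (e : seq k) (N : int),
  [/\ N != 0, int_free e & forall a, a \in s -> exists q : nat -> int,
     N%:~R * a = \sum_(i < size e) (q i)%:~R * e`_i].
Proof.
elim: s => [|a s [e [N [N0 ef es]]]]; first by exists [::], 1; split=> // z _ [].
have [[z0 [z [z00 za]]]|na] := pselect (exists (z0 : int) (z : nat -> int),
    z0 != 0 /\ z0%:~R * a = \sum_(i < size e) (z i)%:~R * e`_i).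
  exists e, (z0 * N); split=> //; first by rewrite mulf_neq0.
  move=> b; rewrite inE => /predU1P[->|/es[q bq]].
    exists (fun i => N * z i); rewrite (mulrC z0) intrM -mulrA za mulr_sumr.
    by apply: eq_bigr => i _; rewrite intrM mulrA.
  exists (fun i => z0 * q i); rewrite intrM -mulrA bq mulr_sumr.
  by apply: eq_bigr => i _; rewrite intrM mulrA.
have sumE (q : nat -> int) : \sum_(i < size (rcons e a)) (q i)%:~R * (rcons e a)`_i =
    \sum_(i < size e) (q i)%:~R * e`_i + (q (size e))%:~R * a.
  rewrite size_rcons big_ord_recr /= nth_rcons ltnn eqxx; congr (_ + _).
  by apply: eq_bigr => i _; rewrite nth_rcons ltn_ord.
exists (rcons e a), N; split=> // [z|b].
  rewrite sumE => z0; have zN : z (size e) = 0.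
    apply: contrapT => /eqP zN; apply: na; exists (z (size e)), (fun i => - z i).
    split=> //; move/eqP: z0; rewrite addrC addr_eq0 => /eqP ->; rewrite -sumrN.
    by apply: eq_bigr => i _; rewrite intrN mulNr.
  move=> i; rewrite size_rcons ltnS leq_eqVlt => /predU1P[-> //|].
  by apply: ef; rewrite -[RHS]z0 zN mul0r addr0.
rewrite inE => /predU1P[->|/es[q bq]].
  pose q0 i := if i == size e then N else 0; exists q0.
  by rewrite sumE /q0 eqxx big1 ?add0r // => i _; rewrite ltn_eqF ?mul0r.
pose q0 i := if (i < size e)%N then q i else 0; exists q0.
by rewrite sumE /q0 ltnn mul0r addr0 bq; apply: eq_bigr => i _; rewrite ltn_ord.
Qed.

End IntegralCoefficients.

(** * Noetherian rings and the Artin-Rees lemma *)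

Section Noetherian.

Definition ideal (R : comNzRingType) (I : R -> Prop) :=
  [/\ I 0, forall x y, I x -> I y -> I (x + y) & forall a x, I x -> I (a * x)].

Lemma idealN (R : comNzRingType) (I : R -> Prop) x : ideal I -> I x -> I (- x).
Proof. by case=> _ _ IM Ix; rewrite -mulN1r; apply: IM. Qed.

Lemma idealB (R : comNzRingType) (I : R -> Prop) x y : ideal I -> I x -> I y -> I (x - y).
Proof. by move=> Ii Ix Iy; case: (Ii) => _ ID _; apply: ID => //; apply: idealN. Qed.

Definition noetherian (R : comNzRingType) := forall J : nat -> R -> Prop,
  (forall n, ideal (J n)) -> (forall n x, J n x -> J n.+1 x) ->
  exists n, forall m x, J m x -> J n x.

Lemma chain_le (T : Type) (J : nat -> T -> Prop) (JS : forall n x, J n x -> J n.+1 x) m n x :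
  (m <= n)%N -> J m x -> J n x.
Proof. by move=> /subnK <-; elim: (n - m)%N => // d IHd /IHd /JS. Qed.

Lemma noetherian_field (k : fieldType) : noetherian k.
Proof.
move=> J Ji JS; have [[n [x [Jx x0]]]|J0] := pselect (exists n x, J n x /\ x != 0).
  exists n => m y _; case: (Ji n) => _ _ JM.
  by rewrite -[y](divfK x0); apply: JM.
exists 0%N => m x Jx; have [->|x0] := eqVneq x 0; first by case: (Ji 0%N).
by case: J0; exists m, x.
Qed.

Lemma noetherian_image (R S : comNzRingType) (f : {rmorphism R -> S}) :
  (forall y, exists x, f x = y) -> noetherian R -> noetherian S.
Proof.
move=> fsurj Rn J Ji JS; have [n|n x|n nP] := Rn (fun n x => J n (f x)).
- case: (Ji n) => J0 JD JM; split=> [|x y Jx Jy|a x Jx].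
  + by rewrite rmorph0.
  + by rewrite rmorphD; apply: JD.
  + by rewrite rmorphM; apply: JM.
- exact: JS.
- by exists n => m y; have [x <-] := fsurj y; apply: nP.
Qed.

(** Hilbert's argument: [L n d] is the ideal of coefficients in degree d of the elements of [J n] of
    degree at most d. The diagonal chain [L n n] becomes stable at some N, which settles the degrees
    d >= N at once; the finitely many d < N are treated one by one. *)
Lemma noetherian_poly (R : comNzRingType) : noetherian R -> noetherian {poly R}.
Proof.
move=> Rn J Ji JS.
pose L n d (a : R) := exists p, [/\ J n p, (size p <= d.+1)%N & p`_d = a].
have Li n d : ideal (L n d).
  case: (Ji n) => J0 JD JM; split=> [|a b [p [Jp sp <-]] [q [Jq sq <-]]|a b [p [Jp sp <-]]].
  - by exists 0; rewrite size_poly0 coef0.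
  - exists (p + q); rewrite coefD; split=> //; first exact: JD.
    by apply: leq_trans (size_polyD _ _) _; rewrite geq_max sp.
  - exists (a%:P * p); rewrite coefCM; split=> //; first exact: JM.
    by rewrite mul_polyC; apply: leq_trans (size_scale_leq _ _) sp.
have LS n d a : L n d a -> L n.+1 d a by case=> p [Jp sp <-]; exists p; split=> //; apply: JS.
have LX n d e a : (d <= e)%N -> L n d a -> L n e a.
  move=> de [p [Jp sp <-]]; exists ('X^(e - d) * p); split.
  - by case: (Ji n) => _ _; apply.
  - by apply: leq_trans (size_polyMleq _ _) _; rewrite size_polyXn; lia.
  - by rewrite mulrC coefMXn; case: ltnP => [|_]; [lia | congr nth; lia].
have [n a La|N NP] := Rn _ (fun n => Li n n); first exact/LX/LS/La.
have [M MP] : exists M, forall d, (d < N)%N -> forall m a, L m d a -> L M d a.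
  elim: N {NP} => [|N [M MP]]; first by exists 0%N.
  have [n a La|M' M'P] := Rn _ (fun n => Li n N); first exact: LS.
  exists (maxn M M') => d; rewrite ltnS leq_eqVlt => /predU1P[->|dN] m a La.
    by apply: (chain_le (J := fun n => L n N)) (leq_maxr _ _) (M'P m a La) => n b; apply: LS.
  by apply: (chain_le (J := fun n => L n d)) (leq_maxl _ _) (MP _ dN m a La) => n b; apply: LS.
exists (maxn M N) => m p; have [d] := ubnP (size p); elim: d m p => // d IHd m p sp Jp.
have [->|p0] := eqVneq p 0; first by case: (Ji (maxn M N)).
have sz : size p = (size p).-1.+1 by rewrite prednK // lt0n size_poly_eq0.
have Lp : L m (size p).-1 (lead_coef p) by exists p; rewrite -sz.
have [q [Jq sq qE]] : L (maxn M N) (size p).-1 (lead_coef p).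
  have [pN|Np] := ltnP (size p).-1 N.
    apply: (chain_le (J := fun n => L n (size p).-1)) (leq_maxl _ _) (MP _ pN m _ Lp).
    by move=> n b; apply: LS.
  apply: (chain_le (J := fun n => L n (size p).-1)) (leq_maxr _ _) _.
    by move=> n b; apply: LS.
  apply: (LX _ _ _ _ Np); apply: (NP (maxn m (size p).-1)); apply: (LX _ _ _ _ (leq_maxr _ _)).
  apply: (chain_le (J := fun n => L n (size p).-1)) (leq_maxl _ _) Lp.
  by move=> n b; apply: LS.
case: (Ji (maxn M N)) => _ JD _; rewrite -[p](subrK q); apply: JD => //.
apply: (IHd (maxn m (maxn M N))).
  rewrite ltnS in sp; apply: leq_trans _ sp; rewrite sz ltnS; apply/leq_sizeP => j; rewrite leq_eqVlt.
  case/predU1P => [<-|ltj]; first by rewrite coefB qE lead_coefE subrr.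
  by rewrite coefB !nth_default ?subrr //; [apply: leq_trans sq _ | rewrite sz].
apply: idealB (Ji _) _ _.
  exact: (chain_le (J := J)) (leq_maxl _ _) Jp.
exact: (chain_le (J := J)) (leq_maxr _ _) Jq.
Qed.

Lemma noetherian_fg (k : fieldType) (A : comAlgType k) :
  finitely_generated A -> noetherian A.
Proof.
case=> s sP.
(* An iterated polynomial ring over k that maps onto the subalgebra generated by s. It is kept as a
   plain ring, with its scalars recorded by the function c. *)
have [T [Tn [c [f [fc fs]]]]] : exists T : comNzRingType, noetherian T /\
    exists (c : k -> T) (f : {rmorphism T -> A}), (forall a, f (c a) = a%:A) /\
      forall x, x \in s -> exists t, f t = x.
  elim: s {sP} => [|x s [T [Tn [c [f [fc fs]]]]]].
    by exists k; split; [apply: noetherian_field | exists id, (in_alg A)].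
  have cx : commr_rmorph f x by move=> t; rewrite /GRing.comm mulrC.
  exists {poly T}; split; first exact: noetherian_poly.
  exists (fun a => (c a)%:P), (horner_morph cx); split=> [a|y].
    by rewrite /= horner_morphC fc.
  rewrite inE => /predU1P[->|/fs[t <-]].
    by exists 'X; rewrite /= horner_morphX.
  by exists t%:P; rewrite /= horner_morphC.
apply: noetherian_image Tn => y; apply/asboolP.
apply: (sP [pred y | `[< exists x, f x = y >]]) => [|x xs]; last exact/asboolP/fs.
split=> [|a u v /asboolP[x <-] /asboolP[z <-]|u v /asboolP[x <-] /asboolP[z <-]].
- by apply/asboolP; exists 1; rewrite rmorph1.
- by apply/asboolP; exists (c a * x + z); rewrite rmorphD rmorphM fc mulr_algl.
- by apply/asboolP; exists (x * z); rewrite rmorphM.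
Qed.

End Noetherian.

Section IdealPowers.
Variable R : comNzRingType.
Implicit Type I : R -> Prop.

Fixpoint ipow I (j : nat) : R -> Prop :=
  match j with
  | 0 => fun=> True
  | j'.+1 => fun x => exists s : seq (R * R),
      (forall p, p \in s -> I p.1 /\ ipow I j' p.2) /\ x = \sum_(p <- s) p.1 * p.2
  end.

Lemma ipow_mul I j x y : I x -> ipow I j y -> ipow I j.+1 (x * y).
Proof.
by move=> Ix Iy; exists [:: (x, y)]; rewrite big_seq1; split=> // p; rewrite inE => /eqP ->.
Qed.

Lemma ipow_ind I j (Q : R -> Prop) : Q 0 -> (forall x y, Q x -> Q y -> Q (x + y)) ->
  (forall x y, I x -> ipow I j y -> Q (x * y)) -> forall x, ipow I j.+1 x -> Q x.
Proof.
move=> Q0 QD QM x [s [sP ->]]; rewrite big_seq; apply: big_ind => // p /sP[].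
exact: QM.
Qed.

Lemma ipow0 I j : ipow I j 0.
Proof. by case: j => // j; exists [::]; rewrite big_nil. Qed.

Lemma ipowD I j x y : ipow I j x -> ipow I j y -> ipow I j (x + y).
Proof.
case: j => // j [s [sP ->]] [t [tP ->]]; exists (s ++ t); rewrite big_cat; split=> // p.
by rewrite mem_cat => /orP[/sP|/tP].
Qed.

Lemma ipow_mull I j a x : ipow I j x -> ipow I j (a * x).
Proof.
elim: j a x => // j IHj a x; move: x; apply: ipow_ind => [|y z|y z Iy Iz].
- by rewrite mulr0; apply: ipow0.
- by rewrite mulrDr; apply: ipowD.
- by rewrite mulrCA; apply: ipow_mul => //; apply: IHj.
Qed.

Lemma ipow_ideal I j : ideal (ipow I j).
Proof. by split; [apply: ipow0 | apply: ipowD | apply: ipow_mull]. Qed.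

Lemma ipowN I j x : ipow I j x -> ipow I j (- x).
Proof. by apply: idealN; apply: ipow_ideal. Qed.

Lemma ipowB I j x y : ipow I j x -> ipow I j y -> ipow I j (x - y).
Proof. by apply: idealB; apply: ipow_ideal. Qed.

Lemma ipow_sgn I j n x : ipow I j x -> ipow I j (sgn n x).
Proof. by rewrite /sgn; case: odd => // /ipowN. Qed.

Lemma ipow_sum I j (T : Type) (r : seq T) (P : pred T) F :
  (forall i, P i -> ipow I j (F i)) -> ipow I j (\sum_(i <- r | P i) F i).
Proof. by move=> FP; apply: big_ind => //; [apply: ipow0 | apply: ipowD]. Qed.

Lemma ipow_sub I j x : ipow I j.+1 x -> ipow I j x.
Proof.
by apply: ipow_ind => [|y z|y z _ Iz]; [apply: ipow0 | apply: ipowD | apply: ipow_mull].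
Qed.

Lemma ipow_le I i j x : (i <= j)%N -> ipow I j x -> ipow I i x.
Proof. by move=> /subnK <-; elim: (j - i)%N => // d IHd /ipow_sub. Qed.

Lemma ipow1 I x : ideal I -> ipow I 1 x <-> I x.
Proof.
case=> I0 ID IM; split; last by move=> Ix; rewrite -[x]mulr1; apply: ipow_mul.
by apply: ipow_ind => // y z Iy _; rewrite mulrC; apply: IM.
Qed.

Lemma ipow_split I a b (Q : R -> Prop) : Q 0 -> (forall x y, Q x -> Q y -> Q (x + y)) ->
  (forall x y, ipow I a x -> ipow I b y -> Q (x * y)) ->
  forall x, ipow I (a + b) x -> Q x.
Proof.
elim: a Q => [|a IHa] Q Q0 QD QM x.
  by move=> Ix; rewrite -[x]mul1r; apply: QM.
rewrite addSn; apply: ipow_ind => // y z Iy; apply: (IHa (fun z => Q (y * z))).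
- by rewrite mulr0.
- by move=> u v Qu Qv; rewrite mulrDr; apply: QD.
- by move=> u v Iu Iv; rewrite mulrA; apply: QM => //; apply: ipow_mul.
Qed.

Lemma ipowM I a b x y : ipow I a x -> ipow I b y -> ipow I (a + b) (x * y).
Proof.
elim: a x => [|a IHa] x; first by move=> _; apply: ipow_mull.
move=> Ix Iy; move: x Ix; apply: ipow_ind => [|u v|u v Iu Iv].
- by rewrite mul0r; apply: ipow0.
- by rewrite mulrDl; apply: ipowD.
- by rewrite -mulrA addSn; apply: ipow_mul => //; apply: IHa.
Qed.

(** Adding one generator g to N, induction puts a power I^J inside N + (g), and then I^(mJ) inside N
    + (g^m). *)
Lemma ipow_nilpotent (gs : seq R) (N I : R -> Prop) : ideal N ->
  (forall x, I x -> exists n, N n /\ exists c : R -> R, x = n + \sum_(g <- gs) c g * g) ->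
  (forall g, g \in gs -> exists m, N (g ^+ m)) ->
  exists J, forall x, ipow I J x -> N x.
Proof.
elim: gs N => [|g gs IHgs] N Ni Igs gsN.
  case: (Ni) => N0 ND NM; exists 1%N; apply: ipow_ind => // x y /Igs[n [Nn [c ->]]] _.
  by rewrite big_nil addr0 mulrC; apply: NM.
case: (Ni) => N0 ND NM; pose N' x := exists n a, N n /\ x = n + a * g.
have N'i : ideal N'.
  split=> [|_ _ [n [a [Nn ->]]] [m [b [Nm ->]]]|c _ [n [a [Nn ->]]]].
  - by exists 0, 0; rewrite mul0r addr0.
  - exists (n + m), (a + b); split; first exact: ND.
    by rewrite mulrDl addrACA.
  - exists (c * n), (c * a); split; first exact: NM.
    by rewrite mulrDr mulrA.
have [x /Igs[n [Nn [c ->]]]|h hgs|J JN'] := IHgs N' N'i.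
- exists (n + c g * g); split; first by exists n, (c g).
  by exists c; rewrite big_cons addrA.
- have [|m Nm] := gsN h; first by rewrite inE hgs orbT.
  by exists m, (h ^+ m), 0; rewrite mul0r addr0.
have [m Nm] := gsN g (mem_head _ _).
exists (m * J)%N.
suff key : forall x, ipow I (m * J) x -> exists n a, N n /\ x = n + a * g ^+ m.
  by move=> x /key[n [a [Nn ->]]]; apply: ND => //; apply: NM.
elim: m {Nm} => [|m IHm] x Ix; first by exists 0, x; rewrite add0r mulr1.
move: x Ix; rewrite mulSn; apply: ipow_split => [|x y [n [a [Nn ->]]] [n' [a' [Nn' ->]]]|].
- by exists 0, 0; rewrite mul0r addr0.
- exists (n + n'), (a + a'); split; first exact: ND.
  by rewrite mulrDl addrACA.
move=> x y /JN'[n [a [Nn ->]]] /IHm[n' [a' [Nn' ->]]].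
exists ((n' + a' * g ^+ m) * n + (a * g) * n'), (a * a'); split.
  by apply: ND; apply: NM.
by rewrite exprS; ring.
Qed.

(* Krull's argument: enlarge I Z to an ideal N maximal among those that meet Z in
   I Z; for x in I, the ideal N + (x^m) with m such that (N : x^m) = (N : x^(m+1))
   still meets Z in I Z, so that x^m is in N. *)
Lemma artin_rees (I Z : R -> Prop) (gs : seq R) : noetherian R -> ideal I -> ideal Z ->
  (forall x, I x -> exists c : R -> R, x = \sum_(g <- gs) c g * g) ->
  (forall g, g \in gs -> I g) ->
  exists J, forall x, ipow I J x -> Z x ->
    exists s : seq (R * R), (forall p, p \in s -> I p.1 /\ Z p.2) /\
      x = \sum_(p <- s) p.1 * p.2.
Proof.
move=> Rn Ii Zi Igs gsI; case: (Zi) => Z0 ZD ZM.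
pose IZ x := exists s : seq (R * R), (forall p, p \in s -> I p.1 /\ Z p.2) /\
      x = \sum_(p <- s) p.1 * p.2.
have IZ0 : IZ 0 by exists [::]; rewrite big_nil.
have IZD x y : IZ x -> IZ y -> IZ (x + y).
  move=> [s [sP ->]] [t [tP ->]]; exists (s ++ t); rewrite big_cat; split=> // p.
  by rewrite mem_cat => /orP[/sP|/tP].
have IZ1 x y : I x -> Z y -> IZ (x * y).
  by move=> Ix Zy; exists [:: (x, y)]; rewrite big_seq1; split=> // p; rewrite inE => /eqP ->.
have IZM a x : IZ x -> IZ (a * x).
  move=> [s [sP ->]]; rewrite mulr_sumr big_seq; apply: big_ind => // p /sP[Ip Zp].
  by rewrite mulrCA; apply: IZ1 => //; apply: ZM.
have IZZ x : IZ x -> Z x.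
  by move=> [s [sP ->]]; rewrite big_seq; apply: big_ind => // p /sP[_]; apply: ZM.
(* As the empty union must satisfy the property, 0 is left out of it; this is why the enlargement of
   N by I Z below adds 0 by hand. *)
pose P (N : R -> Prop) := [/\ forall x y, N x -> N y -> N (x + y),
  forall a x, N x -> N (a * x) & forall z, N z -> Z z -> IZ z].
have [F FP Ftot|N [[ND NM NZ] Nmax]] := @classical_sets.Zorn_bigcup R P.
  split=> [x y [A FA Ax] [B FB By]|a x [A FA Ax]|z [A FA Az]].
  - have [AB|BA] := Ftot A B FA FB.
      by exists B => //; case: (FP B FB) => BD _ _; apply: BD => //; apply: AB.
    by exists A => //; case: (FP A FA) => AD _ _; apply: AD => //; apply: BA.
  - by exists A => //; case: (FP A FA) => _ AM _; apply: AM.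
  - by case: (FP A FA) => _ _ AZ; apply: AZ.
have NIZ x : IZ x -> N x.
  move=> IZx; apply: contrapT => Nx.
  apply: (Nmax (fun y => exists n y', (N n \/ n = 0) /\ IZ y' /\ y = n + y')).
    split=> [y Ny|]; first by exists y, 0; rewrite addr0; split; [left|].
    by move=> /(_ x) xN; apply/Nx/xN; exists 0, x; rewrite add0r; split; [right|].
  split=> [_ _ [n [y [Nn [IZy ->]]]] [n' [y' [Nn' [IZy' ->]]]]|a _ [n [y [Nn [IZy ->]]]]|
    z [n [y [Nn [IZy ->]]]] Zz].
  - exists (n + n'), (y + y'); split; last by split; [apply: IZD | rewrite addrACA].
    by case: Nn Nn' => [Nn|->] [Nn'|->]; rewrite ?add0r ?addr0;
      [left; apply: ND | left | left | right].
  - exists (a * n), (a * y); split; last by split; [apply: IZM | rewrite mulrDr].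
    by case: Nn => [Nn|->]; [left; apply: NM | right; rewrite mulr0].
  - apply: IZD => //; case: Nn => [Nn|-> //]; apply: NZ => //.
    rewrite -[n](addrK y) ; apply: idealB => //; exact: IZZ.
have Ni : ideal N by split=> //; apply: NIZ.
have Ipow x : I x -> exists m, N (x ^+ m).
  move=> Ix; have [n|n y|m mP] := Rn (fun n y => N (x ^+ n * y)).
  - split=> [|y z|a y]; first by rewrite mulr0; apply: NIZ.
    + by rewrite mulrDr; apply: ND.
    + by rewrite mulrCA; apply: NM.
  - by rewrite exprS -mulrA; apply: NM.
  exists m; apply: contrapT => Nxm.
  apply: (Nmax (fun y => exists n a, N n /\ y = n + a * x ^+ m)).
    split=> [y Ny|]; first by exists y, 0; rewrite mul0r addr0.
    move=> /(_ (x ^+ m)) xN; apply/Nxm/xN; exists 0, 1; rewrite mul1r add0r.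
    by split=> //; apply: NIZ.
  split=> [_ _ [n [a [Nn ->]]] [n' [a' [Nn' ->]]]|c _ [n [a [Nn ->]]]|
    z [n [a [Nn ze]]] Zz].
  - exists (n + n'), (a + a'); split; first exact: ND.
    by rewrite mulrDl addrACA.
  - exists (c * n), (c * a); split; first exact: NM.
    by rewrite mulrDr mulrA.
  (* Multiplication by x brings z into I Z, hence into N, so x^(m+1) a is in N; by stability of the
     colon ideals so is x^m a, and the enlargement of N gained nothing at z. *)
  - apply: NZ => //; rewrite ze; apply: ND => //; rewrite mulrC; apply: (mP m.+1).
    have -> : x ^+ m.+1 * a = x * z - x * n by rewrite ze exprS; ring.
    by apply: idealB => //; [apply/NIZ/IZ1 | apply: NM].
have [x Ix|g gg|J JP] := @ipow_nilpotent gs N I Ni; last first.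
- by exists J => x /JP Nx Zx; apply: NZ.
- by apply/Ipow/gsI.
by have [c ->] := Igs x Ix; exists 0; split; [apply: NIZ | exists c; rewrite add0r].
Qed.

End IdealPowers.

Lemma ipow_morph (R S : comNzRingType) (f : {rmorphism R -> S}) (I : R -> Prop)
    (I' : S -> Prop) : (forall x, I x -> I' (f x)) ->
  forall j x, ipow I j x -> ipow I' j (f x).
Proof.
move=> fI; elim=> // j IHj; apply: ipow_ind => [|x y|x y Ix Iy].
- by rewrite rmorph0; apply: ipow0.
- by rewrite rmorphD; apply: ipowD.
- by rewrite rmorphM; apply: ipow_mul; [apply: fI | apply: IHj].
Qed.

(** * Algebra maps, subalgebras, quotients and dual numbers *)

Section BundleAlg.
Variables (k : fieldType) (A B : comAlgType k) (f : A -> B).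
Hypotheses (f_lin : linear f) (f_mul : GRing.monoid_morphism f).
Definition bundled_alg := let _ := f_lin in let _ := f_mul in f.
HB.instance Definition _ := GRing.isLinear.Build k A B *:%R bundled_alg f_lin.
HB.instance Definition _ := GRing.isMonoidMorphism.Build A B bundled_alg f_mul.
Definition mk_lrmorphism : {lrmorphism A -> B} := bundled_alg.
End BundleAlg.

Section Subalgebra.
Variables (k : fieldType) (A : comAlgType k) (S : {pred A}) (S_alg : subalg_closed S).
Definition subalg_pred : {pred A} := let _ := S_alg in S.
HB.instance Definition _ := GRing.isSubalgClosed.Build k A subalg_pred S_alg.
Record subalg := Subalg { subalg_val : A; _ : subalg_val \in subalg_pred }.
HB.instance Definition _ := [isSub for subalg_val].
HB.instance Definition _ := [Choice of subalg by <:].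
HB.instance Definition _ := [SubChoice_isSubComNzRing of subalg by <:].
HB.instance Definition _ := [SubZmodule_isSubLmodule of subalg by <:].
HB.instance Definition _ := [SubNzRing_SubLmodule_isSubLalgebra of subalg by <:].
HB.instance Definition _ := [SubLalgebra_isSubAlgebra of subalg by <:].
Definition subalg_type : comAlgType k := subalg.
Lemma subalg_val_linear : linear (subalg_val : subalg_type -> A).
Proof. by move=> a x y; apply: (linearP (\val : subalg -> A)). Qed.
Lemma subalg_val_monoid : GRing.monoid_morphism (subalg_val : subalg_type -> A).
Proof. by split; [apply: (rmorph1 (\val : subalg -> A)) | apply: (rmorphM (\val : subalg -> A))]. Qed.
Definition subalg_incl : {lrmorphism subalg_type -> A} :=
  mk_lrmorphism subalg_val_linear subalg_val_monoid.

Lemma subalg_corestrict (B : comAlgType k) (f : {lrmorphism B -> A}) :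
  (forall b, f b \in S) -> exists g : {lrmorphism B -> subalg_type}, lrcomp subalg_incl g = f.
Proof.
move=> fS; pose g b : subalg_type := Subalg (fS b).
have g_lin : linear g by move=> a b c; apply: val_inj; rewrite /= !linearP.
have g_mul : GRing.monoid_morphism g.
  by split=> [|b c]; apply: val_inj; rewrite /= ?rmorph1 ?rmorphM.
by exists (mk_lrmorphism g_lin g_mul); apply: lrmorphism_eq.
Qed.
End Subalgebra.

Section QuotientAlgebra.
Variables (k : fieldType) (A : comAlgType k) (P : {pred A}) (P_id : idealr_closed P).
Definition quot_pred : {pred A} := let _ := P_id in P.
HB.instance Definition _ := isIdealr.Build A quot_pred P_id.
Definition quot_alg := Quotient.quot quot_pred.
HB.instance Definition _ := GRing.ComNzRing.on quot_alg.
Definition quot_pi : A -> quot_alg := \pi_quot_alg%qT.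
HB.instance Definition _ := GRing.RMorphism.on quot_pi.
Definition quot_scale (a : k) (q : quot_alg) : quot_alg := quot_pi a%:A * q.
Lemma quot_scaleA a b q : quot_scale a (quot_scale b q) = quot_scale (a * b) q.
Proof.
by rewrite /quot_scale mulrA -(rmorphM quot_pi) /= -scalerAl mul1r scalerA.
Qed.
Lemma quot_scale1 : left_id 1 quot_scale.
Proof. by move=> q; rewrite /quot_scale scale1r rmorph1 mul1r. Qed.
Lemma quot_scaleDr : right_distributive quot_scale +%R.
Proof. by move=> a x y; apply: mulrDr. Qed.
Lemma quot_scaleDl q : {morph quot_scale^~ q : a b / a + b}.
Proof. by move=> a b; rewrite /quot_scale scalerDl rmorphD mulrDl. Qed.
HB.instance Definition _ := GRing.Zmodule_isLmodule.Build k quot_alg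
  quot_scaleA quot_scale1 quot_scaleDr quot_scaleDl.
Lemma quot_scaleAl (a : k) (u v : quot_alg) : a *: (u * v) = (a *: u) * v.
Proof. exact: mulrA. Qed.
HB.instance Definition _ := GRing.Lmodule_isLalgebra.Build k quot_alg quot_scaleAl.
HB.instance Definition _ := GRing.Lalgebra_isComAlgebra.Build k quot_alg.

Lemma quot_alg_exists : exists (B : comAlgType k) (f : {lrmorphism A -> B}),
  (forall b, exists a, f a = b) /\ (forall a, f a = 0 <-> a \in P).
Proof.
have lin : linear quot_pi.
  by move=> a x y; rewrite raddfD /= -[a *: x]mulr_algl (rmorphM quot_pi).
have mul : GRing.monoid_morphism quot_pi by split; [apply: rmorph1 | apply: rmorphM].
exists quot_alg, (mk_lrmorphism lin mul); split=> [b|a].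
  by exists (repr b); apply: reprK.
have -> : (a \in P) = (a - 0 \in quot_pred) by rewrite subr0.
rewrite Quotient.idealrBE; split=> [/= pa|/eqP pa].
  by apply/eqP; rewrite [LHS]pa; apply/esym/(raddf0 quot_pi).
by rewrite -[RHS](raddf0 quot_pi).
Qed.
End QuotientAlgebra.

Section DualNumbers.
Variables (k : fieldType).

(** An alias of the product that carries the multiplication of A[e] with e^2 = 0 instead of the
    componentwise one. *)
Definition dual (A : comAlgType k) : Type := (A * A)%type.

Lemma dual_eq (A : comAlgType k) (x y : dual A) : x.1 = y.1 -> x.2 = y.2 -> x = y.
Proof. by case: x y => [x x'] [y y'] /= -> ->. Qed.

Section Ring.
Variable A : comAlgType k.
HB.instance Definition _ := GRing.Lmodule.copy (dual A) (A * A)%type.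
Definition dual_one : dual A := (1, 0).
Definition dual_mul (x y : dual A) : dual A := (x.1 * y.1, x.1 * y.2 + x.2 * y.1).
Lemma dual_mulA : associative dual_mul.
Proof. by move=> [a b] [c d] [e f]; congr (_, _) => /=; ring. Qed.
Lemma dual_mulC : commutative dual_mul.
Proof. by move=> [a b] [c d]; congr (_, _) => /=; ring. Qed.
Lemma dual_mul1 : left_id dual_one dual_mul.
Proof. by move=> [a b]; congr (_, _) => /=; ring. Qed.
Lemma dual_mulD : left_distributive dual_mul +%R.
Proof. by move=> [a b] [c d] [e f]; congr (_, _) => /=; ring. Qed.
Lemma dual_one_neq0 : dual_one != 0.
Proof. by apply/eqP => -[/eqP]; rewrite oner_eq0. Qed.
HB.instance Definition _ := GRing.Zmodule_isComNzRing.Build (dual A)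
  dual_mulA dual_mulC dual_mul1 dual_mulD dual_one_neq0.
Lemma dual_scaleAl (a : k) (u v : dual A) : a *: dual_mul u v = dual_mul (a *: u) v.
Proof.
apply: dual_eq; first exact: scalerAl.
by rewrite [LHS]scalerDr; congr (_ + _); apply: scalerAl. Qed.
HB.instance Definition _ := GRing.Lmodule_isLalgebra.Build k (dual A) dual_scaleAl.
HB.instance Definition _ := GRing.Lalgebra_isComAlgebra.Build k (dual A).
End Ring.

Lemma dualM (A : comAlgType k) (x y : dual A) :
  x * y = (x.1 * y.1, x.1 * y.2 + x.2 * y.1) :> dual A.
Proof. by []. Qed.

Lemma dual_sum (A : comAlgType k) (T : Type) (r : seq T) (P : pred T) (F : T -> dual A) :
  \sum_(i <- r | P i) F i = (\sum_(i <- r | P i) (F i).1, \sum_(i <- r | P i) (F i).2) :> dual A.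
Proof. by elim/big_rec3: _ => // i y1 y2 y3 _ ->. Qed.

Lemma der_point (A B : comAlgType k) (f : {lrmorphism A -> B}) (d : {linear A -> B}) :
  (forall u v, d (u * v) = f u * d v + d u * f v) ->
  exists g : {lrmorphism A -> dual B}, forall u, g u = (f u, d u).
Proof.
move=> dM; pose g u : dual B := (f u, d u).
have g_lin : linear g by move=> a u v; rewrite /g !linearP.
have d1 : d 1 = 0.
  by have /eqP := dM 1 1; rewrite !rmorph1 !mul1r mulr1 -subr_eq subrr => /eqP.
have g_mul : GRing.monoid_morphism g.
  by split=> [|u v]; rewrite /g ?rmorph1 ?d1 // rmorphM dM.
by exists (mk_lrmorphism g_lin g_mul).
Qed.

Lemma dual_fst (A : comAlgType k) : exists g : {lrmorphism dual A -> A}, forall x, g x = x.1.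
Proof.
pose g (x : dual A) : A := x.1.
have g_lin : linear g by [].
have g_mul : GRing.monoid_morphism g by [].
by exists (mk_lrmorphism g_lin g_mul).
Qed.

Lemma dual_incl (A : comAlgType k) : exists g : {lrmorphism A -> dual A}, forall x, g x = (x, 0).
Proof.
have lin0 : linear (fun _ : A => 0 : A) by move=> a x y; rewrite scaler0 addr0.
by apply: (@der_point A A idfun (mk_linear lin0)) => u v; rewrite /= mulr0 mul0r addr0.
Qed.
End DualNumbers.

(** * Affine groups and representation algebras *)

Section Comultiplication.
Variables (k : fieldType) (G : affine_group k).
Notation R := (coord_ring G).

Definition counit : {lrmorphism R -> k^o} := point_one G k^o.

(** Only the multiplication is assumed natural. Naturality of the unit follows because the image of
    the unit over k is an idempotent of the group of points over B. *)
Lemma point_oneE (B : comAlgType k) u : point_one G B u = (counit u)%:A.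
Proof.
have in_algP : exists f : {lrmorphism k^o -> B}, forall a, f a = a%:A.
  have lin : linear (fun a : k^o => a%:A : B).
    by move=> a x y; rewrite scalerDl scalerA.
  have mul : GRing.monoid_morphism (fun a : k^o => a%:A : B).
    by split=> [|x y]; rewrite ?scale1r // -scalerAl mul1r scalerA.
  by exists (mk_lrmorphism lin mul).
case: in_algP => f fE; rewrite -fE -[RHS]/(lrcomp f counit u).
pose z : points G B := lrcomp f counit.
have : (z * z = z)%g by rewrite -[LHS]point_mul_natural point_mul1.
by rewrite -[RHS]mulg1 -/z => /mulgI ->.
Qed.

(** The elements of this shape form a subalgebra of B through which both points factor; by
    naturality their product factors through it too. This stands for the coproduct without a tensor
    product. *)
Lemma comul_word (B : comAlgType k) (x y : points G B) u :
  exists s : seq (R * R), point_mul x y u = \sum_(p <- s) x p.1 * y p.2.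
Proof.
pose S : {pred B} := [pred b | `[< exists s : seq (R * R), b = \sum_(p <- s) x p.1 * y p.2 >]].
have S_alg : subalg_closed S.
  split=> [|a _ _ /asboolP[s ->] /asboolP[t ->]|_ _ /asboolP[s ->] /asboolP[t ->]].
  - by apply/asboolP; exists [:: (1, 1)]; rewrite big_seq1 !rmorph1 mul1r.
  - apply/asboolP; exists ([seq (a *: p.1, p.2) | p <- s] ++ t).
    rewrite big_cat big_map scaler_sumr; congr (_ + _); apply: eq_bigr => p _.
    by rewrite linearZ /= scalerAl.
  - apply/asboolP; exists [seq (p.1 * q.1, p.2 * q.2) | p <- s, q <- t].
    rewrite big_allpairs_dep mulr_suml; apply: eq_bigr => p _.
    by rewrite mulr_sumr; apply: eq_bigr => q _; rewrite !rmorphM mulrACA.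
have [v|x' x'E] := @subalg_corestrict k B S S_alg R x.
  by apply/asboolP; exists [:: (v, 1)]; rewrite big_seq1 rmorph1 mulr1.
have [v|y' y'E] := @subalg_corestrict k B S S_alg R y.
  by apply/asboolP; exists [:: (1, v)]; rewrite big_seq1 rmorph1 mul1r.
have <- : subalg_incl S_alg (point_mul x' y' u) = point_mul x y u.
  by rewrite -x'E -y'E -point_mul_natural.
have SP b : b \in subalg_pred S_alg -> exists s : seq (R * R), b = \sum_(p <- s) x p.1 * y p.2.
  by move=> bS; apply/asboolP.
by apply: SP; apply: (valP (point_mul x' y' u : subalg S_alg)).
Qed.

(* The universal pair of points lives over the representation algebra of the
   free group on two generators. *)
Lemma comul (u : R) : exists s : seq (R * R), forall (B : comAlgType k) (x y : points G B),
  point_mul x y u = \sum_(p <- s) x p.1 * y p.2.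
Proof.
pose F2 := pres_group (fun _ : word bool => False).
pose a : F2 := pres_gen (fun _ : word bool => False) true.
pose b : F2 := pres_gen (fun _ : word bool => False) false.
have [s sE] := comul_word (rep_univ G a) (rep_univ G b) u.
exists s => B x y.
have rel0 w : False -> word_eval (fun c => if c then x else y) w = 1%g by [].
pose rho0 := pres_lift (rel_ := fun _ => False) (fun c : bool => if c then x else y).
have rhoM : {morph rho0 : g h / (g * h)%g} by apply: pres_liftM.
pose M := monoid.isMultiplicative.Build F2 (points G B) rho0 rhoM.
pose rho : {multiplicative F2 -> points G B} := HB.pack rho0 M.
have xE : lrcomp (rep_eval rho) (rep_univ G a) = x.
  by rewrite rep_eval_univ [LHS]pres_lift_gen.
have yE : lrcomp (rep_eval rho) (rep_univ G b) = y.
  by rewrite rep_eval_univ [LHS]pres_lift_gen.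
rewrite -xE -yE -point_mul_natural /= sE rmorph_sum; apply: eq_bigr => p _.
by rewrite rmorphM.
Qed.

Lemma counit_alg (c : k) : counit c%:A = c.
Proof. by rewrite linearZ /= rmorph1 [LHS]mulr1. Qed.

(** Each factor v of the coproduct is replaced by v - eps(v); the values at (x, 1), (1, y) and (1,
    1) account for the terms outside the sum. *)
Lemma comul_normal (u : R) : exists s : seq (R * R),
  (forall p, p \in s -> counit p.1 = 0 /\ counit p.2 = 0) /\
  forall (B : comAlgType k) (x y : points G B),
    point_mul x y u = x u + y u - (counit u)%:A + \sum_(p <- s) x p.1 * y p.2.
Proof.
have [s sE] := comul u; pose e (v : R) : R := (counit v)%:A.
exists [seq (p.1 - e p.1, p.2 - e p.2) | p <- s]; split=> [_ /mapP[p ps ->] | B x y].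
  by rewrite /= !raddfB /= !counit_alg !subrr.
have xa (z : points G B) c : z c%:A = c%:A by rewrite linearZ /= rmorph1.
have xE := sE B x 1%g; have yE := sE B 1%g y; have eE := sE B 1%g 1%g.
rewrite point_mul1 in yE; rewrite point_mul1 in eE.
rewrite point_mul_1 in xE; rewrite sE big_map /=.
rewrite xE yE -point_oneE eE -!big_split /= -sumrB -big_split /=.
apply: eq_bigr => p _; rewrite (raddfB (x : {lrmorphism R -> B})).
rewrite (raddfB (y : {lrmorphism R -> B})) /= !xa -!point_oneE -!/(1%g : points G B).
move: (x p.1) (y p.2) ((1%g : points G B) p.1) ((1%g : points G B) p.2) => a b c d.
by ring.
Qed.
End Comultiplication.

Lemma gen_idealP (R : comNzRingType) (ys : seq R) :
  ideal (fun u => exists c : R -> R, u = \sum_(y <- ys) c y * y).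
Proof.
split=> [|_ _ [c ->] [c' ->]|a _ [c ->]].
- by exists (fun=> 0); rewrite big1 // => y _; rewrite mul0r.
- by exists (fun y => c y + c' y); rewrite -big_split; apply: eq_bigr => y _; rewrite mulrDl.
- by exists (fun y => a * c y); rewrite mulr_sumr; apply: eq_bigr => y _; rewrite mulrA.
Qed.

Lemma gen_ideal_mem (R : comNzRingType) (ys : seq R) y : y \in ys ->
  exists c : R -> R, y = \sum_(z <- undup ys) c z * z.
Proof.
move=> yys; exists (fun z => (z == y)%:R).
rewrite (bigD1_seq y) ?mem_undup ?undup_uniq //= eqxx mul1r big1 ?addr0 // => z /negPf ->.
by rewrite mul0r.
Qed.

Section Augmentation.
Variables (k : fieldType) (A : comAlgType k) (e : {lrmorphism A -> k^o}).

Definition aug_ideal (u : A) : Prop := e u = 0.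

Lemma aug_alg (c : k) : e c%:A = c.
Proof. by rewrite linearZ /= rmorph1 [LHS]mulr1. Qed.

Lemma aug_idealP : ideal aug_ideal.
Proof.
rewrite /aug_ideal; split=> [|x y x0 y0|a x x0]; first exact: raddf0.
  by rewrite raddfD /= x0 y0 addr0.
by rewrite rmorphM /= x0 mulr0.
Qed.

Lemma aug_sub (u : A) : aug_ideal (u - (e u)%:A).
Proof. by rewrite /aug_ideal raddfB /= aug_alg subrr. Qed.

Lemma ipowZ j (a : k) x : ipow aug_ideal j x -> ipow aug_ideal j (a *: x).
Proof. by move=> Ix; rewrite -mulr_algl; apply: ipow_mull. Qed.

Lemma fg_aug_ideal : finitely_generated A -> exists ys : seq A,
  (forall y, y \in ys -> aug_ideal y) /\
  forall u, aug_ideal u -> exists c : A -> A, u = \sum_(y <- ys) c y * y.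
Proof.
move=> [s sP]; pose ys := undup [seq y - (e y)%:A | y <- s].
pose S : {pred A} := [pred u | `[< exists c : A -> A, u - (e u)%:A = \sum_(y <- ys) c y * y >]].
have [J0 JD JM] := gen_idealP ys.
exists ys; split=> [y|u u0].
  by rewrite mem_undup => /mapP[z _ ->]; apply: aug_sub.
suff /asboolP : u \in S by rewrite u0 scale0r subr0.
apply: sP => [|y ys0]; last by apply/asboolP/gen_ideal_mem/map_f.
split=> [|a u1 u2 /asboolP Ju1 /asboolP Ju2|u1 u2 /asboolP Ju1 /asboolP Ju2]; apply/asboolP.
- by rewrite rmorph1 scale1r subrr.
- rewrite linearP /=.
  have -> : a *: u1 + u2 - (a *: e u1 + e u2)%:A = a%:A * (u1 - (e u1)%:A) + (u2 - (e u2)%:A).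
    have -> : a *: e u1 + e u2 = a * e u1 + e u2 by [].
    by rewrite mulr_algl scalerBr scalerDl -scalerA; zmodu.
  by apply: JD => //; apply: JM.
- rewrite rmorphM /=.
  have -> : u1 * u2 - (e u1 * e u2)%:A = u2 * (u1 - (e u1)%:A) + (e u1)%:A * (u2 - (e u2)%:A).
    have -> : (e u1 * e u2)%:A = (e u1)%:A * (e u2)%:A :> A by rewrite -scalerAl mul1r scalerA.
    by ring.
  by apply: JD; apply: JM.
Qed.

Lemma der_ipow (d : {linear A -> A}) : (forall u v, d (u * v) = u * d v + d u * v) ->
  forall j u, ipow aug_ideal j.+1 u -> ipow aug_ideal j (d u).
Proof.
move=> dM; elim=> // j IHj; apply: ipow_ind => [|u v|u v Iu Iv].
- by rewrite raddf0; apply: ipow0.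
- by rewrite raddfD; apply: ipowD.
- rewrite dM; apply: ipowD; last exact: ipow_mull.
  by apply: ipow_mul => //; apply: IHj.
Qed.

(** A derivation that is the identity on I / I^2 acts on I^j / I^(j+1) as the Euler operator on
    forms of degree j, by the Leibniz rule. *)
Lemma euler_ipow (d : {linear A -> A}) : (forall u v, d (u * v) = u * d v + d u * v) ->
  (forall u, aug_ideal u -> ipow aug_ideal 2 (d u - u)) ->
  forall j u, ipow aug_ideal j u -> ipow aug_ideal j.+1 (d u - u *+ j).
Proof.
move=> dM dE; have [I0 ID IM] := aug_idealP.
have dI u : aug_ideal u -> aug_ideal (d u).
  move=> Iu; rewrite -[d u](subrK u); apply: ID => //.
  by apply/(ipow1 _ aug_idealP)/ipow_sub/dE.
elim=> [|j IHj] u.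
  move=> _; apply/(ipow1 _ aug_idealP); rewrite mulr0n subr0.
  have d1 : d 1 = 0.
    by have /eqP := dM 1 1; rewrite !mul1r mulr1 -subr_eq subrr eq_sym => /eqP.
  rewrite -[u](subrK (e u)%:A) raddfD /= [d _%:A]linearZ /= d1 scaler0 addr0.
  exact/dI/aug_sub.
move: u; apply: ipow_ind => [|u v Iu Iv|u v Iu Iv].
- by rewrite raddf0 mul0rn subrr; apply: ipow0.
- by rewrite raddfD mulrnDl opprD addrACA; apply: ipowD.
- have -> : d (u * v) - (u * v) *+ j.+1 = u * (d v - v *+ j) + v * (d u - u).
    by rewrite dM mulrSr mulrBr mulrBr mulrnAr; ring.
  apply: ipowD; first by apply: ipow_mul => //; apply: IHj.
  by rewrite mulrC -[j.+2]/(2 + j)%N; apply: ipowM => //; apply: dE.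
Qed.
End Augmentation.

(** * Coordinates at the unit *)

Section Coordinates.
Variable k : fieldType.

(** Greedy extraction of a basis of the span of ys modulo W. *)
Lemma independent_mod (V : lmodType k) (W : V -> Prop) (ys : seq V) :
  W 0 -> (forall a x y, W x -> W y -> W (a *: x + y)) ->
  exists xs : seq V, [/\ {subset xs <= ys},
    forall c : nat -> k, W (\sum_(i < size xs) c i *: xs`_i) -> forall i : 'I_(size xs), c i = 0
  & forall y, y \in ys -> exists c : nat -> k, W (y - \sum_(i < size xs) c i *: xs`_i)].
Proof.
move=> W0 WL; elim: ys => [|y ys [xs [xsys xsI xsG]]].
  by exists [::]; split=> // c _ [].
have [[c cP]|nc] := pselect (exists c : nat -> k, W (y - \sum_(i < size xs) c i *: xs`_i)).
  exists xs; split=> [z /xsys zys|//|z]; first by rewrite inE zys orbT.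
  by rewrite inE => /orP[/eqP ->|/xsG //]; exists c.
exists (y :: xs); split=> [z|c|z] /=.
- by rewrite !inE => /orP[->|/xsys ->] //; rewrite orbT.
- rewrite big_ord_recl /= => cW.
  have c0 : c 0%N = 0.
    apply: contra_notP nc => /eqP c0; exists (fun i => - (c 0%N)^-1 * c i.+1).
    have := WL (c 0%N)^-1 _ _ cW W0; rewrite addr0 scalerDr scalerA mulVf // scale1r.
    rewrite scaler_sumr -sumrN; congr (W (_ + _)); apply: eq_bigr => i _.
    by rewrite scalerA mulNr scaleNr opprK.
  move: cW; rewrite c0 scale0r add0r => cW i.
  case: (unliftP ord0 i) => [j ->|-> //]; exact: (xsI (fun i => c i.+1) cW j).
- rewrite inE => /orP[/eqP ->|/xsG[c cP]].
    exists (fun i => (i == 0)%:R); rewrite big_ord_recl /= scale1r big1 ?addr0 ?subrr // => i _.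
    by rewrite scale0r.
  exists (fun i => if i is j.+1 then c j else 0).
  by rewrite big_ord_recl /= scale0r add0r.
Qed.

(** The classes of the x_i are a basis of the cotangent space I / I^2, and the p_i are the dual
    basis of tangent vectors, viewed as derivations at e. *)
Definition coordinates (A : comAlgType k) (e : {lrmorphism A -> k^o}) d
    (x : 'I_d -> A) (p : 'I_d -> {linear A -> k^o}) : Prop :=
  [/\ forall i, e (x i) = 0, forall i j, p i (x j) = (i == j)%:R,
      forall i u v, p i (u * v) = e u * p i v + e v * p i u
    & forall u, e u = 0 -> ipow (aug_ideal e) 2 (u - \sum_i p i u *: x i)].

Lemma coordinates_exist (A : comAlgType k) (e : {lrmorphism A -> k^o}) :
  finitely_generated A -> exists d x p, @coordinates A e d x p.
Proof.
move=> /(fg_aug_ideal e)[ys [ysI ysG]]; pose I2 := ipow (aug_ideal e) 2.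
have I2L a u v : I2 u -> I2 v -> I2 (a *: u + v) by move=> ? ?; apply: ipowD => //; apply: ipowZ.
have I20 : I2 0 by apply: ipow0.
have [xs [xsys xsI xsG]] := independent_mod ys I20 I2L.
have xs0 (i : 'I_(size xs)) : e xs`_i = 0 by apply/ysI/xsys/mem_nth.
pose Sp u := exists c : nat -> k, I2 (u - \sum_(i < size xs) c i *: xs`_i).
have SpL a u v : Sp u -> Sp v -> Sp (a *: u + v).
  move=> [c cP] [c' c'P]; exists (fun i => a * c i + c' i).
  have := I2L a _ _ cP c'P; congr I2; rewrite scalerBr addrACA -opprD; congr (_ - _).
  rewrite scaler_sumr -big_split; apply: eq_bigr => i _ /=.
  by rewrite scalerDl scalerA.
have Sp0 : Sp 0.
  by exists (fun=> 0); rewrite big1 ?subrr // => i _; rewrite scale0r.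
have SpI u : e u = 0 -> Sp u.
  move=> /ysG[c ->]; rewrite big_seq; elim/big_rec: _ => // y u' yys IH.
  (* Modulo I^2 the coefficient c(y) may be replaced by the constant e(c(y)), since y is in I. *)
  have -> : c y * y + u' = (c y - (e (c y))%:A) * y + (e (c y) *: y + u').
    by rewrite mulrBl mulr_algl; zmodu.
  have [c' c'P] := SpL (e (c y)) _ _ (xsG y yys) IH; exists c'.
  rewrite -addrA; apply: ipowD => //; apply: ipow_mul; first exact: aug_sub.
  by apply/(ipow1 _ (aug_idealP e))/ysI.
pose Rel (i : 'I_(size xs)) (u : A) (a : k^o) := exists c : nat -> k,
  I2 (u - (e u)%:A - \sum_(i < size xs) c i *: xs`_i) /\ a = c i.
have sumL a (c c' : nat -> k) : \sum_(i < size xs) (a * c i + c' i) *: xs`_i =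
    a *: \sum_(i < size xs) c i *: xs`_i + \sum_(i < size xs) c' i *: xs`_i.
  by rewrite scaler_sumr -big_split; apply: eq_bigr => i _; rewrite scalerDl scalerA.
have RelL i a u v b b' : Rel i u b -> Rel i v b' -> Rel i (a *: u + v) (a *: b + b').
  move=> [c [cP ->]] [c' [c'P ->]]; exists (fun i => a * c i + c' i); split=> //.
  have := I2L a _ _ cP c'P; congr I2; rewrite sumL linearP /=.
  have -> : a *: e u + e v = a * e u + e v by [].
  by rewrite !scalerBr scalerDl -scalerA; zmodu.
have /choice[p pP] : forall i, exists p : {linear A -> k^o}, forall u, Rel i u (p u).
  move=> i; apply: linear_of_rel => [u|a [c [cP ->]]|a u a' v b' Ru Rv]; last exact: RelL.
    by have [c cP] := SpI _ (aug_sub e u); exists (c i), c.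
  move: cP; rewrite raddf0 scale0r subrr sub0r => cP.
  apply: (xsI (fun i => c i)); have := I2L (-1) _ _ cP I20; congr I2.
  by rewrite scaleN1r opprK addr0.
have puniq u (c : nat -> k) : I2 (u - (e u)%:A - \sum_(i < size xs) c i *: xs`_i) ->
    forall i, p i u = c i.
  move=> cP i; have [c' [c'P ->]] := pP i u; apply/eqP; rewrite -subr_eq0 addrC -mulN1r addrC.
  have := xsI (fun i => -1 * c i + c' i) _ i; rewrite addrC => -> //.
  have := I2L (-1) _ _ c'P cP; congr I2; rewrite sumL !scaleN1r; zmod.
exists (size xs), (fun i => xs`_i), p; split=> [//|i j|i u v|u u0].
- rewrite (puniq _ (fun n => (n == j)%:R)) //; rewrite (bigD1 j) //= eqxx scale1r big1 => [|m mj].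
    by rewrite xs0 scale0r subr0 addr0 subrr.
  by rewrite (negPf (mj : (m != j :> nat))) scale0r.
- pose c u n := if insub n is Some i then p i u else 0.
  have cE w (j : 'I_(size xs)) : c w j = p j w by rewrite /c valK.
  have cP w : I2 (w - (e w)%:A - \sum_(i < size xs) c w i *: xs`_i).
    have [c' c'P] := SpI _ (aug_sub e w); have := c'P; congr (I2 (_ - _)).
    by apply: eq_bigr => j _; rewrite cE (puniq _ _ c'P).
  rewrite (puniq _ (fun n => e u * c v n + e v * c u n)) ?cE //.
  (* The Leibniz rule for p_i expresses that (u - e(u))(v - e(v)) lies in I^2. *)
  have := I2L (e u) _ _ (cP v) (I2L (e v) _ _ (cP u)
    (ipow_mul (aug_sub e u) ((ipow1 _ (aug_idealP e)).2 (aug_sub e v)))).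
  congr I2; under [in RHS]eq_bigr do rewrite scalerDl -!scalerA.
  rewrite big_split /= -!scaler_sumr !scalerBr rmorphM /=.
  have -> : (e u * e v)%:A = (e u)%:A * (e v)%:A :> A by rewrite -scalerAl mul1r scalerA.
  rewrite -[e u *: v]mulr_algl -[e v *: u]mulr_algl -[e u *: (e v)%:A]mulr_algl.
  by rewrite -[e v *: (e u)%:A]mulr_algl; ring.
- have [c' c'P] := SpI _ (aug_sub e u); have := c'P; rewrite u0 scale0r subr0.
  congr (I2 (_ - _)); apply: eq_bigr => j _; rewrite (puniq u c') // u0 scale0r subr0.
Qed.
End Coordinates.

(** * Invariant derivations of the coordinate ring *)

Section Derivations.
Variable k : fieldType.

Definition derivation (A B : comAlgType k) (f d : A -> B) : Prop :=
  forall u v, d (u * v) = f u * d v + d u * f v.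

Lemma derivation1 (A B : comAlgType k) (f : {lrmorphism A -> B}) (d : A -> B) :
  derivation f d -> d 1 = 0.
Proof. by move=> dM; have /eqP := dM 1 1; rewrite !rmorph1 !mul1r mulr1 -subr_eq subrr eq_sym => /eqP. Qed.

Lemma dual_derivation (A B : comAlgType k) (t : {lrmorphism A -> dual B}) :
  exists d : {linear A -> B}, (forall u, d u = (t u).2) /\
    derivation (fun u => (t u).1) d.
Proof.
have lin : linear (fun u => (t u).2) by move=> a u v; rewrite linearP.
exists (mk_linear lin); split=> // u v; by rewrite -[LHS]/((t (u * v)).2) rmorphM.
Qed.

Section Group.
Variables (G : affine_group k) (d : nat) (x : 'I_d -> coord_ring G).
Variable p : 'I_d -> {linear coord_ring G -> k^o}.
Hypothesis xp : coordinates (counit G) x p.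
Notation R := (coord_ring G).
Notation eps := (counit G).

(** A derivation at the unit kills constants and I^2, so it only sees the class of u in I / I^2. *)
Lemma coord_at1 (B : comAlgType k) (h : {linear R -> B}) :
  (forall u v, h (u * v) = eps u *: h v + eps v *: h u) ->
  forall u, h u = \sum_j p j u *: h (x j).
Proof.
case: xp => x0 _ pM pS hM u; have h1 : h 1 = 0.
  by have /eqP := hM 1 1; rewrite rmorph1 !scale1r mul1r -subr_eq subrr eq_sym => /eqP.
have p1 j : p j 1 = 0.
  have /eqP := pM j 1 1; rewrite rmorph1 mul1r mul1r.
  by rewrite -subr_eq subrr eq_sym => /eqP.
have hI v : ipow (aug_ideal eps) 2 v -> h v = 0.
  have [_ _ IM] := aug_idealP eps.
  move: v; apply: ipow_ind => [|v w hv hw|v w Iv /(ipow1 _ (aug_idealP eps)) Iw].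
  - exact: raddf0.
  - by rewrite raddfD /= hv hw addr0.
  - by rewrite hM Iv Iw !scale0r addr0.
have -> : h u = h (u - (eps u)%:A) by rewrite raddfB /= linearZ /= h1 scaler0 subr0.
have -> : \sum_j p j u *: h (x j) = \sum_j p j (u - (eps u)%:A) *: h (x j).
  apply: eq_bigr => j _; congr (_ *: _).
  by rewrite raddfB /= linearZ /= p1 scaler0 subr0.
have := hI _ (pS _ (aug_sub eps u)); rewrite raddfB raddf_sum /= => /eqP.
by rewrite subr_eq0 => /eqP ->; apply: eq_bigr => j _; rewrite linearZ.
Qed.

Definition tangent_at (B : comAlgType k) (i : 'I_d) (c : B) (t : points G (dual B)) : Prop :=
  forall u, t u = ((eps u)%:A, p i u *: c).

Lemma tangent_exists (B : comAlgType k) i (c : B) : exists t, tangent_at i c t.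
Proof.
case: xp => _ _ pM _.
have lin : linear (fun u => p i u *: c).
  by move=> a u v; rewrite linearP /= scalerDl -scalerA.
have [|t tE] := @der_point k R B (point_one G B) (mk_linear lin).
  have hE w : mk_linear lin w = p i w *: c by [].
  have key (a b a' b' : k) : (a * b + a' * b') *: c = a%:A * (b *: c) + (b' *: c) * a'%:A.
    by rewrite scalerDl [in RHS]mulr_algl [X in _ = _ + X]mulrC mulr_algl !scalerA.
  by move=> u v; rewrite (hE (u * v)) (hE u) (hE v) (pM i u v) (point_oneE B u) (point_oneE B v).
by exists t => u; rewrite tE point_oneE.
Qed.

Lemma der_exists i : exists D : {linear R -> R}, derivation id D /\
  forall u s, (forall (B : comAlgType k) (y z : points G B),
    point_mul y z u = \sum_(q <- s) y q.1 * z q.2) -> D u = \sum_(q <- s) p i q.2 *: q.1.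
Proof.
have [t tE] := @tangent_exists R i 1; have [io ioE] := dual_incl R.
have [D [DE DM]] := dual_derivation (point_mul (io : points G _) t).
have mulE u s : (forall (B : comAlgType k) (y z : points G B),
    point_mul y z u = \sum_(q <- s) y q.1 * z q.2) ->
    point_mul (io : points G _) t u =
    (\sum_(q <- s) q.1 * (eps q.2)%:A, \sum_(q <- s) p i q.2 *: q.1).
  move=> ->; rewrite dual_sum; congr (_, _); apply: eq_bigr => q _;
    rewrite ioE tE //= mul0r addr0 -scalerAr mulr1 //.
exists D; split=> [u v|u s sE]; last by rewrite DE (mulE _ _ sE).
have t1 w : (point_mul (io : points G _) t w).1 = w.
  have [s sE] := comul w; rewrite (mulE _ _ sE) /=.
  have idE : (point_mul (idfun : points G R) (point_one G R)) w = w by rewrite [point_mul _ _]point_mul_1.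
  rewrite -[RHS]idE sE; apply: eq_bigr => q _.
  by rewrite point_oneE.
by rewrite DM !t1.
Qed.

Definition hopf_der i : {linear R -> R} := sval (cid (der_exists i)).

Lemma hopf_derM i : derivation id (hopf_der i).
Proof. by case: (svalP (cid (der_exists i))). Qed.

Lemma hopf_derE i u s : (forall (B : comAlgType k) (y z : points G B),
    point_mul y z u = \sum_(q <- s) y q.1 * z q.2) ->
  hopf_der i u = \sum_(q <- s) p i q.2 *: q.1.
Proof. by case: (svalP (cid (der_exists i))) => _; apply. Qed.

Lemma eps_hopf_der i u : eps (hopf_der i u) = p i u.
Proof.
have [s sE] := comul u; rewrite (hopf_derE i sE) raddf_sum /=.
have := sE R (point_one G R) (idfun : points G R).
rewrite point_mul1 /= => ->; rewrite raddf_sum; apply: eq_bigr => q _ /=.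
by rewrite point_oneE mulr_algl !linearZ /= [LHS]mulrC.
Qed.

(* A derivation over f is read off from the translate of the corresponding
   point of the dual numbers to the origin. *)
Lemma der_span (B : comAlgType k) (f : {lrmorphism R -> B}) (h : {linear R -> B}) :
  derivation f h -> exists c : 'I_d -> B, forall u, h u = \sum_i f (hopf_der i u) * c i.
Proof.
move=> hM; have [t tE] := der_point hM; have [io ioE] := dual_incl B.
have [pr prE] := dual_fst B; pose fi : points G (dual B) := lrcomp io f.
pose y : points G (dual B) := (fi^-1 * (t : points G (dual B)))%g.
have y1 u : (y u).1 = (eps u)%:A.
  rewrite -prE -[LHS]/(lrcomp pr y u) [lrcomp pr y]point_mul_natural.
  have -> : lrcomp pr t = lrcomp pr fi.
    by apply: lrmorphism_eq => v; rewrite /= !prE tE ioE.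
  have E : point_mul (fi^-1)%g fi = point_one G (dual B) by apply: point_mulV.
  by rewrite -point_mul_natural E -[LHS]/(pr (point_one G (dual B) u)) prE point_oneE.
have [h' [h'E h'M]] := dual_derivation y.
have h'S := @coord_at1 B h' _; exists (fun j => h' (x j)) => u.
have [s sE] := comul u.
have -> : h u = (point_mul fi y u).2.
  have -> : point_mul fi y = t by rewrite -[LHS]/(fi * y)%g /y mulgA mulgV mul1g.
  by rewrite tE.
rewrite sE dual_sum /=.
under [RHS]eq_bigr do rewrite (hopf_derE _ sE) raddf_sum mulr_suml.
rewrite exchange_big; apply: eq_bigr => q _ /=.
rewrite ioE /= mul0r addr0 -h'E h'S; last first.
  by move=> v w; rewrite h'M !y1 !mulr_algl mulrC mulr_algl.
by rewrite mulr_sumr; apply: eq_bigr => j _; rewrite linearZ /= -scalerAl scalerAr.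
Qed.

End Group.
End Derivations.

(** * Derivations of representation algebras from additive characters *)

Record charac (k : fieldType) (Gam : groupType) := Charac {
  charac_fun :> Gam -> k;
  characM : forall g h, charac_fun (g * h)%g = charac_fun g + charac_fun h
}.

Section Characters.
Variables (k : fieldType) (Gam : groupType) (mu : charac k Gam).
Lemma charac1 : mu 1%g = 0.
Proof. by have /eqP := characM mu 1%g 1%g; rewrite mulg1 -subr_eq subrr eq_sym => /eqP. Qed.
Lemma characV g : mu (g^-1)%g = - mu g.
Proof. by apply/eqP; rewrite -addr_eq0 -characM mulVg charac1. Qed.
Variables (Gam' : groupType) (phi : {multiplicative Gam' -> Gam}).
Lemma charac_compM g h : mu (phi (g * h)%g) = mu (phi g) + mu (phi h).
Proof. by rewrite gmulfM characM. Qed.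
Definition charac_comp : charac k Gam' := Charac charac_compM.
End Characters.

(* What is used of the representation algebras; proofs over a variable of this
   type cannot unfold the quotient construction. *)
Record rep_model (k : fieldType) (G : affine_group k) := RepModel {
  repA : groupType -> comAlgType k;
  rgen : forall Gam : groupType, Gam -> {lrmorphism coord_ring G -> repA Gam};
  rmap : forall (Gam Gam' : groupType),
    {multiplicative Gam -> Gam'} -> {lrmorphism repA Gam -> repA Gam'};
  reval : forall (Gam : groupType) (B : comAlgType k),
    {multiplicative Gam -> points G B} -> {lrmorphism repA Gam -> B};
  rmap_gen : forall (Gam Gam' : groupType) (phi : {multiplicative Gam -> Gam'}) g u,
    rmap phi (rgen g u) = rgen (phi g) u;
  reval_gen : forall (Gam : groupType) (B : comAlgType k)
    (rho : {multiplicative Gam -> points G B}) g u, reval rho (rgen g u) = rho g u;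
  rgenM : forall (Gam : groupType) (g h : Gam),
    rgen (g * h)%g = point_mul (rgen g) (rgen h);
  repA_ind : forall (Gam : groupType) (P : repA Gam -> Prop),
    P 1 -> (forall a x y, P x -> P y -> P (a *: x + y)) ->
    (forall x y, P x -> P y -> P (x * y)) -> (forall g u, P (rgen g u)) -> forall z, P z
}.
Arguments rgen {k G} r {Gam} g.
Arguments rmap {k G} r {Gam Gam'} phi.
Arguments reval {k G} r {Gam B} rho.

Section RepAlgModel.
Variables (k : fieldType) (G : affine_group k).

Lemma rep_alg_ind (Gam : groupType) (P : rep_alg G Gam -> Prop) :
  P 1 -> (forall a x y, P x -> P y -> P (a *: x + y)) ->
  (forall x y, P x -> P y -> P (x * y)) -> (forall g u, P (rep_gen g u)) -> forall z, P z.
Proof.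
move=> P1 PL PM Pg z; rewrite -[z]reprK; rewrite -[X in P X]/(rep_pi (repr z)).
have P0 : P 0 by have := PL (-1) _ _ P1 P1; rewrite scaleN1r addNr.
have PD x y : P x -> P y -> P (x + y) by move=> Px /(PL 1 _ _ Px); rewrite scale1r.
rewrite [repr _]monalgE (raddf_sum (@rep_pi k G Gam)); apply: big_ind => // m _.
have -> : forall c, << c *g m >> = c *: << m >> :> rep_free G Gam.
  by move=> c; rewrite -mul_malgC malgM_def fgmulUU mulr1 mul1m.
rewrite -[P _]/(P (rep_pi _)) (@rep_pi_scalable k G Gam) -[_ *: _]addr0; apply: PL => //.
rewrite free_monomE (rmorph_prod (@rep_pi k G Gam)); apply: big_ind => // i _.
rewrite (rmorphXn (@rep_pi k G Gam)); elim: (m i) => // n IHn.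
by rewrite exprS; apply: PM => //; case: (i) => g u; apply: Pg.
Qed.


Lemma rep_univM_eq (Gam : groupType) (g h : Gam) :
  rep_univ G (g * h)%g = point_mul (rep_univ G g) (rep_univ G h).
Proof. exact: (@rep_univM k G Gam). Qed.

Definition rep_alg_model : rep_model G :=
  @RepModel k G (rep_alg G) (@rep_univ k G) (@rep_map k G) (@rep_eval k G)
    (@rep_map_gen k G) (@rep_eval_gen k G) rep_univM_eq rep_alg_ind.
End RepAlgModel.

Section RepTheory.
Variables (k : fieldType) (G : affine_group k) (M : rep_model G).
Notation R := (coord_ring G).
Notation eps := (counit G).
Notation F := (repA M).

Lemma rgen1 (Gam : groupType) u : rgen M (1%g : Gam) u = (eps u)%:A.
Proof.
pose z : points G (F Gam) := rgen M (1%g : Gam).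
have : (z * z = z)%g by rewrite -[LHS]/(point_mul z z) -rgenM mulg1.
rewrite -[RHS]mulg1 => /mulgI z1.
by rewrite -[rgen _ _]/z z1 -point_oneE.
Qed.

Lemma repA_hom_eq (Gam : groupType) (B : comAlgType k) (h h' : {lrmorphism F Gam -> B}) :
  (forall g u, h (rgen M g u) = h' (rgen M g u)) -> h =1 h'.
Proof.
move=> hh; apply: repA_ind => [|a y z dy dz|y z dy dz|//]; first by rewrite !rmorph1.
  by rewrite (linearP h) (linearP h') /= dy dz.
by rewrite (rmorphM h) (rmorphM h') /= dy dz.
Qed.

Section Augmentation.
Variable Gam : groupType.
Definition rep_aug : {lrmorphism F Gam -> k^o} := reval M (@trivial_rep k G Gam k^o).

Lemma rep_aug_gen g u : rep_aug (rgen M g u) = eps u.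
Proof. exact: reval_gen. Qed.

Notation I := (ipow (aug_ideal rep_aug)).

Lemma rep_gen_aug g u : eps u = 0 -> aug_ideal rep_aug (rgen M g u).
Proof. by rewrite /aug_ideal rep_aug_gen. Qed.

Lemma rep_genM (g h : Gam) u : exists s : seq (R * R),
  (forall q, q \in s -> eps q.1 = 0 /\ eps q.2 = 0) /\
  rgen M (g * h)%g u = rgen M g u + rgen M h u - (eps u)%:A +
    \sum_(q <- s) rgen M g q.1 * rgen M h q.2.
Proof. by have [s [sI sE]] := comul_normal u; exists s; split=> //; rewrite rgenM sE. Qed.

Lemma rep_genM_I (g h : Gam) u : eps u = 0 ->
  I 2 (rgen M (g * h)%g u - (rgen M g u + rgen M h u) ).
Proof.
move=> u0; have [s [sI ->]] := rep_genM g h u.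
rewrite u0 scale0r subr0 addrAC subrr add0r big_seq; apply: ipow_sum => q /sI[q1 q2].
apply: ipow_mul; first exact: rep_gen_aug.
by apply/(ipow1 _ (aug_idealP _))/rep_gen_aug.
Qed.

Lemma rep_genV_I (g : Gam) u : eps u = 0 ->
  I 2 (rgen M (g^-1)%g u + rgen M g u ).
Proof.
move=> u0; have := rep_genM_I (g^-1)%g g u0; rewrite mulVg rgen1 u0 scale0r sub0r.
by move/ipowN; rewrite opprK.
Qed.
End Augmentation.

Lemma rep_aug_map (Gam Gam' : groupType) (phi : {multiplicative Gam -> Gam'}) z :
  rep_aug Gam' (rmap M phi z) = rep_aug Gam z.
Proof.
move: z; apply: repA_ind => [|a y z dy dz|y z dy dz|g u].
- by rewrite (rmorph1 (rmap M phi)) !rmorph1.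
- by rewrite (linearP (rmap M phi)) !linearP /= dy dz.
- by rewrite (rmorphM (rmap M phi)) !rmorphM /= dy dz.
- by rewrite rmap_gen !rep_aug_gen.
Qed.

Lemma repS_laws (S : sgroup) :
  simplicial_laws (fun m n (f : simplex_map m n) => rmap M (sgroup_act S f) : F (S n) -> F (S m)).
Proof.
have [S1 SM] := sgroup_laws S; split=> [n|m n p g f].
  by apply: (@repA_hom_eq _ _ (rmap M (sgroup_act S (simplex_id n))) idfun) => x u; rewrite rmap_gen S1.
apply: (@repA_hom_eq _ _ (rmap M (sgroup_act S (simplex_comp g f)))
  (lrcomp (rmap M (sgroup_act S f)) (rmap M (sgroup_act S g)))) => x u.
by rewrite rmap_gen SM -[RHS]/(rmap M _ (rmap M _ _)) !rmap_gen.
Qed.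

Definition repS (S : sgroup) : scalg k := SCAlg (repS_laws S).

Lemma repS_gen (S : sgroup) m n (f : simplex_map m n) (g : S n) u :
  scalg_act (repS S) f (rgen M g u) = rgen M (sgroup_act S f g) u.
Proof. exact: rmap_gen. Qed.

Variables (hcomm : commutative_group_scheme G) (d : nat) (x : 'I_d -> R).
Variable p : 'I_d -> {linear R -> k^o}.
Hypothesis xp : coordinates eps x p.
Notation hder := (hopf_der xp).

(** With t(c) the tangent vector c times the i-th one, g -> rho(g) t(mu(g)) deforms the universal
    representation rho over the dual numbers; the derivation is the infinitesimal part of the
    corresponding algebra map. *)
Lemma charac_der_exists (Gam : groupType) (mu : charac k Gam) i :
  exists D : {linear F Gam -> F Gam}, derivation id D /\
    forall g u, D (rgen M g u) = mu g *: rgen M g (hder i u).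
Proof.
have [io ioE] := dual_incl (F Gam).
have /choice[t tE] : forall c : k, exists t, tangent_at p i (c%:A : F Gam) t.
  by move=> c; apply: (tangent_exists xp).
pose r g : points G (dual (F Gam)) := ((lrcomp io (rgen M g) : points G _) * t (mu g))%g.
have rE g u s : (forall (B : comAlgType k) (y z : points G B),
    point_mul y z u = \sum_(q <- s) y q.1 * z q.2) ->
    r g u = (\sum_(q <- s) rgen M g q.1 * (eps q.2)%:A,
             \sum_(q <- s) (p i q.2 * mu g) *: rgen M g q.1).
  move=> sE; rewrite -[LHS]/(point_mul _ _ u) sE dual_sum; congr (_, _); apply: eq_bigr => q _.
    by rewrite /= ioE tE.
  by rewrite /= ioE tE /= mul0r addr0 scalerA -scalerAr mulr1.
(* Tangent vectors at the unit multiply by addition: in the infinitesimal part of the coproduct one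
   factor is always evaluated at the unit. *)
have tM c c' : point_mul (t c) (t c') = t (c + c').
  apply: lrmorphism_eq => u; have [s sE] := comul u.
  have key (a b e : k) : (b *: e%:A) * a%:A = (a * b * e)%:A :> F Gam.
    by rewrite [LHS]mulrC mulr_algl !scalerA mulrA.
  have [pc pcE] := dual_fst (F Gam).
  apply: dual_eq; rewrite tE.
    rewrite -pcE -[LHS]/(lrcomp pc (point_mul (t c) (t c')) u) point_mul_natural.
    have t1 c1 : lrcomp pc (t c1) = point_one G (F Gam).
      by apply: lrmorphism_eq => v; rewrite /= pcE tE point_oneE.
    by rewrite !t1 point_mul1 point_oneE.
  have sl := sE R (point_one G R) idfun; rewrite point_mul1 in sl.
  have sr := sE R idfun (point_one G R); rewrite [point_mul _ _]point_mul_1 in sr.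
  rewrite sE dual_sum /=; under eq_bigr do rewrite !tE /=.
  have -> : p i u *: (c + c')%:A = (p i u * c)%:A + (p i u * c')%:A :> F Gam.
    by rewrite scalerA mulrDr scalerDl.
  rewrite big_split /= addrC; congr (_ + _).
    rewrite -[u in RHS]/(idfun u) sr raddf_sum mulr_suml scaler_suml; apply: eq_bigr => q _ /=.
    have -> : q.1 * point_one G R q.2 = eps q.2 *: q.1 by rewrite point_oneE -scalerAr mulr1.
    by rewrite key linearZ.
  rewrite -[u in RHS]/(idfun u) sl raddf_sum mulr_suml scaler_suml; apply: eq_bigr => q _ /=.
  have -> : point_one G R q.1 * q.2 = eps q.1 *: q.2 by rewrite point_oneE mulr_algl.
  by rewrite [LHS]mulrC key linearZ.
(* Commutativity of G moves t(mu(g)) past rho(h). *)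
have rM : {morph r : g h / (g * h)%g}.
  move=> g h; rewrite /r characM -tM rgenM point_mul_natural.
  set y : points G _ := lrcomp io _; set z : points G _ := lrcomp io _.
  set t1 : points G _ := t _; set t2 : points G _ := t _.
  rewrite -[point_mul y z]/(y * z)%g -[point_mul t1 t2]/(t1 * t2)%g.
  by rewrite -!mulgA; congr (_ * _)%g; rewrite !mulgA (hcomm z t1).
pose M0 := monoid.isMultiplicative.Build Gam (points G (dual (F Gam))) r rM.
pose rho : {multiplicative Gam -> points G (dual (F Gam))} := HB.pack r M0.
have [D [DE DM]] := dual_derivation (reval M rho).
have r1 z : (reval M rho z).1 = z.
  have [pr prE] := dual_fst (F Gam); rewrite -prE -[LHS]/(lrcomp pr (reval M rho) z).
  apply: (@repA_hom_eq _ _ (lrcomp pr (reval M rho)) idfun) => g u; rewrite /= prE reval_gen; have [s sE] := comul u.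
  rewrite -[rho g u]/(r g u) (rE _ _ _ sE) /=.
  have idE : point_mul (rgen M g) (point_one G (F Gam)) u = rgen M g u by rewrite [point_mul _ _]point_mul_1.
  by rewrite -idE sE; apply: eq_bigr => q _; rewrite point_oneE.
exists D; split=> [y z|g u]; first by rewrite DM !r1.
rewrite DE reval_gen -[rho g u]/(r g u); have [s sE] := comul u.
rewrite (rE _ _ _ sE) (hopf_derE xp i sE) raddf_sum scaler_sumr; apply: eq_bigr => q _.
by rewrite /= linearZ /= scalerA mulrC.
Qed.

Definition charac_der (Gam : groupType) i (mu : charac k Gam) : {linear F Gam -> F Gam} :=
  sval (cid (charac_der_exists mu i)).

Lemma charac_derM (Gam : groupType) i (mu : charac k Gam) : derivation id (charac_der i mu).
Proof. by case: (svalP (cid (charac_der_exists mu i))). Qed.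

Lemma charac_der_gen (Gam : groupType) i (mu : charac k Gam) g u :
  charac_der i mu (rgen M g u) = mu g *: rgen M g (hder i u).
Proof. by case: (svalP (cid (charac_der_exists mu i))). Qed.

Lemma charac_der_map (Gam Gam' : groupType) (phi : {multiplicative Gam' -> Gam}) i
    (mu : charac k Gam) z :
  charac_der i mu (rmap M phi z) = rmap M phi (charac_der i (charac_comp mu phi) z).
Proof.
move: z; apply: repA_ind => [|a y z dy dz|y z dy dz|g u].
- by rewrite rmorph1 !(derivation1 (f := idfun) (charac_derM _ _)) raddf0.
- by rewrite !linearP /= dy dz.
- by rewrite rmorphM /= !charac_derM dy dz raddfD /= !rmorphM.
- by rewrite rmap_gen !charac_der_gen linearZ /= rmap_gen.
Qed.

(* Euler's formula: both sides are derivations modulo higher powers, so that it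
   is enough to compare them on generators modulo the square of the ideal. *)
Lemma charac_euler (Gam : groupType) (T : Type) (r : seq T) (t : T -> Gam)
    (mu : T -> charac k Gam) :
  (forall i g, ipow (aug_ideal (rep_aug Gam)) 2
     (rgen M g (x i) - \sum_(y <- r) mu y g *: rgen M (t y) (x i))) ->
  forall j z, ipow (aug_ideal (rep_aug Gam)) j z -> ipow (aug_ideal (rep_aug Gam)) j.+1
    (\sum_(y <- r) \sum_i rgen M (t y) (x i) * charac_der i (mu y) z - z *+ j).
Proof.
move=> tE; set I := ipow _; case: (xp) => x0 _ _ xS.
pose E z := \sum_(y <- r) \sum_i rgen M (t y) (x i) * charac_der i (mu y) z.
have Elin : linear E.
  move=> a y z; rewrite /E scaler_sumr -big_split; apply: eq_bigr => w _ /=.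
  rewrite scaler_sumr -big_split; apply: eq_bigr => i _ /=.
  by rewrite linearP /= mulrDr scalerAr.
have EM : derivation id (mk_linear Elin).
  move=> y z; rewrite -[LHS]/(E (y * z)) -[mk_linear Elin y]/(E y) -[mk_linear Elin z]/(E z).
  rewrite /E mulr_sumr mulr_suml -big_split; apply: eq_bigr => w _ /=.
  rewrite mulr_sumr mulr_suml -big_split; apply: eq_bigr => i _ /=.
  by rewrite charac_derM /=; ring.
apply: (euler_ipow EM); 
suff Esub z : I 2 (E z - (z - (rep_aug Gam z)%:A)).
  by move=> z z0; have := Esub z; rewrite [rep_aug Gam z]z0 scale0r subr0.
have E1 : E 1 = 0 by apply: (derivation1 (f := idfun) EM).
have subI z' : aug_ideal (rep_aug Gam) (z' - (rep_aug Gam z')%:A) by apply: aug_sub.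
move: z; apply: repA_ind => [|a y z dy dz|y z dy dz|g u].
- by rewrite E1 rmorph1 scale1r subrr subr0; apply: ipow0.
- have := ipowD (ipowZ a dy) dz; congr (I 2 _); rewrite [E (_ + _)]Elin linearP /=.
  have -> : a *: rep_aug Gam y + rep_aug Gam z = a * rep_aug Gam y + rep_aug Gam z by [].
  by rewrite scalerDl -scalerA !scalerBr; zmodu.
- set y0 := (rep_aug Gam y)%:A in dy *; set z0 := (rep_aug Gam z)%:A in dz *.
  have -> : E (y * z) - (y * z - (rep_aug Gam (y * z))%:A) =
      (y * (E z - (z - z0)) + z * (E y - (y - y0))) + (y - y0) * (z - z0).
    rewrite [E _](EM y z) -[mk_linear Elin y]/(E y) -[mk_linear Elin z]/(E z) rmorphM /=.
    have -> : (rep_aug Gam y * rep_aug Gam z)%:A = y0 * z0 by rewrite -scalerAl mul1r scalerA.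
    by ring.
  apply: ipowD; first by apply: ipowD; apply: ipow_mull.
  by apply: ipow_mul; [apply: subI | apply/(ipow1 _ (aug_idealP _)); apply: subI].
have mapI v : ipow (aug_ideal eps) 2 v -> I 2 (rgen M g v).
  apply: (ipow_morph (f := rgen M g)) => w; exact: rep_gen_aug.
have gen_a (c : k) : rgen M g c%:A = c%:A by rewrite linearZ /= rmorph1.
rewrite rep_aug_gen.
have -> : rgen M g u - (eps u)%:A = rgen M g (u - (eps u)%:A) by rewrite raddfB /= gen_a.
have -> : E (rgen M g u) = E (rgen M g (u - (eps u)%:A)).
  rewrite raddfB /= gen_a [RHS](raddfB (mk_linear Elin)).
  rewrite [X in _ - X](_ : _ = eps u *: E 1); last exact: (linearZ_LR (mk_linear Elin)).
  by rewrite E1 scaler0 subr0.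
set v := u - _; have v0 : eps v = 0 by apply: aug_sub.
(* Three errors, each in I^2: D_i v against its value p_i(v) at the unit, v against its linear part,
   and x_i(g) against its expansion in the given elements. *)
have -> : E (rgen M g v) - rgen M g v =
    (\sum_(y <- r) \sum_i rgen M (t y) (x i) * (mu y g *: rgen M g (hder i v - (p i v)%:A))) -
    (rgen M g (v - \sum_i p i v *: x i) +
     \sum_i p i v *: (rgen M g (x i) - \sum_(y <- r) mu y g *: rgen M (t y) (x i))).
  have -> : \sum_(y <- r) \sum_i rgen M (t y) (x i) * (mu y g *: rgen M g (hder i v - (p i v)%:A)) =
      E (rgen M g v) - \sum_i p i v *: \sum_(y <- r) mu y g *: rgen M (t y) (x i).
    under [X in _ - X]eq_bigr do rewrite scaler_sumr.
    rewrite [X in _ - X]exchange_big -sumrB; apply: eq_bigr => y _ /=.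
    rewrite -sumrB; apply: eq_bigr => i _.
    rewrite charac_der_gen raddfB /= gen_a scalerBr mulrBr; congr (_ - _).
    by rewrite -!scalerAr mulr1 !scalerA mulrC.
  have -> : rgen M g (v - \sum_i p i v *: x i) = rgen M g v - \sum_i p i v *: rgen M g (x i).
    by rewrite raddfB raddf_sum; congr (_ - _); apply: eq_bigr => i _; apply: (linearZ_LR (rgen M g)).
  under [X in _ = _ - (_ + X)]eq_bigr do rewrite scalerBr.
  rewrite sumrB.
  by zmodu.
apply: ipowB.
  apply: ipow_sum => y _; apply: ipow_sum => i _.
  apply: ipow_mul; first by apply: rep_gen_aug.
  apply/ipowZ/(ipow1 _ (aug_idealP _))/rep_gen_aug.
  by rewrite raddfB /= eps_hopf_der aug_alg subrr.
apply: ipowD; first exact/mapI/xS.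
by apply: ipow_sum => i _; apply: ipowZ.
Qed.
End RepTheory.

(** * Krull dimension and the cotangent space *)

Section DerivationExtension.
Variables (k : fieldType) (R : comAlgType k).
Hypothesis char0 : [pchar k] =i pred0.

(** First-order Taylor expansion, exact because the square of the increment is 0. *)
Lemma dual_horner_add (B : comAlgType k) (F : {poly (dual B)}) (s : dual B) (b : B) :
  F.[s + (0, b) : dual B] = F.[s] + (0, b * (F^`().[s]).1) :> dual B.
Proof.
elim/poly_ind: F => [|F c IH].
  by rewrite !horner0 deriv0 horner0 mulr0 addr0.
rewrite !hornerMXaddC IH derivD derivM derivC derivX addr0 mulr1 hornerD hornerMX.
by apply: dual_eq; rewrite /= ?dualM /=; ring.
Qed.

(* A subring T of R[e] is the graph of a derivation modulo the prime P, defined on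
   a subring of R, if its elements x + y e are such that x in P implies y in P. *)
Definition subring (T : dual R -> Prop) : Prop :=
  [/\ T 1, forall x y, T x -> T y -> T (x - y) & forall x y, T x -> T y -> T (x * y)].

(** Derivations here take values in R rather than in the fraction field of R / P, so denominators
    are cleared by multiplying the derivation by some c outside P. *)
Lemma dual_rescale_exists (c : R) : exists f : {lrmorphism dual R -> dual R},
  forall x, f x = (x.1, c * x.2).
Proof.
pose f (x : dual R) : dual R := (x.1, c * x.2).
have lin : linear f by move=> a x y; apply: dual_eq; rewrite //= mulrDr scalerAr.
have mul : GRing.monoid_morphism f.
  by split=> [|x y]; apply: dual_eq; rewrite /= ?dualM /= ?mulr0 //; ring.
by exists (mk_lrmorphism lin mul).
Qed.

Definition rescale c := sval (cid (dual_rescale_exists c)).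
Lemma rescaleE c x : rescale c x = (x.1, c * x.2).
Proof. exact: svalP (cid (dual_rescale_exists c)) x. Qed.
Definition dfst := sval (cid (dual_fst R)).
Lemma dfstE x : dfst x = x.1.
Proof. exact: svalP (cid (dual_fst R)) x. Qed.

Definition poly_over (T : dual R -> Prop) (F : {poly (dual R)}) := forall i, T F`_i.

(* Evaluation at s of the polynomials over T, after multiplying the derivation by c. *)
Definition adjoin (T : dual R -> Prop) (c : R) (s : dual R) : dual R -> Prop :=
  fun y => exists F, poly_over T F /\ (map_poly (rescale c) F).[s] = y.

Lemma fst_adjoin c s (F : {poly (dual R)}) :
  ((map_poly (rescale c) F).[s]).1 = (map_poly dfst F).[s.1].
Proof.
rewrite -dfstE -horner_map /= -map_poly_comp dfstE; congr (_.[_]).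
by apply: eq_map_poly => z; rewrite /= rescaleE !dfstE.
Qed.

Section Subring.
Variable T : dual R -> Prop.
Hypothesis sT : subring T.
Let TP := poly_over T.

Lemma subring0 : T 0.
Proof. by case: sT => T1 TB _; rewrite -(subrr 1); apply: TB. Qed.
Lemma subringD x y : T x -> T y -> T (x + y).
Proof.
case: (sT) => T1 TB _ Tx Ty; rewrite -[y]opprK; apply: (TB x) => //.
by rewrite -sub0r; apply: (TB 0 y) => //; apply: subring0.
Qed.
Lemma subring_sum (I : Type) (r : seq I) (Q : pred I) F : (forall i, Q i -> T (F i)) ->
  T (\sum_(i <- r | Q i) F i).
Proof. by move=> FT; apply: big_ind => //; [apply: subring0 | apply: subringD]. Qed.
Lemma subring_nat x n : T x -> T (x *+ n).
Proof. by move=> Tx; rewrite -[n]card_ord -sumr_const; apply: subring_sum. Qed.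

Lemma poly_subringC c : T c -> TP c%:P.
Proof. by move=> Tc i; rewrite coefC; case: eqP => // _; apply: subring0. Qed.
Lemma poly_subringX : TP 'X.
Proof. by move=> i; rewrite coefX; case: (sT) => T1 _ _; case: eqP => // _; apply: subring0. Qed.
Lemma poly_subringB F H : TP F -> TP H -> TP (F - H).
Proof. by case: (sT) => _ TB _ FT HT i; rewrite coefB; apply: TB. Qed.
Lemma poly_subringM F H : TP F -> TP H -> TP (F * H).
Proof. by case: (sT) => _ _ TM FT HT i; rewrite coefM; apply: subring_sum => j _; apply: TM. Qed.
Lemma poly_subring_deriv F : TP F -> TP F^`().
Proof. by move=> FT i; rewrite coef_deriv; apply: subring_nat. Qed.

Lemma adjoin_subring c s : subring (adjoin T c s).
Proof.
split=> [|_ _ [F [FT <-]] [H [HT <-]]|_ _ [F [FT <-]] [H [HT <-]]].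
- exists 1; rewrite rmorph1 -[1]/(1%:P) hornerC; split=> //.
  by apply: poly_subringC; case: sT.
- by exists (F - H); rewrite raddfB hornerD hornerN; split=> //; apply: poly_subringB.
- by exists (F * H); rewrite rmorphM hornerM; split=> //; apply: poly_subringM.
Qed.
Lemma adjoin_mem c s t : T t -> adjoin T c s (rescale c t).
Proof. by move=> Tc; exists t%:P; rewrite map_polyC hornerC; split=> //; apply: poly_subringC. Qed.
Lemma adjoin_gen c s : adjoin T c s s.
Proof. by exists 'X; rewrite map_polyX hornerX; split=> //; apply: poly_subringX. Qed.
End Subring.

Variables (P : {pred R}) (Pp : prime_ideal P).

Lemma primeD x y : x \in P -> y \in P -> x + y \in P.
Proof. by case: Pp => -[_ _ PL] _ Px; rewrite -[x]mul1r; apply: PL. Qed.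
Lemma primeMl a x : x \in P -> a * x \in P.
Proof. by case: Pp => -[P0 _ PL] _ Px; rewrite -[_ * _]addr0; apply: PL. Qed.
Lemma primeB x y : x \in P -> y \in P -> x - y \in P.
Proof. by move=> Px Py; rewrite -mulN1r; apply/primeD/primeMl. Qed.
Lemma primeM x y : x * y \in P -> x \in P \/ y \in P.
Proof. by case: Pp => _ Pm /Pm /orP. Qed.
Lemma prime0 : 0 \in P. Proof. by case: Pp => -[]. Qed.
Lemma prime1 : 1 \notin P. Proof. by case: Pp => -[]. Qed.
Lemma primeBr x y : x - y \in P -> x \in P -> y \in P.
Proof. by move=> xy x0; rewrite -[y](subKr x); apply: primeB. Qed.
Lemma prime_sum (I : Type) (r : seq I) (Q : pred I) F : (forall i, Q i -> F i \in P) ->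
  \sum_(i <- r | Q i) F i \in P.
Proof.
move=> FP; apply: (@big_ind R (fun x => x \in P)) => //; [exact: prime0 | exact: primeD].
Qed.
Lemma prime_natr n : (n.+1)%:R \notin P.
Proof.
apply/negP => nP; case/negP: prime1.
have := primeMl ((n.+1)%:R^-1 : k)%:A nP.
have -> : (n.+1)%:R = ((n.+1)%:R : k)%:A :> R by rewrite scaler_nat.
by rewrite -scalerAl mul1r scalerA mulVf ?scale1r // natr_char0.
Qed.

Definition der_mod (T : dual R -> Prop) := forall t, T t -> t.1 \in P -> t.2 \in P.

Lemma horner_prime (F : {poly (dual R)}) (s : dual R) :
  (forall i, (F`_i).1 \in P /\ (F`_i).2 \in P) -> F.[s].1 \in P /\ F.[s].2 \in P.
Proof.
move=> FP; rewrite horner_coef dual_sum /=.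
split; apply: prime_sum => i _; have [F1 F2] := FP i; first by rewrite mulrC; apply: primeMl.
by apply: primeD; rewrite mulrC; apply: primeMl.
Qed.

Section Extend.
Variables (T : dual R -> Prop) (s : R).
Hypotheses (sT : subring T) (dT : der_mod T).
Let TP := poly_over T.
Let ev (F : {poly (dual R)}) := (map_poly dfst F).[s].
Let good F := [/\ TP F, (lead_coef F).1 \notin P & ev F \in P].

(** Below the least size of a [good] polynomial, the leading coefficient of a polynomial vanishing
    at s modulo P must itself lie in P; its term is removed and the argument repeated. *)
Lemma truncate N : (forall F, good F -> N <= size F)%N ->
  forall F, TP F -> (size F < N)%N -> ev F \in P -> forall i, (F`_i).1 \in P.
Proof.
move=> Ngood F; have [n] := ubnP (size F); elim: n F => // n IHn F Fn FT FN FP i.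
have [->|F0] := eqVneq F 0; first by rewrite coef0; apply: prime0.
have leadP : (lead_coef F).1 \in P.
  by apply: contraT => lP; have := Ngood F (And3 FT lP FP); rewrite leqNgt FN.
pose L := (lead_coef F)%:P * 'X^((size F).-1).
have LT : TP L.
  move=> j; rewrite coefCM coefXn; case: eqP => _; last by rewrite mulr0; apply: subring0.
  by rewrite mulr1; apply: FT.
have size_lt : (size (F - L)%R < size F)%N.
  rewrite -[in X in (_ < X)%N](prednK (n := size F)) ?size_poly_gt0 // ltnS.
  apply/leq_sizeP => j; rewrite leq_eqVlt => /orP[/eqP <-|jF].
    by rewrite coefB coefCM coefXn eqxx mulr1 subrr.
  rewrite coefB coefCM coefXn gtn_eqF // mulr0 subr0.
  by apply: nth_default; move: jF; rewrite -(ltn_predK (m := 0) (n := size F)) ?size_poly_gt0.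
have Li : (L`_i).1 \in P.
  rewrite coefCM coefXn; case: eqP => _; first by rewrite mulr1.
  by rewrite mulr0; apply: prime0.
have -> : F`_i = (F - L)`_i + L`_i by rewrite coefB subrK.
apply: primeD => //; apply: IHn.
- by rewrite -ltnS; apply: leq_trans size_lt Fn.
- exact: poly_subringB.
- exact: ltn_trans size_lt FN.
- have -> : ev (F - L) = ev F - ev L by rewrite /ev raddfB hornerD hornerN.
  apply: primeB => //.
  rewrite /ev /L rmorphM /= map_polyC hornerM hornerC /= dfstE mulrC; exact: primeMl.
Qed.

Lemma pseudo_division F0 H : TP F0 -> TP H -> F0 != 0 -> (lead_coef F0).1 \notin P ->
  exists a Q Q', [/\ T a, a.1 \notin P, TP Q /\ TP Q', a%:P * H = Q * F0 + Q'
    & (size Q' < size F0)%N].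
Proof.
move=> F0T HT F00 lP; have [n] := ubnP (size H); elim: n H HT => // n IHn H HT Hn.
have [HF|FH] := ltnP (size H) (size F0).
  exists 1, 0, H; rewrite mul1r mul0r add0r; split=> //; first by case: sT.
    exact: prime1.
  by split=> // i; rewrite coef0; apply: subring0.
pose m := (size H - size F0)%N.
have sF0 : (0 < size F0)%N by rewrite size_poly_gt0.
have mH : (m <= (size H).-1)%N by rewrite -subn1 leq_sub2l.
pose S := (lead_coef H)%:P * 'X^m.
have ST : TP S.
  apply: poly_subringM => //; first by apply: poly_subringC => //; apply: HT.
  by move=> j; rewrite coefXn; case: (sT) => T1 _ _; case: eqP => // _; apply: subring0.
pose H1 := (lead_coef F0)%:P * H - S * F0.
have H1T : TP H1.
  by apply: poly_subringB => //; apply: poly_subringM => //; apply: poly_subringC => //; apply: F0T.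
have H1n : (size H1 < n)%N.
  rewrite -ltnS; apply: leq_trans Hn; rewrite ltnS.
  rewrite -(prednK (n := size H)) ?(leq_trans sF0) // ltnS; apply/leq_sizeP => j.
  rewrite /H1 coefB coefCM -mulrA coefCM coefXnM leq_eqVlt => /orP[/eqP <-|jH].
    rewrite ltnNge mH /= (_ : (_ - m)%N = (size F0).-1); last by rewrite -!subn1 subnAC subKn.
    by rewrite mulrC subrr.
  rewrite ltnNge (leq_trans mH (ltnW jH)) /=.
  have Hj : (size H <= j)%N by apply: leq_trans (leqSpred _) jH.
  by rewrite !nth_default ?mulr0 ?subrr // -(subKn FH) leq_sub2r.
have [a [Q [Q' [Ta aP [QT Q'T] E sQ']]]] := IHn H1 H1T H1n.
exists (a * lead_coef F0), (Q + a%:P * S), Q'; split=> //.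
- by case: (sT) => _ _ TM; apply: TM => //; apply: F0T.
- by apply/negP => /= /primeM[]; apply/negP.
- split=> //; move=> i; rewrite coefD; apply: subringD => //.
  by apply: poly_subringM => //; apply: poly_subringC.
- by rewrite polyCM mulrDl addrAC -E /H1 mulrBr !mulrA subrK.
Qed.

(** If there is no [good] polynomial, s is transcendental modulo P and its derivative may be 0.
    Otherwise pseudo-division by one of least degree reduces every relation satisfied by s to a
    multiple of it, up to a remainder whose coefficients lie in P together with their
    derivatives. *)
Lemma extend_derivation : exists c b, [/\ c \notin P & der_mod (adjoin T c (s, b))].
Proof.
have [[F0 F0g]|nog] := pselect (exists F0, good F0); last first.
  exists 1, 0; split=> [|_ [F [FT <-]]]; first exact: prime1.
  rewrite fst_adjoin => FP.
  have F1 i : (F`_i).1 \in P.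
    by apply: (@truncate (size F).+1) => // H Hg; case: nog; exists H.
  have [] // := @horner_prime (map_poly (rescale 1) F) (s, 0) _ => i.
  by rewrite coef_map /= rescaleE /= mul1r; split=> //; apply: dT.
have [|n /asboolP[F [[FT lP FP] Fn]] Fmin] := @ex_minnP (fun n => `[< exists F, good F /\ size F = n >]).
  by exists (size F0); apply/asboolP; exists F0.
have minF H : good H -> (n <= size H)%N by move=> Hg; apply/Fmin/asboolP; exists H.
have F00 : F != 0 by apply: contraNneq lP => ->; rewrite lead_coef0; apply: prime0.
(* The derivation must kill F(s), which forces the value - f2 / c at s: f2 is the derivation applied
   to the coefficients of F and c is F'(s), the factor that clears the denominator. By minimality of
   F, c is outside P, as F' has a leading coefficient outside P in characteristic 0. *)
pose c := ev F^`(); pose f2 := (F.[(s, 0) : dual R]).2.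
have cP : c \notin P.
  apply/negP => cP; have sF : (0 < size F)%N by rewrite size_poly_gt0.
  have := truncate minF (poly_subring_deriv sT FT) _ cP.
  rewrite -Fn lt_size_deriv // => /(_ isT (size F).-2); rewrite coef_deriv.
  have [sF1|sF1] := leqP (size F) 1.
    have s1 : size F = 1%N by apply/eqP; rewrite eqn_leq sF1.
    move=> _; case/negP: lP; rewrite lead_coefE s1.
    suff <- : ev F = (F`_0).1 by [].
    by rewrite {1}(size1_polyC sF1) /ev map_polyC hornerC /= dfstE.
  rewrite (_ : (size F).-2.+1 = (size F).-1); last by lia.
  rewrite -mulr_natr -dfstE rmorphM rmorph_nat /= dfstE => /primeM[]; apply/negP => //.
  by move: sF1; case: (size F) => [|[|q]] //= _; apply: prime_natr.
exists c, (- f2); split=> // _ [H [HT <-]]; rewrite fst_adjoin => HP.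
pose pt : dual R := (s, - f2).
have Fpt : (map_poly (rescale c) F).[pt].2 = 0.
  have -> : pt = (s, 0) + (0, - f2) :> dual R by apply: dual_eq; rewrite /= ?addr0 ?add0r.
  rewrite dual_horner_add; have E0 : rescale c (s, 0) = (s, 0) by rewrite rescaleE mulr0.
  rewrite -{1}E0 horner_map deriv_map fst_adjoin /= rescaleE /=.
  by rewrite -/f2 -/(ev _) -/c; ring.
have [a [Q [Q' [Ta aP [QT Q'T] E sQ']]]] := pseudo_division FT HT F00 lP.
have E2 := congr1 (fun P0 => (map_poly (rescale c) P0).[pt]) E.
rewrite /= rmorphM rmorphD rmorphM /= map_polyC hornerCM hornerD hornerM in E2.
have Q'1 : ev Q' \in P.
  have := congr1 ev E; rewrite /ev rmorphM rmorphD rmorphM /= map_polyC hornerCM hornerD hornerM.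
  move=> E1; have -> : (map_poly dfst Q').[s] =
      dfst a * (map_poly dfst H).[s] - (map_poly dfst Q).[s] * (map_poly dfst F).[s].
    by rewrite E1 addrAC subrr add0r.
  by apply: primeB; [exact: primeMl HP | exact: primeMl FP].
have Q'P i : (Q'`_i).1 \in P by apply: (truncate minF) => //; rewrite -Fn.
have [_ Q'2] : (map_poly (rescale c) Q').[pt].1 \in P /\ (map_poly (rescale c) Q').[pt].2 \in P.
  apply: horner_prime => i; rewrite coef_map /= rescaleE /=; split=> //.
  by apply: primeMl; apply: dT.
have E3 : (rescale c a).1 * (map_poly (rescale c) H).[pt].2 +
    (rescale c a).2 * (map_poly (rescale c) H).[pt].1 =
    (map_poly (rescale c) Q).[pt].1 * (map_poly (rescale c) F).[pt].2 +
    (map_poly (rescale c) Q).[pt].2 * (map_poly (rescale c) F).[pt].1 +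
    (map_poly (rescale c) Q').[pt].2 := congr1 snd E2.
rewrite rescaleE Fpt mulr0 add0r !fst_adjoin /= in E3.
have : a.1 * (map_poly (rescale c) H).[pt].2 \in P.
  move/eqP: E3; rewrite -subr_eq0 => /eqP E3.
  set y := _ * _; have -> : y = (map_poly (rescale c) Q).[pt].2 * ev F + (map_poly (rescale c) Q').[pt].2 - c * a.2 * (map_poly dfst H).[s].
    by apply/eqP; rewrite -subr_eq0 -E3 /ev /y; apply/eqP; ring.
  by apply: primeB; [apply: primeD => //; apply: primeMl | apply: primeMl].
by case/primeM => // aP'; case/negP: aP.
Qed.
End Extend.

Lemma extend_generators (gs : seq R) (T : dual R -> Prop) : subring T -> der_mod T ->
  (forall c : k, T (c%:A, 0)) ->
  exists c T', [/\ c \notin P, subring T', der_mod T', forall t, T t -> T' (rescale c t)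
    & forall g, g \in gs -> exists b, T' (g, b)].
Proof.
elim: gs T => [|g gs IHgs] T sT dT kT.
  exists 1, T; split=> //; first exact: prime1.
  by move=> t; rewrite rescaleE mul1r -surjective_pairing.
have [c [b [cP dT1]]] := extend_derivation g sT dT.
have [||x|c' [T' [c'P sT' dT' TT' gT']]] := IHgs (adjoin T c (g, b)).
- exact: adjoin_subring.
- exact: dT1.
- have := adjoin_mem sT c (g, b) (kT x).
  by rewrite rescaleE /= mulr0.
exists (c' * c), T'; split=> // [|t Tt|h].
- by apply/negP => /primeM[]; apply/negP.
- have := TT' _ (adjoin_mem sT c (g, b) Tt).
  by rewrite !rescaleE /= mulrA.
- rewrite inE => /orP[/eqP ->|/gT' //].
  by exists (c' * b); have := TT' _ (adjoin_gen sT c (g, b)); rewrite rescaleE.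
Qed.
End DerivationExtension.

Section PrimeChain.
Variables (k : fieldType) (R : comAlgType k).
Hypothesis char0 : [pchar k] =i pred0.

(** Elements picked along a strict chain of primes are algebraically independent modulo the smallest
    one, so a derivation may take prescribed values on them. *)
Lemma chain_derivation n (P : nat -> {pred R}) (a : nat -> R) (b : nat -> R) :
  (forall i, (i <= n)%N -> prime_ideal (P i)) ->
  (forall i, (i < n)%N -> {subset P i <= P i.+1} /\ a i \in P i.+1 /\ a i \notin P i) ->
  exists T, [/\ subring T, der_mod (P 0%N) T, forall c : k, T (c%:A, 0)
    & forall i, (i < n)%N -> T (a i, b i)].
Proof.
move=> Pp Pa.
have P0 i x : (i <= n)%N -> x \in P 0%N -> x \in P i.
  elim: i => // i IHi lin /(IHi (ltnW lin)); by apply: (proj1 (Pa i lin)).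
(* Descent from P_n, where T is k, to P_0: a_m is adjoined on the way from P_(m+1) to P_m. A
   polynomial in a_m lying in P_m has its constant term in P_(m+1), hence trivial modulo P_0 by
   induction; division by a_m, which is outside P_m, disposes of the other coefficients. *)
suff : forall j, (j <= n)%N -> exists T, [/\ subring T,
    forall t : dual R, T t -> t.1 \in P (n - j)%N -> t.1 \in P 0%N /\ t.2 \in P 0%N,
    forall c : k, T (c%:A, 0) & forall i, (n - j <= i)%N -> (i < n)%N -> T (a i, b i)].
  move=> /(_ n (leqnn n))[T [sT dT kT aT]]; exists T; split=> // [t Tt|i]; last by apply: aT; rewrite subnn.
  by rewrite subnn in dT; case/(dT t Tt).
elim=> [_|j IHj jn].
  exists (fun t => exists c : k, t = (c%:A, 0)); split=> [|_ [c ->]|c|i].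
  - split=> [|_ _ [c ->] [c' ->]|_ _ [c ->] [c' ->]]; first by exists 1; rewrite scale1r.
      by exists (c - c'); apply: dual_eq; rewrite /= ?subr0 // scalerBl.
    exists (c * c'); apply: dual_eq; rewrite dualM /= ?mulr0 ?mul0r ?addr0 //.
    by rewrite -scalerAl mul1r scalerA.
  - rewrite subn0 /= => cP; have [c0|c0] := eqVneq c 0.
      by rewrite c0 scale0r; split; apply: prime0; apply: Pp.
    case/negP: (prime1 (Pp n (leqnn n))).
    have := primeMl (Pp n (leqnn n)) (c^-1)%:A cP.
    by rewrite -scalerAl mul1r scalerA mulVf // scale1r.
  - by exists c.
  - by rewrite subn0 => ni; rewrite ltnNge ni.
have [T [sT dT kT aT]] := IHj (ltnW jn).
set m := (n - j.+1)%N; have mE : (n - j)%N = m.+1 by rewrite /m subnSK.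
have mn : (m < n)%N by rewrite -mE leq_subr.
have [Pm [am anm]] := Pa m mn; rewrite mE in dT aT.
have Pmp := Pp m (ltnW mn); have PSp := Pp m.+1 mn; have P0p := Pp 0%N (leq0n n).
exists (adjoin T 1 (a m, b m)); split=> [|_ [F [FT <-]]|c|i].
- exact: adjoin_subring.
- move=> FP; rewrite fst_adjoin /= in FP; apply: (horner_prime P0p) => i.
  rewrite coef_map /= rescaleE /= mul1r.
  elim/poly_ind: F i FT FP => [|F c IHF] i FT; first by rewrite coef0 /=; split; apply: prime0.
  have cT : T c by have := FT 0%N; rewrite coefD coefMX coefC add0r.
  have FT' : poly_over T F by move=> e; have := FT e.+1; rewrite coefD coefMX coefC addr0.
  rewrite rmorphD rmorphM /= map_polyX map_polyC hornerMXaddC /= dfstE => FP.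
  have cP : c.1 \in P m.+1.
    have -> : c.1 = ((map_poly (dfst R) F).[a m] * a m + c.1) - (map_poly (dfst R) F).[a m] * a m.
      by rewrite addrAC subrr add0r.
    by apply: (primeB PSp); [apply: Pm | apply: (primeMl PSp)].
  have [c1 c2] := dT c cT cP.
  have : (map_poly (dfst R) F).[a m] * a m \in P m.
    by have := primeB Pmp FP (P0 m c.1 (ltnW mn) c1); rewrite addrK.
  case/(primeM Pmp) => [FPm|aP]; last by rewrite aP in anm.
  have IH := IHF _ FT' FPm.
  by rewrite coefD coefMX coefC; case: i => [|i] /=; rewrite ?add0r ?addr0.
- have := adjoin_mem sT 1 (a m, b m) (kT c).
  by rewrite rescaleE /= mulr0.
- rewrite leq_eqVlt => /orP[/eqP <- _|mi ni]; first exact: adjoin_gen.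
  by have := adjoin_mem sT 1 (a m, b m) (aT i mi ni); rewrite rescaleE mul1r.
Qed.

End PrimeChain.

(** Such a chain would give d + 1 derivations from R to the domain R / P_0 whose matrix on the a_i
    is diagonal with nonzero entries, although by [der_span] they are combinations of the d
    invariant derivations. *)
Lemma prime_chain_le (k : fieldType) (G : affine_group k) d (x : 'I_d -> coord_ring G)
    (p : 'I_d -> {linear coord_ring G -> k^o}) : [pchar k] =i pred0 ->
  finitely_generated (coord_ring G) -> coordinates (counit G) x p ->
  ~ prime_chain (coord_ring G) d.+1.
Proof.
set R := coord_ring G => char0 [gs gsP] xp [P [Pp Ps]].
have /choice[a aP] : forall i, exists a, (i < d.+1)%N -> a \in P i.+1 /\ a \notin P i.
  move=> i; have [id|] := boolP (i < d.+1)%N; last by exists 0.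
  by have [_ [a a1 a2]] := Ps i id; exists a.
have P0p : prime_ideal (P 0%N) by apply: Pp.
have [A [f [f_surj fP]]] := quot_alg_exists (proj1 P0p).
have derP (j : 'I_d.+1) : exists c (h : {linear R -> A}), [/\ c \notin P 0%N, derivation f h
    & forall i : 'I_d.+1, h (a i) = f (c * (i == j)%:R)].
  have [|T0 [sT0 dT0 kT0 aT0]] := chain_derivation (n := d.+1) (a := a) (fun i => (i == j)%:R) Pp.
    by move=> i id; have [Pi _] := Ps i id; split=> //; apply: aP.
  have [c [T [cP sT dT T0T gT]]] := extend_generators char0 P0p gs sT0 dT0 kT0.
  have kT (e : k) : T (e%:A, 0) by have := T0T _ (kT0 e); rewrite rescaleE mulr0.
  have allT u : exists b, T (u, b).
    suff /asboolP : u \in [pred u | `[< exists b, T (u, b) >]] by [].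
    apply: gsP => [|g /gT gb]; last exact/asboolP.
    case: (sT) => T1 TB TM.
    split=> [|e u1 u2 /asboolP[b1 u1T] /asboolP[b2 u2T]|u1 u2 /asboolP[b1 u1T] /asboolP[b2 u2T]]; apply/asboolP.
    - by exists 0.
    - exists (e *: b1 + b2); have := subringD sT (TM _ _ (kT e) u1T) u2T; congr T.
      by apply: dual_eq; rewrite /= ?mul0r ?addr0 mulr_algl.
    - by exists (u1 * b2 + b1 * u2); apply: (TM _ _ u1T u2T).
  pose Rel u w := exists b, T (u, b) /\ w = f b.
  have Tuniq u b b' : T (u, b) -> T (u, b') -> f b = f b'.
    case: (sT) => _ TB _ ub ub'; apply/eqP; rewrite -subr_eq0 -raddfB; apply/eqP/fP.
    by apply: (dT _ (TB _ _ ub ub')); rewrite /= subrr; apply: prime0.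
  have [u|w [b [bT ->]]|e u w u' w' [b [bT ->]] [b' [bT' ->]]|h hR] := @linear_of_rel k R A Rel.
  - by have [b bT] := allT u; exists (f b), b.
  - by rewrite -(raddf0 f); apply: Tuniq bT _; have := kT 0; rewrite scale0r.
  - exists (e *: b + b'); rewrite linearP; split=> //; case: (sT) => _ _ TM.
    have := subringD sT (TM _ _ (kT e) bT) bT'; congr T.
    by apply: dual_eq; rewrite /= ?mul0r ?addr0 mulr_algl.
  have hE u b : T (u, b) -> h u = f b.
    by move=> ub; have [b' [ub' ->]] := hR u; apply: Tuniq ub.
  exists c, h; split=> // [u v|i].
    have [b ub] := allT u; have [b' vb'] := allT v; rewrite (hE _ _ ub) (hE _ _ vb').
    case: (sT) => _ _ TM; rewrite (hE _ (u * b' + b * v)); last exact: (TM _ _ ub vb').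
    by rewrite (rmorphD f) !(rmorphM f).
  by have := T0T _ (aT0 i (ltn_ord i)); rewrite rescaleE => /hE.
have /choice[c /choice[h chP]] := derP.
have /choice[C CE] : forall j, exists C : 'I_d -> A, forall u, h j u = \sum_i f (hopf_der xp i u) * C i.
  by move=> j; case: (chP j) => _ hM _; apply: (der_span xp hM).
pose M1 : 'M[A]_(d.+1, d) := \matrix_(j, i) C j i.
pose M2 : 'M[A]_(d, d.+1) := \matrix_(i, m) f (hopf_der xp i (a m)).
have ME : M1 *m M2 = diag_mx (\row_j f (c j)).
  apply/matrixP => j m; rewrite !mxE; case: (chP j) => _ _ /(_ m).
  rewrite CE => E; under eq_bigr do rewrite !mxE mulrC.
  by rewrite E (eq_sym m); case: (j == m) => /=; rewrite ?mulr1 // mulr0 raddf0.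
have : \det (M1 *m M2) = 0.
  (* Padded to square matrices, the first factor has a zero column, so the product has determinant
     0. *)
  have -> : M1 *m M2 = row_mx 0 M1 *m (col_mx 0 M2 : 'M_(1 + d, d.+1)).
    by rewrite mul_row_col mul0mx add0r.
  rewrite -[d.+1]/(1 + d)%N in M1 M2 ME *; rewrite det_mulmx.
  rewrite (expand_det_col (row_mx 0 M1 : 'M_(1 + d)) (lshift d ord0)) big1 ?mul0r // => i _.
  by rewrite row_mxEl mxE mul0r.
rewrite ME det_diag; under eq_bigr do rewrite mxE.
rewrite -(rmorph_prod f) => /fP; apply/negP; elim/big_rec: _ => [|j y _ yP].
  exact: (prime1 P0p).
by apply/negP => /(primeM P0p)[]; apply/negP => //; case: (chP j).
Qed.

(** * Primes stable under a derivation *)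

Section DifferentialPrime.
Variables (k : fieldType) (R : comAlgType k).
Hypothesis char0 : [pchar k] =i pred0.
Variables (D : {linear R -> R}) (DM : derivation id D).
Variables (P : {pred R}) (Pp : prime_ideal P).

Lemma iter_der_linear n a u v : iter n D (a *: u + v) = a *: iter n D u + iter n D v.
Proof. by elim: n u v => //= n IHn u v; rewrite IHn linearP. Qed.

Lemma iter_derD n u v : iter n D (u + v) = iter n D u + iter n D v.
Proof. by have := iter_der_linear n 1 u v; rewrite !scale1r. Qed.

Lemma iter_der_vanish n u v a b : (forall i, (i < a)%N -> iter i D u \in P) ->
  (forall i, (i < b)%N -> iter i D v \in P) -> (n < a + b)%N -> iter n D (u * v) \in P.
Proof.
elim: n u v a b => [|n IHn] u v a b ua vb.
  case: a ua => [|a] ua; last by rewrite mulrC => _; apply: (primeMl Pp); apply: (ua 0%N).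
  by move=> b0; apply: (primeMl Pp); apply: (vb 0%N).
move=> nab; rewrite iterSr DM iter_derD; apply: (primeD Pp).
  case: b vb nab => [|b] vb nab; first by apply: (IHn _ _ a 0%N) => //; lia.
  by apply: (IHn _ _ a b) => [//|i ib|]; [rewrite -iterSr; apply: vb | lia].
case: a ua nab => [|a] ua nab; first by apply: (IHn _ _ 0%N b) => //; lia.
by apply: (IHn _ _ a b) => [i ia|//|]; [rewrite -iterSr; apply: ua | lia].
Qed.

(** In the Leibniz expansion of D^(a+b)(uv) all terms but one lie in P. Its binomial coefficient is
    retained as a positive integer [N.+1]. *)
Lemma iter_der_lead n u v a b : (forall i, (i < a)%N -> iter i D u \in P) ->
  (forall i, (i < b)%N -> iter i D v \in P) -> n = (a + b)%N ->
  exists N, iter n D (u * v) - iter a D u * iter b D v *+ N.+1 \in P.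
Proof.
elim: n u v a b => [|n IHn] u v a b ua vb.
  case: a b {ua vb} => [|a] [|b] //= _; exists 0%N.
  by rewrite subrr; apply: (prime0 Pp).
move=> nab; rewrite iterSr DM iter_derD /=.
have [bP|[N bP]] : b = 0%N /\ iter n D (u * D v) \in P \/
    exists N, iter n D (u * D v) - iter a D u * iter b D v *+ N.+1 \in P.
- case: b vb nab => [|b] vb nab.
    by left; split=> //; apply: (iter_der_vanish (a := a) (b := 0%N)) => //; lia.
  right; rewrite [iter b.+1 _ _]iterSr; apply: IHn => [//|i ib|]; last by lia.
  by rewrite -iterSr; apply: vb.
- case: bP => b0 bP; rewrite b0 /= addn0 in nab *; subst a.
  have [|//||N NP] := IHn (D u) v n 0%N; rewrite ?addn0 //.
    by move=> i ia; rewrite -iterSr; apply: ua.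
  by exists N; rewrite iterSr -addrA; apply: (primeD Pp).
have [aP|[N' aP]] : a = 0%N /\ iter n D (D u * v) \in P \/
    exists N, iter n D (D u * v) - iter a D u * iter b D v *+ N.+1 \in P.
- case: a ua {bP} nab => [|a] ua nab.
    by left; split=> //; apply: (iter_der_vanish (a := 0%N) (b := b)) => //; lia.
  right; rewrite [iter a.+1 _ _]iterSr; apply: IHn => [i ia|//|]; last by lia.
  by rewrite -iterSr; apply: ua.
- by case: aP => _ aP; exists N; rewrite addrAC; apply: (primeD Pp).
exists (N + N'.+1)%N; rewrite -addSn mulrnDr opprD addrACA.
exact: (primeD Pp).
Qed.

Definition der_core : {pred R} := [pred u | `[< forall n, iter n D u \in P >]].

Lemma der_core_sub u : u \in der_core -> u \in P.
Proof. by move=> /asboolP /(_ 0%N). Qed.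

(** For u and v outside the core, take the least a and b with D^a u and D^b v outside P: then
    D^(a+b)(uv) is a positive multiple of their product modulo P, and positive integers are outside
    P. *)
Lemma der_core_prime : prime_ideal der_core.
Proof.
split; first split.
- apply/asboolP => n; rewrite (_ : iter n D 0 = 0) ?(prime0 Pp) //.
  by elim: n => //= n ->; apply: raddf0.
- by apply/negP => /der_core_sub; apply/negP/(prime1 Pp).
- move=> a u v /asboolP uP /asboolP vP; apply/asboolP => n; rewrite iter_derD.
  apply: (primeD Pp) => //; apply: (iter_der_vanish (a := 0%N) (b := n.+1)) => //.
move=> u v /asboolP uvP; apply/orP.
have ex w : w \notin der_core -> exists a, iter a D w \notin P /\ forall i, (i < a)%N -> iter i D w \in P.
  move=> wP; have [|a aP amin] := @ex_minnP (fun n => iter n D w \notin P).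
    by apply: contra_notP (negP wP) => nw; apply/asboolP => n; apply: contra_notT nw => nP; exists n.
  by exists a; split=> // i ia; apply: contraTT ia => iP; rewrite -leqNgt; apply: amin.
have [|/ex[a [aP ua]]] := boolP (u \in der_core); first by left.
have [|/ex[b [bP vb]]] := boolP (v \in der_core); first by right.
have [N NP] := iter_der_lead ua vb erefl.
have : iter a D u * iter b D v *+ N.+1 \in P by apply: (primeBr Pp NP); apply: uvP.
rewrite -mulr_natr => /(primeM Pp)[/(primeM Pp)[h|h]|h].
- by rewrite h in aP.
- by rewrite h in bP.
- by have := prime_natr char0 Pp N; rewrite h.
Qed.
End DifferentialPrime.

Section LongChain.
Variables (k : fieldType) (G : affine_group k).
Notation R := (coord_ring G).
Hypothesis char0 : [pchar k] =i pred0.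
Variables (d : nat) (x : 'I_d -> R) (p : 'I_d -> {linear R -> k^o}).
Hypothesis xp : coordinates (counit G) x p.

(* Multiplying the D_m by the adjugate of the Jacobian matrix makes the x_l into
   coordinates for which these derivations are multiples of the partial ones. *)
Lemma adapted_derivations : exists (D : 'I_d -> {linear R -> R}) (w : R),
  [/\ forall j, derivation id (D j), counit G w != 0
    & forall j l, D j (x l) = w *+ (j == l)].
Proof.
case: (xp) => _ pd _ _.
pose J : 'M[R]_d := \matrix_(m, l) hopf_der xp m (x l).
pose D j u := \sum_m \adj J j m * hopf_der xp m u.
have Dlin j : linear (D j).
  move=> a u v; rewrite /D scaler_sumr -big_split; apply: eq_bigr => m _ /=.
  by rewrite linearP mulrDr scalerAr.
exists (fun j => mk_linear (@Dlin j)), (\det J); split=> [j u v||j l].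
- rewrite -[LHS]/(D j (u * v)) -[mk_linear _ u]/(D j u) -[mk_linear _ v]/(D j v) /D.
  rewrite mulr_sumr mulr_suml -big_split; apply: eq_bigr => m _ /=.
  by rewrite hopf_derM /=; ring.
- rewrite -(det_map_mx (counit G)) (_ : map_mx _ _ = 1%:M) ?det1 ?oner_neq0 //.
  by apply/matrixP => m l; rewrite !mxE /= eps_hopf_der pd.
- have := congr1 (fun A : 'M_d => A j l) (mul_adj_mx J); rewrite !mxE => <-.
  by rewrite -[LHS]/(D j (x l)) /D; apply: eq_bigr => m _; rewrite [J m l]mxE.
Qed.

(** From the maximal ideal of the unit, cores are taken for the adapted derivations in turn. The
    element x_l stays until the core for the derivation l, which it leaves because that derivation
    maps it to w, outside the maximal ideal. The ideals decrease, so the chain lists them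
    backwards. *)
Lemma prime_chain_coordinates : prime_chain R d.
Proof.
have [D [w [DM w0 Dx]]] := adapted_derivations; case: (xp) => x0 _ _ _.
pose Q := fix Q n : {pred R} := if n is n'.+1 then
  (if insub n' is Some j then der_core (D j) (Q n') else Q n') else [pred u | counit G u == 0].
have Q0p : prime_ideal (Q 0%N).
  split; first split.
  - by rewrite inE raddf0.
  - by rewrite inE rmorph1 oner_eq0.
  - by move=> a u v; rewrite !inE rmorphD rmorphM /= => /eqP -> /eqP ->; rewrite mulr0 addr0.
  - by move=> u v; rewrite !inE rmorphM /= mulf_eq0.
have Qp n : prime_ideal (Q n).
  by elim: n => //= n IHn; case: insubP => // j _ _; apply: der_core_prime.
have QS n u : u \in Q n.+1 -> u \in Q n.
  by rewrite /=; case: insubP => // j _ _; apply: der_core_sub.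
have wQ n : w \notin Q n.
  elim: n => [|n IHn]; first by rewrite inE.
  by apply: contraNN IHn; apply: QS.
have xQ n (l : 'I_d) : (n <= l)%N -> x l \in Q n.
  elim: n => [_|n IHn nl]; first by rewrite inE x0.
  rewrite /=; case: insubP => [j _ jn|_]; last exact/IHn/ltnW.
  apply/asboolP => -[|m]; first exact/IHn/ltnW.
  rewrite iterSr Dx (_ : (j == l) = false); last by rewrite -val_eqE jn ltn_eqF.
  by elim: m => [|m IHm]; [apply: (prime0 (Qp n)) | rewrite iterSr raddf0].
exists (fun i => Q (d - i)%N); split=> [i _|i id]; first exact: Qp.
have jd : (d - i.+1 < d)%N by lia.
rewrite (_ : (d - i)%N = (d - i.+1).+1); last by lia.
split=> [u|]; first exact: QS.
exists (x (Ordinal jd)); first exact: xQ.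
rewrite /= insubT /=; apply/negP => /asboolP /(_ 1%N) /=.
rewrite Dx (_ : (_ == _) = true) ?mulr1n; [exact/negP/wQ | exact: eqxx].
Qed.
End LongChain.

Lemma krull_dim_coordinates (k : fieldType) (G : affine_group k) l d
    (x : 'I_d -> coord_ring G) (p : 'I_d -> {linear coord_ring G -> k^o}) :
  [pchar k] =i pred0 -> finitely_generated (coord_ring G) ->
  coordinates (counit G) x p -> krull_dim (coord_ring G) l -> d = l.
Proof.
move=> char0 Gfg xp [[P [Pp Ps]] nl]; have [dl|ld|//] := ltngtP d l.
  case: (prime_chain_le char0 Gfg xp); exists P; split=> i idl.
    by apply: Pp; apply: leq_trans idl _.
  by apply: Ps; apply: leq_trans idl _.
case: nl; have [Q [Qp Qs]] := prime_chain_coordinates char0 xp.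
by exists Q; split=> i il; [apply: Qp | apply: Qs]; apply: leq_trans il _.
Qed.

(* A simplicial algebra with derivations indexed by a cosimplicial set. *)
Record dersys (k : fieldType) := DerSys {
  dA : scalg k;
  dC : nat -> Type;
  dC_map : forall m n, simplex_map m n -> dC m -> dC n;
  dC_comp : forall m n p (g : simplex_map n p) (f : simplex_map m n) v,
    dC_map (simplex_comp g f) v = dC_map g (dC_map f v);
  dD : forall n, dC n -> {additive dA n -> dA n};
  dD_mul : forall n (v : dC n) x y, dD v (x * y) = x * dD v y + dD v x * y;
  dD_nat : forall m n (f : simplex_map m n) (v : dC m) z,
    dD v (scalg_act dA f z) = scalg_act dA f (dD (dC_map f v) z)
}.
Arguments dC_map {k} d {m n} f v.
Arguments dD {k} d {n} v.

(** * Contractions *)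

Section Contractions.
Variable k : fieldType.

Definition ddec (Q : dersys k) : dersys k :=
  @DerSys k (adec (dA Q)) (fun n => dC Q n.+1) (fun m n f => dC_map Q (shift false f))
    (fun m n p g f v => etrans (congr1 (fun h => dC_map Q h v) (esym (shift_false_comp false g f)))
       (dC_comp (shift false g) (shift false f) v))
    (fun n v => dD Q (n := n.+1) v) (fun n => @dD_mul k Q n.+1)
    (fun m n f => @dD_nat k Q _ _ (shift false f)).

(** The cap product: v acts through the front r-dimensional face, and the result is restricted to
    the back face. It is 0 outside the right degree, so no transport of degrees is needed. *)
Definition contr (Q : dersys k) r (v : dC Q r) p m (z : dA Q p) : dA Q m :=
  if p == (m + r)%N
  then scalg_act (dA Q) (back r m p) (dD Q (dC_map Q (front r p) v) z) else 0.
Arguments contr Q {r} v p m z.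

Lemma contrE Q r v m (z : dA Q (m + r)%N) :
  contr Q v (m + r) m z = scalg_act (dA Q) (back r m (m + r)) (dD Q (dC_map Q (front r (m + r)) v) z).
Proof. by rewrite /contr eqxx. Qed.

Lemma contr_dim Q r (v : dC Q r) p m z : p != (m + r)%N -> contr Q v p m z = 0.
Proof. by rewrite /contr => /negPf ->. Qed.

Lemma contr_is_additive Q r (v : dC Q r) p m : zmod_morphism (contr Q v p m).
Proof. by move=> x y; rewrite /contr; case: eqP => _; rewrite ?subr0 // !raddfB. Qed.
HB.instance Definition _ Q r (v : dC Q r) p m :=
  GRing.isZmodMorphism.Build (dA Q p) (dA Q m) (contr Q v p m) (@contr_is_additive Q r v p m).

Lemma shift_front r p : shift false (front r p) = front r.+1 p.+1.
Proof.
apply: simplexS_eq => [|i]; apply: val_inj.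
  by rewrite shift0 inord_false [RHS]frontE min0n.
by rewrite shiftS [RHS]frontE [LHS]lift0 frontE lift0 minnSS.
Qed.

Lemma shift_back_coface0 r m p :
  simplex_comp (shift false (back r m p)) (coface ord0) = back r.+1 m p.+1.
Proof.
rewrite shift_coface0; apply: simplex_val_eq => i.
by rewrite simplex_compE cofaceE leq0n add1n !backE addnS minnSS.
Qed.

Lemma contrS Q r (v : dC Q r.+1) p m (z : dA Q p.+1) :
  contr Q v p.+1 m z = zface (T := dA Q) ord0 (contr (ddec Q) (r := r) v p m z : dA Q m.+1).
Proof.
rewrite /contr addnS eqSS; case: eqP => _; last by rewrite raddf0.
rewrite -[RHS]/(scalg_act (dA Q) (coface ord0) (scalg_act (dA Q) (shift false (back r m p))
  (dD Q (dC_map Q (shift false (front r p)) v) z))).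
rewrite [RHS](szmod_actM (T := dA Q) (shift false (back r m p)) (coface ord0)).
by rewrite shift_back_coface0 shift_front.
Qed.

Definition null (Q : dersys k) r (v : dC Q r) := forall p (f : simplex_map r p) z, dD Q (dC_map Q f v) z = 0.

Definition normalized (Q : dersys k) r : dC Q r -> Prop :=
  match r with 0 => fun=> True
  | r'.+1 => fun v => forall i : 'I_r'.+1, null (dC_map Q (codegen i) v) end.

Lemma normalized_dec Q r (v : dC Q r.+1) : normalized v -> @normalized (ddec Q) r v.
Proof.
case: r v => // r v vN i p f z.
rewrite -[LHS]/(dD Q (dC_map Q (shift false f) (dC_map Q (shift false (codegen i)) v)) z).
by rewrite shift_codegen; apply: vN.
Qed.

Lemma contr_adegen Q r (v : dC Q r.+1) p m (y : dA Q p) : normalized v ->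
  contr (ddec Q) (r := r) v p m (adegen y : adec (dA Q) p) = 0.
Proof.
move=> vN; rewrite /contr; case: eqP => // _.
have -> : dD (ddec Q) (dC_map (ddec Q) (front r p) v) (adegen y) =
    dD Q (dC_map Q (shift false (front r p)) v) (scalg_act (dA Q) (codegen ord0) y) by [].
rewrite shift_front dD_nat -dC_comp.
have -> : simplex_comp (codegen ord0) (front r.+1 p.+1) = simplex_comp (front r p) (codegen ord0).
  by rewrite -shift_front codegen0_shift //; apply: val_inj; rewrite /= inordK ?min0n.
by rewrite dC_comp vN raddf0 [LHS]raddf0.
Qed.

Lemma adegen_derivation (A : scalg k) (E : forall n, {additive A n -> A n}) n (x : A n) :
  commutes0 (M := A) (M' := A) E -> E n.+1 (adegen x) = adegen (E n x).
Proof. by move=> E0; apply: (E0 _ _ (codegen ord0)); apply: codegen00. Qed.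

Lemma msh_der n : forall (A : scalg k) (E : forall n, {additive A n -> A n}),
  commutes0 (M := A) (M' := A) E -> (forall n x y, E n (x * y) = x * E n y + E n x * y) ->
  forall p q (x : A p) (y : A q),
    E n (msh n A x y) = msh n A (E p x) y + msh n A x (E q y).
Proof.
elim: n => [|n IHn] A E E0 EM p q x y.
  have m00 (u v : A 0%N) : msh 0 A u v = u * v by rewrite mshE.
  case: p q x y => [|p] [|q] x y; first by rewrite !m00 EM addrC.
  - by rewrite !msh_dim ?addr0 ?raddf0.
  - by rewrite !msh_dim ?addr0 ?raddf0.
  - by rewrite !msh_dim ?addr0 ?raddf0.
have Ed m (u : A m) : E m.+1 (adegen u) = adegen (E m u) by apply: adegen_derivation.
have IH := IHn (adec A) (fun n => E n.+1) (commutes0_dec E0) (fun n => EM n.+1).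
case: p q x y => [|p] [|q] x y.
- by rewrite !msh00 addr0 raddf0.
- by rewrite !msh0S IH Ed.
- by rewrite !mshS0 IH Ed.
- rewrite !mshSS raddfD raddf_sgn !IH !Ed sgnD.
  by zmodu.
Qed.

Lemma front0_codegen n m (f : simplex_map m n) : f ord0 = ord0 ->
  simplex_comp f (front 0 m) = front 0 n.
Proof.
move=> f0; apply: simplex_val_eq => i; rewrite simplex_compE (_ : front 0 m i = ord0) ?f0.
  by rewrite [RHS]frontE ord1 min0n.
by apply: val_inj; rewrite [LHS]frontE ord1 min0n.
Qed.

Lemma back0 n : back 0 n n = simplex_id n.
Proof. by apply: simplex_val_eq => i; rewrite backE addn0 /=; have := ltn_ord i; lia. Qed.

Lemma zface0_msh_adec n (A : scalg k) p q (x : A p.+1) (y : A q.+1) :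
  zface (T := A) ord0 (msh n (adec A) (p := p) (q := q) x y : A n.+1) =
  msh n A (zface (T := A) ord0 x) (zface (T := A) ord0 y).
Proof. by rewrite -shuf_pdec mshE; apply: (@zface0_shuf_dec n (pmul A)). Qed.

Lemma zface0_adegen (A : scalg k) n (x : A n) : zface (T := A) ord0 (adegen x) = x.
Proof. exact: (zface0_degen (T := A)). Qed.

(** Induction on r through [contrS]. In each half of the shuffle recursion one factor is degenerate,
    and a normalized v contracts it to 0 in the decalage; the two surviving terms are those of the
    Leibniz rule, after d_0 has undone the degeneracies. *)
Lemma contr_msh r : forall Q (v : dC Q r) n m p q (x : dA Q p) (y : dA Q q),
  normalized v -> n = (m + r)%N -> n = (p + q)%N ->
  contr Q v n m (msh n (dA Q) x y) =
  msh m (dA Q) (contr Q v p (p - r) x) y + sgn (r * p) (msh m (dA Q) x (contr Q v q (q - r) y)).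
Proof.
elim: r => [|r IHr] Q v n m p q x y vN nm npq.
  rewrite addn0 in nm; subst m; rewrite mul0n /sgn /=.
  have c0 n0 (z : dA Q n0) : contr Q v n0 n0 z = dD Q (dC_map Q (front 0 n0) v) z.
    by rewrite /contr addn0 eqxx back0; apply: (szmod_act1 (T := dA Q)).
  move: (p - 0)%N (subn0 p) (q - 0)%N (subn0 q) => p0 p0E q0 q0E; subst p0 q0.
  rewrite !c0; apply: (@msh_der n (dA Q) (fun n => dD Q (dC_map Q (front 0 n) v))) => [i j f z f0|j z w].
    by rewrite dD_nat -dC_comp front0_codegen.
  exact: dD_mul.
case: n nm npq => [|n] nm npq; first by lia.
have nmr : n = (m + r)%N by lia.
have vD := normalized_dec vN.
have cS a (z : dA Q a.+1) : contr Q v a.+1 (a.+1 - r.+1) z =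
    zface (T := dA Q) ord0 (contr (ddec Q) (r := r) v a (a - r) z : dA Q (a - r).+1) := contrS v (a - r) z.
have IH := IHr (ddec Q) v n m _ _ _ _ vD nmr; rewrite contrS.
case: p q x y npq => [|p] [|q] x y npq; first by lia.
- rewrite msh0S (IH 0%N q) ?contr_adegen //; last by lia.
  rewrite msh0l add0r muln0 /sgn /= zface0_msh_adec zface0_adegen cS.
  by rewrite muln0 [contr Q v 0 _ x]contr_dim ?msh0l ?add0r // addnS.
- rewrite mshS0 (IH p 0%N) ?contr_adegen //; last by lia.
  rewrite [X in sgn _ X]raddf0 sgn0 addr0 zface0_msh_adec zface0_adegen cS.
  by rewrite [contr Q v 0 _ y]contr_dim ?addnS // [X in sgn _ X]raddf0 sgn0 addr0.
- have cD t a b : contr (ddec Q) (r := r) v n m (a + sgn t b) =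
      contr (ddec Q) (r := r) v n m a + sgn t (contr (ddec Q) (r := r) v n m b).
    by rewrite raddfD raddf_sgn.
  have zD t t' (a b : dA Q m.+1) : zface (T := dA Q) ord0 (a + sgn t (sgn t' b)) =
      zface (T := dA Q) ord0 a + sgn (t + t') (zface (T := dA Q) ord0 b).
    by rewrite raddfD !raddf_sgn sgn_sgn.
  rewrite mshSS cD (IH p q.+1) ?(IH p.+1 q) ?contr_adegen //; [|lia|lia].
  rewrite [X in sgn (r * p) X]raddf0 msh0l sgn0 addr0 add0r zD !zface0_msh_adec !zface0_adegen !cS.
  by congr (_ + sgn _ _); lia.
Qed.

Lemma act_dD (Q : dersys k) r p n (v : dC Q r) (f : simplex_map p n) (g : simplex_map r p) z :
  dD Q (dC_map Q g v) (scalg_act (dA Q) f z) =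
  scalg_act (dA Q) f (dD Q (dC_map Q (simplex_comp f g) v) z).
Proof. by rewrite dD_nat dC_comp. Qed.

Lemma contr_face_gt Q r (v : dC Q r) m (z : dA Q (m.+1 + r)%N) (a : nat) : (0 < a <= m.+1)%N ->
  zface (T := dA Q) (inord a) (contr Q v (m.+1 + r) m.+1 z) =
  contr Q v (m + r) m (zface (T := dA Q) (inord (a + r) : 'I_(m + r).+2) z).
Proof.
move=> am; rewrite contrE [RHS]contrE act_dD.
rewrite [LHS](szmod_actM (T := dA Q)) [RHS](szmod_actM (T := dA Q)).
rewrite front_coface_gt; last by lia.
by rewrite back_coface_gt ?addnK //; lia.
Qed.

Lemma contr_face_le Q r (v : dC Q r) m (z : dA Q (m + r).+1) (a : nat) : (a <= r)%N ->
  contr Q v (m + r) m (zface (T := dA Q) (inord a) z) =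
  scalg_act (dA Q) (back r.+1 m (m + r).+1)
    (dD Q (dC_map Q (front r.+1 (m + r).+1) (dC_map Q (coface (inord a)) v)) z).
Proof.
move=> ar; rewrite contrE act_dD [LHS](szmod_actM (T := dA Q)).
by rewrite front_coface_le ?dC_comp ?back_coface_le //; lia.
Qed.

Lemma contr_face0 Q r (v : dC Q r) m (z : dA Q (m.+1 + r)%N) :
  zface (T := dA Q) ord0 (contr Q v (m.+1 + r) m.+1 z) =
  scalg_act (dA Q) (back r.+1 m (m + r).+1)
    (dD Q (dC_map Q (front r.+1 (m + r).+1) (dC_map Q (coface (inord r.+1)) v)) z).
Proof.
rewrite contrE [LHS](szmod_actM (T := dA Q)) (_ : ord0 = inord 0) ?back_coface_first; last first.
  by apply: val_inj; rewrite /= inordK.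
by rewrite -dC_comp front_coface_last //; lia.
Qed.

Definition cocycle (Q : dersys k) r (v : dC Q r) := forall n (f : simplex_map r.+1 n) z,
  \sum_(i < r.+2) sgn i (dD Q (dC_map Q f (dC_map Q (coface i) v)) z) = 0.

(** The cocycle identity on the front face of dimension r + 1: the cofaces of v of index at most r
    turn into faces of z, and the last one into d_0 of the contraction. *)
Lemma contr_boundary Q r (v : dC Q r) m (z : dA Q (m.+1 + r)%N) : cocycle v ->
  \sum_(i < r.+1) sgn i (contr Q v (m + r) m (zface (T := dA Q) (inord i) z)) +
  sgn r.+1 (zface (T := dA Q) ord0 (contr Q v (m.+1 + r) m.+1 z)) = 0.
Proof.
move=> vc; rewrite contr_face0.
rewrite -[RHS](raddf0 (scalg_act (dA Q) (back r.+1 m (m + r).+1))).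
have E := vc _ (front r.+1 (m + r).+1) z; rewrite big_ord_recr in E.
rewrite -{}E [RHS](raddfD (scalg_act (dA Q) _)) (raddf_sum (scalg_act (dA Q) _)) /=; congr (_ + _).
  apply: eq_bigr => i _; have ir : (i <= r)%N by rewrite -ltnS.
  rewrite (contr_face_le v z ir) [RHS](raddf_sgn (scalg_act (dA Q) _)).
  have -> : inord i = widen_ord (leqnSn r.+1) i; last by reflexivity.
  by apply: val_inj; rewrite /= inordK // ltnS ltnW.
rewrite [RHS](raddf_sgn (scalg_act (dA Q) _)).
have -> : inord r.+1 = ord_max :> 'I_r.+2; last by reflexivity.
by apply: val_inj; rewrite /= inordK.
Qed.

Lemma contr_cycle Q r (v : dC Q r) m (z : dA Q (m + r)%N) : cocycle v ->
  moore_cycle (T := dA Q) z -> moore_cycle (T := dA Q) (contr Q v (m + r) m z).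
Proof.
case: m z => // m z vc zc a.
have [a0|a0] := posnP a.
  have := contr_boundary z vc; rewrite big1 => [|i _]; last by rewrite zc raddf0 sgn0.
  rewrite add0r (_ : a = ord0); last exact: val_inj.
  by move/(congr1 (sgn r.+1)); rewrite sgn_sgn sgn0 /sgn addnn odd_double.
rewrite -(inord_val a) contr_face_gt ?a0 //=; last by rewrite -ltnS.
by rewrite zc raddf0.
Qed.

Lemma contr_mbd Q r (v : dC Q r) m (z : dA Q (m + r)%N) : cocycle v ->
  mbd (T := dA Q) z -> mbd (T := dA Q) (contr Q v (m + r) m z).
Proof.
move=> vc [b bm <-].
have bi i : (i > 0)%N -> (i < (m + r).+2)%N -> zface (T := dA Q) (inord i) b = 0.
  case: i => // i _ im; rewrite (_ : inord i.+1 = lift ord0 (inord i : 'I_(m + r).+1)) ?bm //.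
  by apply: val_inj; rewrite /= !inordK.
have := contr_boundary (b : dA Q (m.+1 + r)%N) vc; rewrite big_ord_recl big1 => [|i _]; last first.
  by rewrite bi ?raddf0 ?sgn0 // lift0; have := ltn_ord i; lia.
rewrite addr0 (_ : inord (ord0 : 'I_r.+1) = ord0 :> 'I_(m + r).+2); last first.
  by apply: val_inj; rewrite /= inordK.
rewrite [sgn (ord0 : 'I_r.+1) _]/sgn /= => /eqP; rewrite addr_eq0 => /eqP ->.
apply: mbdN; apply: mbd_sgn; eexists; last by [].
have im (i : 'I_m.+1) : (0 < i.+1 <= m.+1)%N by apply: ltn_ord.
move=> i; rewrite (_ : lift ord0 i = inord i.+1) ?contr_face_gt //; last first.
  by apply: val_inj; rewrite /= inordK // ltnS.
by rewrite bi ?raddf0 //; have := ltn_ord i; lia.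
Qed.
End Contractions.
Arguments contr {k} Q {r} v p m z.

(** * Chains on the loop group *)

Section FreeModule.
Variables (k : fieldType) (K : choiceType).

Lemma malg_scaleU (c : k) (x : K) : << c *g x >> = c *: << x >> :> {malg k[K]}.
Proof. by apply/malgP => y; rewrite mcoeffZ !mcoeffU mulrnAr mulr1. Qed.

Lemma malg_expand (c : {malg k[K]}) : c = \sum_(x <- msupp c) c@_x *: << x >>.
Proof. by rewrite [LHS]monalgE; apply: eq_bigr => x _; rewrite malg_scaleU. Qed.

Lemma lin_extU (V : lmodType k) (f : K -> V) x : lin_ext f << x >> = f x.
Proof. by rewrite /lin_ext msuppU oner_eq0 big_seq_fset1 mcoeffUU scale1r. Qed.

Lemma malg_linear_eq (V : lmodType k) (f g : {linear {malg k[K]} -> V}) :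
  (forall x, f << x >> = g << x >>) -> f =1 g.
Proof.
move=> fg c; rewrite [c]malg_expand !raddf_sum; apply: eq_bigr => x _.
by rewrite [LHS](linearZ_LR f) [RHS](linearZ_LR g) /= fg.
Qed.
End FreeModule.

Section Chains.
Variables (k : fieldType) (X : sset).
Notation C n := {malg k[X n]}.

Definition chain_act m n (f : simplex_map m n) : C n -> C m :=
  lin_ext (fun x => << sset_act f x >>).
HB.instance Definition _ m n (f : simplex_map m n) := GRing.Linear.on (chain_act f).

Lemma chain_actU m n (f : simplex_map m n) x : chain_act f << x >> = << sset_act f x >>.
Proof. exact: lin_extU. Qed.

Lemma chain_laws : simplicial_laws chain_act.
Proof.
split=> [n|m n p g f].
  by apply: (malg_linear_eq (f := chain_act (simplex_id n)) (g := idfun)) => x;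
    rewrite /= chain_actU sset_act_id.
apply: (malg_linear_eq (f := chain_act (simplex_comp g f)) (g := chain_act f \o chain_act g)) => x.
by rewrite /= !chain_actU sset_act_comp.
Qed.

Definition chz : szmod := SZmod chain_laws.

Lemma boundary_alt n (c : C n.+1) : boundary c = alt_bd (T := chz) c.
Proof.
pose f : C n.+1 -> C n := fun c => alt_bd (T := chz) c.
have f_lin : linear f.
  move=> a u v; rewrite /f /alt_bd scaler_sumr -big_split; apply: eq_bigr => i _ /=.
  by rewrite linearP /= sgnD scale_sgn.
apply: (malg_linear_eq (f := @boundary k X n) (g := mk_linear f_lin)) => x.
rewrite [LHS]lin_extU -[RHS]/(f << x >>) /f /alt_bd; apply: eq_bigr => i _.
by rewrite [RHS]sgnZ; congr (_ *: _); apply/esym/chain_actU.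
Qed.

Lemma chz_actU m n (f : simplex_map m n) x : szmod_act chz f << x >> = << sset_act f x >>.
Proof. exact: chain_actU. Qed.

Lemma chain_actZ m n (f : simplex_map m n) a (c : C n) :
  szmod_act chz f (a *: c) = a *: (szmod_act chz f c : C m).
Proof. exact: (linearZ_LR (chain_act f)). Qed.

Definition integral n (c : C n) : Prop := forall x, exists z : int, c@_x = z%:~R.

Lemma integral0 n : integral (0 : C n).
Proof. by move=> x; exists 0; rewrite mcoeff0. Qed.
Lemma integralB n (c c' : C n) : integral c -> integral c' -> integral (c - c').
Proof. by move=> ci c'i x; have [z cz] := ci x; have [z' cz'] := c'i x; exists (z - z'); rewrite mcoeffB cz cz' rmorphB. Qed.
Lemma integralN n (c : C n) : integral c -> integral (- c).
Proof. by move=> ci; rewrite -sub0r; apply: integralB => //; apply: integral0. Qed.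
Lemma integralD n (c c' : C n) : integral c -> integral c' -> integral (c + c').
Proof. by move=> ci c'i; rewrite -[c']opprK; apply: integralB => //; apply: integralN. Qed.
Lemma integral_sum n (I : Type) (r : seq I) (P : pred I) (F : I -> C n) :
  (forall i, P i -> integral (F i)) -> integral (\sum_(i <- r | P i) F i).
Proof. by move=> Fi; apply: big_ind => //; [apply: integral0 | apply: integralD]. Qed.
Lemma integralU n (z : int) (x : X n) : integral (z%:~R *: << x >>).
Proof.
move=> y; exists (z *+ (x == y)); rewrite mcoeffZ mcoeffU.
by case: (x == y); rewrite ?mulr1 ?mulr0.
Qed.
Lemma integral_basis n (x : X n) : integral << x >>.
Proof. by move=> y; exists (x == y)%:Z; rewrite mcoeffU; case: (x == y). Qed.
Lemma integral_act m n (f : simplex_map m n) (c : C n) : integral c -> integral (chain_act f c).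
Proof.
move=> ci; rewrite [c]malg_expand (raddf_sum (chain_act f)); apply: integral_sum => x _ /=.
have [z ->] := ci x; rewrite (linearZ_LR (chain_act f)) /= chain_actU; exact: integralU.
Qed.

Lemma mproj_closed n : forall (T : szmod) (P : forall n, T n -> Prop),
  (forall n x y, P n x -> P n y -> P n (x - y)) ->
  (forall m n (f : simplex_map m n) x, P n x -> P m (szmod_act T f x)) ->
  forall x, P n x -> P n (mproj n T x).
Proof.
elim: n => [|n IHn] T P PB Pact x Px //; rewrite mprojS.
have Py := IHn (zdec T) (fun n => P n.+1) (fun n => PB n.+1) (fun m n f => Pact _ _ (shift false f)) x Px.
by apply: PB => //; apply: (Pact _ _ (codegen ord0)); apply: Pact.
Qed.
End Chains.
Arguments chain_act {k X m n} f.

Section WordSums.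
Variables (T : choiceType) (V : zmodType) (f : T -> V).
Definition wsum (w : word T) : V := \sum_(a <- w) (if a.2 then f a.1 else - f a.1).
Lemma wsum_cat u v : wsum (u ++ v) = wsum u + wsum v.
Proof. exact: big_cat. Qed.
(** S is a subgroup containing the sums of the relators: 0 when a map to chains is to be well
    defined, the integral boundaries for the edge-path group. *)
Lemma wsum_eq (rel_ : word T -> Prop) (S : V -> Prop) : S 0 -> (forall x y, S x -> S y -> S (x - y)) ->
  (forall w, rel_ w -> S (wsum w)) ->
  forall u v, word_eq rel_ u v -> S (wsum u - wsum v).
Proof.
move=> S0 SB Srel; have SN x : S x -> S (- x) by move=> Sx; rewrite -sub0r; apply: SB.
have SD x y : S x -> S y -> S (x + y) by move=> Sx Sy; rewrite -[y]opprK; apply: SB => //; apply: SN.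
move=> u v; elim=> {u v} [u|u v _ Suv|u v w _ Suv _ Svw|u u' v v' _ Su _ Sv|x b|w /Srel].
- by rewrite subrr.
- by rewrite -opprB; apply: SN.
- by have := SD _ _ Suv Svw; rewrite addrA subrK.
- by rewrite !wsum_cat opprD addrACA; apply: SD.
- have -> : wsum [::] = 0 by apply: big_nil.
  by rewrite subr0 /wsum !big_cons big_nil addr0; case: b => /=; rewrite ?subrr ?addNr.
- by rewrite [wsum [::]]big_nil subr0.
Qed.
End WordSums.

(** * The abelianized loop group *)

Section Hurewicz.
Variables (k : fieldType) (X : sset).
Hypothesis char0 : [pchar k] =i pred0.
Notation C n := {malg k[X n]}.
Notation Gam n := (kan_obj X n).
Notation Ch := (chz k X).

(** Chains modulo the image of s_0 are identified with the kernel of d_0 by the projection 1 - s_0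
    d_0, so that the relators of the loop group map to 0. *)
Definition kan_chain n (x : X n.+1) : C n.+1 := << x >> - << degen ord0 (face ord0 x) >>.

Definition reduce0 n (c : C n.+1) : C n.+1 := c - zdegen (T := Ch) (zface (T := Ch) ord0 c).

Lemma degen_face_degen n (y : X n) : degen ord0 (face ord0 (degen ord0 y)) = degen ord0 y.
Proof. by rewrite /face /degen [sset_act (coface _) _]sset_act_comp codegen0_coface0 sset_act_id. Qed.

Definition ch n (g : Gam n) : C n.+1 := wsum (@kan_chain n) (repr g).

Lemma ch_class n w : ch (pres_class (@kan_rel X n) w) = wsum (@kan_chain n) w.
Proof.
apply/eqP; rewrite -subr_eq0; apply/eqP.
apply: (wsum_eq (rel_ := @kan_rel X n) (S := fun v => v = 0)) => [//|x y -> ->|_ [y ->]|].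
- by rewrite subrr.
- by rewrite /wsum big_seq1 /= /kan_chain degen_face_degen subrr.
- exact: word_eq_repr.
Qed.

Lemma chM n (g h : Gam n) : ch (g * h)%g = ch g + ch h.
Proof.
elim/pres_ind: g => u; elim/pres_ind: h => v.
by rewrite -pres_classM !ch_class wsum_cat.
Qed.

Lemma ch1 n : ch (1%g : Gam n) = 0.
Proof. by have := chM (1%g : Gam n) 1%g; rewrite mulg1 => /eqP; rewrite -subr_eq subrr eq_sym => /eqP. Qed.

Lemma chV n (g : Gam n) : ch (g^-1)%g = - ch g.
Proof. by apply/eqP; rewrite -addr_eq0 -chM mulVg ch1. Qed.

Lemma ch_gen n (x : X n.+1) : ch (kan_gen x) = kan_chain x.
Proof. by rewrite [LHS]ch_class /wsum big_seq1. Qed.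

Lemma kan_ind n (P : Gam n -> Prop) : P 1%g -> (forall g h, P g -> P h -> P (g * h)%g) ->
  (forall g, P g -> P (g^-1)%g) -> (forall x, P (kan_gen x)) -> forall g, P g.
Proof.
move=> P1 PM PV Pg; elim/pres_ind; elim=> [//|[x b] w IHw].
rewrite -cat1s pres_classM; apply: PM => //; case: b; first exact: Pg.
by rewrite -[[:: _]]/(word_inv [:: (x, true)]) pres_classV; apply: PV; apply: Pg.
Qed.

Lemma kan_chain_reduce n (x : X n.+1) : kan_chain x = reduce0 << x >>.
Proof.
rewrite /reduce0 -[zface _ _]/(chain_act (coface ord0) << x >>) chain_actU.
by rewrite -[zdegen _]/(chain_act (codegen ord0) << _ >>) chain_actU.
Qed.

Lemma kan_actM m n (f : simplex_map m n) (g h : Gam n) :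
  kan_act f (g * h)%g = (kan_act f g * kan_act f h)%g.
Proof. exact: (pres_liftM (@kan_val_rel X m n f)). Qed.

Lemma zface0_reduce0 n (c : C n.+1) : zface (T := Ch) ord0 (reduce0 c : Ch n.+1) = 0.
Proof.
rewrite /reduce0 (raddfB (zface (T := Ch) ord0)).
by rewrite [X in _ - X](zface0_degen (T := Ch)) subrr.
Qed.

Lemma reduce0D n (a b : C n.+1) : reduce0 (a + b) = reduce0 a + reduce0 b.
Proof.
rewrite /reduce0 (raddfD (zface (T := Ch) ord0)) (raddfD (zdegen (T := Ch))).
by rewrite opprD addrACA.
Qed.

(** The twisted operators of the loop group become those of the decalage. With x' and x'' the two
    pullbacks of a generator x, the degenerate parts of x' and x'' agree, and x'' is the pullback of
    s_0 d_0 x. *)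
Lemma ch_act m n (f : simplex_map m n) g : ch (kan_act f g) = szmod_act Ch (shift false f) (ch g).
Proof.
elim/kan_ind: g => [|g h IHg IHh|g IHg|x].
- by rewrite (mult1 (kan_act f)) !ch1 raddf0.
- by rewrite kan_actM !chM IHg IHh raddfD.
- by rewrite (multV (kan_act f)) !chV IHg raddfN.
rewrite kan_act_gen /kan_val chM chV !ch_gen /kan_chain (raddfB (szmod_act Ch (shift false f))).
rewrite !chz_actU /face /degen !sset_act_comp.
have -> : simplex_comp (shift true f) (simplex_comp (coface ord0) (codegen ord0)) =
          simplex_comp (shift false f) (simplex_comp (coface ord0) (codegen ord0)).
  apply: simplexS_eq => [|i]; rewrite !simplex_compE; first by rewrite codegen00 !shiftS.
  by rewrite codegen0S !shiftS.
rewrite opprB addrA subrK; congr (<< _ >> - << _ >>); congr (sset_act _ x).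
apply: simplexS_eq => [|i]; rewrite !simplex_compE; last by rewrite !shiftS codegen0S.
by rewrite !shift0 inord_true inord_false codegen00.
Qed.

Lemma ch_face0 n (g : Gam n) : zface (T := Ch) ord0 (ch g : Ch n.+1) = 0.
Proof.
elim/kan_ind: g => [|g h IHg IHh|g IHg|x].
- by rewrite ch1 raddf0.
- by rewrite chM raddfD /= IHg IHh addr0.
- by rewrite chV raddfN /= IHg oppr0.
by rewrite ch_gen kan_chain_reduce zface0_reduce0.
Qed.

Lemma ch_face n (g : Gam n.+1) (i : 'I_n.+2) :
  ch (kan_act (coface i) g) = zface (T := Ch) (lift ord0 i) (ch g).
Proof. by rewrite ch_act shift_coface. Qed.

Lemma ch_integral n (g : Gam n) : integral (ch g).
Proof.
elim/kan_ind: g => [|g h IHg IHh|g IHg|x].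
- by rewrite ch1; apply: integral0.
- by rewrite chM; apply: integralD.
- by rewrite chV; apply: integralN.
by rewrite ch_gen; apply: integralB; apply: integral_basis.
Qed.

Lemma ch_lift n (c : C n.+1) : integral c -> exists g : Gam n, ch g = reduce0 c.
Proof.
move=> ci; have rD := @reduce0D n.
have r0 : reduce0 (0 : C n.+1) = 0.
  by have /eqP := rD 0 0; rewrite addr0 -subr_eq subrr eq_sym => /eqP.
have rN (a : C n.+1) : reduce0 (- a) = - reduce0 a.
  by apply/eqP; rewrite -addr_eq0 -rD addNr r0.
rewrite [c]malg_expand; elim/big_rec: _ => [|x y _ [g gE]]; first by exists 1%g; rewrite ch1 r0.
suff [h hE] : exists h : Gam n, ch h = reduce0 (c@_x *: << x >>) by exists (h * g)%g; rewrite chM rD hE gE.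
have [z ->] := ci x.
have nat_case (m : nat) : exists h : Gam n, ch h = reduce0 (m%:R *: << x >>).
  elim: m => [|m [h hE]]; first by exists 1%g; rewrite ch1 scale0r r0.
  have -> : m.+1%:R *: << x >> = << x >> + m%:R *: << x >> :> C n.+1.
    by rewrite mulrS scalerDl scale1r.
  by exists (kan_gen x * h)%g; rewrite rD -kan_chain_reduce -hE -ch_gen -chM.
case: z => m; first exact: nat_case.
have [h hE] := nat_case m.+1; exists (h^-1)%g; rewrite chV hE NegzE rmorphN /= scaleNr.
by rewrite rN.
Qed.

Section CommutativeTarget.
Variables (A : groupType) (Acomm : forall a b : A, (a * b = b * a)%g).
Variables (n : nat) (phi : Gam n -> A) (phiM : forall g h, phi (g * h)%g = (phi g * phi h)%g).

(** A first letter that is not degenerate is cancelled against an occurrence of its inverse. If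
    there were none, its exponent sum would be a positive integer up to sign, which is not 0 in
    k. *)
Lemma kan_comm_word w : (forall x, (forall y, x <> degen ord0 y) ->
    \sum_(a <- w) (if a.2 then (a.1 == x)%:R else - (a.1 == x)%:R) = 0 :> k) ->
  phi (pres_class (@kan_rel X n) w) = 1%g.
Proof.
have phi1 : phi 1%g = 1%g by apply: (mulgI (phi 1%g)); rewrite -phiM !mulg1.
have phiV g : phi (g^-1)%g = ((phi g)^-1)%g by apply: (mulgI (phi g)); rewrite -phiM !mulgV.
have [m] := ubnP (size w); elim: m w => // m IHm [|[x b] w] wm wx; first exact: phi1.
rewrite -cat1s pres_classM phiM.
have [[y xy]|nd] := pselect (exists y, x = degen ord0 y).
  rewrite (_ : phi _ = 1%g) ?mul1g.
    apply: IHm => // z zy; have := wx z zy; rewrite big_cons /=.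
    by rewrite (_ : (x == z) = false) ?oppr0 ?if_same ?add0r //; apply/eqP => xz; apply: (zy y); rewrite -xz.
  have xg : phi (kan_gen x) = 1%g by rewrite xy kan_gen_degen phi1.
  case: b {wx wm} => //; rewrite -[[:: _]]/(word_inv [:: (x, true)]) pres_classV phiV.
  by rewrite -[pres_class _ _]/(kan_gen x) xg invg1.
have ndx y : x <> degen ord0 y by move=> xy; apply: nd; exists y.
have [xw|xw] := boolP ((x, ~~ b) \in w).
  case/splitPr: xw wm wx => u v wm wx.
  have E1 : pres_class (@kan_rel X n) ((x, ~~ b) :: v) =
      (pres_class (@kan_rel X n) [:: (x, ~~ b)] * pres_class (@kan_rel X n) v)%g.
    by rewrite -pres_classM.
  have E2 : (pres_class (@kan_rel X n) [:: (x, b)] * pres_class (@kan_rel X n) [:: (x, ~~ b)])%g = 1%g.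
    by rewrite -pres_classM; apply/pres_classP/WordCancel.
  rewrite pres_classM E1 !phiM (Acomm (phi (pres_class _ u))) !mulgA.
  rewrite -(phiM (pres_class _ [:: (x, b)]) (pres_class _ [:: (x, ~~ b)])) E2 phi1 mul1g.
  rewrite Acomm -phiM -pres_classM; apply: IHm => [|z zy].
    by move: wm; rewrite /= !size_cat /=; lia.
  have := wx z zy; rewrite big_cons !big_cat big_cons /= => E; rewrite -[RHS]E.
  by case: (b) => /=; zmod.
have : (if b then 1 else - 1) * (count (fun a => a.1 == x) w).+1%:R = 0 :> k.
  rewrite -(wx x ndx) big_cons /= eqxx mulrS mulrDr mulr1; congr (_ + _).
  elim: w xw {wm wx} => [|[y c] w IHw]; first by rewrite big_nil mulr0.
  rewrite inE negb_or big_cons /= => /andP[yc /IHw <-]; rewrite natrD mulrDr; congr (_ + _).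
  move: yc; rewrite xpair_eqE eq_sym; case: eqP => _ /=; last by rewrite mulr0 oppr0 if_same.
  by case: (b); case: (c) => // _; rewrite ?mul1r ?mulN1r.
move/eqP; rewrite mulf_eq0 (natr_char0 char0) orbF; case: (b); rewrite ?oppr_eq0 oner_eq0 //.
Qed.

Lemma kan_comm_eq g h : ch g = ch h -> phi g = phi h.
Proof.
move=> gh; have : phi (g * h^-1)%g = 1%g.
  have : ch (g * h^-1)%g = 0 by rewrite chM chV gh subrr.
  elim/pres_ind: (g * h^-1)%g => w; rewrite ch_class => w0.
  apply: kan_comm_word => x nd; have E : mcoeff x (wsum (@kan_chain n) w) = 0 by rewrite w0 mcoeff0.
  rewrite -[RHS]E /wsum (raddf_sum (mcoeff x)) /=; apply: eq_bigr => -[y b] _ /=.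
  have yx : mcoeff x (kan_chain y) = (y == x)%:R :> k.
    rewrite /kan_chain mcoeffB !mcoeffU (_ : (degen _ _ == x) = false) ?subr0 //.
    by apply/eqP => xE; apply: (nd (face ord0 y)).
  by case: b; rewrite ?mcoeffN yx.
rewrite phiM => gh1; have phi1 : phi 1%g = 1%g by apply: (mulgI (phi 1%g)); rewrite -phiM !mulg1.
by rewrite -[phi h]mul1g -gh1 -mulgA -phiM mulVg phi1 mulg1.
Qed.
End CommutativeTarget.
End Hurewicz.
Arguments ch {k X n} g.

(** * Cycles in the representation algebra from the loop group *)

Section FlatElements.
Variables (k : fieldType) (G : affine_group k) (M : rep_model G) (X : sset).
Hypotheses (char0 : [pchar k] =i pred0) (hcomm : commutative_group_scheme G).
Notation R := (coord_ring G).
Notation eps := (counit G).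
Notation Ch := (chz k X).
Notation B := (repS M (kan_loop X)).
Notation rg := (rgen M).

(** A representation in a commutative group factors through the abelianization, which chains over a
    field of characteristic 0 detect. *)
Lemma rgen_ch n (g h : kan_obj X n) : ch (k := k) g = ch h -> rg g = rg h.
Proof.
move=> gh; apply: (kan_comm_eq char0 (A := points G (repA M (kan_obj X n))) _ (phi := fun g => rg g) _ gh).
  exact: hcomm.
by move=> a b; apply: rgenM.
Qed.

(** In positive degree this says that the faces of g in the loop group have trivial abelianization,
    so that functions of g vanishing at the unit are Moore cycles. *)
Definition flat n (g : kan_obj X n) : Prop := moore_cycle (T := Ch) (ch g : Ch n.+1).

Lemma zface_rgen n (g : kan_obj X n.+1) u (i : 'I_n.+2) :
  zface (T := B) i (rg g u : B n.+1) = rg (kan_act (coface i) g) u.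
Proof. exact: (@repS_gen k G M (kan_loop X) n n.+1 (coface i) g u). Qed.

Lemma rgen_ch0 n (g : kan_obj X n) u : ch (k := k) g = 0 -> rg g u = (eps u)%:A.
Proof. by move=> g0; rewrite (@rgen_ch n g 1%g) ?rgen1 // ch1. Qed.

Lemma flat_cycle n (g : kan_obj X n) u : flat g -> eps u = 0 ->
  moore_cycle (T := B) (rg g u : B n).
Proof.
case: n g => // n g gf u0 i; rewrite zface_rgen rgen_ch0 ?u0 ?scale0r //.
by rewrite ch_face gf.
Qed.

(** With b' the Moore projection of b and c the chain of g, the chain s_0 c - b' is killed by d_0
    and lifts to some g' in the loop group. Its d_1, which is the face 0 there, is c, and the higher
    faces vanish. *)
Lemma flat_boundary n (g : kan_obj X n) (b : Ch n.+2) u : flat g -> eps u = 0 ->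
  integral b -> ch g = alt_bd (T := Ch) b -> mbd (T := B) (rg g u : B n).
Proof.
move=> gf u0 bi gb; pose b' := mproj n.+2 Ch b.
have b'm : moore b' by apply: mproj_moore.
have b'0 : zface (T := Ch) ord0 b' = ch g.
  rewrite -[LHS]/(zface (T := Ch) ord0 (b' : Ch n.+2)) -alt_bd_moore //.
  by rewrite alt_bd_mproj -gb mproj_cycle.
have b'i : integral (- b').
  apply: integralN; apply: (mproj_closed (T := Ch) (P := fun n (c : Ch n) => integral (c : {malg k[X n]}))) => //.
    by move=> m; apply: integralB.
  by move=> m p f; apply: integral_act.
have [g' g'E] := ch_lift b'i.
have g'E2 : ch g' = zdegen (T := Ch) (ch g) - b' :> Ch n.+2.
  rewrite g'E /reduce0 (raddfN (zface (T := Ch) ord0)) (raddfN (zdegen (T := Ch))).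
  by rewrite opprK b'0 addrC.
exists (rg g' u : B n.+1).
  move=> i; rewrite zface_rgen rgen_ch0 ?u0 ?scale0r // ch_face g'E2.
  rewrite (raddfB (zface (T := Ch) _)) [X in X - _](zface_degen (T := Ch)) b'm subr0.
  by rewrite gf raddf0.
rewrite zface_rgen (@rgen_ch n (kan_act (coface ord0) g') g) //.
rewrite ch_face g'E2 (raddfB (zface (T := Ch) _)) [X in X - _](zface1_degen (T := Ch)).
by rewrite (b'm ord0) subr0.
Qed.

(** Each edge is trivial in the edge-path group, and the chain of a relator is the boundary of its
    2-simplex; the argument keeps coefficients integral. *)
Lemma fund_group_boundary : simply_connected X -> forall c : Ch 1%N, integral c ->
  exists2 b : Ch 2, integral b & alt_bd (T := Ch) b = c.
Proof.
move=> Xsc c ci; pose S (v : Ch 1%N) := exists2 b : Ch 2, integral b & alt_bd (T := Ch) b = v.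
have S0 : S 0 by exists 0; [apply: integral0 | rewrite raddf0].
have SB x y : S x -> S y -> S (x - y).
  by move=> [b bi <-] [b' b'i <-]; exists (b - b'); [apply: integralB | rewrite raddfB].
have SN x : S x -> S (- x) by move=> Sx; rewrite -sub0r; apply: SB.
have SD x y : S x -> S y -> S (x + y) by move=> Sx Sy; rewrite -[y]opprK; apply: SB => //; apply: SN.
have Sx x : S << x >>.
  have /pres_classP wx : pres_class (@edge_rel X) [:: (x, true)] = pres_class (@edge_rel X) [::].
    by rewrite [LHS](Xsc _) [RHS](Xsc _).
  have := wsum_eq (f := fun x => << x >> : Ch 1%N) S0 SB _ wx.
  rewrite /wsum big_seq1 big_nil subr0; apply => _ [s ->].
  rewrite !big_cons big_nil /= addr0; exists << s >>; first exact: integral_basis.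
  rewrite /alt_bd !big_ord_recl big_ord0 /sgn /= addr0 addrCA addrA.
  rewrite !lin_extU /face.
  have i0 : inord 0 = ord0 :> 'I_3 by apply: val_inj; rewrite /= inordK.
  have i1 : inord 1 = lift ord0 ord0 :> 'I_3 by apply: val_inj; rewrite /= inordK.
  have i2 : inord 2 = lift ord0 (lift ord0 ord0) :> 'I_3 by apply: val_inj; rewrite /= inordK.
  by rewrite i0 i1 i2; zmodu.
rewrite [c]malg_expand; elim/big_rec: _ => [//|x y _ Sy]; apply: (SD (c@_x *: << x >>) y) => //.
have [z ->] := ci x; have SM (m : nat) : S (m%:R *: << x >>).
  elim: m => [|m IHm]; first by rewrite scale0r.
  have -> : m.+1%:R *: << x >> = << x >> + m%:R *: << x >> :> {malg k[X 1%N]}.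
    by rewrite mulrS scalerDl scale1r.
  exact: SD.
by case: z => m; [apply: SM | rewrite NegzE rmorphN scaleNr; apply/SN/SM].
Qed.

Hypotheses (Xr : reduced X) (Xsc : simply_connected X).

(** With a single vertex the two faces of a 1-chain agree, and d_0 vanishes on chains of loops. *)
Lemma flat0 (g : kan_obj X 0) : flat g.
Proof.
have [x0 x0P] := Xr; have xx (x y : X 0%N) : x = y by rewrite (x0P x) (x0P y).
have faces (c : {malg k[X 1%N]}) : zface (T := Ch) (lift ord0 ord0) (c : Ch 1%N) = zface (T := Ch) ord0 (c : Ch 1%N).
  apply: (malg_linear_eq (f := chain_act (coface (lift ord0 ord0))) (g := chain_act (coface ord0))) => x.
  by rewrite /= !chain_actU; congr (<< _ >>).
move=> i; case: (unliftP ord0 i) => [j ->|->]; last exact: ch_face0.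
by rewrite (_ : j = ord0) ?faces ?ch_face0 //; apply: val_inj; case: j => [[]].
Qed.

Lemma rgen_mbd0 (g : kan_obj X 0) u : eps u = 0 -> mbd (T := B) (rg g u : B 0%N).
Proof.
move=> u0; have [b bi bE] := fund_group_boundary Xsc (ch_integral k g).
exact: flat_boundary (flat0 g) u0 bi (esym bE).
Qed.

(** This identifies pi_0 with the scalars: coordinates of loops of degree 0 are boundaries as X is
    simply connected, and boundaries of degree 0 form an ideal. *)
Lemma aug_mbd0 (z : B 0%N) : mbd (T := B) (z - (rep_aug M _ z)%:A : B 0%N).
Proof.
have mbdMl a (y : B 0%N) : mbd (T := B) y -> mbd (T := B) (a * y : B 0%N).
  move=> ym; have := @msh_mbdr k B 0 0 0 a y I ym; rewrite mshE //.
move: z; apply: repA_ind => [|a y z ym zm|y z ym zm|g u].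
- by rewrite rmorph1 scale1r subrr; apply: mbd0.
- have := mbdD (mbdZ a ym) zm; congr mbd; rewrite linearP /= scalerBr.
  have -> : a *: rep_aug M _ y + rep_aug M _ z = a * rep_aug M _ y + rep_aug M _ z by [].
  by rewrite scalerDl scalerA; zmodu.
- set y0 := (rep_aug M _ y)%:A in ym; set z0 := (rep_aug M _ z)%:A in zm.
  have -> : y * z - (rep_aug M _ (y * z))%:A = y * (z - z0) + z0 * (y - y0).
    rewrite rmorphM /=; have -> : (rep_aug M _ y * rep_aug M _ z)%:A = y0 * z0 by rewrite -scalerAl mul1r scalerA.
    by ring.
  by apply: mbdD; apply: mbdMl.
- rewrite rep_aug_gen; have -> : rg g u - (eps u)%:A = rg g (u - (eps u)%:A).
    have gen_a (c : k) : rg g c%:A = c%:A by rewrite linearZ /= rmorph1.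
    by rewrite raddfB /= gen_a.
  by apply: rgen_mbd0; rewrite raddfB /= aug_alg subrr.
Qed.

(** For the degreewise product: [mbd_mul_vertex] moves z to its first vertex, which factors through
    a face of z. *)
Lemma cycle_mul_mbd n (y z : B n.+1) : moore_cycle (T := B) y -> moore_cycle (T := B) z ->
  mbd (T := B) (y * z : B n.+1).
Proof.
move=> yc zc; have := mbd_mul_vertex z yc.
rewrite (_ : scalg_act B _ z = 0) ?mulr0 ?subr0 //.
rewrite -[LHS](szmod_actM (T := B)).
have -> : front 0 n.+1 = simplex_comp (coface ord_max) (front 0 n).
  by apply: simplex_val_eq => i; rewrite simplex_compE cofaceE !frontE ord1 !min0n /=.
by rewrite -(szmod_actM (T := B)) [szmod_act B (coface _) z]zc !raddf0.
Qed.

Lemma rgenM_mbd n (g h : kan_obj X n) u : flat g -> flat h -> eps u = 0 ->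
  mbd (T := B) (rg (g * h)%g u - (rg g u + rg h u) : B n).
Proof.
move=> gf hf u0; case: n g h gf hf => [|n] g h gf hf.
  by apply: mbdB; [|apply: mbdD]; apply: rgen_mbd0.
have [s [sI ->]] := rep_genM M g h u.
rewrite u0 scale0r subr0 addrAC subrr add0r big_seq; apply: mbd_sum => q /sI[q1 q2].
by apply: cycle_mul_mbd; apply: flat_cycle.
Qed.
End FlatElements.

Section IntegralDecomposition.
Variables (k : fieldType) (X : sset).
Notation C n := {malg k[X n]}.

Lemma int_decomp n (c : C n) (s e : seq k) (N : int) :
  (forall x, x \in msupp c -> c@_x \in s) ->
  (forall a, a \in s -> exists q : nat -> int,
     N%:~R * a = \sum_(i < size e) (q i)%:~R * e`_i) ->
  exists z : nat -> C n, (forall t, integral (z t)) /\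
    N%:~R *: c = \sum_(t < size e) e`_t *: z t.
Proof.
move=> cs sq; have /choice[q qP] : forall x, exists q : nat -> int, x \in msupp c ->
    N%:~R * c@_x = \sum_(i < size e) (q i)%:~R * e`_i.
  move=> x; have [xc|] := boolP (x \in msupp c); last by exists (fun=> 0).
  by have [q qE] := sq _ (cs x xc); exists q.
exists (fun t => \sum_(x <- msupp c) (q x t)%:~R *: << x >>); split=> [t|].
  by apply: integral_sum => x _; apply: integralU.
under eq_bigr do rewrite scaler_sumr.
rewrite exchange_big {1}[c]malg_expand scaler_sumr big_seq [RHS]big_seq; apply: eq_bigr => x xc /=.
rewrite scalerA qP // scaler_suml; apply: eq_bigr => t _.
by rewrite scalerA mulrC.
Qed.

Lemma int_free_chain n (e : seq k) (z : nat -> C n) : int_free e ->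
  (forall t, integral (z t)) -> \sum_(t < size e) e`_t *: z t = 0 ->
  forall t, (t < size e)%N -> z t = 0.
Proof.
move=> ef zi ez t te; apply/malgP => x; rewrite mcoeff0.
have /choice[q qE] : forall t, exists q : int, (z t)@_x = q%:~R by move=> t'; apply: zi.
rewrite qE ef ?intr0 //; have E := congr1 (mcoeff x) ez.
rewrite mcoeff0 (raddf_sum (mcoeff x)) in E; rewrite -[RHS]E.
by apply: eq_bigr => i _; rewrite /= mcoeffZ qE mulrC.
Qed.
End IntegralDecomposition.

(** * From homology to homotopy of the representation algebra *)

Section Theta.
Variables (k : fieldType) (G : affine_group k) (M : rep_model G) (X : sset).
Hypotheses (char0 : [pchar k] =i pred0) (hcomm : commutative_group_scheme G).
Hypotheses (Xr : reduced X) (Xsc : simply_connected X).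
Notation R := (coord_ring G).
Notation eps := (counit G).
Notation Ch := (chz k X).
Notation C n := {malg k[X n]}.
Notation B := (repS M (kan_loop X)).
Notation rg := (rgen M).
Notation flat := (@flat k X _).

Definition hcl n (w : B n) : homotopy B n := subclass _ _ w.
Definition vcl n (c : C n.+1) : reduced_homology k X n.+1 := subclass _ _ c.

Lemma hcl_eq n (w w' : B n) : moore_cycle (T := B) w -> moore_cycle (T := B) w' ->
  (hcl w = hcl w') <-> mbd (T := B) (w - w').
Proof.
move=> wc w'c; have w1 : w \in @moore_cycles k B n by apply/moore_cyclesP.
have w2 : w' \in @moore_cycles k B n by apply/moore_cyclesP.
split=> [/(subclassP _ w1 w2) /moore_boundariesP //|ww'].
by apply/(subclassP _ w1 w2)/moore_boundariesP.
Qed.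

Lemma hcl_linear n a (w w' : B n) : moore_cycle (T := B) w -> moore_cycle (T := B) w' ->
  hcl (a *: w + w') = a *: hcl w + hcl w'.
Proof.
move=> wc w'c; have w1 : w \in @moore_cycles k B n by apply/moore_cyclesP.
have w2 : w' \in @moore_cycles k B n by apply/moore_cyclesP.
by rewrite /hcl subclassD ?rpredZ // subclassZ.
Qed.

Lemma cyclesP n (c : C n.+1) : reflect (alt_bd (T := Ch) c = 0) (c \in @reduced_cycles k X n.+1).
Proof. by rewrite -(boundary_alt c); apply: eqP. Qed.

Lemma boundariesP n (c : C n) : reflect (exists b : Ch n.+1, alt_bd (T := Ch) b = c) (c \in @boundaries k X n).
Proof. by apply: (iffP (asboolP _)) => -[b bE]; exists b; rewrite -bE boundary_alt. Qed.

Lemma vcl_eq n (c c' : C n.+1) : alt_bd (T := Ch) c = 0 -> alt_bd (T := Ch) c' = 0 ->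
  (vcl c = vcl c') <-> exists b : Ch n.+2, alt_bd (T := Ch) b = c - c'.
Proof.
move=> /cyclesP cc /cyclesP c'c.
split=> [/(subclassP _ cc c'c) /boundariesP //|cc'].
by apply/(subclassP _ cc c'c)/boundariesP.
Qed.

Lemma vcl_linear n a (c c' : C n.+1) : alt_bd (T := Ch) c = 0 -> alt_bd (T := Ch) c' = 0 ->
  vcl (a *: c + c') = a *: vcl c + vcl c'.
Proof.
have lin (x y : chain k X n.+1) : x \in @reduced_cycles k X n.+1 -> y \in @reduced_cycles k X n.+1 ->
    subclass (@reduced_cycles k X n.+1) (@boundaries k X n.+1) (a *: x + y) =
    a *: subclass (@reduced_cycles k X n.+1) (@boundaries k X n.+1) x + subclass _ _ y.
  move=> xc yc; rewrite subclassD; [|exact: rpredZ|exact: yc].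
  by rewrite subclassZ.
by move=> /cyclesP cc /cyclesP c'c; exact: (lin c c' cc c'c).
Qed.

Lemma alt_bdZ n a (c : C n.+1) : alt_bd (T := Ch) (a *: c) = a *: (alt_bd (T := Ch) c : C n).
Proof. by rewrite -!boundary_alt linearZ. Qed.

Lemma alt_bd_sumZ n (I : Type) (s : seq I) (a : I -> k) (F : I -> C n.+1) :
  alt_bd (T := Ch) (\sum_(i <- s) a i *: F i : C n.+1) =
  \sum_(i <- s) a i *: (alt_bd (T := Ch) (F i) : C n).
Proof.
rewrite -boundary_alt (raddf_sum (@boundary k X n)); apply: eq_bigr => i _.
by rewrite /= (linearZ_LR (@boundary k X n)) /= boundary_alt.
Qed.

Lemma flat_alt n (g : kan_obj X n) : flat g -> alt_bd (T := Ch) (ch g) = 0.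
Proof. exact: moore_cycle_alt. Qed.

Lemma moore_flat n (c0 : C n.+1) : moore_cycle (T := Ch) (c0 : Ch n.+1) ->
  exists s : seq (k * kan_obj X n), (forall a, a \in s -> flat a.2) /\ c0 = \sum_(a <- s) a.1 *: ch a.2.
Proof.
move=> c0m.
have [e [N [N0 ef sq]]] := int_free_basis [seq c0@_x | x <- msupp c0].
have [x xc0|z [zi zE]] := int_decomp (c := c0) _ sq; first exact: map_f.
(* Each integral component inherits the vanishing of the faces from c0, because the scalars e are
   independent over the integers; so it lifts to the loop group. *)
have zc t : (t < size e)%N -> moore_cycle (T := Ch) (z t : Ch n.+1).
  move=> te i.
  apply: (@int_free_chain k X n e (fun t => zface (T := Ch) i (z t : Ch n.+1)) ef _ _ t te).
    by move=> t'; apply: (@integral_act k X _ _ (coface i)).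
  have := congr1 (chain_act (coface i)) zE; rewrite linearZ /= [chain_act _ c0]c0m scaler0 => /esym.
  rewrite (raddf_sum (chain_act (coface i))) => E; rewrite -[RHS]E; apply: eq_bigr => j _.
  by rewrite /= [RHS](linearZ_LR (chain_act (coface i))).
have /choice[g gE] : forall t, exists g : kan_obj X n, (t < size e)%N -> ch g = z t.
  move=> t; have [g gE] := ch_lift (zi t); exists g => te; rewrite gE /reduce0.
  by rewrite (zc t te) raddf0 subr0.
have N0k : (N%:~R : k) != 0 by rewrite intr_char0.
exists [seq (N%:~R^-1 * e`_t, g t) | t <- iota 0 (size e)]; split=> [_ /mapP[t + ->]|].
  by rewrite mem_iota add0n => /= te; rewrite /flat gE //; apply: zc.
have c0E : c0 = N%:~R^-1 *: (N%:~R *: c0) by rewrite scalerA mulVf // scale1r.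
rewrite big_map [LHS]c0E zE scaler_sumr.
have -> : iota 0 (size e) = index_iota 0 (size e) by rewrite /index_iota subn0.
rewrite big_mkord.
by apply: eq_bigr => t _; rewrite /= gE // scalerA.
Qed.

(* A cycle of k-chains is homologous to one in the Moore complex, and the latter is
   a linear combination of integral cycles all of whose faces vanish. *)
Lemma flat_span n (v : reduced_homology k X n.+1) : exists s : seq (k * kan_obj X n),
  (forall a, a \in s -> flat a.2) /\ v = vcl (\sum_(a <- s) a.1 *: ch a.2).
Proof.
elim/subclass_ind: v => c /cyclesP cc.
pose c0 : C n.+1 := mproj n.+1 Ch c.
have c0m : moore_cycle (T := Ch) (c0 : Ch n.+1) by apply: alt_cycle_mproj.
have [b bE] := alt_cycle_mproj_homologous cc.
have [s [sf sE]] := moore_flat c0m; exists s; split=> //; rewrite -sE.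
apply: (proj2 (vcl_eq cc (moore_cycle_alt c0m))).
by exists (- b); rewrite raddfN /= -bE opprB.
Qed.

Section Fixed.
Variables (n : nat) (u : R) (u0 : eps u = 0).

(** The integral form of the map to be defined, as a relation: it is additive in both arguments,
    modulo boundaries on the side of the algebra. *)
Definition flat_rel (z : C n.+1) (w : B n) : Prop :=
  exists g : kan_obj X n, [/\ flat g, ch g = z & mbd (T := B) (rg g u - w : B n)].

Lemma flat_rel_gen g : flat g -> flat_rel (ch g) (rg g u).
Proof. by move=> gf; exists g; split=> //; rewrite subrr; apply: mbd0. Qed.

Lemma flatM (g h : kan_obj X n) : flat g -> flat h -> flat (g * h)%g.
Proof. by move=> gf hf; rewrite /flat chM; apply: moore_cycleD. Qed.

Lemma flat_rel0 : flat_rel 0 0.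
Proof.
exists 1%g; rewrite /flat ch1; split=> //; first exact: moore_cycle0.
by rewrite rgen1 u0 scale0r subrr; apply: mbd0.
Qed.

Lemma flat_relD z w z' w' : flat_rel z w -> flat_rel z' w' -> flat_rel (z + z') (w + w').
Proof.
move=> [g [gf <- gw]] [h [hf <- hw]]; exists (g * h)%g; rewrite chM; split=> //; first exact: flatM.
have := mbdD (rgenM_mbd M char0 hcomm Xr Xsc gf hf u0) (mbdD gw hw); congr mbd.
by zmodu.
Qed.

Lemma flat_relN z w : flat_rel z w -> flat_rel (- z) (- w).
Proof.
move=> [g [gf <- gw]]; exists (g^-1)%g; rewrite chV.
have gVf : flat (g^-1)%g by rewrite /flat chV; apply: moore_cycleN.
split=> //; have := mbdN (mbdD (rgenM_mbd M char0 hcomm Xr Xsc gVf gf u0) gw); congr mbd.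
by rewrite mulVg rgen1 u0 scale0r; zmodu.
Qed.

Lemma flat_relMz z w (m : int) : flat_rel z w -> flat_rel (z *~ m) (w *~ m).
Proof.
move=> zw; have nat_case (i : nat) : flat_rel (z *+ i) (w *+ i).
  by elim: i => [|i IHi]; [apply: flat_rel0 | rewrite !mulrS; apply: flat_relD].
case: m => i; first exact: nat_case.
by rewrite NegzE !mulrNz; apply: flat_relN; apply: (nat_case i.+1).
Qed.

Lemma flat_rel_boundary (b : C n.+2) (w : B n) : integral b ->
  flat_rel (alt_bd (T := Ch) b) w -> mbd (T := B) w.
Proof.
move=> bi [g [gf gb gw]]; have gm := flat_boundary M char0 hcomm gf u0 bi gb.
by have := mbdB gm gw; rewrite opprB addrC subrK.
Qed.

(** Well-definedness. The coefficients of the combination and of the chain b are expressed over one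
    independent family e after multiplication by N; the relation then splits into integral
    relations, each of which is handled by [flat_boundary]. *)
Lemma flat_comb_boundary (s : seq (k * kan_obj X n)) (b : C n.+2) :
  (forall a, a \in s -> flat a.2) -> \sum_(a <- s) a.1 *: ch a.2 = alt_bd (T := Ch) b ->
  mbd (T := B) (\sum_(a <- s) a.1 *: rg a.2 u : B n).
Proof.
move=> sf sb.
have [e [N [N0 ef sq]]] := int_free_basis ([seq a.1 | a <- s] ++ [seq b@_x | x <- msupp b]).
have N0k : (N%:~R : k) != 0 by rewrite intr_char0.
have [x xb|z [zi zE]] := int_decomp (c := b) _ sq; first by
    rewrite mem_cat; apply/orP; right; exact: (map_f (fun x => b@_x) xb).
have /choice[q qE] : forall a : k, exists q : nat -> int, a \in [seq a.1 | a <- s] ->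
    N%:~R * a = \sum_(i < size e) (q i)%:~R * e`_i.
  move=> a; have [as_|] := boolP (a \in [seq a.1 | a <- s]); last by exists (fun=> 0).
  by have [|q qE] := sq a; [rewrite mem_cat as_ | exists q => _].
pose Z t : C n.+1 := \sum_(a <- s) ch a.2 *~ q a.1 t.
pose W t : B n := \sum_(a <- s) rg a.2 u *~ q a.1 t.
have ZW t : flat_rel (Z t) (W t).
  rewrite /Z /W big_seq [\sum_(a <- s) _ *~ _ in X in flat_rel _ X]big_seq.
  elim/big_rec2: _ => [|a w y sa zw]; first exact: flat_rel0.
  by apply: flat_relD => //; apply: flat_relMz; apply: flat_rel_gen; apply: sf.
have comb (V : lmodType k) (F : kan_obj X n -> V) :
    \sum_(t < size e) e`_t *: (\sum_(a <- s) F a.2 *~ q a.1 t) = N%:~R *: \sum_(a <- s) a.1 *: F a.2.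
  under eq_bigr do rewrite scaler_sumr.
  rewrite exchange_big scaler_sumr big_seq [RHS]big_seq; apply: eq_bigr => a sa /=.
  rewrite scalerA qE ?map_f // scaler_suml; apply: eq_bigr => t _.
  by rewrite -scaler_int scalerA mulrC.
have Zb t : (t < size e)%N -> Z t = alt_bd (T := Ch) (z t).
  move=> te; apply/eqP; rewrite -subr_eq0; apply/eqP.
  apply: (@int_free_chain k X n.+1 e (fun t => Z t - alt_bd (T := Ch) (z t)) ef _ _ t te) => [t'|].
    apply: integralB.
      apply: integral_sum => a _; case: (q a.1 t') => i.
        rewrite -[i]card_ord -[_ *~ _]sumr_const; apply: integral_sum => _ _; exact: ch_integral.
      rewrite NegzE mulrNz; apply: integralN.
      rewrite -[i.+1]card_ord -[_ *~ _]sumr_const; apply: integral_sum => _ _; exact: ch_integral.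
    apply: integral_sum => i _; rewrite /sgn; case: odd; [apply: integralN|];
      exact: (@integral_act k X _ _ (coface i)).
  under eq_bigr do rewrite scalerBr.
  rewrite sumrB (comb (C n.+1) (fun g => ch g)) -(alt_bd_sumZ _ (fun t : 'I_(size e) => e`_t)) -zE sb.
  by rewrite [X in _ - X]alt_bdZ subrr.
have Wb : mbd (T := B) (N%:~R *: \sum_(a <- s) a.1 *: rg a.2 u : B n).
  rewrite -(comb (B n) (fun g => rg g u)); apply: mbd_sum => t _; apply: mbdZ.
  by apply: (flat_rel_boundary (zi t)); rewrite -Zb //; apply: ZW.
by have := mbdZ (N%:~R^-1) Wb; rewrite scalerA mulVf // scale1r.
Qed.

Lemma flat_comb_cycle (s : seq (k * kan_obj X n)) : (forall a, a \in s -> flat a.2) ->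
  moore_cycle (T := B) (\sum_(a <- s) a.1 *: rg a.2 u : B n).
Proof.
move=> sf; rewrite big_seq; apply: moore_cycle_sum => a /sf af.
by apply: moore_cycleZ; apply: (flat_cycle M char0 hcomm).
Qed.

Lemma flat_comb_alt (s : seq (k * kan_obj X n)) : (forall a, a \in s -> flat a.2) ->
  alt_bd (T := Ch) (\sum_(a <- s) a.1 *: ch a.2 : C n.+1) = 0.
Proof.
move=> sf; rewrite (alt_bd_sumZ s (fun a => a.1) (fun a => ch a.2)) big_seq big1 // => a /sf af.
by rewrite (flat_alt af) scaler0.
Qed.

Lemma theta_exists : exists th : {linear reduced_homology k X n.+1 -> homotopy B n},
  forall s : seq (k * kan_obj X n), (forall a, a \in s -> flat a.2) ->
    th (vcl (\sum_(a <- s) a.1 *: ch a.2)) = hcl (\sum_(a <- s) a.1 *: rg a.2 u).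
Proof.
pose Rel (v : reduced_homology k X n.+1) (w : homotopy B n) := exists s : seq (k * kan_obj X n),
  [/\ forall a, a \in s -> flat a.2, v = vcl (\sum_(a <- s) a.1 *: ch a.2)
    & w = hcl (\sum_(a <- s) a.1 *: rg a.2 u)].
have RelL a v w v' w' : Rel v w -> Rel v' w' -> Rel (a *: v + v') (a *: w + w').
  move=> [s [sf -> ->]] [s' [s'f -> ->]]; exists ([seq (a * b.1, b.2) | b <- s] ++ s').
  have E (V : lmodType k) (F : kan_obj X n -> V) :
      \sum_(b <- [seq (a * b.1, b.2) | b <- s] ++ s') b.1 *: F b.2 =
      a *: \sum_(b <- s) b.1 *: F b.2 + \sum_(b <- s') b.1 *: F b.2.
    rewrite big_cat big_map scaler_sumr; congr (_ + _); apply: eq_bigr => b _.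
    by rewrite scalerA.
  split=> [b||].
  - by rewrite mem_cat => /orP[/mapP[b' /sf b'f ->] //|/s'f].
  - by rewrite E vcl_linear //; apply: flat_comb_alt.
  - by rewrite (E (B n) (fun g => rg g u)) hcl_linear //; apply: flat_comb_cycle.
have Rel0 w : Rel 0 w -> w = 0.
  move=> [s [sf v0 ->]]; have v00 : vcl (0 : C n.+1) = 0.
    have E := @vcl_linear n 1 0 0 (raddf0 _) (raddf0 _).
    rewrite scaler0 addr0 scale1r in E.
    by apply: (addrI (vcl (0 : C n.+1))); rewrite addr0 -E.
  have /(vcl_eq (flat_comb_alt sf) (raddf0 _))[b bE] :
      vcl (\sum_(a <- s) a.1 *: ch a.2) = vcl (0 : C n.+1) by rewrite v00.
  rewrite subr0 in bE.
  have h00 : hcl (0 : B n) = 0.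
    have E := @hcl_linear n 1 0 0 (@moore_cycle0 B n) (@moore_cycle0 B n).
    rewrite scaler0 addr0 scale1r in E.
    by apply: (addrI (hcl (0 : B n))); rewrite addr0 -E.
  rewrite -h00; apply: (proj2 (hcl_eq (flat_comb_cycle sf) (@moore_cycle0 B n))).
  by rewrite subr0; apply: flat_comb_boundary (esym bE).
have Relt v : exists w, Rel v w.
  have [s [sf ->]] := flat_span v.
  by exists (hcl (\sum_(a <- s) a.1 *: rg a.2 u)), s.
have [th thP] := linear_of_rel Relt Rel0 RelL.
exists th => s sf; apply/eqP; rewrite -subr_eq0; apply/eqP/Rel0.
set v := vcl _; set w := hcl _; have vw : Rel v w by exists s.
by have := RelL (-1) _ _ _ _ vw (thP v); rewrite !scaleN1r addNr addrC.
Qed.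
End Fixed.
End Theta.

Section CharacDerivations.
Variables (k : fieldType) (G : affine_group k) (M : rep_model G).
Variables (hcomm : commutative_group_scheme G) (d : nat) (x : 'I_d -> coord_ring G).
Variable p : 'I_d -> {linear coord_ring G -> k^o}.
Hypothesis xp : coordinates (counit G) x p.
Notation D := (charac_der M hcomm xp).

Lemma charac_ext (Gam : groupType) (mu nu : charac k Gam) : mu =1 nu -> mu = nu.
Proof.
case: mu nu => [f fM] [g gM] /= /funext fg; case: _ / fg in gM *.
by congr Charac; apply: Prop_irrelevance.
Qed.

Lemma charac_der_comb (Gam : groupType) (J : Type) (s : seq J) (mu : J -> charac k Gam)
    (nu : charac k Gam) (a : J -> k) i :
  (forall g, nu g = \sum_(j <- s) a j * mu j g) ->
  forall z, D i nu z = \sum_(j <- s) a j *: D i (mu j) z.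
Proof.
move=> nuE; have d1 (mu' : charac k Gam) := derivation1 (f := idfun) (charac_derM hcomm xp i mu').
apply: repA_ind => [|b y z dy dz|y z dy dz|g u].
- by rewrite d1 big1 // => j _; rewrite d1 scaler0.
- rewrite linearP /= dy dz scaler_sumr -big_split; apply: eq_bigr => j _ /=.
  by rewrite linearP /= scalerDr !scalerA [b * _]mulrC.
- rewrite charac_derM dy dz mulr_sumr mulr_suml -big_split; apply: eq_bigr => j _ /=.
  by rewrite charac_derM scalerDr -scalerAr -scalerAl.
- rewrite charac_der_gen nuE scaler_suml; apply: eq_bigr => j _.
  by rewrite charac_der_gen scalerA.
Qed.

Lemma charac_der0 (Gam : groupType) (mu : charac k Gam) i : (forall g, mu g = 0) ->
  forall z, D i mu z = 0.
Proof.
move=> mu0 z; rewrite (@charac_der_comb _ nat [::] (fun=> mu) mu (fun=> 0)) ?big_nil // => g.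
by rewrite big_nil.
Qed.

Lemma charac_der_sum (Gam : groupType) (m : nat) (mu : 'I_m -> charac k Gam) (a : 'I_m -> nat) i :
  (forall g, \sum_j sgn (a j) (mu j g) = 0) -> forall z, \sum_j sgn (a j) (D i (mu j) z) = 0.
Proof.
move=> mu0 z; have z0 : (fun _ : Gam => 0 : k) 1%g = 0 by [].
have zM (g h : Gam) : (fun _ : Gam => 0 : k) (g * h)%g = 0 + 0 by rewrite addr0.
rewrite -[RHS](@charac_der0 _ (Charac zM) i _ z) //.
rewrite (@charac_der_comb _ _ (index_enum 'I_m) mu _ (fun j => (-1) ^+ a j)) => [|g].
  by apply: eq_bigr => j _; rewrite sgnZ.
by rewrite -[LHS](mu0 g); apply: eq_bigr => j _; rewrite sgnM.
Qed.
End CharacDerivations.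

Section ChainRetraction.
Variables (k : fieldType) (X : sset).
Notation Ch := (chz k X).
Notation C n := {malg k[X n]}.

Lemma mproj_chainZ n (a : k) (c : C n) : mproj n Ch (a *: c) = a *: (mproj n Ch c : C n).
Proof.
pose f m : {additive Ch m -> Ch m} := GRing.scale a : {additive C m -> C m}.
apply: esym; apply: (@mproj_nat n Ch Ch f) => i j h y _.
by rewrite /f /= [RHS]chain_actZ.
Qed.

(* A linear projection onto the cycles, applied after the Moore projection, which
   kills the degenerate chains and preserves the homology classes. *)
Lemma chain_retraction n : exists r : {linear C n.+1 -> reduced_homology k X n.+1},
  (forall c, alt_bd (T := Ch) c = 0 -> r c = vcl c) /\
  (forall (i : 'I_n.+1) (y : C n), r (szmod_act Ch (codegen i) y) = 0).
Proof.
have [|a u v u0 v0|q [qN q0]] := @complement k (C n.+1) (fun c => alt_bd (T := Ch) c = 0).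
- exact: raddf0.
- by rewrite raddfD /= alt_bdZ u0 v0 scaler0 addr0.
pose P (c : C n.+1) : C n.+1 := mproj n.+1 Ch c - q (mproj n.+1 Ch c).
have PZ c : alt_bd (T := Ch) (P c) = 0 by apply: qN.
have lin : linear (fun c => vcl (P c)).
  move=> a u v; rewrite -vcl_linear //; congr vcl.
  have E : mproj n.+1 Ch (a *: u + v) = a *: (mproj n.+1 Ch u : C n.+1) + (mproj n.+1 Ch v : C n.+1).
    by rewrite -mproj_chainZ; apply: (raddfD (mproj n.+1 Ch)).
  have Eq (b c : C n.+1) : (a *: b + c) - q (a *: b + c) = a *: (b - q b) + (c - q c).
    by rewrite linearP scalerBr opprD addrACA.
  by rewrite /P E; apply: Eq.
have rE c : mk_linear lin c = vcl (P c) by [].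
exists (mk_linear lin); split=> [c c0|i y]; rewrite rE.
  have cm := alt_cycle_mproj c0; have cm0 := moore_cycle_alt cm.
  rewrite /P q0 // subr0; apply: (proj2 (vcl_eq cm0 c0)).
  by have [b bE] := alt_cycle_mproj_homologous c0; exists b.
rewrite /P mproj_degen raddf0 subr0; have := rE 0; rewrite raddf0 => E; rewrite [RHS]E.
by rewrite /P raddf0 raddf0 subr0.
Qed.
End ChainRetraction.

(** * Contractions on the loop algebra *)

Section LoopContractions.
Variables (k : fieldType) (G : affine_group k) (M : rep_model G) (X : sset).
Hypotheses (char0 : [pchar k] =i pred0) (hcomm : commutative_group_scheme G).
Hypotheses (Xr : reduced X) (Xsc : simply_connected X).
Variables (d : nat) (x : 'I_d -> coord_ring G).
Variable p : 'I_d -> {linear coord_ring G -> k^o}.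
Hypothesis xp : coordinates (counit G) x p.
Notation R := (coord_ring G).
Notation Ch := (chz k X).
Notation C n := {malg k[X n]}.
Notation B := (repS M (kan_loop X)).
Notation rg := (rgen M).
Notation H n := (reduced_homology k X n.+1).
Notation Hlin n := {linear reduced_homology k X n.+1 -> k^o}.

Lemma loop_dC_comp m n q (g : simplex_map n q) (f : simplex_map m n) (v : charac k (kan_loop X m)) :
  charac_comp v (sgroup_act (kan_loop X) (simplex_comp g f)) =
  charac_comp (charac_comp v (sgroup_act (kan_loop X) f)) (sgroup_act (kan_loop X) g).
Proof. by apply: charac_ext => h; rewrite /= (sgroup_laws (kan_loop X)).2. Qed.

Definition loop_dersys (i : 'I_d) : dersys k :=
  @DerSys k B (fun n => charac k (kan_loop X n))
    (fun m n f v => charac_comp v (sgroup_act (kan_loop X) f)) loop_dC_comp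
    (fun n v => charac_der M hcomm xp i v : {additive B n -> B n})
    (fun n v => charac_derM hcomm xp i v)
    (fun m n f v => charac_der_map hcomm xp (sgroup_act (kan_loop X) f) i v).

Definition retr n : {linear C n.+1 -> H n} := sval (cid (chain_retraction k X n)).

Lemma retr_cycle n c : alt_bd (T := Ch) c = 0 -> retr n c = vcl c.
Proof. by case: (svalP (cid (chain_retraction k X n))) => + _; apply. Qed.

Lemma retr_degen n i (y : C n) : retr n (szmod_act Ch (codegen i) y) = 0.
Proof. by case: (svalP (cid (chain_retraction k X n))) => _; apply. Qed.

Section Functional.
Variables (r : nat) (h : Hlin r) (i : 'I_d).

Lemma loop_characM (g g' : kan_loop X r) :
  (h (retr r (ch (g * g')%g)) : k) = h (retr r (ch g)) + h (retr r (ch g')).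
Proof. by rewrite chM !raddfD. Qed.

(** A functional on homology, extended to chains by the retraction. It is normalized because the
    retraction kills degenerate chains, and a cocycle because it kills boundaries. *)
Definition loop_charac : dC (loop_dersys i) r := Charac loop_characM.
End Functional.

Lemma loop_charac_normalized r (h : Hlin r) i : normalized (loop_charac h i).
Proof.
case: r h => // m f j q g z.
apply: charac_der0 => w /=.
by rewrite ch_act shift_codegen retr_degen raddf0.
Qed.

Section Functional2.
Variables (r : nat) (h : Hlin r) (i : 'I_d).
(** The faces of the loop group are d_1, d_2, ... on chains, and d_0 vanishes there, so the
    alternating sum is minus the boundary. *)
Lemma loop_charac_cocycle : cocycle (loop_charac h i).
Proof.
move=> n f z; apply: (charac_der_sum hcomm xp) => g.
set g' := sgroup_act (kan_loop X) f g.
have b0 : alt_bd (T := Ch) (alt_bd (T := Ch) (ch g')) = 0 by apply: alt_bdK.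
have r0 : retr r (alt_bd (T := Ch) (ch g')) = 0.
  rewrite retr_cycle //; have v0 := retr_cycle (raddf0 (@alt_bd Ch r)); rewrite raddf0 in v0; rewrite [RHS]v0.
  by apply: (proj2 (vcl_eq b0 (raddf0 _))); exists (ch g'); rewrite subr0.
have := congr1 h r0; rewrite raddf0 /alt_bd big_ord_recl [X in sgn _ X]ch_face0 sgn0 add0r.
rewrite (raddf_sum (retr r)) (raddf_sum h) => /(congr1 -%R).
rewrite oppr0 -[LHS]sumrN => E; rewrite -[RHS]E; apply: eq_bigr => j _.
rewrite -[LHS]/(sgn j (h (retr r (ch (kan_act (coface j) g'))) : k)) ch_face.
set y := zface _ _.
have E2 : retr r (sgn (V := Ch r.+1) (lift ord0 j) y) = - sgn j (retr r y).
  by rewrite -sgnS; apply: (raddf_sgn (retr r)).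
transitivity (- h (- sgn j (retr r y))); last by congr (- h _); rewrite -E2.
by rewrite (raddfN h) opprK; apply/esym/(raddf_sgn h).
Qed.

Notation contr := (contr (loop_dersys i) (loop_charac h i)).

(** The derivative of x_j(g) is h(g) times (D_i x_j)(g). Restricted to a vertex it is constant
    modulo boundaries by [aug_mbd0], with the value p_i(x_j) at the unit. *)
Lemma contr_rgen_const (g : kan_obj X r) j :
  mbd (T := B) (contr r 0 (rg g (x j)) - (h (retr r (ch g)) *+ (i == j))%:A : B 0%N).
Proof.
rewrite [contr _ _ _](contrE (Q := loop_dersys i) (loop_charac h i) (m := 0)).
have -> : front r (0 + r) = simplex_id r.
  by apply: simplex_val_eq => a; rewrite frontE; apply/minn_idPl; rewrite -ltnS.
set mu := dC_map _ _ _.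
have -> : dD (loop_dersys i) mu (rg g (x j)) = (mu : charac k _) g *: rg g (hopf_der xp i (x j)).
  exact: charac_der_gen.
have -> : (mu : charac k _) g = h (retr r (ch g)).
  by rewrite /mu /= (sgroup_laws (kan_loop X)).1.
have -> : scalg_act B (back r 0 (0 + r)) (h (retr r (ch g)) *: rg g (hopf_der xp i (x j))) =
    h (retr r (ch g)) *: rg (kan_act (back r 0 r) g) (hopf_der xp i (x j)).
  by rewrite linearZ_LR; congr (_ *: _); apply: repS_gen.
have [_ pE _ _] := xp; have := mbdZ (A := B) (h (retr r (ch g)) : k) (aug_mbd0 (M := M) char0 hcomm Xr Xsc (rg (kan_act (back r 0 r) g) (hopf_der xp i (x j)))).
rewrite rep_aug_gen eps_hopf_der pE scalerBr scalerA.
by rewrite mulr_natr.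
Qed.

(** A front face of smaller dimension factors through a face of g, where the chain of a flat element
    vanishes. *)
Lemma contr_rgen_flat q m (g : kan_obj X q) u : (0 < m)%N -> flat k g ->
  contr q m (rg g u) = 0.
Proof.
have [qm|qm] := eqVneq q (m + r)%N; last by rewrite [contr _ _ _]contr_dim.
subst q; case: m g => // m g _ gf.
rewrite [contr _ _ _](contrE (Q := loop_dersys i) (loop_charac h i)).
set mu := dC_map _ _ _.
have -> : dD (loop_dersys i) mu (rg g u) = (mu : charac k _) g *: rg g (hopf_der xp i u).
  exact: charac_der_gen.
have -> : (mu : charac k _) g = 0; last by rewrite scale0r raddf0.
rewrite /mu /=.
have -> : front r (m.+1 + r) = simplex_comp (coface (inord (m + r).+1)) (front r (m + r)).
  by rewrite front_coface_gt //; lia.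
rewrite (sgroup_laws (kan_loop X)).2 ch_act ch_face gf !raddf0 //.
Qed.
End Functional2.
End LoopContractions.

(* What is used of the free algebra and of the ideal defining Sym; proofs over a
   variable of this type cannot unfold the monoid algebra. *)
Record sym_model (k : fieldType) (V : nat -> lmodType k) := SymModel {
  symT : lalgType k;
  letter : {n : nat & V n} -> symT;
  symI : submodClosed symT;
  symZr : forall a (P Q : symT), P * (a *: Q) = a *: (P * Q);
  symIM : forall P Q R, Q \in symI -> P * Q * R \in symI;
  symI_linear : forall n a (u v : V n),
    letter (Tagged V (a *: u + v)) - (a *: letter (Tagged V u) + letter (Tagged V v)) \in symI;
  symI_comm : forall l l' : {n : nat & V n},
    letter l * letter l' - (-1) ^+ (tag l * tag l') *: (letter l' * letter l) \in symI;
  symI_min : forall J : symT -> Prop, J 0 -> (forall a P Q, J P -> J Q -> J (a *: P + Q)) ->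
    (forall P Q R, J Q -> J (P * Q * R)) ->
    (forall n a (u v : V n),
      J (letter (Tagged V (a *: u + v)) - (a *: letter (Tagged V u) + letter (Tagged V v)))) ->
    (forall l l' : {n : nat & V n},
      J (letter l * letter l' - (-1) ^+ (tag l * tag l') *: (letter l' * letter l))) ->
    forall P, P \in symI -> J P;
  sym_expand : forall P, exists s : seq (k * seq {n : nat & V n}),
    P = \sum_(a <- s) a.1 *: foldr (fun l Q => letter l * Q) 1 a.2;
  sym_ext : forall (W : lmodType k) (f : seq {n : nat & V n} -> W),
    exists g : {linear symT -> W}, forall w, g (foldr (fun l Q => letter l * Q) 1 w) = f w
}.
Arguments symI {k V} s.
Arguments letter {k V} s l.

(** * Free models of the symmetric algebra *)

Section FreeModel.
Variables (k : fieldType) (V : nat -> lmodType k).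
Notation L := {n : nat & V n}.
Notation T := (sym_free V : lalgType k).

Lemma free_symZr a (P Q : T) : P * (a *: Q) = a *: (P * Q).
Proof.
have [z [zl zr]] : exists z : T, (forall R : T, z * R = a *: R) /\ (forall R : T, R * z = a *: R).
  exists (<< a *g (mone : {fmonom L}) >> : sym_free V); split=> R; first exact: mul_malgC.
  transitivity (fgmul R << a *g (mone : {fmonom L}) >>); first by [].
  rewrite fgmulgU [in RHS](monalgE R) scaler_sumr; apply: eq_bigr => m _.
  by rewrite mulm1; apply/malgP => y; rewrite mcoeffZ !mcoeffU mulrC mulrnAr.
by rewrite -zl mulrA zr scalerAl.
Qed.

Definition free_word (w : seq L) : T := foldr (fun l Q => (<< fmu l >> : T) * Q) 1 w.

Lemma free_wordE (m : {fmonom L}) : << m >> = free_word m.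
Proof.
case: m => s; elim: s => [|l s IHs] /=.
  by rewrite -[RHS]/(<< (mone : {fmonom L}) >> : sym_free V); congr << _ >>; apply: val_inj; rewrite /= fm1.
rewrite -[RHS]/((<< fmu l >> : sym_free V) * free_word s) -IHs malgM_def fgmulUU mulr1; congr << _ >>; apply: val_inj.
by rewrite /= fmM fmU.
Qed.

Lemma free_expand (P : T) : exists s : seq (k * seq L), P = \sum_(a <- s) a.1 *: free_word a.2.
Proof.
exists [seq (mcoeff m P, (m : seq L)) | m <- msupp P]; rewrite big_map.
by rewrite [LHS]malg_expand; apply: eq_bigr => m _; rewrite -free_wordE.
Qed.

Lemma free_ext (W : lmodType k) (f : seq L -> W) : exists g : {linear T -> W}, forall w, g (free_word w) = f w.
Proof.
exists (lin_ext (fun m : {fmonom L} => f m)) => w.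
by rewrite -[w]/(FMonom w : seq L) -free_wordE; apply: (lin_extU (K := {fmonom L}) (fun m => f m)).
Qed.

Lemma free_symIM (P Q R : T) : Q \in @sym_ideal k V -> P * Q * R \in @sym_ideal k V.
Proof.
move=> /asboolP QI; apply/asboolP => I Ii Ir.
by case: (Ii) => _; apply; apply: QI.
Qed.

Lemma free_symI_rel r : sym_rel r -> r \in @sym_ideal k V.
Proof. by move=> rr; apply/asboolP => I _; apply. Qed.

Lemma free_symI_min (J : T -> Prop) : J 0 -> (forall a P Q, J P -> J Q -> J (a *: P + Q)) ->
    (forall P Q R, J Q -> J (P * Q * R)) -> (forall r : sym_free V, sym_rel r -> J r) ->
  forall P, P \in @sym_ideal k V -> J P.
Proof.
move=> J0 JL JM Jr P /asboolP/(_ (fun Q => `[< J Q >])) H; apply/asboolP; apply: H.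
  split; first by split=> [|a Q R /asboolP JQ /asboolP JR]; apply/asboolP => //; apply: JL.
  by move=> Q R S /asboolP JS; apply/asboolP; apply: JM.
by move=> r rr; apply/asboolP; apply: Jr.
Qed.

Definition free_model : sym_model V.
Proof.
refine (@SymModel k V T (fun l => << fmu l >>) (@sym_ideal k V) free_symZr free_symIM
  (fun n a u v => free_symI_rel (SymLinear a u v)) _ _ free_expand free_ext).
  by case=> n v [n' v']; apply: free_symI_rel (SymComm v v').
move=> J J0 JL JM Jlin Jcomm; apply: free_symI_min => // r [n a u v|n n' u v]; first exact: Jlin.
exact: (Jcomm (Tagged V u) (Tagged V v)).
Defined.
End FreeModel.

(** * Words, partial derivatives and Euler's formula in Sym *)

Section Words.
Variables (k : fieldType) (V : nat -> lmodType k) (S : sym_model V).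
Notation L := {n : nat & V n}.
Notation T := (symT S).
Notation letter := (letter S).
Notation SI P := (P \in symI S).

Definition wd (w : seq L) : T := foldr (fun l Q => letter l * Q) 1 w.

Lemma wd_cons l w : wd (l :: w) = letter l * wd w. Proof. by []. Qed.

Lemma symZl a (P Q : T) : (a *: P) * Q = a *: (P * Q).
Proof. by rewrite scalerAl. Qed.

Lemma wd_cat u w : wd (u ++ w) = wd u * wd w.
Proof. by elim: u => [|l u IHu]; [rewrite mul1r | rewrite cat_cons !wd_cons IHu mulrA]. Qed.

Definition wext (W : lmodType k) (f : seq L -> W) : {linear T -> W} := sval (cid (@sym_ext k V S W f)).

Lemma wextE (W : lmodType k) (f : seq L -> W) w : wext f (wd w) = f w.
Proof. exact: (svalP (cid (@sym_ext k V S W f))). Qed.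

Definition wdeg (w : seq L) : nat := sumn [seq tag l | l <- w].

Lemma SIMl a P : SI P -> SI (a * P).
Proof. by move=> PI; rewrite -[_ * _]mulr1; apply: symIM. Qed.
Lemma SIMr b P : SI P -> SI (P * b).
Proof. by move=> PI; rewrite -[P]mul1r; apply: symIM. Qed.

Lemma SI_eq (P Q : T) : SI P -> P = Q -> SI Q. Proof. by move=> ? <-. Qed.

Lemma SIN (P : T) : SI P -> SI (- P). Proof. by rewrite -scaleN1r; apply: rpredZ. Qed.

Lemma SI_letter0 n : SI (letter (Tagged V (0 : V n))).
Proof.
have := symI_linear S 1 (0 : V n) 0; rewrite !scale1r addr0 opprD addrA subrr add0r => /SIN.
by rewrite opprK.
Qed.

Lemma SI_sum n (I : Type) (s : seq I) (a : I -> k) (v : I -> V n) :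
  SI (letter (Tagged V (\sum_(i <- s) a i *: v i)) - \sum_(i <- s) a i *: letter (Tagged V (v i))).
Proof.
elim: s => [|i s IHs]; first by rewrite !big_nil subr0 SI_letter0.
rewrite !big_cons; apply: SI_eq (rpredD (symI_linear S (a i) (v i) (\sum_(i <- s) a i *: v i)) IHs) _.
by rewrite !opprD !addrA subrK.
Qed.

Section Contraction.
Variable t : {n : nat & (V n * {linear V n -> k^o})%type}.

(** The functional of t, extended by 0 to letters of other degrees; the vector in t is its partner
    in Euler's formula. *)
Definition ev (l : L) : k := @untag nat V k 0 (tag t) (fun v => (tagged t).2 v : k) l.

Fixpoint iota_word (w : seq L) : T :=
  if w is l :: w' then ev l *: wd w' + sgn (tag t * tag l) (letter l * iota_word w') else 0.

Definition iota_sym : {linear T -> T} := wext iota_word.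

Lemma iota_wd w : iota_sym (wd w) = iota_word w.
Proof. exact: wextE. Qed.
End Contraction.

(** A generalized inverse of the map from k^s to W takes the place of a basis of the span of s: the
    s_t may be dependent, and the identity holds all the same. *)
Lemma frame (W : lmodType k) (s : seq W) : exists f : nat -> {linear W -> k^o},
  forall v, v \in s -> v = \sum_(t < size s) (f t v : k) *: s`_t.
Proof.
have lin : linear (fun c : {ffun 'I_(size s) -> k^o} => \sum_(t < size s) (c t : k) *: s`_t).
  move=> a b c; rewrite scaler_sumr -big_split; apply: eq_bigr => t _ /=.
  by rewrite !ffunE scalerDl scalerA.
have [g gE] := generalized_inverse (mk_linear lin).
have lin2 t : linear (fun v => if insub t is Some i then (g v i : k^o) else 0).
  move=> a u v; case: insub => [i|]; last by rewrite scaler0 addr0.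
  by rewrite linearP !ffunE.
exists (fun t => mk_linear (lin2 t)) => v vs.
have ls : (index v s < size s)%N by rewrite index_mem.
have vE : v = mk_linear lin [ffun t => (t == Ordinal ls)%:R].
  rewrite -[RHS]/(\sum_(t < size s) _ *: _) (bigD1 (Ordinal ls)) //= ffunE eqxx scale1r.
  by rewrite nth_index // big1 ?addr0 // => i /negPf il; rewrite ffunE il scale0r.
rewrite [LHS]vE -gE -vE -[LHS]/(\sum_(t < size s) _ *: _); apply: eq_bigr => t _.
by congr (_ *: _); rewrite -[RHS]/(if insub (val t) is Some i then (g v i : k) else 0) valK.
Qed.

Lemma letters_frame (Ls : seq L) : exists F : seq {n : nat & (V n * {linear V n -> k^o})%type},
  forall l, l \in Ls ->
    SI (letter l - \sum_(t <- F) ev t l *: letter (Tagged V (tagged t).1)).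
Proof.
pose s n := [seq @untag nat V (V n) 0 n id l | l <- Ls].
pose f n := sval (cid (frame (s n))); pose fE n := svalP (cid (frame (s n))).
pose F := [seq Tagged (fun n => (V n * {linear V n -> k^o})%type) ((s n)`_t, f n t) |
  n <- undup [seq tag l | l <- Ls], t <- iota 0 (size Ls)].
exists F => -[n v] ls.
have -> : \sum_(t <- F) ev t (Tagged V v) *: letter (Tagged V (tagged t).1) =
    \sum_(t < size Ls) (f n t v : k) *: letter (Tagged V (s n)`_t).
  rewrite /F big_allpairs_dep /= (bigD1_seq n) ?undup_uniq ?mem_undup //=; last first.
    exact: (map_f (fun l : L => tag l) ls).
  rewrite [X in _ + X]big1 ?addr0 => [|n' n'n]; last first.
    rewrite big1 // => t _; rewrite /ev /untag /=.
    by case: eqP => [e|_]; [rewrite e eqxx in n'n | rewrite scale0r].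
  rewrite -[size Ls]subn0 -/(index_iota 0 (size Ls)) big_mkord subn0; apply: eq_bigr => t _.
  by rewrite /ev /untag /=; case: eqP => // e; rewrite [e]eq_axiomK.
have vs : v \in s n.
  apply/mapP; exists (Tagged V v) => //; rewrite /untag /=.
  by case: eqP => // e; rewrite [e]eq_axiomK.
have sz : size Ls = size (s n) by rewrite size_map.
rewrite sz {1}(fE n v vs); exact: SI_sum.
Qed.

(** Induction on the word: graded commutativity carries e_t past the letter l, and its sign cancels
    the one in [iota_word]. *)
Lemma euler_word (F : seq {n : nat & (V n * {linear V n -> k^o})%type}) (w : seq L) :
  (forall l, l \in w -> SI (letter l - \sum_(t <- F) ev t l *: letter (Tagged V (tagged t).1))) ->
  SI (\sum_(t <- F) letter (Tagged V (tagged t).1) * iota_word t w - (size w)%:R *: wd w).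
Proof.
elim: w => [|l w IHw] wF.
  by rewrite scale0r subr0 big1 ?rpred0 // => t _; rewrite /= mulr0.
have /IHw {}IHw l' : l' \in w -> SI (letter l' - \sum_(t <- F) ev t l' *: letter (Tagged V (tagged t).1)).
  by move=> l'w; apply: wF; rewrite inE l'w orbT.
have lF := wF l (mem_head _ _).
set e := fun t : {n : nat & (V n * {linear V n -> k^o})%type} => letter (Tagged V (tagged t).1) in IHw lF *.
have C1 t : SI (e t * sgn (tag t * tag l) (letter l * iota_word t w) - letter l * (e t * iota_word t w)).
  have := SIMr (iota_word t w) (symI_comm S (Tagged V (tagged t).1) l).
  rewrite -[tag (Tagged _ _)]/(tag t) mulrBl symZl => /(rpredZ ((-1) ^+ (tag t * tag l))).
  rewrite scalerBr scalerA -exprMn mulrNN mulr1 expr1n scale1r sgnZ symZr.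
  by rewrite !mulrA.
have C2 : SI (\sum_(t <- F) (e t * sgn (tag t * tag l) (letter l * iota_word t w) - letter l * (e t * iota_word t w))).
  by apply: rpred_sum => t _; apply: C1.
have lF' := SIN lF.
apply: SI_eq (rpredD (rpredD C2 (SIMl (letter l) IHw)) (SIMr (wd w) lF')) _.
rewrite sumrB -mulr_sumr mulrBr opprB mulrBl mulr_suml.
have -> : \sum_(t <- F) letter (Tagged V (tagged t).1) * iota_word t (l :: w) =
    \sum_(t <- F) ev t l *: e t * wd w + \sum_(t <- F) e t * sgn (tag t * tag l) (letter l * iota_word t w).
  by rewrite -big_split; apply: eq_bigr => t _; rewrite /= mulrDr symZr -symZl.
rewrite symZr (mulrS 1 (size w)) scalerDl scale1r.
by zmodu.
Qed.
End Words.

(** * From words to shuffle products *)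

Section WordProducts.
Variables (k : fieldType) (V : nat -> lmodType k) (S : sym_model V) (A : scalg k).
Notation L := {n : nat & V n}.
Notation T := (symT S).
Variable rep : forall n, V n -> A n.
Hypothesis rep_cycle : forall n (v : V n), moore_cycle (T := A) (rep v).
Hypothesis rep_linear : forall n a (u v : V n),
  mbd (T := A) (rep (a *: u + v) - (a *: rep u + rep v) : A n).

Definition unit_in N : A N := if N is 0 then 1 else 0.

(** The shuffle product of the representatives of the letters. The degree N is a parameter and the
    value is 0 unless it is the degree of w, so sums of degrees need no transport. *)
Fixpoint wc N (w : seq L) : A N :=
  if w is l :: w' then msh N A (rep (tagged l)) (wc (N - tag l) w') else unit_in N.

Lemma msh1r n (x : A n) : msh n A x (1 : A 0%N) = x.
Proof. by rewrite msh_comm msh1l muln0. Qed.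

Lemma wc_cons N l w q : N = (tag l + q)%N -> wc N (l :: w) = msh N A (rep (tagged l)) (wc q w).
Proof. by move=> Nq; rewrite /= (_ : (N - tag l)%N = q) // Nq addKn. Qed.

Lemma wc_dim N w : N != wdeg w -> wc N w = 0.
Proof.
elim: w N => [|l w IHw] N; first by case: N.
rewrite -[wdeg _]/(tag l + wdeg w)%N /= => Nw.
have [lN|lN] := leqP (tag l) N; last by rewrite msh_dim //; lia.
rewrite IHw; last by lia.
by rewrite msh_comm msh0l sgn0.
Qed.

Lemma wc_cycle N w : moore_cycle (T := A) (wc N w).
Proof.
elim: w N => [|l w IHw] N; last exact: msh_cycle.
by case: N => [|N]; [ | apply: moore_cycle0].
Qed.

Lemma wc_cat N u w q : N = (wdeg u + q)%N ->
  wc N (u ++ w) = msh N A (wc (wdeg u) u) (wc q w).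
Proof.
elim: u N => [|l u IHu] N; first by rewrite add0n => -> /=; rewrite msh1l.
rewrite -[wdeg _]/(tag l + wdeg u)%N => Nq.
rewrite cat_cons (@wc_cons N l (u ++ w) (wdeg u + q)) ?addnA // (IHu _ erefl).
by rewrite (@wc_cons (tag l + wdeg u) l u (wdeg u)) // (@msh_assoc k N A _ _ _ (tag l + wdeg u)).
Qed.

Definition Phi N : {linear T -> A N} := wext S (wc N).

Lemma PhiE N w : Phi N (wd S w) = wc N w.
Proof. exact: wextE. Qed.

Lemma PhiL N a P Q : Phi N (a *: P + Q) = a *: Phi N P + Phi N Q.
Proof. exact: linearP. Qed.

Lemma PhiB N P Q : Phi N (P - Q) = Phi N P - Phi N Q.
Proof. exact: raddfB. Qed.

Lemma PhiZ N a P : Phi N (a *: P) = a *: Phi N P.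
Proof. exact: linearZ_LR. Qed.

Lemma Phi00 N : Phi N 0 = 0.
Proof. exact: raddf0. Qed.

Lemma wdeg_cat (u w : seq L) : wdeg (u ++ w) = (wdeg u + wdeg w)%N.
Proof. by rewrite /wdeg map_cat sumn_cat. Qed.

Lemma sym_ind (Pr : T -> Prop) : Pr 0 -> (forall a P Q, Pr P -> Pr Q -> Pr (a *: P + Q)) ->
  (forall w, Pr (wd S w)) -> forall P, Pr P.
Proof.
move=> P0 PL Pw P; have [s ->] := sym_expand P.
by elim: s => [|a s IHs]; rewrite ?big_nil ?big_cons //; apply: PL => //; apply: Pw.
Qed.

Lemma mshZr n p q a (x : A p) (y : A q) : msh n A x (a *: y) = a *: msh n A x y.
Proof. by rewrite msh_comm mshZl scale_sgn -msh_comm. Qed.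

Lemma msh0r n p q (x : A p) : msh n A x (0 : A q) = 0.
Proof. by rewrite msh_comm msh0l sgn0. Qed.

Lemma Phi_mull N u q Q : N = (wdeg u + q)%N ->
  Phi N (wd S u * Q) = msh N A (wc (wdeg u) u) (Phi q Q).
Proof.
move=> Nq; move: Q; apply: sym_ind => [|a P Q dP dQ|w].
- by rewrite mulr0 !Phi00 msh0r.
- by rewrite mulrDr symZr !PhiL dP dQ mshDr mshZr.
- by rewrite -wd_cat !PhiE; apply: wc_cat.
Qed.

Lemma Phi_mulr N w q Q : N = (q + wdeg w)%N ->
  Phi N (Q * wd S w) = msh N A (Phi q Q) (wc (wdeg w) w).
Proof.
move=> Nq; move: Q; apply: sym_ind => [|a P Q dP dQ|u].
- by rewrite mul0r !Phi00 msh0l.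
- by rewrite mulrDl symZl !PhiL dP dQ mshDl mshZl.
rewrite -wd_cat !PhiE; have [uq|uq] := eqVneq (wdeg u) q.
  by subst q; apply: wc_cat.
rewrite [wc q u]wc_dim 1?eq_sym // msh0l wc_dim // wdeg_cat; lia.
Qed.

Lemma Phi_mull0 N u Q : (N < wdeg u)%N -> Phi N (wd S u * Q) = 0.
Proof.
move=> Nu; move: Q; apply: sym_ind => [|a P Q dP dQ|w].
- by rewrite mulr0 Phi00.
- by rewrite mulrDr symZr PhiL dP dQ scaler0 addr0.
- by rewrite -wd_cat PhiE wc_dim // wdeg_cat; lia.
Qed.

Lemma Phi_mulr0 N u Q : (N < wdeg u)%N -> Phi N (Q * wd S u) = 0.
Proof.
move=> Nu; move: Q; apply: sym_ind => [|a P Q dP dQ|w].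
- by rewrite mul0r Phi00.
- by rewrite mulrDl symZl PhiL dP dQ scaler0 addr0.
- by rewrite -wd_cat PhiE wc_dim // wdeg_cat; lia.
Qed.

Definition Phi_null (P : T) := forall N, mbd (T := A) (Phi N P : A N).

Lemma Phi_nullL a P Q : Phi_null P -> Phi_null Q -> Phi_null (a *: P + Q).
Proof. by move=> P0 Q0 N; rewrite PhiL; apply: mbdD; [apply: mbdZ |]. Qed.

Lemma Phi_null_wdl u Q : Phi_null Q -> Phi_null (wd S u * Q).
Proof.
move=> Q0 N; have [uN|Nu] := leqP (wdeg u) N; last by rewrite Phi_mull0 //; apply: mbd0.
rewrite (@Phi_mull N u (N - wdeg u)) ?subnKC //.
by apply: msh_mbdr => //; apply: wc_cycle.
Qed.

Lemma Phi_null_wdr u Q : Phi_null Q -> Phi_null (Q * wd S u).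
Proof.
move=> Q0 N; have [uN|Nu] := leqP (wdeg u) N; last by rewrite Phi_mulr0 //; apply: mbd0.
rewrite (@Phi_mulr N u (N - wdeg u)) ?subnK //.
by apply: msh_mbdl => //; apply: wc_cycle.
Qed.

Lemma Phi_letter N l : Phi N (letter S l) = wc N [:: l].
Proof. by rewrite -[letter S l]mulr1 -PhiE. Qed.

Lemma wc1 n (v : V n) : wc n [:: Tagged V v] = rep v.
Proof. by rewrite (@wc_cons n (Tagged V v) [::] 0%N) ?addn0 //= msh1r. Qed.

Lemma symI_null P : P \in symI S -> Phi_null P.
Proof.
move: P; apply: symI_min => [N|a Q R|Q R U R0|n a u v N|[p u] [q v] N].
- by rewrite Phi00; apply: mbd0.
- exact: Phi_nullL.
- have {}R0 : Phi_null (Q * R).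
    move: Q; apply: sym_ind => [N|a P Q P0 Q0|w]; last exact: Phi_null_wdl.
      by rewrite mul0r Phi00; apply: mbd0.
    by rewrite mulrDl symZl; apply: Phi_nullL.
  move: U; apply: sym_ind => [N|a P' Q' P0 Q0|w]; last exact: Phi_null_wdr.
    by rewrite mulr0 Phi00; apply: mbd0.
  by rewrite mulrDr symZr; apply: Phi_nullL.
- rewrite PhiB PhiL !Phi_letter; have [->|nN] := eqVneq N n.
    by rewrite !wc1; apply: rep_linear.
  have z (l : L) : tag l = n -> wc N [:: l] = 0.
    by move=> ln; rewrite wc_dim // /wdeg /= addn0 ln.
  by rewrite !z // scaler0 addr0 subr0; apply: mbd0.
- rewrite PhiB PhiZ.
  have E (l l' : L) : letter S l * letter S l' = wd S [:: l; l'] by rewrite !wd_cons mulr1.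
  rewrite !E !PhiE; have [->|nN] := eqVneq N (p + q)%N; last first.
    have w0 (l l' : L) : (tag l + tag l' = p + q)%N -> wc N [:: l; l'] = 0.
      by move=> ll'; rewrite wc_dim // /wdeg /= addn0 ll'.
    by rewrite !w0 ?scaler0 ?subr0 //=; [apply: mbd0 | rewrite addnC].
  rewrite (@wc_cons _ (Tagged V u) _ q) // wc1 (@wc_cons _ (Tagged V v) _ p) 1?addnC // wc1.
  rewrite -sgnZ [X in X - _]msh_comm subrr; exact: mbd0.
Qed.

(** What the cap product with a cocycle provides: an operator on A that corresponds, modulo
    boundaries, to the partial derivative [iota_sym] on words. *)
Record contraction (t : {n : nat & (V n * {linear V n -> k^o})%type}) (c : forall p m, A p -> A m) := {
  c_linear : forall p m, linear (c p m);
  c_dim : forall p m z, p != (m + tag t)%N -> c p m z = 0;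
  c_msh : forall n m p q (x : A p) (y : A q), n = (m + tag t)%N -> n = (p + q)%N ->
    c n m (msh n A x y) =
    msh m A (c p (p - tag t)%N x) y + sgn (tag t * p) (msh m A x (c q (q - tag t)%N y));
  c_mbd : forall m z, mbd (T := A) z -> mbd (T := A) (c (m + tag t)%N m z : A m);
  c_rep : forall (l : L) m, (0 < m)%N -> mbd (T := A) (c (tag l) m (rep (tagged l)) : A m);
  c_rep0 : forall l : L, mbd (T := A) (c (tag l) 0%N (rep (tagged l)) - (ev t l)%:A : A 0%N)
}.

Lemma ev_dim t (l : L) : tag l != tag t -> ev t l = 0.
Proof. by rewrite /ev /untag; case: eqP. Qed.

Lemma mshBr n p q (x : A p) (y z : A q) : msh n A x (y - z) = msh n A x y - msh n A x z.
Proof. by rewrite mshDr -scaleN1r mshZr scaleN1r. Qed.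

Lemma mshBl n p q (x y : A p) (z : A q) : msh n A (x - y) z = msh n A x z - msh n A y z.
Proof. by rewrite mshDl -scaleN1r mshZl scaleN1r. Qed.

Lemma Phi_letter_mul N l q Q : N = (tag l + q)%N ->
  Phi N (letter S l * Q) = msh N A (rep (tagged l)) (Phi q Q).
Proof.
move=> Nq; move: Q; apply: sym_ind => [|a P Q dP dQ|w].
- by rewrite mulr0 !Phi00 msh0r.
- by rewrite mulrDr symZr !PhiL dP dQ mshDr mshZr.
- by rewrite -wd_cons !PhiE; apply: wc_cons.
Qed.

Section Contract.
Variables (t : {n : nat & (V n * {linear V n -> k^o})%type}) (c : forall p m, A p -> A m).
Hypothesis ct : contraction t c.
Notation r := (tag t).

Lemma contr0 p m : c m (0 : A p) = 0.
Proof. by have := c_linear ct m (-1) (0 : A p) 0; rewrite !scaleN1r oppr0 addr0 addNr. Qed.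

(** The Leibniz rule for c reproduces the recursion of [iota_word]; the errors are shuffle products
    of a boundary with a cycle. *)
Lemma contraction_wc w : forall m p, p = (m + r)%N ->
  mbd (T := A) (c m (wc p w) - Phi m (iota_word S t w) : A m).
Proof.
elim: w => [|l w IHw] m p pm.
  rewrite Phi00 subr0; case: p pm => [|p] pm; last by rewrite /= contr0; apply: mbd0.
  have m0 : m = 0%N by lia.
  (* The Leibniz rule for 1 times 1 gives c(1) = c(1) + c(1). *)
  subst m; have := c_msh ct (1 : A 0%N) (1 : A 0%N) pm (esym (addn0 0)).
  rewrite muln0 sub0n !msh1l !msh1r /sgn /= => /eqP; rewrite -subr_eq0 opprD addrA subrr sub0r oppr_eq0.
  by move=> /eqP ->; apply: mbd0.
have -> : Phi m (iota_word S t (l :: w)) = ev t l *: wc m w + sgn (r * tag l) (Phi m (letter S l * iota_word S t w)).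
  by rewrite /= PhiL PhiE (raddf_sgn (Phi m)).
have [lp|pl] := leqP (tag l) p; last first.
  rewrite wc_dim ?contr0; last by rewrite -[wdeg _]/(tag l + wdeg w)%N; lia.
  rewrite ev_dim; last by apply/eqP => e; rewrite e pm ltnNge leq_addl in pl.
  rewrite -[letter S l]mulr1 -[letter S l * 1]/(wd S [:: l]) Phi_mull0; last first.
    by rewrite /wdeg /=; lia.
  by rewrite scale0r sgn0 addr0 subr0; apply: mbd0.
have pq : p = (tag l + (p - tag l))%N by rewrite subnKC.
set q := (p - tag l)%N in pq; rewrite (wc_cons w pq) (c_msh ct _ _ pm pq) opprD addrACA.
apply: mbdD; last rewrite -sgnB.
  have [lr|lr] := eqVneq (tag l) r.
    have qm : q = m by lia.
    have z : (tag l - r)%N = 0%N by lia.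
    rewrite qm z -[ev t l *: wc m w]msh1l mshZr -mshZl -mshBl.
    by apply: msh_mbdl; [apply: c_rep0 | apply: wc_cycle].
  rewrite ev_dim // scale0r subr0; have [rl|rl] := ltnP r (tag l).
    by apply: msh_mbdl; [apply: (c_rep ct); rewrite subn_gt0 | apply: wc_cycle].
  by rewrite (c_dim ct) ?msh0l; [apply: mbd0 | lia].
apply: mbd_sgn; have [rq|qr] := leqP r q.
  rewrite (@Phi_letter_mul m l (q - r)) -?mshBr; last by lia.
  by apply: msh_mbdr => //; apply: IHw; rewrite subnK.
rewrite (c_dim ct) ?msh0r; last by lia.
rewrite -[letter S l]mulr1 -[letter S l * 1]/(wd S [:: l]) Phi_mull0; last first.
  by rewrite /wdeg /=; lia.
by rewrite subr0; apply: mbd0.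
Qed.

Lemma contraction_null P : Phi_null P -> Phi_null (iota_sym S t P).
Proof.
have E : forall P m p, p = (m + r)%N -> mbd (T := A) (c m (Phi p P) - Phi m (iota_sym S t P) : A m).
  apply: sym_ind => [m p pm|a Q R dQ dR m p pm|w m p pm].
  - by rewrite (raddf0 (iota_sym S t)) !Phi00 contr0 subr0; apply: mbd0.
  - rewrite (linearP (iota_sym S t)) !PhiL (c_linear ct); have := mbdD (mbdZ a (dQ m p pm)) (dR m p pm).
    by congr mbd; rewrite scalerBr; zmodu.
  - by rewrite PhiE iota_wd; apply: contraction_wc.
move=> P0 m; have := mbdB (c_mbd ct (P0 (m + r)%N)) (E P m _ erefl).
by rewrite opprB addrC subrK.
Qed.
End Contract.

Definition short j (P : T) := exists2 s : seq (k * seq L),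
  (forall a, a \in s -> (size a.2 <= j)%N) & P = \sum_(a <- s) a.1 *: wd S a.2.

Lemma shortL j a P Q : short j P -> short j Q -> short j (a *: P + Q).
Proof.
move=> [s sj ->] [s' s'j ->]; exists ([seq (a * b.1, b.2) | b <- s] ++ s').
  by move=> b; rewrite mem_cat => /orP[/mapP[b' /sj b'j ->] //|/s'j].
rewrite big_cat big_map scaler_sumr; congr (_ + _).
by apply: eq_bigr => b _; rewrite scalerA.
Qed.

Lemma short_wd j w : (size w <= j)%N -> short j (wd S w).
Proof. by move=> wj; exists [:: (1, w)]; [move=> a; rewrite inE => /eqP -> | rewrite big_seq1 scale1r]. Qed.

Lemma short0 j : short j 0.
Proof. by exists [::]; rewrite ?big_nil. Qed.

Lemma short_letter j l P : short j P -> short j.+1 (letter S l * P).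
Proof.
move=> [s sj ->]; exists [seq (a.1, l :: a.2) | a <- s].
  by move=> b /mapP[a /sj aj ->].
by rewrite big_map mulr_sumr; apply: eq_bigr => a _; rewrite symZr.
Qed.

Lemma iota_short t w : forall j, (size w <= j.+1)%N -> short j (iota_word S t w).
Proof.
elim: w => [|l w IHw] j; first by move=> _; apply: short0.
rewrite /= ltnS => wj; apply: shortL; first exact: short_wd.
rewrite sgnZ -[_ *: _]addr0; apply: shortL; last exact: short0.
case: j wj => [|j] wj; last by apply/short_letter/IHw.
by case: w wj {IHw} => //= _; rewrite mulr0; apply: short0.
Qed.

Hypothesis char0 : [pchar k] =i pred0.
Hypothesis contr_exists : forall t, exists c, contraction t c.
Hypothesis one_nbd : ~ mbd (T := A) (1 : A 0%N).

(** Induction on the length j + 1 of the words in P. The partial derivatives are again null and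
    shorter, hence in the ideal, so by Euler's formula the sum Q of the terms of P weighted by their
    lengths is in the ideal. Then (j + 1) P - Q is null with words of length at most j. For the
    empty word, 1 is not a boundary. *)
Lemma Phi_injective P : Phi_null P -> P \in symI S.
Proof.
have [j] : exists j, short j P.
  have [s PE] := sym_expand P; exists (\max_(a <- s) size a.2), s => // a sa; apply: (@leq_bigmax_seq _ s xpredT (fun a => size a.2)); [exact: sa | by []].
elim: j P => [|j IHj] P [s sj PE] P0.
  have P1 : P = (\sum_(a <- s) a.1) *: 1.
    rewrite PE scaler_suml big_seq [RHS]big_seq; apply: eq_bigr => a /sj.
    by rewrite leqn0 size_eq0 => /eqP ->.
  have [c0|c0] := eqVneq (\sum_(a <- s) a.1) 0; first by rewrite P1 c0 scale0r rpred0.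
  case: one_nbd; have := mbdZ (A := A) (\sum_(a <- s) a.1)^-1 (P0 0%N).
  rewrite P1 (linearZ_LR (Phi 0%N)) /= scalerA mulVf // scale1r.
  by rewrite -[1]/(wd S [::]) PhiE.
have [F FP] := letters_frame S (flatten [seq a.2 | a <- s]).
pose e (t : {n : nat & (V n * {linear V n -> k^o})%type}) := letter S (Tagged V (tagged t).1).
have iE t : iota_sym S t P = \sum_(a <- s) a.1 *: iota_word S t a.2.
  rewrite PE (raddf_sum (iota_sym S t)); apply: eq_bigr => a _.
  by rewrite /= (linearZ_LR (iota_sym S t)) /= iota_wd.
have iI t : iota_sym S t P \in symI S.
  apply: IHj; last by have [c ct] := contr_exists t; apply: (contraction_null ct).
  rewrite iE big_seq; elim/big_rec: _ => [|a Q /sj aj Qj]; first exact: short0.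
  by apply: shortL => //; apply: iota_short.
have EI : \sum_(t <- F) e t * iota_sym S t P \in symI S.
  by apply: rpred_sum => t _; apply: SIMl.
have EE : \sum_(t <- F) e t * iota_sym S t P - \sum_(a <- s) a.1 *: ((size a.2)%:R *: wd S a.2) \in symI S.
  have -> : \sum_(t <- F) e t * iota_sym S t P = \sum_(a <- s) a.1 *: \sum_(t <- F) e t * iota_word S t a.2.
    under eq_bigr do rewrite iE mulr_sumr.
    rewrite exchange_big; apply: eq_bigr => a _; rewrite scaler_sumr.
    by apply: eq_bigr => t _; rewrite symZr.
  rewrite -sumrB big_seq; apply: rpred_sum => a sa; rewrite -scalerBr; apply: rpredZ.
  apply: euler_word => l la; apply: FP; apply/flattenP; exists a.2 => //.
  exact: (map_f (fun a => a.2) sa).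
have QI := rpredD EI (SIN EE); rewrite opprB addrC subrK in QI.
set Q := \sum_(a <- s) _ in QI.
have P'I : j.+1%:R *: P - Q \in symI S.
  apply: IHj.
    have -> : j.+1%:R *: P - Q = \sum_(a <- s) ((j.+1%:R - (size a.2)%:R) * a.1) *: wd S a.2.
      rewrite PE scaler_sumr -sumrB; apply: eq_bigr => a _.
      by rewrite mulrBl scalerBl !scalerA [a.1 * _]mulrC.
    rewrite big_seq; elim/big_rec: _ => [|a R /sj aj Rj]; first exact: short0.
    move: aj; rewrite leq_eqVlt => /orP[/eqP ->|aj]; first by rewrite subrr mul0r scale0r add0r.
    by apply: shortL => //; apply: short_wd.
  rewrite -scaleN1r addrC; apply: Phi_nullL; first exact: symI_null.
  rewrite -[_ *: P]addr0; apply: Phi_nullL => // N; rewrite Phi00; exact: mbd0.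
have := rpredD P'I QI; rewrite subrK => /(rpredZ (j.+1%:R^-1)).
by rewrite scalerA mulVf ?scale1r // natr_char0.
Qed.
End WordProducts.

(** * Injectivity *)

Section LoopSymmetric.
Variables (k : fieldType) (G : affine_group k) (M : rep_model G) (X : sset).
Hypotheses (char0 : [pchar k] =i pred0) (hcomm : commutative_group_scheme G).
Hypotheses (Xr : reduced X) (Xsc : simply_connected X).
Variables (d : nat) (x : 'I_d -> coord_ring G).
Variable p : 'I_d -> {linear coord_ring G -> k^o}.
Hypothesis xp : coordinates (counit G) x p.
Notation R := (coord_ring G).
Notation eps := (counit G).
Notation B := (repS M (kan_loop X)).
Notation rg := (rgen M).
Notation H n := (reduced_homology k X n.+1).

Definition gens n : lmodType k := {ffun 'I_d -> H n}.

Lemma coord_x0 i : eps (x i) = 0.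
Proof. by case: xp. Qed.

Definition theta i n : {linear H n -> homotopy B n} :=
  sval (cid (theta_exists M char0 hcomm Xr Xsc n (coord_x0 i))).

Lemma thetaE i n (s : seq (k * kan_obj X n)) : (forall a, a \in s -> flat k a.2) ->
  theta i n (vcl (\sum_(a <- s) a.1 *: ch a.2)) = hcl (\sum_(a <- s) a.1 *: rg a.2 (x i)).
Proof. exact: (svalP (cid (theta_exists M char0 hcomm Xr Xsc n (coord_x0 i)))). Qed.

Definition loop_rep n (v : gens n) : B n := subrepr (\sum_i theta i n (v i)).

Lemma rep_cycle n (v : gens n) : moore_cycle (T := B) (loop_rep v).
Proof. by apply/moore_cyclesP/subreprP. Qed.

Lemma hcl_rep n (v : gens n) : hcl (loop_rep v) = \sum_i theta i n (v i).
Proof. exact: subreprK. Qed.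

Lemma rep_linear n a (u v : gens n) :
  mbd (T := B) (loop_rep (a *: u + v) - (a *: loop_rep u + loop_rep v) : B n).
Proof.
apply/hcl_eq; [exact: rep_cycle | |].
  by apply: moore_cycleD; [apply: moore_cycleZ |]; apply: rep_cycle.
rewrite hcl_linear ?hcl_rep; try exact: rep_cycle.
rewrite scaler_sumr -big_split; apply: eq_bigr => i _ /=.
by rewrite !ffunE linearP.
Qed.

Lemma hcl_sum n (I : Type) (r : seq I) (F : I -> B n) : (forall i, moore_cycle (T := B) (F i)) ->
  hcl (\sum_(i <- r) F i) = \sum_(i <- r) hcl (F i).
Proof.
move=> Fc; have h0 : hcl (0 : B n) = 0.
  have E := @hcl_linear k G M X n 1 0 0 (@moore_cycle0 B n) (@moore_cycle0 B n).
  rewrite scaler0 addr0 scale1r in E.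
  by apply: (addrI (hcl (0 : B n))); rewrite addr0 -E.
elim: r => [|i r IHr]; first by rewrite !big_nil.
rewrite !big_cons -IHr -[F i]scale1r hcl_linear ?scale1r //.
exact: moore_cycle_sum.
Qed.

Lemma rep_flat n (v : gens n) : exists s : 'I_d -> seq (k * kan_obj X n),
  [/\ forall i a, a \in s i -> flat k a.2,
    forall i, v i = vcl (\sum_(a <- s i) a.1 *: ch a.2)
  & mbd (T := B) (loop_rep v - \sum_i \sum_(a <- s i) a.1 *: rg a.2 (x i) : B n)].
Proof.
pose s i := sval (cid (flat_span char0 (v i))).
have sP i : (forall a, a \in s i -> flat k a.2) /\ v i = vcl (\sum_(a <- s i) a.1 *: ch a.2).
  exact: (svalP (cid (flat_span char0 (v i)))).
exists s; split=> [i|i|]; [exact: (sP i).1 | exact: (sP i).2 |].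
have cs i : moore_cycle (T := B) (\sum_(a <- s i) a.1 *: rg a.2 (x i) : B n).
  exact: (flat_comb_cycle M char0 hcomm (coord_x0 i) (sP i).1).
apply/hcl_eq; [exact: rep_cycle | exact: moore_cycle_sum |].
rewrite hcl_rep hcl_sum //; apply: eq_bigr => i _.
by rewrite {1}(sP i).2 thetaE //; apply: (sP i).1.
Qed.

(** The augmentation takes the same value on all faces of b, and d_1 b = 0. *)
Lemma one_nbd : ~ mbd (T := B) (1 : B 0%N).
Proof.
move=> [b b0 b1]; have /eqP := oner_neq0 k; apply.
have E (i : 'I_2) : rep_aug M _ (zface (T := B) i b : repA M (kan_loop X 0)) = rep_aug M _ b.
  exact: (rep_aug_map (sgroup_act (kan_loop X) (coface i))).
have E1 := E (lift ord0 ord0); rewrite -(E ord0) b0 b1 in E1.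
rewrite -[LHS](rmorph1 (rep_aug M (kan_loop X 0))); exact: etrans (esym E1) (raddf0 _).
Qed.

Lemma contr_loop_linear i r (h : {linear H r -> k^o}) q m :
  linear (contr (loop_dersys M X hcomm xp i) (loop_charac M hcomm xp h i) q m : B q -> B m).
Proof.
move=> a y z; rewrite /contr; case: eqP => _; last by rewrite scaler0 addr0.
have DL v : dD (loop_dersys M X hcomm xp i) v (a *: y + z) =
    a *: (dD (loop_dersys M X hcomm xp i) v y : B q) + dD (loop_dersys M X hcomm xp i) v z.
  exact: (linearP (charac_der M hcomm xp i v)).
by rewrite DL; exact: linearP.
Qed.

Definition gen_at i n (w : H n) : gens n := [ffun j => if j == i then w else 0].

Lemma gen_at_linear i n : linear (@gen_at i n).
Proof.
move=> a u v; apply/ffunP => j; rewrite !ffunE; case: eqP => // _.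
by rewrite scaler0 addr0.
Qed.
HB.instance Definition _ i n := GRing.isLinear.Build k (H n) (gens n) *:%R (@gen_at i n) (@gen_at_linear i n).

Lemma gen_at_sum n (v : gens n) : v = \sum_i gen_at i (v i).
Proof.
apply/ffunP => j; rewrite sum_ffunE (bigD1 j) //= ffunE eqxx big1 ?addr0 // => i ij.
by rewrite ffunE eq_sym (negPf ij).
Qed.

(** A functional on the d-fold sum of the homology has d components; the contraction is the sum over
    i of the cap product of the i-th component with the i-th derivation. *)
Lemma loop_contraction t : exists c, contraction (V := gens) (A := B) loop_rep t c.
Proof.
case: t => r [v0 f].
pose h i : {linear H r -> k^o} := f \o @gen_at i r : {linear _ -> _}.
pose ci i q m : B q -> B m := contr (loop_dersys M X hcomm xp i) (loop_charac M hcomm xp (h i) i) q m.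
have ciL i q m : linear (ci i q m) by apply: contr_loop_linear.
have ciB i q m : forall y z : B q, ci i q m (y - z) = ci i q m y - ci i q m z.
  exact: (contr_is_additive (loop_charac M hcomm xp (h i) i)).
have ci_sum i q m (I : Type) (s : seq I) (F : I -> B q) : ci i q m (\sum_(j <- s) F j) = \sum_(j <- s) ci i q m (F j).
  exact: (raddf_sum (contr (loop_dersys M X hcomm xp i) (loop_charac M hcomm xp (h i) i) q m)).
have ciZ i q m a (z : B q) : ci i q m (a *: z) = a *: ci i q m z.
  exact: (linearZ_LR (mk_linear (ciL i q m))).
have ci_mbd i m (z : B (m + r)%N) : mbd (T := B) z -> mbd (T := B) (ci i _ m z).
  move=> zm; have H := @contr_mbd k (loop_dersys M X hcomm xp i) r _ m z _ zm.
  by apply: H; apply: loop_charac_cocycle.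
exists (fun q m z => \sum_i ci i q m z); split=> /=.
- move=> q m a y z; rewrite scaler_sumr -big_split; apply: eq_bigr => i _; exact: ciL.
- move=> q m z qm; rewrite big1 // => i _; exact: (contr_dim (Q := loop_dersys M X hcomm xp i)).
- move=> n m q q' y z nm nq; rewrite msh_suml.
  have msh_sumr a b c (y' : B a) (F : 'I_d -> B b) : msh c B y' (\sum_i F i) = \sum_i msh c B y' (F i).
    by apply: (big_morph _ (fun u u' => mshDr c y' u u') (msh0r c b y')).
  rewrite msh_sumr sgn_sum -big_split; apply: eq_bigr => i _.
  exact: (contr_msh (Q := loop_dersys M X hcomm xp i) y z (loop_charac_normalized M hcomm xp (h i) i) nm nq).
- by move=> m z zm; apply: mbd_sum => i _; apply: ci_mbd.
- move=> [n v] m m0 /=; apply: mbd_sum => i _; have [nm|nm] := eqVneq n (m + r)%N; last first.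
    by rewrite [ci i _ _ _](contr_dim _ _ nm); apply: mbd0.
  subst n; have [s [sf _ vs]] := rep_flat v; have := ci_mbd i m _ vs; rewrite ciB.
  rewrite [X in _ - X](_ : _ = 0) ?subr0 // ci_sum big1 // => j _.
  rewrite ci_sum big_seq big1 // => a /sf af; rewrite ciZ.
  by rewrite [ci _ _ _ _](contr_rgen_flat M hcomm xp (h i) i (x j) m0 af) scaler0.
- move=> [n v] /=; have [nr|nr] := eqVneq n r; last first.
    rewrite ev_dim // scale0r subr0 big1 => [|i _]; first exact: mbd0.
    by apply: (contr_dim (Q := loop_dersys M X hcomm xp i)); rewrite add0n.
  subst n; have [s [sf vE vs]] := rep_flat v.
  have -> : ev (Tagged (fun n => (gens n * {linear gens n -> k^o})%type) (v0, f)) (Tagged gens v) = f v.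
    by rewrite /ev /untag /=; case: eqP => // e; rewrite [e]eq_axiomK.
  have cE i : mbd (T := B) (ci i r 0 (loop_rep v) - (h i (v i))%:A : B 0%N).
    have m1 := ci_mbd i 0%N _ vs; rewrite ciB in m1; set w := ci i _ _ (\sum_i _) in m1.
    suff m2 : mbd (T := B) (w - (h i (v i))%:A : B 0%N) by have := mbdD m1 m2; rewrite addrA subrK.
    rewrite /w ci_sum.
    have -> : (h i (v i))%:A = \sum_j \sum_(a <- s j) a.1 *: ((h i (retr k X r (ch a.2)) : k) *+ (i == j))%:A :> B 0%N.
      rewrite (bigD1 i) // [X in _ = _ + X]big1 ?addr0 => [|j ij]; last first.
        by rewrite big1 // => a _; rewrite eq_sym (negPf ij) mulr0n scale0r scaler0.
      have -> : v i = \sum_(a <- s i) a.1 *: retr k X r (ch a.2).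
        rewrite vE -retr_cycle; last exact: (flat_comb_alt (sf i)).
        rewrite (raddf_sum (retr k X r)); apply: eq_bigr => a _; exact: (linearZ_LR (retr k X r)).
      rewrite (raddf_sum (h i)) scaler_suml; apply: eq_bigr => a _.
      have hZ : h i (a.1 *: retr k X r (ch a.2)) = a.1 * (h i (retr k X r (ch a.2)) : k).
        exact: (linearZ_LR (h i)).
      by rewrite eqxx mulr1n [RHS]scalerA; exact: (congr1 (fun b : k => b%:A) hZ).
    rewrite -sumrB; apply: mbd_sum => j _; rewrite ci_sum -sumrB; apply: mbd_sum => a _.
    rewrite ciZ -scalerBr; apply: mbdZ.
    exact: (contr_rgen_const M char0 hcomm Xr Xsc xp (h i) i a.2 j).
  rewrite {2}(gen_at_sum v) (raddf_sum f) scaler_suml -sumrB.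
  by apply: mbd_sum => i _; apply: cE.
Qed.

Lemma loop_Phi_injective (S : sym_model gens) P :
  Phi_null (A := B) loop_rep P -> P \in symI S.
Proof.
apply: Phi_injective => //; [exact: rep_cycle | exact: rep_linear | exact: loop_contraction | exact: one_nbd].
Qed.
End LoopSymmetric.

Section Closure.

Lemma mproj_h_closed n : forall (T : szmod) (P : forall n, T n -> Prop),
  (forall n x y, P n x -> P n y -> P n (x - y)) ->
  (forall m n (f : simplex_map m n) x, P n x -> P m (szmod_act T f x)) ->
  (forall n (T : szmod) (P : forall n, T n -> Prop),
    (forall n x y, P n x -> P n y -> P n (x - y)) ->
    (forall m n (f : simplex_map m n) x, P n x -> P m (szmod_act T f x)) ->
    forall x, P n x -> P n (mproj n T x)) ->
  forall x, P n x -> P n.+1 (mproj_h n T x).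
Proof.
elim: n => [|n IHn] T P PB Pact mp x Px; first exact: (Pact _ _ (codegen ord0)).
rewrite mproj_hS; apply: (PB n.+2).
  apply: (mp n.+1 (zdec T) (fun n => P n.+1)) => [m|m p f|]; [exact: (PB m.+1) | exact: Pact |].
  exact: (Pact _ _ (codegen ord0)).
apply: (IHn (zdec T) (fun n => P n.+1)) => // [m|m p f]; [exact: (PB m.+1) | exact: Pact].
Qed.

Variable k : fieldType.

(** Applied to filtrations: with powers of the augmentation ideals for P, Q and S, shuffle products
    add the exponents. *)
Lemma msh_closed n : forall (A : scalg k) (P Q S : forall n, A n -> Prop),
  (forall m n (f : simplex_map m n) x, P n x -> P m (scalg_act A f x)) ->
  (forall m n (f : simplex_map m n) x, Q n x -> Q m (scalg_act A f x)) ->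
  (forall n, S n 0) -> (forall n x y, S n x -> S n y -> S n (x - y)) ->
  (forall n x y, P n x -> Q n y -> S n (x * y)) ->
  forall p q (x : A p) (y : A q), P p x -> Q q y -> S n (msh n A x y).
Proof.
elim: n => [|n IHn] A P Q S Pa Qa S0 SB PQ p q x y Px Qy.
  by case: p q x y Px Qy => [|p] [|q] x y Px Qy; rewrite mshE; [exact: PQ | | |]; apply: S0.
have IH := IHn (adec A) (fun n => P n.+1) (fun n => Q n.+1) (fun n => S n.+1)
  (fun m n f => Pa _ _ (shift false f)) (fun m n f => Qa _ _ (shift false f))
  (fun n => S0 n.+1) (fun n => SB n.+1) (fun n => PQ n.+1).
have SD m u v : S m u -> S m v -> S m (u + v).
  by move=> Su Sv; rewrite -[v]opprK; apply: (SB m) => //; rewrite -sub0r; apply: (SB m).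
have Ssgn m r u : S m u -> S m (sgn r u).
  by move=> Su; rewrite /sgn; case: odd => //; rewrite -sub0r; apply: (SB m).
case: p q x y Px Qy => [|p] [|q] x y Px Qy.
- by rewrite msh00; apply: S0.
- by rewrite msh0S; apply: IH => //; apply: (Pa _ _ (codegen ord0)).
- by rewrite mshS0; apply: IH => //; apply: (Qa _ _ (codegen ord0)).
- rewrite mshSS; apply: SD; last apply: Ssgn; apply: IH => //.
    exact: (Qa _ _ (codegen ord0)).
  exact: (Pa _ _ (codegen ord0)).
Qed.

Definition aemh n (A : scalg k) (x y : A n) : A n.+1 := emh n (pmul A) x y.
Arguments aemh n A x y : clear implicits.

Lemma aemhS n (A : scalg k) (x y : A n.+1) : aemh n.+1 A x y =
  (\sum_(p < n.+2) msh n.+1 (adec A) (scalg_act (adec A) (front p n.+1) (adegen x : adec A n.+1))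
    (scalg_act (adec A) (back p (n.+1 - p) n.+1) (adegen y : adec A n.+1)) : A n.+2) -
  aemh n (adec A) x y.
Proof.
rewrite /aemh {1}/emh -/emh; congr (_ - _).
  by apply: eq_bigr => p _; apply: shuf_pdec.
exact: (@emh_nat n (pdec (pmul A)) (pmul (adec A)) (fun _ x => x) (fun _ x => x)
  (fun n => (idfun : {additive A n.+1 -> A n.+1}))).
Qed.

Lemma aemh_closed n : forall (A : scalg k) (P Q S : forall n, A n -> Prop),
  (forall m n (f : simplex_map m n) x, P n x -> P m (scalg_act A f x)) ->
  (forall m n (f : simplex_map m n) x, Q n x -> Q m (scalg_act A f x)) ->
  (forall n, S n 0) -> (forall n x y, S n x -> S n y -> S n (x - y)) ->
  (forall n x y, P n x -> Q n y -> S n (x * y)) ->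
  forall x y, P n x -> Q n y -> S n.+1 (aemh n A x y).
Proof.
elim: n => [|n IHn] A P Q S Pa Qa S0 SB PQ x y Px Qy.
  by apply: PQ; [apply: (Pa _ _ (codegen ord0)) | apply: (Qa _ _ (codegen ord0))].
have SD m u v : S m u -> S m v -> S m (u + v).
  by move=> Su Sv; rewrite -[v]opprK; apply: (SB m) => //; rewrite -sub0r; apply: (SB m).
have PD m p (f : simplex_map m p) := Pa _ _ (shift false f).
have QD m p (f : simplex_map m p) := Qa _ _ (shift false f).
rewrite aemhS; apply: (SB n.+2).
  apply: big_ind => [|u v|p _]; [exact: S0 | exact: SD |].
  apply: (@msh_closed n.+1 (adec A) (fun n => P n.+1) (fun n => Q n.+1) (fun n => S n.+1)) => //.
  - by move=> m u v; apply: (SB m.+1).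
  - by move=> m u v; apply: (PQ m.+1).
  - by apply: PD; apply: (Pa _ _ (codegen ord0)).
  - by apply: QD; apply: (Qa _ _ (codegen ord0)).
apply: (IHn (adec A) (fun n => P n.+1) (fun n => Q n.+1) (fun n => S n.+1)) => //.
- by move=> m u v; apply: (SB m.+1).
- by move=> m u v; apply: (PQ m.+1).
Qed.

Lemma msh_linear_l n (A : scalg k) p q (y : A q) : linear (fun x : A p => msh n A x y).
Proof. by move=> a u v; rewrite mshDl mshZl. Qed.

Lemma aemh_linear n : forall (A : scalg k) (x : A n), linear (aemh n A x).
Proof.
elim: n => [|n IHn] A x a y z.
  by rewrite -![aemh 0 A _ _]/(adegen _ * adegen _) /adegen linearP mulrDr scalerAr.
rewrite !aemhS (IHn (adec A)) scalerBr opprD addrACA; congr (_ + _).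
rewrite scaler_sumr -big_split; apply: eq_bigr => p _.
by rewrite /adegen !linearP.
Qed.

Lemma aemh_linear_l n : forall (A : scalg k) (y : A n), linear (fun x => aemh n A x y).
Proof.
elim: n => [|n IHn] A y a u v.
  by rewrite -![aemh 0 A _ _]/(adegen _ * adegen _) /adegen linearP mulrDl scalerAl.
rewrite !aemhS (IHn (adec A)) scalerBr opprD addrACA; congr (_ + _).
rewrite scaler_sumr -big_split; apply: eq_bigr => p _.
by rewrite /adegen !linearP mshDl mshZl.
Qed.

Lemma alt_bd_aemh n (A : scalg k) (x y : A n.+1) :
  alt_bd (T := A) (aemh n.+1 A x y) +
  \sum_(i < n.+2) sgn i (aemh n A (zface (T := A) i x) (zface (T := A) i y)) =
  \sum_(p < n.+2) msh n.+1 A (scalg_act A (front p n.+1) x) (scalg_act A (back p (n.+1 - p) n.+1) y) - x * y.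
Proof.
rewrite [LHS](@alt_bd_emh n (pmul A) x y); congr (_ - _).
by apply: eq_bigr => p _; rewrite mshE.
Qed.

Lemma alt_bd_msh0 n (A : scalg k) p (x : A p.+1) (y : A 0%N) :
  alt_bd (T := A) (msh n.+1 A x y) = \sum_(i < p.+2) sgn i (msh n A (zface (T := A) i x) y).
Proof.
rewrite mshE [LHS](@alt_bd_shuf n (pmul A)) sgn0 addr0.
by apply: eq_bigr => i _; rewrite mshE.
Qed.

Lemma alt_bd_mshS n (A : scalg k) p q (x : A p.+1) (y : A q.+1) :
  alt_bd (T := A) (msh n.+1 A x y) =
  \sum_(i < p.+2) sgn i (msh n A (zface (T := A) i x) y) + sgn p.+1 (msh n A x (alt_bd (T := A) y)).
Proof.
rewrite mshE [LHS](@alt_bd_shuf n (pmul A)); congr (_ + sgn _ _).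
  by apply: eq_bigr => i _; rewrite mshE.
rewrite /alt_bd [RHS](raddf_sum (msh n A x)); apply: eq_bigr => i _.
by rewrite -mshE; apply/esym/(raddf_sgn (msh n A x)).
Qed.
End Closure.
Arguments aemh {k} n A x y.

(** * Surjectivity *)

Section ChainContraction.
Variables (k : fieldType) (X : sset).
Hypothesis Xr : reduced X.
Notation Ch := (chz k X).
Notation T := (zdec Ch).
Notation C n := {malg k[X n]}.

(* The chains of degree n + 1 killed by d_0, whose faces are renumbered from d_1,
   form the free simplicial module spanned by the abelianized loop group. *)
Definition lchain n (c : C n.+1) : Prop := zface (T := Ch) ord0 (c : Ch n.+1) = 0.

Lemma lchainB n (c c' : C n.+1) : lchain c -> lchain c' -> lchain (c - c').
Proof. by move=> c0 c'0; rewrite /lchain (raddfB (zface (T := Ch) ord0)) c0 c'0 subrr. Qed.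

Lemma lchain0 n : lchain (0 : C n.+1).
Proof. exact: (raddf0 (zface (T := Ch) ord0)). Qed.

Lemma lchainN n (c : C n.+1) : lchain c -> lchain (- c).
Proof. by move=> cl; rewrite -sub0r; apply: lchainB => //; apply: lchain0. Qed.

Lemma lchainD n (c c' : C n.+1) : lchain c -> lchain c' -> lchain (c + c').
Proof. by move=> cl c'l; rewrite -[c']opprK; apply: lchainB => //; apply: lchainN. Qed.

Lemma lchain_act m n (f : simplex_map m n) (c : C n.+1) : lchain c ->
  lchain (szmod_act T f c : C m.+1).
Proof.
move=> c0; have := @tface0_commutes Ch m n f c; rewrite /lchain -[LHS]/(zface (T := Ch) ord0 (szmod_act T f c)) => ->.
by rewrite [tface _ _]c0 [LHS](raddf0 (szmod_act Ch f)).
Qed.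

Definition lbd n (c : C n.+2) : C n.+1 := alt_bd (T := T) (n := n) c.

Lemma chain_act_linear m n (f : simplex_map m n) : linear (szmod_act Ch f : C n -> C m).
Proof. exact: (linearP (chain_act f)). Qed.

Lemma lbd_is_linear n : linear (@lbd n).
Proof.
move=> a u v; rewrite /lbd /alt_bd scaler_sumr -big_split; apply: eq_bigr => i _ /=.
by rewrite -[in LHS]/(szmod_act Ch (shift false (coface i)) _) chain_act_linear sgnD scale_sgn.
Qed.
HB.instance Definition _ n := GRing.isLinear.Build k (C n.+2) (C n.+1) *:%R (@lbd n) (@lbd_is_linear n).

Lemma lchain_sgn n i (c : C n.+1) : lchain c -> lchain (sgn i c).
Proof. by rewrite /sgn; case: odd => // /lchainN. Qed.

Lemma lchain_lbd n (c : C n.+2) : lchain c -> lchain (lbd c).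
Proof.
move=> c0; rewrite /lbd /alt_bd; apply: big_ind => [|u v|i _]; [exact: lchain0 | exact: lchainD |].
by apply: lchain_sgn; apply: lchain_act.
Qed.

Lemma lbdK n (c : C n.+3) : lbd (lbd c) = 0.
Proof. exact: (alt_bdK (T := T) c). Qed.

Lemma reduce0_is_linear n : linear (@reduce0 k X n).
Proof.
move=> a u v; rewrite /reduce0.
rewrite -![zface _ _]/(szmod_act Ch _ _) -![zdegen _]/(szmod_act Ch _ _) !chain_act_linear.
by rewrite scalerBr opprD addrACA.
Qed.
HB.instance Definition _ n := GRing.isLinear.Build k (C n.+1) (C n.+1) *:%R (@reduce0 k X n) (@reduce0_is_linear n).

Lemma reduce0_lchain n (c : C n.+1) : lchain (reduce0 c).
Proof. exact: zface0_reduce0. Qed.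

Lemma reduce0_id n (c : C n.+1) : lchain c -> reduce0 c = c.
Proof. by move=> c0; rewrite /reduce0 [zface _ _]c0 raddf0 subr0. Qed.

Lemma scale_commutes a : @commutes0 T T
  (fun n => (GRing.scale a : {additive C n.+1 -> C n.+1}) : {additive T n -> T n}).
Proof. by move=> m n f c _ /=; rewrite [RHS](chain_actZ (shift false f)). Qed.

Lemma mproj_linear n : linear (mproj n T : C n.+1 -> C n.+1).
Proof.
move=> a u v; rewrite (raddfD (mproj n T)); congr (_ + _).
exact/esym/(@mproj_nat n T T _ (scale_commutes a) u).
Qed.

Lemma mproj_h_linear n : linear (mproj_h n T : C n.+1 -> C n.+2).
Proof.
move=> a u v; rewrite (raddfD (mproj_h n T)); congr (_ + _).
exact/esym/(@mproj_h_nat n T T _ (scale_commutes a) u).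
Qed.

Lemma lchain_mproj n (c : C n.+1) : lchain c -> lchain (mproj n T c : C n.+1).
Proof.
apply: (@mproj_closed n T (fun n c => @lchain n c)) => [m x y|m p f x]; first exact: lchainB.
exact: lchain_act.
Qed.

Lemma lchain_mproj_h n (c : C n.+1) : lchain c -> lchain (mproj_h n T c : C n.+2).
Proof.
apply: (@mproj_h_closed n T (fun n c => @lchain n c)) => [m x y|m p f x|].
- exact: lchainB.
- exact: lchain_act.
exact: mproj_closed.
Qed.

Lemma lchain1_cycle (c : C 1%N) : lchain c -> moore_cycle (T := Ch) (c : Ch 1%N).
Proof.
have [x0 x0P] := Xr; have xx (x y : X 0%N) : x = y by rewrite (x0P x) (x0P y).
have faces : zface (T := Ch) (lift ord0 ord0) (c : Ch 1%N) = zface (T := Ch) ord0 (c : Ch 1%N).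
  apply: (malg_linear_eq (f := chain_act (coface (lift ord0 ord0))) (g := chain_act (coface ord0))) => x.
  by rewrite /= !chain_actU; congr (<< _ >>).
move=> c0 i; case: (unliftP ord0 i) => [j ->|->] //.
by rewrite (_ : j = ord0) ?faces //; apply: val_inj; case: j => [[]].
Qed.

Lemma lchain_cycle n (c : C n.+2) : lchain c -> moore_cycle (T := T) (c : T n.+1) ->
  moore_cycle (T := Ch) (c : Ch n.+2).
Proof.
move=> c0 cT i; case: (unliftP ord0 i) => [j ->|->] //.
by rewrite -[RHS](cT j) /zface /= shift_coface.
Qed.

(* With K a generalized inverse of the boundary, 1 - d K - K d is a projection onto
   a complement of the boundaries in the cycles; the Moore projection moves it to
   cycles all of whose faces vanish. *)
Lemma chain_sdr : exists (K : forall n, {linear C n.+1 -> C n.+2})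
    (E : forall n, {linear C n.+1 -> C n.+1}),
  [/\ forall n c, lchain c -> lchain (K n c),
    forall n c, lchain c -> moore_cycle (T := Ch) (E n c : Ch n.+1),
    forall n (c : C n.+2), lchain c -> E n (lbd c) = 0,
    forall c : C 1%N, lchain c -> c = E 0%N c + lbd (K 0%N c)
  & forall n (c : C n.+2), lchain c -> c = E n.+1 c + lbd (K n.+1 c) + K n (lbd c)].
Proof.
(* [reduce0] projects onto the chains satisfying [lchain]; the generalized inverse is taken between
   full spaces of chains and projected back in [K0]. *)
pose f n : {linear C n.+2 -> C n.+1} := @lbd n \o @reduce0 k X n.+1.
pose g n := sval (cid (generalized_inverse (f n))).
have gE n c : f n (g n (f n c)) = f n c by apply: (svalP (cid (generalized_inverse (f n)))).
pose K0 n : {linear C n.+1 -> C n.+2} := @reduce0 k X n.+1 \o g n.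
have K0l n c : lchain (K0 n c) by apply: reduce0_lchain.
have lK n c : lchain c -> lbd (K0 n (lbd c)) = lbd c.
  by move=> cl; have := gE n c; rewrite /f /= (reduce0_id cl).
pose e n : {linear C n.+1 -> C n.+1} := match n with
  | 0 => idfun \- (@lbd 0 \o K0 0%N)
  | n'.+1 => (idfun \- (@lbd n'.+1 \o K0 n'.+1)) \- (K0 n' \o @lbd n') end.
have eS n c : e n.+1 c = c - lbd (K0 n.+1 c) - K0 n (lbd c) by [].
have el n c : lchain c -> lchain (e n c).
  case: n c => [|n] c cl; first by apply: lchainB => //; apply: lchain_lbd.
  by rewrite eS; apply: lchainB => //; apply: lchainB => //; apply: lchain_lbd.
have ed n (c : C n.+2) : lchain c -> e n (lbd c) = 0.
  case: n c => [|n] c cl; first by rewrite /= lK // subrr.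
  by rewrite eS lK // subrr sub0r lbdK (raddf0 (K0 n)) oppr0.
have de n (c : C n.+2) : lchain c -> lbd (e n.+1 c) = 0.
  have lB (u v : C n.+2) : lbd (u - v) = lbd u - lbd v := raddfB (@lbd n) u v.
  by move=> cl; rewrite eS (lB (c - _)) (lB c) lbdK lK // subr0 subrr.
(* Replacing [e] by its Moore projection changes the identity by a boundary, which the term [hh] of
   K absorbs; in degree 0 there is nothing to project. *)
pose E n : {linear C n.+1 -> C n.+1} := mk_linear (@mproj_linear n) \o e n.
pose hh n : {linear C n.+1 -> C n.+2} := mk_linear (@mproj_h_linear n).
pose K n : {linear C n.+1 -> C n.+2} := match n with
  | 0 => K0 0%N | n'.+1 => K0 n'.+1 \- (hh n'.+1 \o e n'.+1) end.
have hhE n c : hh n c = mproj_h n T c by [].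
exists K, E; split.
- move=> [|n] c cl; first exact: K0l.
  by apply: lchainB => //; apply: lchain_mproj_h; apply: (el n.+1).
- move=> [|n] c cl; first by apply: lchain1_cycle; apply: (el 0%N).
  apply: lchain_cycle; first by apply: lchain_mproj; apply: (el n.+1).
  by apply: alt_cycle_mproj; apply: de.
- by move=> n c cl; rewrite -[LHS]/(mproj n T (e n (lbd c))) ed // raddf0.
- by move=> c cl; rewrite -[E 0%N c]/(c - lbd (K0 0%N c)) subrK.
- move=> n c cl; have := @alt_bd_mproj_h n T (e n.+1 c).
  have -> : alt_bd (T := T) (e n.+1 c : T n.+1) = 0 by apply: de.
  rewrite raddf0 addr0 => hE.
  have KE : lbd (K n.+1 c) = lbd (K0 n.+1 c) - (mproj n.+1 T (e n.+1 c) - e n.+1 c).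
    by rewrite -[K n.+1 c]/(K0 n.+1 c - hh n.+1 (e n.+1 c)) raddfB -hE.
  have Kd : K n (lbd c) = K0 n (lbd c).
    by case: (n) c cl {hE KE} => // m c cl; rewrite -[LHS]/(K0 m.+1 _ - hh m.+1 (e m.+1 (lbd c))) ed // raddf0 subr0.
  rewrite KE Kd -[E n.+1 c]/(mproj n.+1 T (e n.+1 c)).
  have alg (mp a b c' : C n.+2) : c' = mp + (a - (mp - (c' - a - b))) + b by zmod.
  by rewrite {2}eS; apply: alg.
Qed.
End ChainContraction.

(** * Loop algebras with finitely many simplices in each degree *)

Section FiniteLoops.
Variables (k : fieldType) (G : affine_group k) (M : rep_model G) (X : sset).
Hypotheses (hcomm : commutative_group_scheme G).
Variables (d : nat) (x : 'I_d -> coord_ring G).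
Variable p : 'I_d -> {linear coord_ring G -> k^o}.
Hypothesis xp : coordinates (counit G) x p.
Variable r : forall n, seq (X n).
Hypotheses (r_uniq : forall n, uniq (r n)) (rP : forall n y, y \in r n).
Notation eps := (counit G).
Notation Ch := (chz k X).
Notation T := (zdec Ch).
Notation C n := {malg k[X n]}.
Notation B := (repS M (kan_loop X)).
Notation rg := (rgen M).
Notation Gam n := (kan_obj X n).
Notation I n := (ipow (aug_ideal (rep_aug M (kan_loop X n)))).
Notation tgen y := (kan_gen y).
Notation kc y := (kan_chain k y).
Notation Q i := (loop_dersys M X hcomm xp i).

Let x0 i : eps (x i) = 0. Proof. by case: xp. Qed.

Lemma malg_finite n (c : C n) : c = \sum_(y <- r n) c@_y *: << y >>.
Proof.
apply/malgP => z; rewrite (raddf_sum (mcoeff z)) (bigD1_seq z (rP z) (r_uniq _)) /= mcoeffZ mcoeffUU mulr1.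
by rewrite big1 ?addr0 // => y /negPf yz; rewrite mcoeffZ mcoeffU yz mulr0.
Qed.

Lemma lchain_finite n (c : C n.+1) : lchain c -> c = \sum_(y <- r n.+1) c@_y *: kc y.
Proof.
move=> cl; rewrite -{1}(reduce0_id cl) {1}[c]malg_finite (raddf_sum (@reduce0 k X n)).
by apply: eq_bigr => y _; rewrite /= kan_chain_reduce; apply: (linearZ_LR (@reduce0 k X n)).
Qed.

Lemma lchain_kan_chain n (y : X n.+1) : lchain (kc y).
Proof. by rewrite kan_chain_reduce; apply: reduce0_lchain. Qed.

Lemma lchain_ch n (g : Gam n) : lchain (ch g : C n.+1).
Proof. exact: ch_face0. Qed.

Section Coordinate.
Variable i : 'I_d.

(** The linear extension of y -> x_i(t(y)) to chains. On the chain of a loop g it agrees with x_i(g)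
    modulo I^2, since x_i is additive to first order. *)
Definition gen_lift n (c : C n.+1) : B n := \sum_(y <- r n.+1) c@_y *: rg (tgen y) (x i).

Lemma xi_is_linear n : linear (@gen_lift n).
Proof.
move=> a u v; rewrite /gen_lift scaler_sumr -big_split; apply: eq_bigr => y _ /=.
by rewrite mcoeffD mcoeffZ scalerDl scalerA.
Qed.
HB.instance Definition _ n := GRing.isLinear.Build k (C n.+1) (B n) *:%R (@gen_lift n) (@xi_is_linear n).

Lemma xi_basis n (y : X n.+1) : gen_lift << y >> = rg (tgen y) (x i).
Proof.
rewrite /gen_lift (bigD1_seq y (rP y) (r_uniq _)) /= mcoeffUU scale1r big1 ?addr0 // => z /negPf zy.
by rewrite mcoeffU eq_sym zy scale0r.
Qed.

Lemma xi_gen n (y : X n.+1) : gen_lift (kc y) = rg (tgen y) (x i).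
Proof.
rewrite /kan_chain (raddfB (@gen_lift n)) /= !xi_basis kan_gen_degen rgen1 x0 scale0r.
exact: subr0.
Qed.

Lemma xi_ch n (g : Gam n) : I n 2 (rg g (x i) - gen_lift (ch g)).
Proof.
elim/kan_ind: g => [|g h Ig Ih|g Ig|y].
- by rewrite ch1 rgen1 x0 scale0r (raddf0 (@gen_lift n)) subr0; apply: ipow0.
- have := ipowD (rep_genM_I M g h (x0 i)) (ipowD Ig Ih); congr (I n 2 _).
  by rewrite chM (raddfD (@gen_lift n)) /=; zmodu.
- have := ipowB (rep_genV_I M g (x0 i)) Ig; congr (I n 2 _).
  by rewrite chV (raddfN (@gen_lift n)) /=; zmodu.
- by rewrite ch_gen xi_gen subrr; apply: ipow0.
Qed.

Lemma xi_act m n (f : simplex_map m n) (c : C n.+1) : lchain c ->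
  I m 2 (scalg_act B f (gen_lift c) - gen_lift (szmod_act T f c : C m.+1)).
Proof.
move=> cl; have -> : gen_lift (szmod_act T f c : C m.+1) =
    \sum_(y <- r n.+1) c@_y *: gen_lift (ch (kan_act f (tgen y))).
  rewrite {1}(lchain_finite cl) (raddf_sum (szmod_act T f)) (raddf_sum (@gen_lift m)); apply: eq_bigr => y _.
  rewrite -(linearZ_LR (@gen_lift m)) /=; congr (gen_lift _).
  by rewrite ch_act ch_gen; apply: (chain_actZ (shift false f)).
rewrite /gen_lift (raddf_sum (scalg_act B f)) -sumrB; apply: ipow_sum => y _.
have := ipowZ c@_y (xi_ch (kan_act f (tgen y))); rewrite scalerBr; congr (I m 2 (_ - _)).
by rewrite -[RHS]/(scalg_act B f (c@_y *: rg (tgen y) (x i))) linearZ_LR; congr (_ *: _); apply/esym/repS_gen.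
Qed.
End Coordinate.

Lemma I_act m n (f : simplex_map m n) j z : I n j z -> I m j (scalg_act B f z).
Proof.
apply: (ipow_morph (f := scalg_act B f)) => w w0; rewrite /aug_ideal.
by rewrite -[RHS]w0; apply: (rep_aug_map (sgroup_act (kan_loop X) f)).
Qed.

Lemma I_msh n q m (y : B q) (w : B m) a b : I q a y -> I m b w -> I n (a + b) (msh n B y w).
Proof.
apply: (@msh_closed k n B (fun n => I n a) (fun n => I n b) (fun n => I n (a + b)%N)).
- by move=> *; apply: I_act.
- by move=> *; apply: I_act.
- by move=> ?; apply: ipow0.
- by move=> *; apply: ipowB.
- by move=> *; apply: ipowM.
Qed.

Lemma I_aemh n (y w : B n) a b : I n a y -> I n b w -> I n.+1 (a + b) (aemh n B y w).
Proof.
apply: (@aemh_closed k n B (fun n => I n a) (fun n => I n b) (fun n => I n (a + b)%N)).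
- by move=> *; apply: I_act.
- by move=> *; apply: I_act.
- by move=> ?; apply: ipow0.
- by move=> *; apply: ipowB.
- by move=> *; apply: ipowM.
Qed.

Lemma I_mproj n (y : B n) a : I n a y -> I n a (mproj n B y).
Proof.
apply: (@mproj_closed n B (fun n => I n a)) => *; [exact: ipowB | exact: I_act].
Qed.

Lemma cb_charM n (b : X n.+1) (g h : Gam n) : (ch (g * h)%g)@_b = (ch g)@_b + (ch h)@_b :> k.
Proof. by rewrite chM mcoeffD. Qed.

Definition cb n (b : X n.+1) : charac k (Gam n) := Charac (cb_charM b).

(** The characters [cb] are not quite dual to the generators: at t(y) there is an extra term for s_0
    d_0 y. It is multiplied by the value of mu at a degenerate generator, which is 0. *)
Lemma charac_expand n (mu : charac k (Gam n)) g :
  mu g = \sum_(b <- r n.+1) mu (tgen b) * cb b g.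
Proof.
elim/kan_ind: g => [|g h Eg Eh|g Eg|y].
- by rewrite charac1 big1 // => b _; rewrite charac1 mulr0.
- rewrite characM Eg Eh -big_split; apply: eq_bigr => b _ /=.
  by rewrite -mulrDr; congr (_ * _); rewrite cb_charM.
- by rewrite characV Eg -sumrN; apply: eq_bigr => b _; rewrite characV mulrN.
have E b : cb b (tgen y) = (b == y)%:R - (b == degen ord0 (face ord0 y))%:R.
  by rewrite /= ch_gen /kan_chain mcoeffB !mcoeffU ![_ == b]eq_sym.
under eq_bigr do rewrite E mulrBr.
have S z : \sum_(b <- r n.+1) mu (tgen b) * (b == z)%:R = mu (tgen z).
  rewrite (bigD1_seq z (rP z) (r_uniq _)) /= eqxx mulr1 big1 ?addr0 // => b /negPf ->.
  by rewrite mulr0.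
by rewrite sumrB !S kan_gen_degen charac1 subr0.
Qed.

Section Cap.
Variable i : 'I_d.
Notation cap v n m z := (contr (Q i) v n m z : B m).

Lemma cap_expand q (mu : charac k (Gam q)) n m (z : B n) :
  cap (mu : dC (Q i) q) n m z = \sum_(b <- r q.+1) mu (tgen b) *: cap (cb b : dC (Q i) q) n m z.
Proof.
rewrite /contr; case: eqP => _; last by rewrite big1 // => b _; rewrite scaler0.
have H := @charac_der_comb _ _ M hcomm _ _ _ xp (Gam n) _ (r q.+1)
  (fun b => charac_comp (cb b) (kan_act (front q n))) (charac_comp mu (kan_act (front q n)))
  (fun b => mu (tgen b)) i (fun g => charac_expand mu (kan_act (front q n) g)) z.
rewrite -[dD (Q i) (dC_map (Q i) (front q n) mu) z]/(charac_der M hcomm xp i (charac_comp mu (kan_act (front q n))) z).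
rewrite H [LHS](raddf_sum (scalg_act B _)); apply: eq_bigr => b _.
exact: (linearZ_LR (scalg_act B _)).
Qed.

Lemma I_cap q (v : dC (Q i) q) n m (z : B n) j : I n j.+1 z -> I m j (cap v n m z).
Proof.
move=> zI; rewrite /contr; case: eqP => _; last exact: ipow0.
by apply: I_act; apply: (der_ipow (charac_derM hcomm xp i _)).
Qed.

Definition abd q : B q -> B q.-1 := match q with 0 => fun=> 0 | q'.+1 => fun y => alt_bd (T := B) y end.

Lemma alt_bd_msh n a q (y : B a.+1) (w : B q) :
  alt_bd (T := B) (msh n.+1 B y w) =
  \sum_(j < a.+2) sgn j (msh n B (zface (T := B) j y) w) + sgn a.+1 (msh n B y (abd w)).
Proof.
case: q w => [|q] w; last exact: alt_bd_mshS.
by rewrite alt_bd_msh0 (raddf0 (msh n B y)) sgn0 addr0.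
Qed.

(** For a cycle z, d_0 of the cap product is all that remains of the boundary, and the last coface
    is all that remains of the coboundary; the other terms are cap products with faces of z. *)
Lemma cap_boundary q (v : dC (Q i) q) (dv : dC (Q i) q.+1) n m (z : B n) :
  (forall g : Gam q.+1, (dv : charac k _) g = \sum_(a < q.+2) sgn a ((v : charac k _) (kan_act (coface a) g))) ->
  n = (m + q)%N -> moore_cycle (T := B) z ->
  abd (cap v n m z) = sgn q.+1 (cap dv n m.-1 z).
Proof.
case: m => [|m] dvE nm zc.
  by rewrite /= [contr _ dv _ _ _]contr_dim ?sgn0 //; apply/eqP; lia.
subst n; rewrite -[LHS]/(alt_bd (T := B) _) /alt_bd big_ord_recl big1 => [|a _]; last first.
  rewrite (_ : lift ord0 a = inord a.+1); last by apply: val_inj; rewrite /= inordK // ltnS.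
  rewrite [zface _ _](contr_face_gt (Q := Q i) v z) ?(zc _) ?[contr _ _ _ _ _]raddf0 ?sgn0 //.
  exact: ltn_ord.
have s0 (w : B m) : sgn (@ord0 m.+1) w = w by [].
rewrite addr0 s0 [LHS](contr_face0 (Q := Q i) v z).
rewrite /contr (_ : (m.+1 + q)%N == (m + q.+1)%N); last by rewrite addnS.
set f := front q.+1 (m + q).+1.
have dE : dD (Q i) (dC_map (Q i) f dv) z = \sum_(a < q.+2) sgn a (dD (Q i) (dC_map (Q i) f (dC_map (Q i) (coface a) v)) z).
  rewrite [LHS](charac_der_comb hcomm xp (s := index_enum 'I_q.+2)
    (mu := fun a => dC_map (Q i) f (dC_map (Q i) (coface a) v)) (a := fun a => (-1) ^+ a)) => [|g].
    by apply: eq_bigr => a _; rewrite [RHS]sgnZ.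
  by rewrite [LHS]dvE; apply: eq_bigr => a _; rewrite sgnM.
have cz (a : nat) : (a <= q)%N -> scalg_act (dA (Q i)) (back q.+1 m (m + q).+1)
    (dD (Q i) (dC_map (Q i) f (dC_map (Q i) (coface (inord a)) v)) z) = 0.
  move=> aq; rewrite -[LHS](contr_face_le (Q := Q i) v (m := m) z aq) (zc _).
  exact: (raddf0 (contr (Q i) v _ _)).
rewrite -[dD (Q i) (dC_map (Q i) (front q.+1 (m.+1 + q)) dv) z]/(dD (Q i) (dC_map (Q i) f dv) z) dE.
rewrite [X in sgn _ X](raddf_sum (scalg_act B _)) big_ord_recr big1 => [|a _]; last first.
  rewrite [LHS](raddf_sgn (scalg_act B _)) -(_ : inord a = widen_ord (leqnSn q.+1) a).
    by rewrite [X in sgn _ X]cz ?sgn0 // -ltnS.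
  by apply: val_inj; rewrite /= inordK // ltnS ltnW.
rewrite [X in sgn _ X]add0r [X in sgn _ X](raddf_sgn (scalg_act B _)) sgn_sgn -[X in sgn X _]/(q.+1 + q.+1)%N {1}/sgn addnn odd_double.
rewrite (_ : inord q.+1 = ord_max) //; apply: val_inj; rewrite /= inordK //.
Qed.
End Cap.
End FiniteLoops.

Lemma linear_comb (k : fieldType) (V W : lmodType k) (f : V -> W) (J : Type) (s : seq J)
    (a : J -> k) (v : J -> V) :
  linear f -> f (\sum_(j <- s) a j *: v j) = \sum_(j <- s) a j *: f (v j).
Proof.
move=> fl; rewrite -[LHS]/(mk_linear fl _) (raddf_sum (mk_linear fl)); apply: eq_bigr => j _.
exact: (linearZ_LR (mk_linear fl)).
Qed.

Lemma linear_fun0 (k : fieldType) (V W : lmodType k) (f : V -> W) : linear f -> f 0 = 0.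
Proof. by move=> fl; apply: (raddf0 (mk_linear fl)). Qed.

Lemma linear_funB (k : fieldType) (V W : lmodType k) (f : V -> W) u v : linear f -> f (u - v) = f u - f v.
Proof. by move=> fl; apply: (raddfB (mk_linear fl)). Qed.

(** * Euler's formula modulo the next power of the augmentation ideal *)

Section Step.
Variables (k : fieldType) (G : affine_group k) (M : rep_model G) (X : sset).
Hypotheses (char0 : [pchar k] =i pred0) (hcomm : commutative_group_scheme G) (Xr : reduced X).
Variables (d : nat) (x : 'I_d -> coord_ring G).
Variable p : 'I_d -> {linear coord_ring G -> k^o}.
Hypothesis xp : coordinates (counit G) x p.
Variable r : forall n, seq (X n).
Hypotheses (r_uniq : forall n, uniq (r n)) (rP : forall n y, y \in r n).
Notation Ch := (chz k X).
Notation C n := {malg k[X n]}.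
Notation B := (repS M (kan_loop X)).
Notation rg := (rgen M).
Notation Gam n := (kan_obj X n).
Notation I n := (ipow (aug_ideal (rep_aug M (kan_loop X n)))).
Notation tgen y := (kan_gen y).
Notation kc y := (kan_chain k y).
Notation Q i := (loop_dersys M X hcomm xp i).
Notation cap i v n m z := (contr (Q i) v n m z : B m).
Notation xi i c := (gen_lift M x r i c).

(** Modulo I^2, x_i(g) is the combination of the coordinates of the generators with the coefficients
    of the chain of g; bilinearity then moves these coefficients to the second argument. *)
Lemma exchange i q m n (F : B q -> B m -> B n) a (J : Type) (s : seq J) (g : J -> Gam q) (w : J -> B m) :
  (forall v, linear (F^~ v)) -> (forall y, linear (F y)) ->
  (forall u v y t, I q u y -> I m v t -> I n (u + v) (F y t)) ->
  (forall y, I m a (w y)) ->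
  I n (2 + a) (\sum_(y <- s) F (rg (g y) (x i)) (w y) -
    \sum_(b <- r q.+1) F (rg (tgen b) (x i)) (\sum_(y <- s) (ch (g y))@_b *: w y)).
Proof.
move=> Fl Fr FI wI.
have -> : \sum_(b <- r q.+1) F (rg (tgen b) (x i)) (\sum_(y <- s) (ch (g y))@_b *: w y) =
    \sum_(y <- s) F (xi i (ch (g y))) (w y).
  under eq_bigr => b _ do rewrite (linear_comb _ _ _ (Fr _)).
  rewrite exchange_big; apply: eq_bigr => y _.
  by rewrite /gen_lift (linear_comb _ _ _ (Fl _)).
rewrite -sumrB; apply: ipow_sum => y _; rewrite -(linear_funB _ _ (Fl _)).
by apply: FI => //; apply: (xi_ch M xp r_uniq rP).
Qed.

Variables (n' a : nat).
Notation n := n'.+1.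
Variable z : B n.
Hypotheses (zc : moore_cycle (T := B) z) (zI : I n a.+1 z).
Variable Kc : B n -> Prop.
Hypotheses (Kc0 : Kc 0) (KcD : forall u v, Kc u -> Kc v -> Kc (u + v))
  (KcZ : forall c u, Kc u -> Kc (c *: u)).
Hypothesis Kc_msh : forall i q (g : Gam q) (w : B (n - q)%N), (q <= n)%N -> flat k g ->
  moore_cycle (T := B) w -> Kc (msh n B (rg g (x i)) w).

(** The exponent 2 + a is one more than that of the power containing z, so the error is one step
    deeper in the filtration. *)
Definition reachable (u : B n) := exists S W, Kc S /\ I n (2 + a) (u - (S + alt_bd (T := B) (W : B n.+1))).

Lemma reachable_I u : I n (2 + a) u -> reachable u.
Proof. by move=> uI; exists 0, 0; split=> //; rewrite raddf0 addr0 subr0. Qed.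

Lemma reachableD u v : reachable u -> reachable v -> reachable (u + v).
Proof.
move=> [S [W [SK uI]]] [S' [W' [S'K vI]]]; exists (S + S'), (W + W'); split; first exact: KcD.
have := ipowD uI vI; congr (I n _ _).
by rewrite (raddfD (@alt_bd B n)) /=; zmodu.
Qed.

Lemma reachable_sum (J : Type) (s : seq J) (P : pred J) (F : J -> B n) :
  (forall j, P j -> reachable (F j)) -> reachable (\sum_(j <- s | P j) F j).
Proof.
by move=> FP; apply: big_ind => //; [apply: reachable_I; apply: ipow0 | apply: reachableD].
Qed.

Lemma reachable_K u : Kc u -> reachable u.
Proof. by move=> uK; exists u, 0; split=> //; rewrite raddf0 addr0 subrr; apply: ipow0. Qed.

Lemma reachable_bd (W : B n.+1) : reachable (alt_bd (T := B) W).
Proof. by exists 0, W; split=> //; rewrite add0r subrr; apply: ipow0. Qed.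

Lemma reachable_mod u v : I n (2 + a) (u - v) -> reachable v -> reachable u.
Proof. by move=> uv vR; rewrite -[u](subrK v); apply: reachableD => //; apply: reachable_I. Qed.

Lemma lin_characM q (l : {linear C q.+1 -> k^o}) (g h : Gam q) :
  (l (ch (g * h)%g) : k) = l (ch g) + l (ch h).
Proof. by rewrite chM raddfD. Qed.

Definition lin_charac q (l : {linear C q.+1 -> k^o}) : charac k (Gam q) := Charac (lin_characM l).

Lemma lin_charac_cocycle i q (l : {linear C q.+1 -> k^o}) :
  (forall c : C q.+2, lchain c -> l (lbd c) = 0) -> cocycle (lin_charac l : dC (Q i) q).
Proof.
move=> l0 m f y; apply: (charac_der_sum hcomm xp) => g.
set g' := sgroup_act (kan_loop X) f g.
have := l0 _ (lchain_ch k g'); rewrite /lbd /alt_bd (raddf_sum l) => E; rewrite -[RHS]E.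
apply: eq_bigr => j _.
rewrite -[LHS]/(sgn j (l (ch (kan_act (coface j) g')) : k)) ch_act.
exact/esym/(raddf_sgn l).
Qed.

(** A frame f of the finite family of cycles E(b) regroups the sum, so that the second factors
    become cap products with f o E. These are cocycles because E kills boundaries; the first factors
    are combinations of coordinates of flat elements modulo I^2. *)
Lemma reachable_cycles i q (E : {linear C q.+1 -> C q.+1}) : (q <= n)%N ->
  (forall c, lchain c -> moore_cycle (T := Ch) (E c : Ch q.+1)) ->
  (forall c : C q.+2, lchain c -> E (lbd c) = 0) ->
  reachable (\sum_(b <- r q.+1) msh n B (xi i (E (kc b))) (cap i (cb k b) n (n - q)%N z)).
Proof.
move=> qn Ec Ed; pose s := [seq E (kc b) | b <- r q.+1].
have [f fE] := frame s.
pose l t : {linear C q.+1 -> k^o} := f t \o E.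
have -> : \sum_(b <- r q.+1) msh n B (xi i (E (kc b))) (cap i (cb k b) n (n - q)%N z) =
    \sum_(t < size s) msh n B (xi i s`_t) (cap i (lin_charac (l t)) n (n - q)%N z).
  transitivity (\sum_(b <- r q.+1) \sum_(t < size s)
      (f t (E (kc b)) : k) *: msh n B (xi i s`_t) (cap i (cb k b) n (n - q)%N z)).
    rewrite big_seq [RHS]big_seq; apply: eq_bigr => b br.
    rewrite {1}(fE (E (kc b))); last exact: (map_f (fun b => E (kc b))).
    rewrite (linear_comb _ _ _ (@xi_is_linear k G M X d x r i q)).
    by rewrite (linear_comb _ _ _ (@msh_linear_l k n B q (n - q)%N _)).
  rewrite exchange_big; apply: eq_bigr => t _.
  rewrite [in RHS](cap_expand hcomm xp r_uniq rP i (lin_charac (l t)) (n - q)%N z).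
  rewrite [RHS](linear_comb _ _ _ (@msh_linear k n B q (n - q)%N _)).
  by apply: eq_bigr => b _; rewrite /= ch_gen.
apply: reachable_sum => -[t ts] _ /=; set w := contr _ _ _ _ _.
have wc : moore_cycle (T := B) (w : B (n - q)%N).
  have nq : n = (n - q + q)%N by rewrite subnK.
  have aux m (y : B m) : m = (n - q + q)%N -> moore_cycle (T := B) y ->
      moore_cycle (T := B) (cap i (lin_charac (l t)) m (n - q)%N y).
    move=> mE; subst m => yc; apply: (@contr_cycle k (Q i)) => //.
    by apply: lin_charac_cocycle => c cl; rewrite /l /= Ed // raddf0.
  exact: aux.
have wI : I _ a w by apply: I_cap.
have stm : moore_cycle (T := Ch) (s`_t : Ch q.+1).
  by have /mapP[b _ ->] := mem_nth 0 ts; apply: Ec; apply: lchain_kan_chain.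
have [u [uf uE]] := moore_flat char0 stm.
apply: (@reachable_mod _ (\sum_(b <- u) b.1 *: msh n B (rg b.2 (x i)) w)); last first.
  apply: reachable_K; rewrite big_seq; apply: (big_ind Kc) => // b /uf bf.
  by apply: KcZ; apply: Kc_msh.
rewrite uE (linear_comb _ _ _ (@xi_is_linear k G M X d x r i q)).
rewrite (linear_comb _ _ _ (@msh_linear_l k n B q (n - q)%N _)) -sumrB.
apply: ipow_sum => b _; rewrite -scalerBr -(linear_funB _ _ (@msh_linear_l k n B q (n - q)%N _)).
apply: ipowZ; apply: I_msh => //; rewrite -opprB; apply: ipowN.
exact: (xi_ch M xp r_uniq rP).
Qed.

Lemma charac_der_comp i q (f : simplex_map q n) (b : X q.+1) :
  charac_der M hcomm xp i (charac_comp (cb k b) (kan_act f)) z =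
  \sum_(y <- r n.+1) (ch (kan_act f (tgen y)))@_b *: charac_der M hcomm xp i (cb k y) z.
Proof. by apply: charac_der_comb => g; apply: (charac_expand r_uniq rP). Qed.

(** The Eilenberg-Zilber homotopy replaces a degreewise product by shuffle products of its front and
    back faces, up to a boundary and the homotopy on faces. The exchange lemma, applied to each,
    turns the former into cap products and makes the latter negligible. *)
Lemma reachable_diagonal i :
  reachable (\sum_(q < n.+1) \sum_(b <- r q.+1)
    msh n B (rg (tgen b) (x i)) (cap i (cb k b) n (n - q)%N z)) ->
  reachable (\sum_(y <- r n.+1) rg (tgen y) (x i) * charac_der M hcomm xp i (cb k y) z).
Proof.
move=> R1; pose D y : B n := charac_der M hcomm xp i (cb k y) z.
pose xg (y : X n.+1) : B n := rg (tgen y) (x i).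
have DI y : I n a (D y) by apply: (der_ipow (charac_derM hcomm xp i _)).
pose AW y := \sum_(q < n.+1) msh n B (scalg_act B (front q n) (xg y)) (scalg_act B (back q (n - q) n) (D y)).
pose FF y := \sum_(j < n.+1) sgn j (aemh n' B (zface (T := B) j (xg y)) (zface (T := B) j (D y))).
have E y : xg y * D y = AW y + (- alt_bd (T := B) (aemh n B (xg y) (D y)) - FF y).
  have H := @alt_bd_aemh k n' B (xg y) (D y); rewrite -opprD [X in - X]H opprB addrC subrK.
  by [].
rewrite (eq_bigr (fun y => AW y + (- alt_bd (T := B) (aemh n B (xg y) (D y)) - FF y))); last by move=> y _; apply: E.
rewrite big_split; apply: reachableD; last first.
  rewrite big_split; apply: reachableD.
    by rewrite sumrN -(raddf_sum (@alt_bd B n)) -raddfN; exact: reachable_bd.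
  rewrite sumrN; apply/reachable_I/ipowN; rewrite exchange_big; apply: ipow_sum => j _.
  rewrite -[X in I _ _ X]sgn_sum; apply: ipow_sgn.
  have := @exchange i n' n' n (aemh n' B) a _ (r n.+1) (fun y => kan_act (coface j) (tgen y))
    (fun y => zface (T := B) j (D y)) (@aemh_linear_l k n' B) (@aemh_linear k n' B)
    (fun u v y t => @I_aemh k G M X n' y t u v) (fun y => I_act (coface j) (DI y)).
  rewrite [X in _ - X]big1 ?subr0 => [|b _].
    by congr (I n _ _); apply: eq_bigr => y _; congr (aemh n' B _ _); apply/esym/zface_rgen.
  rewrite -(linear_comb _ _ _ (linearP (scalg_act B (coface j)))).
  (* After the exchange the second argument is a derivative of a face of z, hence 0. *)
  rewrite -charac_der_comp -[X in aemh _ _ _ X](charac_der_map hcomm xp (kan_act (coface j))).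
  rewrite [rmap _ _ z](zc j) (raddf0 (charac_der M hcomm xp i (cb k b))).
  exact: (linear_fun0 (@aemh_linear k n' B _)).
apply: reachable_mod R1; rewrite exchange_big -sumrB; apply: ipow_sum => q _.
have qn : (q <= n)%N by rewrite -ltnS.
have := @exchange i q (n - q)%N n (msh n B (p := q) (q := n - q)) a _ (r n.+1)
  (fun y => kan_act (front q n) (tgen y)) (fun y => scalg_act B (back q (n - q) n) (D y))
  (@msh_linear_l k n B q (n - q)%N) (@msh_linear k n B q (n - q)%N)
  (fun u v y t => @I_msh k G M X n q (n - q)%N y t u v) (fun y => I_act (back q (n - q) n) (DI y)).
congr (I n _ (_ - _)).
  by apply: eq_bigr => y _; congr (msh n B _ _); apply/esym/repS_gen.
apply: eq_bigr => b _; congr (msh n B _ _).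
rewrite -(linear_comb _ _ _ (linearP (scalg_act B (back q (n - q) n)))) -charac_der_comp.
by rewrite /contr subnK // eqxx.
Qed.

Section Homotopy.
Variables (K : forall n, {linear C n.+1 -> C n.+2}) (E : forall n, {linear C n.+1 -> C n.+1}).
Hypotheses (Kl : forall n c, lchain c -> lchain (K n c))
  (Ec : forall n c, lchain c -> moore_cycle (T := Ch) (E n c : Ch n.+1))
  (Ed : forall n (c : C n.+2), lchain c -> E n (lbd c) = 0)
  (E0 : forall c : C 1%N, lchain c -> c = E 0%N c + lbd (K 0%N c))
  (ES : forall n (c : C n.+2), lchain c -> c = E n.+1 c + lbd (K n.+1 c) + K n (lbd c)).

Lemma cocharM q (b : X q.+1) (g h : Gam q.+1) :
  (lbd (ch (g * h)%g))@_b = (lbd (ch g))@_b + (lbd (ch h))@_b :> k.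
Proof. by rewrite chM (raddfD (@lbd k X q)) mcoeffD. Qed.

Definition cochar q (b : X q.+1) : charac k (Gam q.+1) := Charac (cocharM b).

Lemma cap_cobd i q (b : X q.+1) : (q <= n)%N ->
  abd (cap i (cb k b) n (n - q)%N z) = sgn q.+1 (cap i (cochar b) n (n - q).-1 z).
Proof.
move=> qn; apply: cap_boundary => [g||//]; last by rewrite subnK.
rewrite /= /lbd /alt_bd (raddf_sum (mcoeff b)); apply: eq_bigr => j _.
by rewrite ch_act; apply: (raddf_sgn (mcoeff b)).
Qed.

(** The chain of each generator is written as E + dK + Kd. The E part is treated by
    [reachable_cycles]; the two others form the boundary of W, up to the failure of [gen_lift] to
    commute with faces, which lies in I^2. *)
Lemma reachable_homotopy i :
  reachable (\sum_(q < n.+1) \sum_(b <- r q.+1)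
    msh n B (rg (tgen b) (x i)) (cap i (cb k b) n (n - q)%N z)).
Proof.
pose cp q (b : X q.+1) m := cap i (cb k b) n m z.
pose KK q := \sum_(b <- r q.+2) msh n B (xi i (K q (lbd (kc b)))) (cp q.+1 b (n - q.+1)%N).
pose LL q := \sum_(b <- r q.+1) msh n B (xi i (lbd (K q (kc b)))) (cp q b (n - q)%N).
pose EE q := \sum_(b <- r q.+1) msh n B (xi i (E q (kc b))) (cp q b (n - q)%N).
have xiD q (c c' : C q.+1) : xi i (c + c') = xi i c + xi i c' by apply: (raddfD (@gen_lift k G M X d x r i q)).
have -> : \sum_(q < n.+1) \sum_(b <- r q.+1) msh n B (rg (tgen b) (x i)) (cp q b (n - q)%N) =
    \sum_(q < n.+1) EE q + (\sum_(q < n.+1) LL q + \sum_(q < n) KK q).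
  have x_gen q (b : X q.+1) : rg (tgen b) (x i) = xi i (kc b) by rewrite (xi_gen M xp r_uniq rP).
  rewrite [\sum_(q < n.+1) \sum_(_ <- _) _]big_ord_recl [\sum_(q < n.+1) EE q]big_ord_recl [\sum_(q < n.+1) LL q]big_ord_recl.
  have -> : \sum_(b <- r 1%N) msh n B (rg (tgen b) (x i)) (cp 0%N b (n - 0)%N) = EE 0%N + LL 0%N.
    rewrite /EE /LL -big_split; apply: eq_bigr => b _ /=.
    by rewrite x_gen {1}(E0 (lchain_kan_chain k b)) xiD mshDl.
  have -> : \sum_(q < n) \sum_(b <- r q.+2) msh n B (rg (tgen b) (x i)) (cp q.+1 b (n - q.+1)%N) =
      \sum_(q < n) EE q.+1 + \sum_(q < n) LL q.+1 + \sum_(q < n) KK q.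
    rewrite -!big_split; apply: eq_bigr => q _ /=; rewrite -!big_split; apply: eq_bigr => b _ /=.
    by rewrite x_gen {1}(ES (lchain_kan_chain k b)) !xiD !mshDl.
  by zmodu.
apply: reachableD.
  apply: reachable_sum => q _; apply: reachable_cycles => //; [by rewrite -ltnS | exact: Ec | exact: Ed].
pose W := \sum_(q < n.+1) \sum_(b <- r q.+1) msh n.+1 B (xi i (K q (kc b))) (cp q b (n - q)%N).
apply: reachable_mod (reachable_bd W).
pose PP q := \sum_(b <- r q.+1) \sum_(j < q.+2) sgn j (msh n B (zface (T := B) j (xi i (K q (kc b)))) (cp q b (n - q)%N)).
have -> : alt_bd (T := B) W = \sum_(q < n.+1) PP q + \sum_(q < n) KK q.
  rewrite (raddf_sum (@alt_bd B n)).
  (* The boundary of the second factor is the cap product with the coboundary of b; expanding it in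
     the characters [cb] and summing over b rebuilds K of the boundary of the generator b'. *)
  have HK (q : nat) : (q <= n)%N -> \sum_(b <- r q.+1) alt_bd (T := B) (msh n.+1 B (xi i (K q (kc b))) (cp q b (n - q)%N)) =
      PP q + KK q.
    move=> qn; under eq_bigr => b _ do rewrite alt_bd_msh.
    rewrite big_split; congr (_ + _).
    have cpE b : sgn q.+1 (msh n B (xi i (K q (kc b))) (abd (cp q b (n - q)%N))) =
        \sum_(b' <- r q.+2) (lbd (kc b'))@_b *: msh n B (xi i (K q (kc b))) (cp q.+1 b' (n - q.+1)%N).
      rewrite /cp (cap_cobd i b qn) -subnS.
      rewrite (raddf_sgn (msh n B _)) sgn_sgn /sgn addnn odd_double /=.
      rewrite (cap_expand hcomm xp r_uniq rP i (cochar b) (n - q.+1)%N z).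
      rewrite (linear_comb _ _ _ (@msh_linear k n B q.+1 (n - q.+1)%N _)).
      by apply: eq_bigr => b' _; rewrite /= ch_gen.
    under eq_bigr => b _ do rewrite cpE.
    rewrite exchange_big; apply: eq_bigr => b' _.
    have lb := lchain_lbd (lchain_kan_chain k b').
    rewrite [in RHS](lchain_finite r_uniq rP lb) (raddf_sum (K q)).
    rewrite (raddf_sum (@gen_lift k G M X d x r i q.+1)) msh_suml; apply: eq_bigr => b _ /=.
    have -> : xi i (K q ((lbd (kc b'))@_b *: kc b)) = (lbd (kc b'))@_b *: xi i (K q (kc b)).
      rewrite [K q _](linearZ_LR (K q)); exact: (linearZ_LR (@gen_lift k G M X d x r i q.+1)).
    by rewrite mshZl.
  under eq_bigr => q _ do rewrite (raddf_sum (@alt_bd B n)).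
  rewrite (eq_bigr (fun q : 'I_n.+1 => PP q + KK q)); last by move=> q _; apply: HK; rewrite -ltnS.
  (* The term q = n contains cap products with cochains of degree n + 1 on an element of degree n,
     which are 0 by convention. *)
  rewrite big_split; congr (_ + _); rewrite big_ord_recr /= [X in _ + X](_ : _ = 0) ?addr0 //.
  rewrite /KK big1 // => b _; rewrite /cp contr_dim ?(linear_fun0 (@msh_linear k n B _ _ _)) //.
  by apply/eqP; lia.
rewrite opprD addrACA subrr addr0 -sumrB; apply: ipow_sum => q _.
rewrite -sumrB; apply: ipow_sum => b _.
have Kb := Kl (lchain_kan_chain k b).
have -> : xi i (lbd (K q (kc b))) = \sum_(j < q.+2) sgn j (xi i (szmod_act (zdec Ch) (coface j) (K q (kc b)) : C q.+1)).
  rewrite /lbd /alt_bd (raddf_sum (@gen_lift k G M X d x r i q)); apply: eq_bigr => j _.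
  exact: (raddf_sgn (@gen_lift k G M X d x r i q)).
rewrite msh_suml -sumrB; apply: ipow_sum => j _.
rewrite mshNl -sgnB; apply: ipow_sgn; rewrite -(linear_funB _ _ (@msh_linear_l k n B q (n - q)%N _)).
apply: I_msh; last exact: I_cap.
rewrite -opprB; apply: ipowN; exact: (xi_act M xp r_uniq rP).
Qed.
End Homotopy.

Lemma reachable_euler : reachable (z *+ a.+1).
Proof.
have [K [E [Kl Ec Ed E0 ES]]] := chain_sdr k Xr.
have H := @charac_euler k G M hcomm d x p xp (Gam n) _ (r n.+1) (fun y => tgen y) (fun y => cb k y).
have xE : forall i (g : Gam n), I n 2 (rg g (x i) - \sum_(y <- r n.+1) cb k y g *: rg (tgen y) (x i)).
  by move=> i g; apply: (xi_ch M xp r_uniq rP).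
have := H xE a.+1 z zI; move=> /ipowN; rewrite opprB => zE; apply: reachable_mod zE _.
rewrite exchange_big; apply: reachable_sum => i _; apply: reachable_diagonal.
exact: (reachable_homotopy Kl Ec Ed E0 ES).
Qed.
End Step.

(** * Induction on the powers of the augmentation ideal *)

Section CycleInduction.
Variables (k : fieldType) (G : affine_group k) (M : rep_model G) (X : sset).
Hypotheses (char0 : [pchar k] =i pred0) (hcomm : commutative_group_scheme G) (Xr : reduced X).
Hypothesis hG : finitely_generated (coord_ring G).
Variables (d : nat) (x : 'I_d -> coord_ring G).
Variable p : 'I_d -> {linear coord_ring G -> k^o}.
Hypothesis xp : coordinates (counit G) x p.
Variable r : forall n, seq (X n).
Hypotheses (r_uniq : forall n, uniq (r n)) (rP : forall n y, y \in r n).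
Notation B := (repS M (kan_loop X)).
Notation rg := (rgen M).
Notation Gam n := (kan_obj X n).
Notation aug n := (rep_aug M (kan_loop X n)).
Notation I n := (ipow (aug_ideal (aug n))).

(** The inverses of the generators of the loop group contribute generators of their own; products of
    loops are covered by the coproduct. *)
Lemma rep_fg n : finitely_generated (repA M (Gam n)).
Proof.
case: hG => sR sRP.
exists (flatten [seq [seq rg (kan_gen y) u | u <- sR] ++ [seq rg ((kan_gen y)^-1)%g u | u <- sR] | y <- r n.+1]).
move=> S Sa sS; have [S1 SL SM] := Sa.
have S0 : 0 \in S by have := SL (-1) _ _ S1 S1; rewrite scaleN1r addNr.
have SZ c w : w \in S -> c *: w \in S by move=> wS; rewrite -[_ *: _]addr0; apply: SL.
have Ssum (J : eqType) (s : seq J) (F : J -> repA M (Gam n)) : (forall j, j \in s -> F j \in S) -> \sum_(j <- s) F j \in S.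
  move=> FS; rewrite big_seq; apply: (big_ind (fun w => w \in S)) => // u v uS vS.
  by rewrite -[u]scale1r; apply: SL.
have gS (g : Gam n) : (forall u, u \in sR -> rg g u \in S) -> forall u, rg g u \in S.
  move=> gs; apply: (sRP [pred u | rg g u \in S]) => [|u /gs //].
  split=> [|c u v|u v]; rewrite !inE ?rmorph1 ?rmorphM ?linearP //; [exact: SL | exact: SM].
suff gS2 (g : Gam n) : (forall u, rg g u \in S) /\ (forall u, rg (g^-1)%g u \in S).
  move=> z; move: z; apply: repA_ind => [|c u v uS vS|u v uS vS|g u] //; [exact: SL | exact: SM |].
  exact: (gS2 g).1.
elim/kan_ind: g => [|g h [gP gVP] [hP hVP]|g [gP gVP]|y].
- by split=> u; rewrite ?invg1 rgen1; apply: SZ.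
- split=> u; have [s sE] := comul u; rewrite ?invgM rgenM sE; apply: Ssum => q _; exact: SM.
- by rewrite invgK.
have inS b : b \in [seq rg (kan_gen y) u | u <- sR] ++ [seq rg ((kan_gen y)^-1)%g u | u <- sR] -> b \in S.
  move=> bs; apply: sS; apply/flattenP; eexists; last exact: bs.
  exact: (map_f (fun y => [seq rg (kan_gen y) u | u <- sR] ++ [seq rg ((kan_gen y)^-1)%g u | u <- sR])).
by split; apply: gS => u us; apply: inS; rewrite mem_cat; apply/orP; [left | right]; apply: map_f.
Qed.

Lemma moore_cycle_ideal n : ideal (fun z : repA M (Gam n) => moore_cycle (T := B) (z : B n)).
Proof.
split=> [|u v uc vc|u v vc]; [exact: (@moore_cycle0 B) | exact: (@moore_cycleD B) |].
case: n u v vc => [//|n] u v vc i.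
by rewrite [LHS](rmorphM (scalg_act B (coface i))) [X in _ * X]vc mulr0.
Qed.

Variable K : forall n, B n -> Prop.
Hypotheses (K0 : forall n, K (0 : B n)) (KD : forall n (u v : B n), K u -> K v -> K (u + v))
  (KZ : forall n c (u : B n), K u -> K (c *: u)) (Kbd : forall n (u : B n), mbd (T := B) u -> K u)
  (K1 : K (1 : B 0%N))
  (KI : forall n (u z : B n), aug n u = 0 -> moore_cycle (T := B) z -> K (u * z))
  (Kmsh : forall i n q (g : Gam q) (w : B (n - q)%N), (q <= n)%N -> flat k g ->
     moore_cycle (T := B) w -> ((0 < q)%N -> K w) -> K (msh n B (rg g (x i)) w)).

(** Beyond the Artin-Rees bound [KI] applies. Before it, [reachable_euler] writes a nonzero integer
    multiple of the cycle as an element of K and a boundary, up to a cycle in the next power. A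
    shuffle product with q = 0 has a second factor of the same degree, out of reach of the induction
    on n, hence the guard in [Kmsh]. *)
Lemma cycle_induction n (z : B n) : moore_cycle (T := B) z -> K z.
Proof.
elim/ltn_ind: n z => -[|n] IHn z zc.
  have aug0 : aug 0 (z - (aug 0 z)%:A) = 0.
    by have := aug_sub (aug 0) z.
  have := KD (KI aug0 (Logic.I : moore_cycle (T := B) (1 : B 0%N))) (KZ (aug 0 z) K1).
  by rewrite mulr1 subrK.
have augz : I n.+1 1 z.
  apply/(ipow1 _ (aug_idealP _)); rewrite /aug_ideal.
  rewrite -(rep_aug_map (sgroup_act (kan_loop X) (coface ord0))).
  by rewrite [rmap _ _ z](zc ord0) raddf0.
have [ys [ysI ysP]] := fg_aug_ideal (aug n.+1) (rep_fg n.+1).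
have [J JP] := artin_rees (noetherian_fg (rep_fg n.+1)) (aug_idealP (aug n.+1)) (moore_cycle_ideal n.+1) ysP ysI.
(* t counts the steps that remain before the Artin-Rees bound J. *)
suff step t : forall a w, (J <= a.+1 + t)%N -> I n.+1 a.+1 w -> moore_cycle (T := B) (w : B n.+1) -> K (w : B n.+1).
  by apply: (step J 0%N z) => //; rewrite add1n.
elim: t => [|t IHt] a w Ja wI wc.
  have [|s [sP ->]] := JP w _ wc; first by apply: ipow_le wI; rewrite addn0 in Ja.
  rewrite big_seq; apply: (big_ind (@K n.+1)) => [|u v|q /sP[q1 q2]]; [exact: K0 | exact: KD |].
  exact: KI.
pose Kc (u : B n.+1) := K u /\ moore_cycle (T := B) u.
have [||||S [W [[SK Sc] wE]]] := reachable_euler char0 hcomm Xr xp r_uniq rP wc wI (Kc := Kc).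
- by split; [exact: K0 | exact: moore_cycle0].
- by move=> u v [uK uc] [vK vc]; split; [exact: KD | exact: moore_cycleD].
- by move=> c u [uK uc]; split; [exact: KZ | exact: moore_cycleZ].
- move=> i q g v qn gf vc; split.
    by apply: Kmsh => // q0; apply: IHn => //; rewrite ltn_subrL q0.
  by apply: msh_cycle => //; apply: (flat_cycle M char0 hcomm gf); case: xp.
have bW : mbd (T := B) (mproj n.+1 B (alt_bd (T := B) W)) := mproj_alt_bd (T := B) W.
(* The Moore projection preserves the powers of the ideal, fixes cycles and turns the boundary of an
   arbitrary W into a Moore boundary, so the error u becomes a cycle. *)
have := I_mproj wE; rewrite (raddfB (mproj n.+1 B)) (raddfD (mproj n.+1 B)) /=.
have wac : moore_cycle (T := B) (w *+ a.+1 : B n.+1) by rewrite -scaler_nat; apply: moore_cycleZ.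
rewrite (mproj_cycle wac) (mproj_cycle Sc).
set b := mproj n.+1 B _ in bW *; set u := _ - _ => uI.
have uc : moore_cycle (T := B) (u : B n.+1).
  by apply: moore_cycleB => //; apply: moore_cycleD => //; apply: mbd_cycle.
have uK : K (u : B n.+1) by apply: (IHt a.+1) => //; rewrite addSnnS.
have : K (w *+ a.+1 : B n.+1).
  have -> : w *+ a.+1 = u + (S + b) by rewrite /u subrK.
  by apply: KD => //; apply: KD => //; apply: Kbd.
move=> /(KZ a.+1%:R^-1); rewrite -scaler_nat scalerA mulVf ?scale1r //.
by rewrite natr_char0.
Qed.
End CycleInduction.

(** * Subcomplexes generated by finitely many simplices *)

Section FiniteSubcomplex.
Variables (X : sset) (N : nat) (L : seq (X N)).

Definition spanned n (y : X n) : bool :=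
  `[< exists2 s, s \in L & exists f : simplex_map n N, y = sset_act f s >].

Lemma spanned_act m n (f : simplex_map m n) (y : X n) : spanned y -> spanned (sset_act f y).
Proof.
move=> /asboolP[s sL [g ->]]; apply/asboolP; exists s => //; exists (simplex_comp g f).
exact: sset_act_comp.
Qed.

Definition span_act m n (f : simplex_map m n) (y : {y : X n | spanned y}) : {y : X m | spanned y} :=
  exist _ (sset_act f (val y)) (spanned_act f (valP y)).

Lemma span_laws : simplicial_laws span_act.
Proof.
split=> [n y|m n q g f y]; apply: val_inj => /=; first exact: sset_act_id.
by rewrite sset_act_comp.
Qed.

Definition span_sset : sset := SSet span_laws.

Lemma span_finite : exists r : forall n, seq (span_sset n),
  (forall n, uniq (r n)) /\ forall n y, y \in r n.
Proof.
(* Finite functions that are not monotone are sent to a constant map, so that all operators are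
   enumerated from a finite type. *)
pose mk n (F : {ffun 'I_n.+1 -> 'I_N.+1}) : simplex_map n N :=
  if pselect ({homo (F : 'I_n.+1 -> 'I_N.+1) : i j / (i <= j)%N}) is left h then SimplexMap h else
  @SimplexMap n N (fun=> ord0) (fun _ _ _ => leqnn _).
pose r n : seq (span_sset n) := undup (pmap insub [seq sset_act (mk n F) s | s <- L, F <- enum {ffun 'I_n.+1 -> 'I_N.+1}]).
exists r; split=> [n|n y]; first exact: undup_uniq.
rewrite /r mem_undup mem_pmap_sub; have /asboolP[s sL [f fE]] := valP y.
apply/allpairsP; exists (s, [ffun i => f i]); split=> //=; first by rewrite mem_enum.
rewrite fE; congr (sset_act _ s); apply: simplex_map_eq => i; rewrite /mk.
case: pselect => [h|[]]; first by rewrite /= ffunE.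
by move=> a b ab; rewrite !ffunE; apply: simplex_mono.
Qed.

Lemma span_reduced s : s \in L -> reduced X -> reduced span_sset.
Proof.
move=> sL [x0 x0P]; have y0P : spanned (sset_act (front 0 N) s).
  by apply/asboolP; exists s => //; exists (front 0 N).
exists (exist (fun y => spanned y) _ y0P : span_sset 0%N) => y; apply: val_inj.
by rewrite (x0P (val y)) (x0P (val _)).
Qed.

Notation X' := span_sset.

Definition kan_incl n : kan_obj X' n -> kan_obj X n :=
  pres_lift (fun y : X' n.+1 => kan_gen (val y)).

Lemma kan_incl_rel n w : kan_rel w -> word_eval (fun y : X' n.+1 => kan_gen (val y)) w = 1%g.
Proof. by case=> y ->; rewrite /= mulg1; apply: (kan_gen_degen (val y)). Qed.

HB.instance Definition _ n := monoid.isMultiplicative.Build (kan_obj X' n) (kan_obj X n)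
  (@kan_incl n) (pres_liftM (@kan_incl_rel n)).

Lemma kan_inclM n (g h : kan_obj X' n) : kan_incl (g * h)%g = (kan_incl g * kan_incl h)%g.
Proof. exact: (pres_liftM (@kan_incl_rel n)). Qed.

Lemma kan_incl_gen n (y : X' n.+1) : kan_incl (kan_gen y) = kan_gen (val y).
Proof. exact/pres_lift_gen/kan_incl_rel. Qed.

Lemma kan_incl_act m n (f : simplex_map m n) (g : kan_obj X' n) :
  kan_incl (kan_act f g) = kan_act f (kan_incl g).
Proof.
elim/kan_ind: g => [|g h Eg Eh|g Eg|y].
- by rewrite (mult1 (kan_act f)) (mult1 (@kan_incl n)) (mult1 (kan_act f)) (mult1 (@kan_incl m)).
- by rewrite kan_actM !kan_inclM kan_actM Eg Eh.
- by rewrite (multV (kan_act f)) (multV (@kan_incl n)) (multV (kan_act f)) (multV (@kan_incl m)) /= Eg.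
by rewrite kan_act_gen kan_incl_gen kan_act_gen /kan_val (multF (@kan_incl m)) /= !kan_incl_gen.
Qed.

(** It need not commute with faces, but in each degree it splits the inclusion of the loop groups,
    which makes the map of representation algebras injective. *)
Definition kan_retr n : kan_obj X n -> kan_obj X' n :=
  pres_lift (fun y : X n.+1 => if insub y is Some y' then kan_gen (y' : X' n.+1) else 1%g).

Lemma kan_retr_rel n w : kan_rel w ->
  word_eval (fun y : X n.+1 => if insub y is Some y' then kan_gen (y' : X' n.+1) else 1%g) w = 1%g.
Proof.
case=> y ->; rewrite /= mulg1; case: insubP => //= y' _ y'E.
rewrite -[RHS](kan_gen_degen (face ord0 (y' : X' n.+1))); apply: (congr1 (@kan_gen X' n)).
by apply: val_inj; rewrite /= [in RHS]y'E [RHS]degen_face_degen.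
Qed.

HB.instance Definition _ n := monoid.isMultiplicative.Build (kan_obj X n) (kan_obj X' n)
  (@kan_retr n) (pres_liftM (@kan_retr_rel n)).

Lemma kan_retrM n (g h : kan_obj X n) : kan_retr (g * h)%g = (kan_retr g * kan_retr h)%g.
Proof. exact: (pres_liftM (@kan_retr_rel n)). Qed.

Lemma kan_retr_gen n (y : X n.+1) :
  kan_retr (kan_gen y) = if insub y is Some y' then kan_gen (y' : X' n.+1) else 1%g.
Proof. exact/pres_lift_gen/kan_retr_rel. Qed.

Lemma kan_inclK n : cancel (@kan_incl n) (@kan_retr n).
Proof.
elim/kan_ind => [|g h Eg Eh|g Eg|y].
- by rewrite (mult1 (@kan_incl n)) (mult1 (@kan_retr n)).
- by rewrite kan_inclM kan_retrM Eg Eh.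
- by rewrite (multV (@kan_incl n)) (multV (@kan_retr n)) /= Eg.
by rewrite kan_incl_gen kan_retr_gen valK.
Qed.

Section Algebras.
Variables (k : fieldType) (G : affine_group k) (M : rep_model G).
Notation B' := (repS M (kan_loop X')).
Notation B := (repS M (kan_loop X)).
Notation rg := (rgen M).

Definition incl n : {lrmorphism B' n -> B n} := rmap M (@kan_incl n).

Lemma incl_gen n (g : kan_obj X' n) u : incl n (rg g u) = rg (kan_incl g) u.
Proof. exact: rmap_gen. Qed.

Lemma incl_inj n : injective (incl n).
Proof.
suff K : cancel (incl n) (rmap M (@kan_retr n)) by exact: can_inj K.
apply: (@repA_hom_eq _ _ _ _ _ (lrcomp (rmap M (@kan_retr n)) (incl n)) idfun) => g u.
rewrite -[LHS]/(rmap M (@kan_retr n) (rmap M (@kan_incl n) (rg g u))) !rmap_gen.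
by congr (rg _ u); apply: kan_inclK.
Qed.

Lemma incl_act m n (f : simplex_map m n) (z : B' n) :
  incl m (scalg_act B' f z) = scalg_act B f (incl n z).
Proof.
move: z; apply: (@repA_hom_eq _ _ _ _ _ (lrcomp (incl m) (scalg_act B' f)) (lrcomp (scalg_act B f) (incl n))) => g u.
rewrite -[LHS]/(incl m (scalg_act B' f (rg g u))) -[RHS]/(scalg_act B f (incl n (rg g u))).
by rewrite repS_gen !incl_gen repS_gen; congr (rg _ u); apply: kan_incl_act.
Qed.

Lemma incl_msh n q m (y : B' q) (w : B' m) :
  incl n (msh n B' y w) = msh n B (incl q y) (incl m w).
Proof.
rewrite !mshE; apply: (@shuf_nat n (pmul B') (pmul B) (fun n z => incl n z) (fun n z => incl n z) (fun n => incl n)).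
- by move=> a b f z _; apply: incl_act.
- by move=> a b f z _; apply: incl_act.
- by move=> a u v; apply: (rmorphM (incl a)).
Qed.

Lemma incl_cycle n (z : B' n) : moore_cycle (T := B) (incl n z) <-> moore_cycle (T := B') z.
Proof.
case: n z => [//|n] z; split=> zc i.
  apply: incl_inj; rewrite (raddf0 (incl n)) -[RHS](zc i).
  exact: incl_act.
by rewrite -[LHS](incl_act (coface i)) [X in incl _ X](zc i) (raddf0 (incl n)).
Qed.

Lemma incl_mbd n (z : B' n) : mbd (T := B') z -> mbd (T := B) (incl n z).
Proof.
move=> [b b0 bz]; exists (incl n.+1 b).
  by move=> i; rewrite -[LHS](incl_act (coface (lift ord0 i))) [X in incl _ X](b0 i) (raddf0 (incl n)).
by rewrite -[LHS](incl_act (coface ord0)); congr (incl n _).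
Qed.

Lemma incl_aug n (z : B' n) : rep_aug M (kan_loop X n) (incl n z) = rep_aug M (kan_loop X' n) z.
Proof. exact: rep_aug_map. Qed.

Definition chain_incl n : {malg k[X' n]} -> {malg k[X n]} := lin_ext (fun y => << val y >>).
HB.instance Definition _ n := GRing.Linear.on (@chain_incl n).

Lemma chain_inclU n (y : X' n) : chain_incl << y >> = << val y >>.
Proof. exact: lin_extU. Qed.

Lemma chain_incl_act m n (f : simplex_map m n) (c : {malg k[X' n]}) :
  chain_incl (chain_act f c) = chain_act f (chain_incl c).
Proof.
apply: (malg_linear_eq (f := @chain_incl m \o chain_act f) (g := chain_act f \o @chain_incl n)) => y.
by rewrite /= chain_actU !chain_inclU chain_actU.
Qed.

Lemma ch_incl n (g : kan_obj X' n) : ch (kan_incl g) = chain_incl (ch g).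
Proof.
elim/kan_ind: g => [|g h Eg Eh|g Eg|y].
- by rewrite (mult1 (@kan_incl n)) !ch1 raddf0.
- by rewrite kan_inclM !chM raddfD /= Eg Eh.
- by rewrite (multV (@kan_incl n)) !chV raddfN /= Eg.
by rewrite kan_incl_gen !ch_gen /kan_chain raddfB /= !chain_inclU.
Qed.

Lemma flat_incl n (g : kan_obj X' n) : flat k g -> flat k (kan_incl g).
Proof.
move=> gf i; rewrite ch_incl -[LHS](chain_incl_act (coface i)) [X in chain_incl X](gf i).
exact: raddf0.
Qed.
End Algebras.
End FiniteSubcomplex.

(** * Cycles as combinations of shuffle products *)

Section Surjectivity.
Variables (k : fieldType) (G : affine_group k) (M : rep_model G) (X : sset).
Hypotheses (char0 : [pchar k] =i pred0) (hcomm : commutative_group_scheme G).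
Hypotheses (hG : finitely_generated (coord_ring G)) (Xr : reduced X) (Xsc : simply_connected X).
Variables (d : nat) (x : 'I_d -> coord_ring G).
Variable p : 'I_d -> {linear coord_ring G -> k^o}.
Hypothesis xp : coordinates (counit G) x p.
Notation B := (repS M (kan_loop X)).
Notation rg := (rgen M).
Notation incl L n := (@incl X _ L k G M n).

Lemma kan_finite n (g : kan_obj X n) : exists L0 : seq (X n.+1), forall L, {subset L0 <= L} ->
  exists g', kan_incl (L := L) g' = g.
Proof.
elim/kan_ind: g => [|g h [Lg Eg] [Lh Eh]|g [Lg Eg]|y].
- by exists [::] => L _; exists 1%g; rewrite (mult1 (@kan_incl _ _ L n)).
- exists (Lg ++ Lh) => L LL; have [|g' <-] := Eg L; first by move=> y yL; apply: LL; rewrite mem_cat yL.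
  have [|h' <-] := Eh L; first by move=> y yL; apply: LL; rewrite mem_cat yL orbT.
  by exists (g' * h')%g; rewrite kan_inclM.
- by exists Lg => L /Eg[g' <-]; exists (g'^-1)%g; rewrite (multV (@kan_incl _ _ L n)).
- exists [:: y] => L yL; have ys : spanned L y.
    by apply/asboolP; exists y; [apply: yL; rewrite inE | exists (simplex_id _); rewrite sset_act_id].
  by exists (kan_gen (exist _ y ys : span_sset L n.+1)); rewrite kan_incl_gen.
Qed.

Lemma rep_finite n (z : B n) : exists L0 : seq (X n.+1), forall L, {subset L0 <= L} ->
  exists z', incl L n z' = z.
Proof.
move: z; apply: repA_ind => [|a y z [Ly Ey] [Lz Ez]|y z [Ly Ey] [Lz Ez]|g u].
- by exists [::] => L _; exists 1; rewrite (rmorph1 (incl L n)).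
- exists (Ly ++ Lz) => L LL; have [|y' <-] := Ey L; first by move=> s sL; apply: LL; rewrite mem_cat sL.
  have [|z' <-] := Ez L; first by move=> s sL; apply: LL; rewrite mem_cat sL orbT.
  by exists (a *: y' + z'); rewrite (linearP (incl L n)).
- exists (Ly ++ Lz) => L LL; have [|y' <-] := Ey L; first by move=> s sL; apply: LL; rewrite mem_cat sL.
  have [|z' <-] := Ez L; first by move=> s sL; apply: LL; rewrite mem_cat sL orbT.
  by exists (y' * z'); rewrite (rmorphM (incl L n)).
- by have [L0 E] := kan_finite g; exists L0 => L /E[g' <-]; exists (rg g' u); rewrite incl_gen.
Qed.

(** In positive degree [mbd_mul_vertex] replaces u by its first vertex, an element of degree 0 in
    the augmentation ideal, hence a boundary. *)
Lemma aug_mul_mbd n (u z : B n) : rep_aug M (kan_loop X n) u = 0 -> moore_cycle (T := B) z ->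
  mbd (T := B) (u * z : B n).
Proof.
have m0 (v : B 0%N) : rep_aug M (kan_loop X 0) v = 0 -> mbd (T := B) v.
  by move=> v0; have := aug_mbd0 (M := M) char0 hcomm Xr Xsc v; rewrite v0 scale0r subr0.
case: n u z => [|n] u z u0 zc.
  apply: m0; rewrite rmorphM /= u0 mul0r //.
have := mbd_mul_vertex u zc; set v := scalg_act B _ u => zv.
suff vm : mbd (T := B) (z * v : B n.+1) by have := mbdD zv vm; rewrite subrK mulrC.
have vE : v = scalg_act B (front n.+1 0) (scalg_act B (front 0 n.+1) u).
  by rewrite /v [RHS](szmod_actM (T := B)).
rewrite mulrC vE -msh_p0; apply: msh_mbdl => //; apply: m0.
by rewrite -[RHS]u0; apply: (rep_aug_map (sgroup_act (kan_loop X) (front 0 n.+1))).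
Qed.

Notation V := (fun n => gens k X d n).
Variable S : sym_model V.
Notation rep := (@loop_rep k G M X char0 hcomm Xr Xsc d x p xp).
Notation Phi := (Phi S (A := B) rep).

Lemma flat_rep i q (g : kan_obj X q) : flat k g ->
  mbd (T := B) (rg g (x i) - rep (gen_at i (vcl (ch g))) : B q).
Proof.
move=> gf; have gc := flat_cycle M char0 hcomm gf (coord_x0 xp i).
apply/hcl_eq => //; first exact: rep_cycle.
rewrite hcl_rep (bigD1 i) //= big1 ?addr0 => [|j ij]; last first.
  by rewrite ffunE (negPf ij) raddf0.
rewrite ffunE eqxx.
have := @thetaE k G M X char0 hcomm Xr Xsc d x p xp i q [:: (1, g)].
by rewrite !big_seq1 !scale1r => -> // b; rewrite inE => /eqP ->.
Qed.

Lemma Phi_surjective n (z : B n) : moore_cycle (T := B) z ->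
  exists P, mbd (T := B) (z - Phi n P : B n).
Proof.
move=> zc; have [L0 L0P] := rep_finite z; have [y0 _] := Xr.
(* The degenerate simplex on the vertex makes the list nonempty, so that the subcomplex contains the
   vertex. *)
pose L := sset_act (front n.+1 0) y0 :: L0.
have [|z' z'E] := L0P L; first by move=> s sL; rewrite inE sL orbT.
have [r [r_uniq rP]] := span_finite L.
have X'r : reduced (span_sset L) by apply: span_reduced Xr; apply: mem_head.
(* The condition is stated over X, which is simply connected; the subcomplex may not be. *)
pose K m (w : repS M (kan_loop (span_sset L)) m) := exists P, mbd (T := B) (incl L m w - Phi m P : B m).
have Kmbd m (w : repS M (kan_loop (span_sset L)) m) : mbd (T := B) (incl L m w : B m) -> K m w.
  by move=> wm; exists 0; rewrite raddf0 subr0.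
rewrite -z'E in zc *; move/incl_cycle: zc => z'c.
apply: (@cycle_induction k G M _ char0 hcomm X'r hG d x p xp r r_uniq rP K _ _ _ _ _ _ _ n z' z'c).
- by move=> m; apply: Kmbd; rewrite raddf0; apply: mbd0.
- move=> m u v [P Pu] [Q Qv]; exists (P + Q); have := mbdD Pu Qv; congr (mbd _).
  by rewrite (raddfD (incl L m)) (raddfD (Phi m)) /=; zmodu.
- move=> m c u [P Pu]; exists (c *: P); have := mbdZ c Pu; congr (mbd _).
  by rewrite (linearZ_LR (incl L m)) (linearZ_LR (Phi m)) scalerBr.
- by move=> m u um; apply: Kmbd; apply: incl_mbd.
- exists 1; rewrite (rmorph1 (incl L 0%N)) -[1 in X in _ - X]/(wd S [::]) PhiE subrr.
  exact: mbd0.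
- move=> m u v u0 vc; apply: Kmbd; rewrite (rmorphM (incl L m)).
  by apply: aug_mul_mbd; [rewrite incl_aug | apply/incl_cycle].
- move=> i m q g w qm gf wc wK; have wc' : moore_cycle (T := B) (incl L _ w) by apply/incl_cycle.
  have gf' := flat_incl gf.
  (* For q = 0 the coordinate of g is itself a boundary over X. Otherwise P comes from the second
     factor, and a letter for g is put in front of it. *)
  case: q g w qm gf wc wK wc' gf' => [|q] g w qm gf wc wK wc' gf'.
    apply: Kmbd; rewrite incl_msh; apply: msh_mbdl => //; rewrite incl_gen.
    by apply: (rgen_mbd0 M char0 hcomm Xr Xsc); apply: (coord_x0 xp).
  have [P wP] := wK isT; pose v : gens k X d q.+1 := gen_at i (vcl (ch (k := k) (kan_incl g))).
  exists (letter S (Tagged V v) * P).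
  rewrite (@Phi_letter_mul k V S B rep m (Tagged V v) (m - q.+1)) ?subnKC // incl_msh incl_gen /=.
  have E1 := msh_mbdl m (flat_rep i gf') wc'.
  have E2 := msh_mbdr m (rep_cycle M char0 hcomm Xr Xsc xp v) wP.
  have := mbdD E1 E2; congr (mbd _).
  by rewrite mshBl mshBr addrA subrK.
Qed.
End Surjectivity.

(** * The graded isomorphism *)

Section FreeHomogeneous.
Variables (k : fieldType) (V : nat -> lmodType k).
Notation S := (free_model V).
Notation T := (symT S).
Notation homog n P := (P \in @sym_homog k V n).

Lemma free_wd_homog w : homog (wdeg w) (wd S w).
Proof.
rewrite (_ : wd S w = (<< (FMonom w : {fmonom {n : nat & V n}}) >> : T)); last first.
  by rewrite free_wordE.
apply/sym_homogP => m; rewrite mcoeffU.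
by have [<- //|_] := eqVneq (FMonom w : {fmonom {n : nat & V n}}) m; rewrite /= eqxx.
Qed.

Lemma free_homog_ind n (Pr : T -> Prop) : Pr 0 -> (forall a P Q, Pr P -> Pr Q -> Pr (a *: P + Q)) ->
  (forall w, wdeg w = n -> Pr (wd S w)) -> forall P : T, homog n P -> Pr P.
Proof.
move=> P0 PL Pw P /allP Pn; rewrite [P]malg_expand.
move: Pn; elim: (enum_fset (msupp P)) => [|m s IHs] Pn; first by rewrite big_nil.
rewrite big_cons; apply: PL; last by apply: IHs => m' m's; apply: Pn; rewrite inE m's orbT.
by rewrite free_wordE; apply: Pw; apply/eqP/Pn/mem_head.
Qed.
End FreeHomogeneous.

Section GradedIsomorphism.
Variables (k : fieldType) (V : nat -> lmodType k) (S : sym_model V).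
Notation T := (symT S).
Variable H : nat -> submodClosed T.
Notation homog n P := (P \in H n).
Hypothesis wd_homog : forall w, homog (wdeg w) (wd S w).
Hypothesis homog_ind : forall n (Pr : T -> Prop), Pr 0 ->
  (forall a P Q, Pr P -> Pr Q -> Pr (a *: P + Q)) ->
  (forall w, wdeg w = n -> Pr (wd S w)) -> forall P, homog n P -> Pr P.

Lemma homogL n a P Q : homog n P -> homog n Q -> homog n (a *: P + Q).
Proof. by move=> Pn Qn; rewrite rpredD // rpredZ. Qed.

Lemma homog_mul p q P Q : homog p P -> homog q Q -> homog (p + q)%N (P * Q).
Proof.
move=> Pp Qq; move: P Pp; apply: homog_ind => [|a P P' hP hP'|u <-].
- by rewrite mul0r rpred0.
- by rewrite mulrDl symZl; apply: homogL.
move: Q Qq; apply: homog_ind => [|a P P' hP hP'|w <-].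
- by rewrite mulr0 rpred0.
- by rewrite mulrDr symZr; apply: homogL.
by rewrite -wd_cat; have := wd_homog (u ++ w); rewrite wdeg_cat.
Qed.

Variables (A : scalg k) (rep : forall n, V n -> A n).
Hypothesis rep_cycle : forall n (v : V n), moore_cycle (T := A) (rep v).
Hypothesis rep_linear : forall n a (u v : V n),
  mbd (T := A) (rep (a *: u + v) - (a *: rep u + rep v) : A n).
Notation Phi := (Phi S (A := A) rep).

Lemma Phi_homog n P : exists2 P', homog n P' & Phi n P' = Phi n P.
Proof.
move: P; apply: sym_ind => [|a P Q [P' P'n P'E] [Q' Q'n Q'E]|w]; first by exists 0; rewrite ?rpred0.
  by exists (a *: P' + Q'); [apply: homogL | rewrite !PhiL P'E Q'E].
have [<-|wn] := eqVneq (wdeg w) n; first by exists (wd S w) => //; apply: wd_homog.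
by exists 0; rewrite ?rpred0 // PhiE Phi00 wc_dim // eq_sym.
Qed.

Lemma Phi_other n N P : homog n P -> N != n -> Phi N P = 0.
Proof.
move=> Pn Nn; move: P Pn; apply: homog_ind => [|a P Q P0 Q0|w wn]; first by rewrite Phi00.
  by rewrite PhiL P0 Q0 scaler0 addr0.
by rewrite PhiE wc_dim // wn.
Qed.

Lemma Phi_mul p q P Q : homog p P -> Phi (p + q) (P * Q) = msh (p + q) A (Phi p P) (Phi q Q).
Proof.
move=> Pp; move: P Pp; apply: homog_ind => [|a P P' hP hP'|u <-].
- by rewrite mul0r !Phi00 msh0l.
- by rewrite mulrDl symZl !PhiL hP hP' mshDl mshZl.
by rewrite (@Phi_mull _ _ _ _ _ _ _ q) // PhiE.
Qed.

Lemma Phi_cycle n P : moore_cycle (T := A) (Phi n P : A n).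
Proof.
move: P; apply: sym_ind => [|a P Q Pc Qc|w].
- by rewrite Phi00; apply: moore_cycle0.
- by rewrite PhiL; apply: moore_cycleD => //; apply: moore_cycleZ.
- by rewrite PhiE; apply: wc_cycle.
Qed.

Hypothesis Phi_inj : forall P, Phi_null (A := A) rep P -> P \in symI S.
Hypothesis Phi_surj : forall n (z : A n), moore_cycle (T := A) z ->
  exists P, mbd (T := A) (z - Phi n P : A n).

Let acl n (z : A n) : homotopy A n := subclass _ _ z.
Let comp n : lmodType k := subquot (H n) (symI S).
Let scl n P : comp n := subclass (H n) (symI S) P.

Lemma acl_eq n (w w' : A n) : moore_cycle (T := A) w -> moore_cycle (T := A) w' ->
  (acl w = acl w') <-> mbd (T := A) (w - w').
Proof.
move=> /moore_cyclesP w1 /moore_cyclesP w2.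
split=> [/(subclassP _ w1 w2) /moore_boundariesP //|ww'].
by apply/(subclassP _ w1 w2)/moore_boundariesP.
Qed.

Lemma acl_linear n a (w w' : A n) : moore_cycle (T := A) w -> moore_cycle (T := A) w' ->
  acl (a *: w + w') = a *: acl w + acl w'.
Proof.
move=> /moore_cyclesP w1 /moore_cyclesP w2.
by rewrite /acl subclassD ?rpredZ // subclassZ.
Qed.

Lemma scl_linear n a P Q : homog n P -> homog n Q -> scl n (a *: P + Q) = a *: scl n P + scl n Q.
Proof. by move=> Pn Qn; rewrite /scl subclassD ?rpredZ // subclassZ. Qed.

(** Injectivity tests all degrees at once; a homogeneous element has zero image in the degrees other
    than its own, so its own degree decides. *)
Lemma scl_Phi n P Q : homog n P -> homog n Q ->
  (scl n P = scl n Q) <-> (acl (Phi n P) = acl (Phi n Q)).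
Proof.
move=> Pn Qn; rewrite acl_eq; try exact: Phi_cycle.
rewrite -PhiB; split=> [/(subclassP _ Pn Qn) PQ|PQ].
  exact: (symI_null (S := S) rep_cycle rep_linear PQ n).
apply/(subclassP _ Pn Qn); apply: (Phi_inj (P := P - Q)) => N.
have [->//|Nn] := eqVneq N n.
have -> : Phi N (P - Q) = 0.
  by apply: (Phi_other _ Nn); rewrite -scaleN1r addrC; apply: homogL.
exact: mbd0.
Qed.

Lemma acl_surj n (z : homotopy A n) : exists P, homog n P /\ acl (Phi n P) = z.
Proof.
elim/subclass_ind: z => z /moore_cyclesP zc; have [P zP] := Phi_surj zc.
have [P' P'n P'E] := Phi_homog n P; exists P'; split=> //; apply/esym/acl_eq => //.
  exact: Phi_cycle.
by rewrite P'E.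
Qed.

Definition sym_model_alg : graded_alg k :=
  @GradedAlg k comp (scl 0 1) (fun p q x y => scl (p + q) (subrepr x * subrepr y)).

(** The map goes from homotopy to Sym: a class is sent to the class of a homogeneous preimage under
    Phi, which exists by surjectivity and is unique modulo the ideal by injectivity. *)
Lemma graded_iso_of_Phi : graded_alg_iso (homotopy_alg A) sym_model_alg.
Proof.
have ex n : exists phi : {linear homotopy A n -> comp n},
    forall z, exists P, [/\ homog n P, acl (Phi n P) = z & scl n P = phi z].
  apply: (linear_of_rel (R := fun z u => exists P, [/\ homog n P, acl (Phi n P) = z & scl n P = u])).
  - by move=> z; have [P [Pn PE]] := acl_surj z; exists (scl n P), P.
  - move=> u [P [Pn PE <-]]; transitivity (scl n 0).
      apply/scl_Phi; rewrite ?rpred0 // PE Phi00.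
      have c0 : moore_cycle (T := A) (0 : A n) by apply: moore_cycle0.
      by have := acl_linear (-1) c0 c0; rewrite scaler0 addr0 scaleN1r addNr.
    by have := scl_linear (-1) (rpred0 (H n)) (rpred0 (H n)); rewrite scaler0 addr0 scaleN1r addNr.
  - move=> a z u z' u' [P [Pn <- <-]] [Q [Qn <- <-]]; exists (a *: P + Q); split.
    + exact: homogL.
    + by rewrite PhiL acl_linear //; apply: Phi_cycle.
    + exact: scl_linear.
pose phi n := sval (cid (ex n)); have phiP n := svalP (cid (ex n)).
have phiE n P : homog n P -> phi n (acl (Phi n P)) = scl n P.
  by move=> Pn; have [Q [Qn QE <-]] := phiP n (acl (Phi n P)); apply/scl_Phi.
have H1 : homog 0%N 1 by apply: (wd_homog [::]).
exists phi; split=> [n||p q x y].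
- exists (fun u => acl (Phi n (subrepr u))) => [z|u].
    have [P [Pn <- PE]] := phiP n z; rewrite -PE.
    by apply/(scl_Phi (subreprP _) Pn); apply: subreprK.
  by rewrite phiE ?subreprP // /scl subreprK.
- rewrite -[gr_one _]/(acl (1 : A 0%N)) -(_ : Phi 0%N 1 = 1) ?phiE //.
  exact: (PhiE S rep 0 [::]).
have [P [Pp xE PE]] := phiP p x; have [Q [Qq yE QE]] := phiP q y.
rewrite -[gr_mul x y]/(acl (shuffle (subrepr x) (subrepr y))) shuffle_msh.
have xc : moore_cycle (T := A) (subrepr x) by apply/moore_cyclesP/subreprP.
have yc : moore_cycle (T := A) (subrepr y) by apply/moore_cyclesP/subreprP.
have PQ : homog (p + q)%N (P * Q) by apply: homog_mul.
have uE : subclass (H p) (symI S) (subrepr (phi p x)) = scl p P by rewrite subreprK PE.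
have vE : subclass (H q) (symI S) (subrepr (phi q y)) = scl q Q by rewrite subreprK QE.
have uH := subreprP (phi p x); have vH := subreprP (phi q y).
transitivity (scl (p + q) (P * Q)); last first.
  apply/(subclassP _ PQ (homog_mul uH vH)).
  move/(subclassP _ uH Pp): uE => uE; move/(subclassP _ vH Qq): vE => vE.
  set u := subrepr (phi p x) in uE uH *; set v := subrepr (phi q y) in vE vH *.
  (* The representatives chosen in [sym_model_alg] differ from P and Q by elements of the ideal, and
     so do the products. *)
  have -> : P * Q - u * v = - (1 * (u - P) * v + P * (v - Q) * 1).
    by rewrite mul1r mulr1 mulrBl mulrBr addrA subrK opprB.
  by apply: SIN; apply: rpredD; apply: symIM.
rewrite -phiE //; congr (phi _ _); apply/acl_eq; try exact: msh_cycle; first exact: Phi_cycle.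
rewrite Phi_mul //.
have E1 : mbd (T := A) (subrepr x - Phi p P).
  by apply/acl_eq => //; [apply: Phi_cycle | rewrite xE /acl subreprK].
have E2 : mbd (T := A) (subrepr y - Phi q Q).
  by apply/acl_eq => //; [apply: Phi_cycle | rewrite yE /acl subreprK].
have := mbdD (msh_mbdl (p + q) E1 yc) (msh_mbdr (p + q) (Phi_cycle p P) E2).
by congr (mbd _); rewrite mshBl mshBr addrA subrK.
Qed.
End GradedIsomorphism.

Theorem theorem4p4 (k : fieldType) (hk : [pchar k] =i pred0)
    (G : affine_group k) (hG : finitely_generated (coord_ring G))
    (hcomm : commutative_group_scheme G)
    (l : nat) (hl : krull_dim (coord_ring G) l)
    (X : sset) (hX : reduced X)
    (hsc : simply_connected X) (hft : finite_rational_type X) :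
  graded_alg_iso (HR X G)
    (graded_sym (fun n => {ffun 'I_l -> reduced_homology k X n.+1})).
Proof.
have [d [x [p xp]]] := coordinates_exist (counit G) hG.
have dl := krull_dim_coordinates hk hG xp hl; subst d.
have -> : HR X G = homotopy_alg (repS (rep_alg_model G) (kan_loop X)).
  (* The two simplicial algebras have the same terms and operators and differ in the proofs of the
     simplicial laws. *)
  by congr homotopy_alg; congr SCAlg; apply: Prop_irrelevance.
set V := fun n => _; pose S := free_model V.
pose H n : submodClosed (symT S) := @sym_homog k V n.
apply: (@graded_iso_of_Phi k V S H _ _ _ (@loop_rep k G (rep_alg_model G) X hk hcomm hX hsc l x p xp)).
- exact: free_wd_homog.
- exact: free_homog_ind.
- exact: rep_cycle.
- exact: rep_linear.
- by move=> P; apply: loop_Phi_injective.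
- by move=> n z; apply: Phi_surjective.
Qed.
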